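(* Let $n\geq 2$ be an integer and let $p>n$ be real. If $\Omega\subset\mathbb{R}^n$ is nonempty, bounded, open, $C^2$, and not mean convex, then $$\lambda_p(\Omega)<\lambda_p(\mathbb{R}^n_+),$$ where $\mathbb{R}^n_+=\{x\in\mathbb{R}^n:x_n>0\}$. Therefore, $\Omega$ has an extremal.
   Context: $\mathcal{D}^{1,p}(\mathbb{R}^n)=\{u\in L^1_{\rm loc}(\mathbb{R}^n): \text{all weak partial derivatives } u_{x_i}\in L^p(\mathbb{R}^n)\}$; since $p>n$, each $u$ is identified with its Hölder continuous representative. For a nonempty open $\Omega\subsetneq\mathbb{R}^n$, $\mathcal{D}^{1,p}_0(\Omega)=\{u\in\mathcal{D}^{1,p}(\mathbb{R}^n): u(x)=0 \text{ for all } x\notin\Omega\}$, with norm $\|Du\|_p$, and $d_\Omega(x)=\inf_{y\in\Omega^c}|x-y|$. For $u\in\mathcal{D}^{1,p}_0(\Omega)\setminus\{0\}$, $\mathcal{R}_p(\Omega,u)=\bigl\|u/d_\Omega^{1-n/p}\bigr\|_\infty^{-p}\,\|Du\|_p^p$ (the supremum norm is taken over $\Omega$), and $\lambda_p(\Omega)=\inf_{u\in\mathcal{D}^{1,p}_0(\Omega)\setminus\{0\}}\mathcal{R}_p(\Omega,u)$. An extremal for $\Omega$ is a $u\in\mathcal{D}^{1,p}_0(\Omega)\setminus\{0\}$ with $\mathcal{R}_p(\Omega,u)=\lambda_p(\Omega)$. $\Omega$ is $C^2$ if its boundary is $C^2$-regular: near each boundary point, after a rigid motion, $\Omega$ coincides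 with the region $\{x_n>f(x')\}$ above the graph of a $C^2$ function $f$ of $n-1$ variables. In such coordinates the mean curvature $H$ of $\partial\Omega$ at $(x',f(x'))$, measured with respect to the outward unit normal, is given by $(n-1)H=\operatorname{div}\bigl(Df/\sqrt{1+|Df|^2}\bigr)$ (so convex sets have nonnegative mean curvature). A $C^2$ set $\Omega$ is mean convex if the mean curvature at each point of $\partial\Omega$ is nonnegative. *)

(* Defs.v *)
From HB Require Import structures.
From mathcomp Require Import all_boot all_order all_algebra.
From mathcomp Require Import all_classical all_reals all_analysis.

Set Implicit Arguments.
Unset Strict Implicit.
Unset Printing Implicit Defensive.

Import Order.TTheory GRing.Theory Num.Theory.
Import numFieldNormedType.Exports.

Local Open Scope classical_set_scope.
Local Open Scope ring_scope.

(* The sigma-algebra on row vectors is the product one, generated by the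
   coordinates, exactly as the library does for n-tuples; for R^n it is the
   Borel sigma-algebra. *)
Definition rV_display : measure_display.
Proof. exact: default_measure_display. Qed.

Section measurable_rV.
Context {R : realType}.
Variable n : nat.

Let coord : 'I_n -> 'rV[R]_n -> measurableTypeR R := fun i x => x 0 i.

Let rV_set0 : g_sigma_preimage coord set0.
Proof. exact: sigma_algebra0. Qed.

Let rV_setC A : g_sigma_preimage coord A -> g_sigma_preimage coord (~` A).
Proof. exact: sigma_algebraC. Qed.

Let rV_bigcup (F : _^nat) : (forall i, g_sigma_preimage coord (F i)) ->
  g_sigma_preimage coord (\bigcup_i (F i)).
Proof. exact: sigma_algebra_bigcup. Qed.

HB.instance Definition _ :=
  @isMeasurable.Build rV_display
    'rV[R]_n (g_sigma_preimage coord) rV_set0 rV_setC rV_bigcup.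

End measurable_rV.

Section measurable_rV_theory.
Context {R : realType}.

Lemma measurable_rV_coord n (i : 'I_n) :
  measurable_fun [set: 'rV[R]_n] (fun x => x 0 i : measurableTypeR R).
Proof.
move=> _ Y mY; rewrite setTI; apply: sub_sigma_algebra => /=.
rewrite -bigcup_seq/=; exists i => /=; first by rewrite mem_index_enum.
by exists Y => //; rewrite setTI.
Qed.

Lemma measurable_fun_rVP d (T : measurableType d) n (f : T -> 'rV[R]_n) :
  (forall i, measurable_fun [set: T] (fun t => f t 0 i : measurableTypeR R)) ->
  measurable_fun [set: T] f.
Proof.
move=> mf.
suff : g_sigma_preimage
    (fun i => (fun x : 'rV[R]_n => x 0 i : measurableTypeR R) \o f)
    `<=` measurable.
  rewrite g_sigma_preimage_comp => prefS _ A mA.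
  by apply: prefS; exists A.
apply: smallest_sub; first exact: sigma_algebra_measurable.
case: n => [|n] in f mf *; first by rewrite big_ord0.
rewrite -bigcup_mkord_ord; apply: bigcup_sub => i Ii.
by move=> A [B mB <-]; exact: mf.
Qed.

End measurable_rV_theory.

Section lebesgue_rV.
Context {R : realType}.
Local Open Scope ereal_scope.

Definition cons_rV n (z : measurableTypeR R * 'rV[R]_n) : 'rV[R]_n.+1 :=
  row_mx (const_mx z.1 : 'rV[R]_1) z.2.

Lemma measurable_cons_rV n : measurable_fun setT (@cons_rV n).
Proof.
apply: measurable_fun_rVP => i.
have -> : (fun t => cons_rV t 0%R i : measurableTypeR R) =
    fun t => if fintype.split (i : 'I_(1 + n)) is inr j then t.2 0%R j else t.1.
  apply/funext => t; rewrite /cons_rV mxE.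
  by case: fintype.split => // a; rewrite mxE.
case: fintype.split => [_|j]; first exact: measurable_fst.
exact: (measurableT_comp (measurable_rV_coord j) measurable_snd).
Qed.

Lemma cons_rV0 n (z : measurableTypeR R * 'rV[R]_n) : cons_rV z 0%R 0%R = z.1.
Proof. by rewrite /cons_rV mxE; case: fintype.splitP => // j _; rewrite mxE. Qed.

Lemma cons_rVS n (z : measurableTypeR R * 'rV[R]_n) i :
  cons_rV z 0%R (lift ord0 i) = z.2 0%R i.
Proof.
rewrite /cons_rV mxE; case: fintype.splitP => [[[|//] ?]//|j /= [ij]].
by congr (z.2 _ _); exact/esym/val_inj.
Qed.

Lemma rsubmx_cons_rV n (z : measurableTypeR R * 'rV[R]_n) :
  @rsubmx _ 1 1 n (cons_rV z) = z.2.
Proof. by rewrite /cons_rV row_mxKr. Qed.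

Lemma measurable_rsubmx n :
  measurable_fun [set: 'rV[R]_n.+1] (@rsubmx _ 1 1 n).
Proof.
apply: measurable_fun_rVP => i.
have -> : (fun t : 'rV[R]_n.+1 => @rsubmx _ 1 1 n t 0%R i : measurableTypeR R) =
    fun t => t 0%R (rshift 1 i) by apply/funext => t; rewrite mxE.
exact: measurable_rV_coord.
Qed.

Section step.
Variables (n : nat) (m : {sigma_finite_measure set 'rV[R]_n -> \bar R}).

Definition leb_cons : set 'rV[R]_n.+1 -> \bar R :=
  pushforward (lebesgue_measure \x m) (@cons_rV n).

Let P : {measure set (measurableTypeR R * 'rV[R]_n) -> \bar R} :=
  [the measure _ _ of lebesgue_measure \x m].

Let mpre A : measurable A -> measurable (@cons_rV n @^-1` A).
Proof. by move=> mA; rewrite -[X in measurable X]setTI; exact: measurable_cons_rV. Qed.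

Let leb_cons0 : leb_cons set0 = 0.
Proof. by rewrite /leb_cons /pushforward preimage_set0 (measure0 P). Qed.

Let leb_cons_ge0 A : 0 <= leb_cons A.
Proof. exact: (measure_ge0 P). Qed.

Let leb_cons_sigma_additive : semi_sigma_additive leb_cons.
Proof.
move=> F mF tF mUF; rewrite /leb_cons /pushforward preimage_bigcup.
apply: (@measure_semi_sigma_additive _ _ _ P).
- by move=> k; exact: mpre.
- apply/trivIsetP => /= i j _ _ ij; rewrite -preimage_setI.
  by move/trivIsetP : tF => /(_ _ _ _ _ ij) ->//; rewrite preimage_set0.
- by rewrite -preimage_bigcup; exact: mpre.
Qed.

HB.instance Definition _ := isMeasure.Build _ _ _ leb_cons
  leb_cons0 leb_cons_ge0 leb_cons_sigma_additive.

Let leb_cons_sigma_finite : sigma_finite setT leb_cons.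
Proof.
have /sigma_finiteP[F [TF ndF Foo]] := sigma_finiteT (@lebesgue_measure R).
have /sigma_finiteP[G [TG ndG Goo]] := sigma_finiteT m.
exists (fun k => (fun x : 'rV[R]_n.+1 => x 0%R 0%R) @^-1` F k `&`
                 @rsubmx _ 1 1 n @^-1` G k).
  apply/seteqP; split => // x _.
  have [i _ Fi] : (\bigcup_i F i) (x 0%R 0%R) by rewrite -TF.
  have [j _ Gj] : (\bigcup_i G i) (@rsubmx _ 1 1 n x) by rewrite -TG.
  exists (maxn i j) => //; split => /=.
    by move: (x 0%R 0%R) Fi; exact/subsetPset/ndF/leq_maxl.
  by move: (@rsubmx _ 1 1 n x) Gj; exact/subsetPset/ndG/leq_maxr.
move=> k; have [mF Fk] := Foo k; have [mG Gk] := Goo k; split.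
  apply: measurableI; rewrite -[X in measurable X]setTI.
    exact: (measurable_rV_coord 0%R).
  exact: measurable_rsubmx.
rewrite /leb_cons /pushforward (_ : _ @^-1` _ = F k `*` G k).
  by rewrite product_measure1E// lte_mul_pinfty// ge0_fin_numE.
by apply/seteqP; split => -[a b] /=; rewrite cons_rV0 rsubmx_cons_rV.
Qed.

HB.instance Definition _ := @Measure_isSigmaFinite.Build _ _ _ leb_cons
  leb_cons_sigma_finite.

End step.

(* Lebesgue measure on R^n (restricted to the product sigma-algebra): the
   iterated product of the one-dimensional Lebesgue measure. *)
Fixpoint leb n : {sigma_finite_measure set 'rV[R]_n -> \bar R} :=
  match n with
  | 0 => [the {sigma_finite_measure set _ -> \bar R} of dirac (0%R : 'rV[R]_0)]
  | m.+1 => [the {sigma_finite_measure set _ -> \bar R} of leb_cons (leb m)]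
  end.

Lemma leb_box n (A : 'I_n -> set (measurableTypeR R)) :
  (forall i, measurable (A i)) ->
  leb n [set x | forall i, A i (x 0%R i)] = \prod_(i < n) lebesgue_measure (A i).
Proof.
elim: n A => [|n IHn] A mA.
  rewrite big_ord0 /= diracE (_ : _ \in _)// mem_set//= => -[].
  by [].
rewrite big_ord_recl /= /leb_cons /pushforward.
have mB : measurable [set x : 'rV[R]_n | forall i, A (lift ord0 i) (x 0%R i)].
  have -> : [set x : 'rV[R]_n | forall i, A (lift ord0 i) (x 0%R i)] =
      \bigcap_(i in [set: 'I_n])
        ((fun x : 'rV[R]_n => x 0%R i) @^-1` A (lift ord0 i)).
    by apply/seteqP; split => x /= h i; [move=> _; exact: h|exact: (h i I)].
  apply: fin_bigcap_measurable => // i _; rewrite -[X in measurable X]setTI.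
  exact: measurable_rV_coord.
rewrite (_ : _ @^-1` _ =
    A ord0 `*` [set x : 'rV[R]_n | forall i, A (lift ord0 i) (x 0%R i)]).
  by rewrite product_measure1E// -IHn.
apply/seteqP; split => -[a b] /= h.
  split; first by have := h ord0; rewrite cons_rV0.
  by move=> i; have := h (lift ord0 i); rewrite cons_rVS.
move=> i; case: (unliftP ord0 i) => [j ->|->].
  by rewrite cons_rVS; exact: h.2.
by rewrite cons_rV0; exact: h.1.
Qed.

End lebesgue_rV.

Section euclidean.
Context {R : realType}.

(* The library's norm on 'rV[R]_n is the sup norm; it is only used through the
   topology and boundedness, which do not depend on the choice of the norm. *)
Definition enorm n (x : 'rV[R]_n) : R := Num.sqrt (\sum_(i < n) x 0 i ^+ 2).

Definition basis_rV n (i : 'I_n) : 'rV[R]_n := delta_mx 0 i.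

Definition partial n (i : 'I_n) (f : 'rV[R]_n -> R) : 'rV[R]_n -> R :=
  'D_(basis_rV i) (f : 'rV[R]_n -> R^o).

Definition grad n (f : 'rV[R]_n -> R) (x : 'rV[R]_n) : 'rV[R]_n :=
  \row_(i < n) partial i f x.

Definition div n (F : 'rV[R]_n -> 'rV[R]_n) (x : 'rV[R]_n) : R :=
  \sum_(i < n) partial i (fun y => F y 0 i) x.

(* All iterated partial derivatives up to order k exist and are continuous. *)
Fixpoint C_ k n (f : 'rV[R]_n -> R) : Prop :=
  continuous f /\
  if k is k'.+1 then
    forall i : 'I_n,
      (forall x, derivable (f : 'rV[R]_n -> R^o) x (basis_rV i)) /\
      C_ k' (partial i f)
  else True.

Definition smooth n (f : 'rV[R]_n -> R) : Prop := forall k, C_ k f.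

Definition test_function n (phi : 'rV[R]_n -> R) : Prop :=
  smooth phi /\ compact (closure [set x | phi x != 0]).

Definition boundary n (A : set 'rV[R]_n) : set 'rV[R]_n :=
  closure A `\` A°.

End euclidean.

Section sobolev.
Context {R : realType}.

Definition loc_integrable n (u : 'rV[R]_n -> R) : Prop :=
  measurable_fun setT u /\
  forall K : set 'rV[R]_n, compact K -> (leb n).-integrable K (EFin \o u).

Definition weak_partial n (i : 'I_n) (u g : 'rV[R]_n -> R) : Prop :=
  loc_integrable g /\
  forall phi, test_function phi ->
    (\int[leb n]_x (u x * partial i phi x)%:E =
     - \int[leb n]_x (g x * phi x)%:E)%E.

Definition weak_gradient n (u : 'rV[R]_n -> R) (G : 'rV[R]_n -> 'rV[R]_n) :
    Prop :=
  forall i : 'I_n, weak_partial i u (fun x => G x 0 i).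

Definition hoelder n (a : R) (u : 'rV[R]_n -> R) : Prop :=
  exists C : R, forall x y, `|u x - u y| <= C * enorm (x - y) `^ a.

(* Elements are functions, not classes: as p > n, each class is represented by
   its unique Hoelder continuous member, of Morrey's exponent 1 - n / p. *)
Definition D1p n (p : R) (u : 'rV[R]_n -> R) : Prop :=
  [/\ loc_integrable u, hoelder (1 - n%:R / p) u &
    exists G, weak_gradient u G /\
      forall i : 'I_n, (fun x => G x 0 i) \in Lfun (leb n) p%:E].

Definition D1p0 n (p : R) (Omega : set 'rV[R]_n) (u : 'rV[R]_n -> R) : Prop :=
  D1p p u /\ forall x, ~ Omega x -> u x = 0.

(* Some weak gradient of u (it is unique up to a null set), 0 if there is
   none. *)
Definition Dw n (u : 'rV[R]_n -> R) : 'rV[R]_n -> 'rV[R]_n :=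
  xget (fun=> 0) [set G | weak_gradient u G].

(* The L^p norm of the Euclidean length of the weak gradient; it is finite on
   D1p. *)
Definition norm_Dw n (p : R) (u : 'rV[R]_n -> R) : R :=
  fine ('N[leb n]_p%:E[EFin \o (fun x => enorm (Dw u x))])%E.

Definition dist_compl n (Omega : set 'rV[R]_n) (x : 'rV[R]_n) : R :=
  inf [set enorm (x - y) | y in ~` Omega].

(* Hoelder continuity of u and u = 0 off Omega make the set below bounded, so
   that the real supremum is the actual one. *)
Definition hardy_norm n (p : R) (Omega : set 'rV[R]_n) (u : 'rV[R]_n -> R) : R :=
  sup [set `|u x / dist_compl Omega x `^ (1 - n%:R / p)| | x in Omega].

Definition rayleigh n (p : R) (Omega : set 'rV[R]_n) (u : 'rV[R]_n -> R) : R :=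
  hardy_norm p Omega u `^ (- p) * norm_Dw p u `^ p.

Definition admissible n (p : R) (Omega : set 'rV[R]_n) : set ('rV[R]_n -> R) :=
  [set u | D1p0 p Omega u /\ u <> (fun=> 0)].

Definition lambda n (p : R) (Omega : set 'rV[R]_n) : \bar R :=
  ereal_inf [set (rayleigh p Omega u)%:E | u in admissible p Omega].

Definition extremal n (p : R) (Omega : set 'rV[R]_n) (u : 'rV[R]_n -> R) :
    Prop :=
  admissible p Omega u /\ (rayleigh p Omega u)%:E = lambda p Omega.

End sobolev.

(* Hypersurfaces live in dimension n.+1, the graph functions have n variables;
   the last coordinate of x is x 0 ord_max. *)
Section hypersurface.
Context {R : realType}.

Definition half_space n : set 'rV[R]_n.+1 := [set x | 0 < x 0 ord_max].

Definition horizontal n (x : 'rV[R]_n.+1) : 'rV[R]_n :=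
  \row_(j < n) x 0 (widen_ord (leqnSn n) j).

Definition rigid_motion n (T : 'rV[R]_n -> 'rV[R]_n) : Prop :=
  exists (Q : 'M[R]_n) (b : 'rV[R]_n),
    Q *m Q^T = 1%:M /\ forall x, T x = x *m Q + b.

(* In the coordinates T x, Omega is the epigraph side of the C^2 function f
   near y. *)
Definition C2_chart n (Omega : set 'rV[R]_n.+1) (y : 'rV[R]_n.+1)
    (T : 'rV[R]_n.+1 -> 'rV[R]_n.+1) (f : 'rV[R]_n -> R) : Prop :=
  [/\ rigid_motion T, C_ 2 f &
    \forall x \near y, Omega x <-> f (horizontal (T x)) < T x 0 ord_max].

Definition C2_set n (Omega : set 'rV[R]_n.+1) : Prop :=
  forall y, boundary Omega y -> exists T f, C2_chart Omega y T f.

(* Mean curvature of the graph of f at (z, f z), with respect to the normal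
   pointing below the graph; n is the ambient dimension minus one. *)
Definition graph_mean_curvature n (f : 'rV[R]_n -> R) (z : 'rV[R]_n) : R :=
  n%:R^-1 *
  div (fun w => (Num.sqrt (1 + enorm (grad f w) ^+ 2))^-1 *: grad f w) z.

(* The value does not depend on the chart. *)
Definition has_mean_curvature n (Omega : set 'rV[R]_n.+1) (y : 'rV[R]_n.+1)
    (H : R) : Prop :=
  exists T f, C2_chart Omega y T f /\
    H = graph_mean_curvature f (horizontal (T y)).

Definition mean_convex n (Omega : set 'rV[R]_n.+1) : Prop :=
  C2_set Omega /\
  forall y, boundary Omega y -> forall H, has_mean_curvature Omega y H -> 0 <= H.

End hypersurface.

Arguments half_space {R} n.

(* Main.v *)
Require Import Defs.
From HB Require Import structures.
From mathcomp Require Import all_boot all_order all_algebra.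
From mathcomp Require Import all_classical all_reals all_analysis.
From mathcomp Require Import measurable_realfun ring lra zify.
Set Implicit Arguments.
Unset Strict Implicit.
Unset Printing Implicit Defensive.
Import Order.TTheory GRing.Theory Num.Theory.
Import numFieldNormedType.Exports.
Local Open Scope classical_set_scope.
Local Open Scope ring_scope.

(* lambda_p(Omega) is the infimum over x of dist(x)^(p-N) cap(x), where cap(x)
  is the least energy of a function vanishing off Omega and equal to 1 at x.
  Let w be the capacitary function of the point e at height 1 over the half
  space, and l its energy. Dilating, rotating and shearing w along the
  quadratic form S makes it a competitor in Omega at height eps over a boundary
  point near which Omega contains {s > S(y)}; its energy is
  l + eps (F(S) + o(1)) with F linear. By rotational symmetry F(S) = c tr S,
  and c > 0: for a large paraboloid S the sheared function, lowered slightly,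
  is supported in a half space closer to e, where l must increase.
  At a boundary point of negative mean curvature one may take tr S < 0, so
  lambda_p(Omega) < l <= lambda_p(half space). A minimizing sequence of points
  x cannot approach the boundary, since by blowing up the limit inferior of
  dist(x)^(p-N) cap(x) is at least l there; hence an extremal exists. *)

(** The half space is unbounded and the shear tilts the gradient by a factor of order |x|, so the
    first variation makes sense only if |Dw|^p |x| is integrable. No regularity theory is used: w is
    compared with an explicit supersolution of the p-Laplace equation that has a pole on the
    boundary. This gives w = O(|x|^(-n/(p-1))) at infinity and w = O(x_0) near the origin, and
    Caccioppoli inequalities turn both bounds into integral bounds on Dw, about which nothing is
    known pointwise. All expansions are one-sided: convexity of |.|^p bounds the energy of a
    competitor from above, which serves both the strict inequality and c > 0. In the proof of c > 0
    the gain (p - N) l, with N = n + 1, is of order one, while lowering the function costs O(t^n)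
    for a paraboloid of width t; here n > 0 and the behaviour of w near the origin enter. The normal
    direction is the coordinate 0, whereas [half_space] uses the last one: [leb] is an iterated
    product that adds the coordinate 0, so Fubini shows at once that shears in this direction
    preserve it. *)

Section measure_space.
Context {R : realType}.
Implicit Types n : nat.

(** * Boxes, open sets and uniqueness of Lebesgue measure on R^n *)

Lemma mx_norm_leP n (x : 'rV[R]_n) (r : R) : 0 <= r ->
 `|x| <= r <-> forall i, `|x 0 i| <= r.
Proof.
move=> r0; rewrite [`|x|]mx_normrE; split => [h i|h].
 apply: le_trans h. exact: (le_bigmax 0 (fun ij : 'I_1 * 'I_n => `|x ij.1 ij.2|) (0, i)).
by apply: bigmax_le => // -[i j] _; rewrite /= ord1.
Qed.

Lemma mx_norm_ltP n (x : 'rV[R]_n) (r : R) : 0 < r ->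
 `|x| < r <-> forall i, `|x 0 i| < r.
Proof.
move=> r0; rewrite [`|x|]mx_normrE; split => [h i|h].
 apply: le_lt_trans h. exact: (le_bigmax 0 (fun ij : 'I_1 * 'I_n => `|x ij.1 ij.2|) (0, i)).
by apply: bigmax_lt => // -[i j] _; rewrite /= ord1.
Qed.

Lemma coord_le_norm n (x : 'rV[R]_n) i : `|x 0 i| <= `|x|.
Proof. by have /mx_norm_leP := lexx `|x|; apply. Qed.

Definition box n (A : 'I_n -> set R) : set 'rV[R]_n :=
 [set x | forall i, A i (x 0 i)].

Lemma measurable_box n (A : 'I_n -> set (measurableTypeR R)) :
 (forall i, measurable (A i)) -> measurable (box A).
Proof.
move=> mA; have -> : box A = \bigcap_(i in [set: 'I_n]) ((fun x : 'rV[R]_n => x 0%R i) @^-1` A i).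
 by apply/seteqP; split => x /= h i; [move=> _; exact: h|exact: (h i I)].
apply: fin_bigcap_measurable => // i _; rewrite -[X in measurable X]setTI.
exact: (measurable_rV_coord i).
Qed.

Definition obox n (a b : 'rV[R]_n) : set 'rV[R]_n :=
 box (fun i => `]a 0 i, b 0 i[%classic).

Definition rat_obox n (c : 'rV[rat]_n * nat) : set 'rV[R]_n :=
 obox (\row_i (ratr (c.1 0 i) - c.2.+1%:R^-1)) (\row_i (ratr (c.1 0 i) + c.2.+1%:R^-1)).

(** The cubes have rational centres and radii 1/(k+1), so the union is countable; this is what makes
    open sets measurable for the sigma-algebra generated by the coordinates. *)
Lemma open_bigcup_obox n (A : set 'rV[R]_n) : open A ->
 A = \bigcup_c (if `[< @rat_obox n c `<=` A >] then rat_obox c else set0).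
Proof.
move=> oA.
 apply/seteqP; split=> [x Ax|x [c _]]; last by case: asboolP => // h /h.
 have /nbhs_ballP[e /= e0 he] := open_nbhs_nbhs (conj oA Ax).
 have [k [d [d0 hd hdk]]] : exists k (d : R), [/\ 0 < d, d < e / 2 & k.+1%:R^-1 = d].
  have := near_infty_natSinv_lt (PosNum (divr_gt0 e0 (ltr0n R 2))).
  by case=> k _ /(_ k (leqnn k)); exists k, k.+1%:R^-1; split => //; rewrite invr_gt0.
 have q (i : 'I_n) : {q : rat | `|ratr q - x 0 i| < d}.
  apply: cid; have [q] := @rat_in_itvoo R (x 0 i - d) (x 0 i + d) ltac:(lra).
  by rewrite in_itv/= => /andP[? ?]; exists q; rewrite ltr_norml; apply/andP; split; lra.
 pose c : 'rV[rat]_n := \row_i sval (q i). exists (c, k) => //; rewrite asboolT.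
  move=> i; rewrite /= in_itv /= !mxE hdk; case: (q i) => r /= hr.
  by move: hr; rewrite ltr_norml => /andP[? ?]; apply/andP; split; lra.
 move=> y By; apply: he; rewrite -ball_normE /=; apply/mx_norm_ltP => // i.
 have := By i; rewrite /= in_itv /= !mxE hdk; case: (q i) => r /= hr /andP[h1 h2].
 move: hr; rewrite ?mxE !ltr_norml => /andP[? ?]; apply/andP; split; lra.
Qed.

Lemma open_measurable_rV n (A : set 'rV[R]_n) : open A -> measurable A.
Proof.
move=> /open_bigcup_obox ->.
apply: countable_bigcupT_measurable; first exact: countableP.
move=> c; case: asboolP => // _; apply: measurable_box => i; exact: measurable_itv.
Qed.

Lemma closed_measurable_rV n (A : set 'rV[R]_n) : closed A -> measurable A.
Proof.
move=> cA; have /measurableC : measurable (~` A) by apply: open_measurable_rV; rewrite openC.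
by rewrite setCK.
Qed.

Lemma continuous_measurable_rV n (f : 'rV[R]_n -> R) : continuous f ->
 measurable_fun setT (f : _ -> measurableTypeR R).
Proof.
move=> cf; apply: (measurability _ (measurable_realfun.RGenOpens.measurableE R)).
move=> _ [_ [a [b ->] <-]]; rewrite setTI; apply: open_measurable_rV.
by apply: open_comp => [x _|]; [exact: cf|exact: interval_open].
Qed.

(** Boxes are stable under intersection and generate the sigma-algebra, and the cubes [g k] have
    finite measure and exhaust the space. Affine changes of variables are verified through this
    criterion. *)
Lemma leb_unique n (m : {measure set 'rV[R]_n -> \bar R}) :
 (forall A : 'I_n -> set (measurableTypeR R), (forall i, measurable (A i)) ->
  m (box A) = (\prod_(i < n) lebesgue_measure (A i))%E) ->
 forall A, measurable A -> m A = leb n A.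
Proof.
move=> hm.
pose G : set (set 'rV[R]_n) := [set X | exists2 A : 'I_n -> set (measurableTypeR R),
 (forall i, measurable (A i)) & X = box A].
pose g (k : nat) : set 'rV[R]_n := box (fun i => `](- k%:R), k%:R]%classic).
have Gm : G `<=` @measurable _ 'rV[R]_n by move=> _ [A mA ->]; exact: measurable_box.
have GB A : (forall i, measurable (A i)) -> G (box A) by exists A.
apply: (measure_unique G g).
- apply/seteqP; split; last by apply: smallest_sub => //; exact: sigma_algebra_measurable.
 apply: smallest_sub; first exact: smallest_sigma_algebra.
 case: n m hm G g Gm GB => [|n] m hm G g Gm GB; first by rewrite big_ord0.
 rewrite -bigcup_mkord_ord; apply: bigcup_sub => i Ii.
 move=> A [B mB <-]; apply: sub_sigma_algebra; rewrite setTI.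
 suff -> : (fun x : 'rV_n.+1 => x 0 (inord i)) @^-1` B = box (fun j => if j == inord i then B else setT).
  by apply: GB => j; case: ifP.
 apply/seteqP; split => x /= h; last by have := h (inord i); rewrite eqxx.
 by move=> j; case: eqP => // ->.
- move=> _ _ [A mA ->] [B mB ->]; exists (fun i => A i `&` B i); first by move=> i; exact: measurableI.
 by apply/seteqP; split => x /=; [move=> [h1 h2] i; split|move=> h; split => i; have [] := h i].
- by move=> k; exists (fun=> `](- k%:R), k%:R]%classic) => // i; exact: measurable_itv.
- apply/seteqP; split=> // x _.
 have [k hk] : exists k : nat, `|x| < k%:R.
  by exists (Num.truncn `|x|).+1; exact: truncnS_gt.
 exists k => // i /=; rewrite in_itv /=. have := le_lt_trans (coord_le_norm x i) hk.
 by rewrite ltr_norml => /andP[-> /ltW ->].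
- by move=> _ [A mA ->]; rewrite hm// -leb_box.
- move=> k /=; rewrite hm; last by move=> i; exact: measurable_itv.
 have : exists r : R, (\prod_(i < n) lebesgue_measure (`](- k%:R)%R, (k%:R)%R]%classic : set R))%E = r%:E; last first.
  by move=> [r ->]; rewrite ltry.
 apply: (big_ind (fun x : \bar R => exists r, x = r%:E)); first by exists 1.
  by move=> _ _ [a ->] [b ->]; exists (a * b).
 move=> i _; rewrite lebesgue_measure_itv /=; case: ifP => _; last by exists 0.
 by eexists; rewrite -EFinD.
Qed.

End measure_space.

(** * Pushforward measures multiplied by a constant *)

Section scaled_pushforward.
Context d1 d2 (T1 : measurableType d1) (T2 : measurableType d2) (R : realType).
Variables (c : {nonneg R}) (m : {measure set T1 -> \bar R}) (f : T1 -> T2).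
Local Open Scope ereal_scope.

(** Taking the proof of measurability as an argument lets the measure structure be attached to the
    term [cpush mf]. *)
Definition cpush of measurable_fun setT f := fun A : set T2 => mscale c m (f @^-1` A).

Variable mf : measurable_fun setT f.

Let cpush0 : cpush mf set0 = 0.
Proof. by rewrite /cpush preimage_set0 measure0. Qed.

Let cpush_ge0 A : 0 <= cpush mf A.
Proof. exact: measure_ge0. Qed.

Let mpre A : measurable A -> measurable (f @^-1` A).
Proof. by move=> mA; rewrite -[X in measurable X]setTI; exact: mf. Qed.

Let cpush_sigma_additive : semi_sigma_additive (cpush mf).
Proof.
move=> F mF tF mUF; rewrite /cpush preimage_bigcup.
apply: measure_semi_sigma_additive.
- by move=> k; exact: mpre.
- apply/trivIsetP => /= i j _ _ ij; rewrite -preimage_setI.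
 by move/trivIsetP : tF => /(_ _ _ _ _ ij) ->//; rewrite preimage_set0.
- by rewrite -preimage_bigcup; exact: mpre.
Qed.

HB.instance Definition _ := isMeasure.Build _ _ _ (cpush mf)
 cpush0 cpush_ge0 cpush_sigma_additive.

Lemma cpush_measure : exists nu : {measure set T2 -> \bar R},
 forall A, nu A = c%:num%:E * m (f @^-1` A).
Proof. by exists [the {measure set T2 -> \bar R} of cpush mf]. Qed.

End scaled_pushforward.

(** * Continuity rules and affine changes of variables *)

Section invariance.
Context {R : realType}.
Implicit Types n : nat.

Lemma continuous_coord n (i : 'I_n) : continuous (fun x : 'rV[R]_n => x 0 i).
Proof. exact: coord_continuous. Qed.

Lemma contD (T : topologicalType) (f g : T -> R) : continuous f -> continuous g ->
 continuous (fun x => f x + g x).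
Proof. by move=> cf cg x; exact: (cvgD (cf x) (cg x)). Qed.

Lemma contB (T : topologicalType) (f g : T -> R) : continuous f -> continuous g ->
 continuous (fun x => f x - g x).
Proof. by move=> cf cg x; exact: (cvgB (cf x) (cg x)). Qed.

Lemma contN (T : topologicalType) (f : T -> R) : continuous f ->
 continuous (fun x => - f x).
Proof. by move=> cf x; exact: (cvgN (cf x)). Qed.

Lemma contM (T : topologicalType) (f g : T -> R) : continuous f -> continuous g ->
 continuous (fun x => f x * g x).
Proof. by move=> cf cg x; exact: (cvgM (cf x) (cg x)). Qed.

Lemma cont_cst (T : topologicalType) (c : R) : continuous (fun _ : T => c).
Proof. by move=> x; exact: cvg_cst. Qed.

Lemma cont_norm (T : topologicalType) (f : T -> R) : continuous f ->
 continuous (fun x => `|f x|).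
Proof. by move=> cf x; exact: (cvg_norm (cf x)). Qed.

Lemma contX (T : topologicalType) (f : T -> R) k : continuous f ->
 continuous (fun x => f x ^+ k).
Proof.
move=> cf; elim: k => [|k IH]; first by under eq_fun do rewrite expr0; exact: cont_cst.
by under eq_fun do rewrite exprS; exact: contM.
Qed.

Lemma cont_sum (T : topologicalType) (I : Type) (r : seq I) (P : pred I) (f : I -> T -> R) :
 (forall i, P i -> continuous (f i)) -> continuous (fun x => \sum_(i <- r | P i) f i x).
Proof. exact: (@continuous_big R I +%R 0 P add_continuous). Qed.

Lemma contV (T : topologicalType) (f : T -> R) : (forall x, f x != 0) -> continuous f ->
 continuous (fun x => (f x)^-1).
Proof. by move=> f0 cf x; exact: (cvgV (f0 x) (cf x)). Qed.

Lemma cont_comp (T U V : topologicalType) (f : T -> U) (g : U -> V) :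
 continuous f -> continuous g -> continuous (fun x => g (f x)).
Proof. by move=> cf cg x; exact: (continuous_comp (cf x) (cg (f x))). Qed.

Lemma continuous_rVP (T : topologicalType) n (f : T -> 'rV[R]_n) :
 (forall i, continuous (fun x => f x 0 i)) -> continuous f.
Proof.
move=> cf x; apply/cvgrPdist_lt => e e0.
have : \forall y \near x, forall i, `|f x 0 i - f y 0 i| < e.
 apply: filter_forall => i; have /cvgrPdist_lt := cf i x; exact.
by apply: filterS => y h; apply/mx_norm_ltP => // i; rewrite !mxE.
Qed.

Lemma continuous_measurable_rV_rV n m (f : 'rV[R]_n -> 'rV[R]_m) : continuous f ->
 measurable_fun setT f.
Proof.
move=> cf; apply: measurable_fun_rVP => i; apply: continuous_measurable_rV => x.
exact: (continuous_comp (cf x) (@continuous_coord _ i (f x))).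
Qed.

Lemma continuous_affine_rV n (a : R) (b : 'rV[R]_n) : continuous (fun x : 'rV[R]_n => a *: x + b).
Proof.
apply: continuous_rVP => i; under eq_fun do rewrite !mxE.
by apply: contD; [apply: contM; [exact: cont_cst|exact: continuous_coord]|exact: cont_cst].
Qed.

Lemma continuous_mulmx n m (Q : 'M[R]_(n, m)) : continuous (fun x : 'rV[R]_n => x *m Q).
Proof.
apply: continuous_rVP => i; under eq_fun do rewrite mxE.
by apply: cont_sum => j _; apply: contM; [exact: continuous_coord|exact: cont_cst].
Qed.

Lemma preimage_measurable n m (f : 'rV[R]_n -> 'rV[R]_m) A : continuous f ->
 measurable A -> measurable (f @^-1` A).
Proof.
by move=> cf mA; rewrite -[X in measurable X]setTI; apply: continuous_measurable_rV_rV.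
Qed.

(** After multiplication by |a| the pushforward agrees with Lebesgue measure on half-open intervals.
    For a < 0 the preimage is closed on the other side, which does not change its length. *)
Lemma lebesgue_affine (a b : R) (A : set (measurableTypeR R)) : a != 0 -> measurable A ->
 lebesgue_measure ((fun x => a * x + b) @^-1` A) = (`|a|^-1%:E * lebesgue_measure A)%E.
Proof.
move=> a0 mA.
have mf : measurable_fun setT (fun x : measurableTypeR R => a * x + b : measurableTypeR R).
 by apply: measurable_funD => //; apply: measurable_funM.
have [mu muE] := cpush_measure (NngNum (normr_ge0 a)) (@lebesgue_measure R) mf.
have H : forall X, ocitv X -> lebesgue_measure X = mu X.
 move=> X /ocitvP[->|[[c d] /= cd ->]]; rewrite muE /=; first by rewrite preimage_set0 !measure0 mule0.
 have [a1|a1] : a < 0 \/ 0 < a by case: (ltgtP a 0) => h; [left|right|rewrite h eqxx in a0].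
  have -> : (fun x => a * x + b) @^-1` `]c, d] = `[(d - b) / a, (c - b) / a[%classic.
   apply/seteqP; split => x /=; rewrite !in_itv /= ler_ndivrMr// ltr_ndivlMr// => /andP[h1 h2]; apply/andP; split; lra.
  rewrite !lebesgue_measure_itv /= !lte_fin cd ltr_nM2r ?invr_lt0// ltrD2r cd -!EFinD -EFinM ltr0_norm//.
  by congr EFin; field.
 have -> : (fun x => a * x + b) @^-1` `]c, d] = `](c - b) / a, (d - b) / a]%classic.
  apply/seteqP; split => x /=; rewrite !in_itv /= ler_pdivlMr// ltr_pdivrMr// => /andP[h1 h2]; apply/andP; split; lra.
 rewrite !lebesgue_measure_itv /= !lte_fin cd ltr_pM2r ?invr_gt0// ltrD2r cd -!EFinD -EFinM gtr0_norm//.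
 by congr EFin; field.
rewrite (lebesgue_measure_unique H mA) muE /=.
by rewrite muleA -EFinM mulVf ?normr_eq0// mul1e.
Qed.

Lemma prode_cstM n (c : R) (F : 'I_n -> \bar R) :
 (\prod_(i < n) (c%:E * F i) = (c ^+ n)%:E * \prod_(i < n) F i)%E.
Proof.
elim: n F => [|n IH] F; first by rewrite !big_ord0 expr0 mule1.
by rewrite !big_ord_recl IH exprS EFinM muleACA.
Qed.

Lemma leb_affine n (a : R) (b : 'rV[R]_n) (A : set 'rV[R]_n) : a != 0 -> measurable A ->
 leb n ((fun x => a *: x + b) @^-1` A) = ((`|a| ^- n)%:E * leb n A)%E.
Proof.
move=> a0 mA.
have mf := continuous_measurable_rV_rV (@continuous_affine_rV n a b).
have [mu muE] := cpush_measure (NngNum (exprn_ge0 n (normr_ge0 a))) (leb n) mf.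
rewrite -[leb n A](@leb_unique R n mu) ?muE//=.
 by rewrite muleA -EFinM mulVf ?expf_eq0 ?normr_eq0 ?(negPf a0) ?andbF// mul1e.
move=> B mB; rewrite muE /=; have -> : (fun x => a *: x + b) @^-1` box B = box (fun i => (fun t => a * t + b 0 i) @^-1` B i).
 by apply/seteqP; split => x /= h i; have := h i; rewrite /= !mxE.
rewrite leb_box; last first.
 move=> i; rewrite -[X in measurable X]setTI.
 have mg : measurable_fun setT (fun t : measurableTypeR R => a * t + b 0 i : measurableTypeR R).
  by apply: measurable_funD => //; apply: measurable_funM.
 exact: (mg measurableT _ (mB i)).
rewrite (eq_bigr (fun i => (`|a|^-1%:E * lebesgue_measure (B i))%E)); last by move=> i _; exact: lebesgue_affine.
by rewrite prode_cstM muleA -EFinM exprVn mulfV ?expf_eq0 ?normr_eq0 ?(negPf a0) ?andbF// mul1e.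
Qed.

Lemma leb_translate n (b : 'rV[R]_n) (A : set 'rV[R]_n) : measurable A ->
 leb n ((fun x => x + b) @^-1` A) = leb n A.
Proof.
move=> mA; have := leb_affine b (oner_neq0 R) mA.
rewrite normr1 expr1n invr1 mul1e => <-; congr (leb n _).
by apply/seteqP; split => x /=; rewrite scale1r.
Qed.

Lemma leb_reflect n (b : 'rV[R]_n) (A : set 'rV[R]_n) : measurable A ->
 leb n ((fun x => b - x) @^-1` A) = leb n A.
Proof.
move=> mA; have a0 : (-1 : R) != 0 by rewrite oppr_eq0 oner_neq0.
have := leb_affine b a0 mA; rewrite normrN1 expr1n invr1 mul1e => <-; congr (leb n _).
by apply/seteqP; split => x /=; rewrite scaleN1r addrC.
Qed.

End invariance.

(** * Euclidean norm, orthogonal matrices and their action on Lebesgue measure *)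

Section euclidean_norm.
Context {R : realType}.
Implicit Types n : nat.

Definition dotp n (x y : 'rV[R]_n) : R := \sum_(i < n) x 0 i * y 0 i.

Lemma dotpC n (x y : 'rV[R]_n) : dotp x y = dotp y x.
Proof. by apply: eq_bigr => i _; rewrite mulrC. Qed.

Lemma dotpDl n (x y z : 'rV[R]_n) : dotp (x + y) z = dotp x z + dotp y z.
Proof. by rewrite -big_split; apply: eq_bigr => i _; rewrite mxE mulrDl. Qed.

Lemma dotpZl n a (x z : 'rV[R]_n) : dotp (a *: x) z = a * dotp x z.
Proof. by rewrite /dotp mulr_sumr; apply: eq_bigr => i _; rewrite mxE mulrA. Qed.

Lemma dotpNl n (x z : 'rV[R]_n) : dotp (- x) z = - dotp x z.
Proof. by rewrite -scaleN1r dotpZl mulN1r. Qed.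

Lemma dotpBl n (x y z : 'rV[R]_n) : dotp (x - y) z = dotp x z - dotp y z.
Proof. by rewrite dotpDl dotpNl. Qed.

Lemma dotpDr n (x y z : 'rV[R]_n) : dotp z (x + y) = dotp z x + dotp z y.
Proof. by rewrite dotpC dotpDl !(dotpC z). Qed.

Lemma dotpZr n a (x z : 'rV[R]_n) : dotp z (a *: x) = a * dotp z x.
Proof. by rewrite dotpC dotpZl (dotpC z). Qed.

Lemma dotpNr n (x z : 'rV[R]_n) : dotp z (- x) = - dotp z x.
Proof. by rewrite dotpC dotpNl (dotpC z). Qed.

Lemma dotpBr n (x y z : 'rV[R]_n) : dotp z (x - y) = dotp z x - dotp z y.
Proof. by rewrite dotpDr dotpNr. Qed.

Lemma dotp0l n (z : 'rV[R]_n) : dotp 0 z = 0.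
Proof. by rewrite -(scale0r (0 : 'rV[R]_n)) dotpZl mul0r. Qed.

Lemma dotp_ge0 n (x : 'rV[R]_n) : 0 <= dotp x x.
Proof. by apply: sumr_ge0 => i _; rewrite -expr2 sqr_ge0. Qed.

Lemma enormE n (x : 'rV[R]_n) : enorm x ^+ 2 = dotp x x.
Proof.
rewrite /enorm sqr_sqrtr; first by apply: eq_bigr => i _; rewrite expr2.
by apply: sumr_ge0 => i _; rewrite sqr_ge0.
Qed.

Lemma enorm_ge0 n (x : 'rV[R]_n) : 0 <= enorm x.
Proof. exact: sqrtr_ge0. Qed.

Lemma enorm_sqrt n (x : 'rV[R]_n) : enorm x = Num.sqrt (dotp x x).
Proof. by rewrite -enormE sqrtr_sqr ger0_norm ?enorm_ge0. Qed.

Lemma norm_le_enorm n (x : 'rV[R]_n) : `|x| <= enorm x.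
Proof.
apply/mx_norm_leP => [|i]; first exact: enorm_ge0.
rewrite -sqrtr_sqr ler_sqrt; last by apply: sumr_ge0 => j _; rewrite sqr_ge0.
by rewrite (bigD1 i) //= lerDl; apply: sumr_ge0 => j _; rewrite sqr_ge0.
Qed.

Lemma dotp_eq0 n (x : 'rV[R]_n) : (dotp x x == 0) = (x == 0).
Proof.
apply/eqP/eqP => [h|->]; last by rewrite dotp0l.
have : `|x| <= 0 by rewrite (le_trans (norm_le_enorm x))// enorm_sqrt h sqrtr0.
by rewrite normr_le0 => /eqP.
Qed.

Lemma enorm_eq0 n (x : 'rV[R]_n) : (enorm x == 0) = (x == 0).
Proof. by rewrite -dotp_eq0 -enormE sqrf_eq0. Qed.

Lemma enorm0 n : enorm (0 : 'rV[R]_n) = 0.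
Proof. by apply/eqP; rewrite enorm_eq0. Qed.

Lemma enorm_gt0 n (x : 'rV[R]_n) : (0 < enorm x) = (x != 0).
Proof. by rewrite lt_def enorm_ge0 andbT enorm_eq0. Qed.

Lemma dotp_sqr_le n (x y : 'rV[R]_n) : dotp x y ^+ 2 <= dotp x x * dotp y y.
Proof.
have [/eqP|y0] := eqVneq (dotp y y) 0.
 by rewrite dotp_eq0 => /eqP ->; rewrite dotpC !dotp0l expr0n mulr0.
have yy : 0 < dotp y y by rewrite lt_def y0 dotp_ge0.
have := dotp_ge0 (dotp y y *: x - dotp x y *: y).
rewrite !(dotpBl, dotpBr, dotpZl, dotpZr) (dotpC y x).
rewrite (_ : _ - _ = dotp y y * (dotp x x * dotp y y - dotp x y ^+ 2)); last by ring.
by rewrite pmulr_rge0// subr_ge0.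
Qed.

Lemma dotp_le n (x y : 'rV[R]_n) : `|dotp x y| <= enorm x * enorm y.
Proof.
rewrite -(@ler_pXn2r _ 2) ?nnegrE ?mulr_ge0 ?enorm_ge0//.
by rewrite exprMn !enormE real_normK ?num_real// dotp_sqr_le.
Qed.

Lemma ler_enormD n (x y : 'rV[R]_n) : enorm (x + y) <= enorm x + enorm y.
Proof.
rewrite -(@ler_pXn2r _ 2) ?nnegrE ?addr_ge0 ?enorm_ge0//.
rewrite enormE !(dotpDl, dotpDr) (dotpC y x) sqrrD !enormE.
have := le_trans (ler_norm _) (dotp_le x y); lra.
Qed.

Lemma enormZ n a (x : 'rV[R]_n) : enorm (a *: x) = `|a| * enorm x.
Proof.
by rewrite !enorm_sqrt dotpZl dotpZr mulrA -expr2 sqrtrM ?sqr_ge0// sqrtr_sqr.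
Qed.

Lemma enormN n (x : 'rV[R]_n) : enorm (- x) = enorm x.
Proof. by rewrite -scaleN1r enormZ normrN1 mul1r. Qed.

Lemma enormB n (x y : 'rV[R]_n) : enorm (x - y) = enorm (y - x).
Proof. by rewrite -enormN opprB. Qed.

Lemma ler_enormB n (x y : 'rV[R]_n) : enorm x - enorm y <= enorm (x - y).
Proof. by rewrite lerBlDr -{1}(subrK y x) ler_enormD. Qed.

Lemma enorm_le_sum n (x : 'rV[R]_n) : enorm x <= \sum_(i < n) `|x 0 i|.
Proof.
rewrite -(@ler_pXn2r _ 2) ?nnegrE ?sumr_ge0 ?enorm_ge0//.
rewrite enormE /dotp.
suff [] : \sum_(i < n) x 0 i * x 0 i <= (\sum_(i < n) `|x 0 i|) ^+ 2 /\ 0 <= \sum_(i < n) `|x 0 i| by [].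
apply: (big_ind2 (fun a b : R => a <= b ^+ 2 /\ 0 <= b)) => [|a b c d [ab b0] [cd d0]|i _].
- by rewrite expr0n.
- split; last exact: addr_ge0.
 by rewrite sqrrD; have := mulr_ge0 b0 d0; lra.
- by rewrite real_normK ?num_real// expr2.
Qed.

Lemma enorm_le_norm n (x : 'rV[R]_n) : enorm x <= n%:R * `|x|.
Proof.
apply: le_trans (enorm_le_sum x) _.
rewrite mulrC mulr_natr -[X in _ *+ X](card_ord n) -sumr_const.
by apply: ler_sum => i _; exact: coord_le_norm.
Qed.

Lemma enorm_continuous n : continuous (@enorm R n).
Proof.
apply: cont_comp (@sqrt_continuous R).
by apply: cont_sum => i _; apply: contX; exact: continuous_coord.
Qed.

Definition orthogonal_mx n (Q : 'M[R]_n) := Q *m Q^T = 1%:M.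

Lemma orthogonal_tr n (Q : 'M[R]_n) : orthogonal_mx Q -> orthogonal_mx Q^T.
Proof. by move=> h; rewrite /orthogonal_mx trmxK; apply: mulmx1C. Qed.

Lemma dotpE n (x y : 'rV[R]_n) : dotp x y = (x *m y^T) 0 0.
Proof. by rewrite mxE; apply: eq_bigr => i _; rewrite mxE. Qed.

Lemma dotp_orthogonal n (Q : 'M[R]_n) x y : orthogonal_mx Q ->
 dotp (x *m Q) (y *m Q) = dotp x y.
Proof. by move=> h; rewrite !dotpE trmx_mul mulmxA -(mulmxA x) h mulmx1. Qed.

Lemma enorm_orthogonal n (Q : 'M[R]_n) x : orthogonal_mx Q -> enorm (x *m Q) = enorm x.
Proof. by move=> h; rewrite !enorm_sqrt dotp_orthogonal. Qed.

Lemma leb_bounded_lty n (A : set 'rV[R]_n) (r : R) : measurable A ->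
 (forall x, A x -> `|x| <= r) -> (leb n A < +oo)%E.
Proof.
move=> mA hA.
pose B : set 'rV[R]_n := box (fun=> `[(- r)%R, r]%classic).
have mB : measurable B by apply: measurable_box => i; exact: measurable_itv.
apply: (@le_lt_trans _ _ (leb n B)).
 apply: le_measure; rewrite ?inE// => x Ax i /=.
 by rewrite in_itv /= -ler_norml; apply: le_trans (coord_le_norm _ _) (hA _ Ax).
rewrite leb_box; last by move=> i; exact: measurable_itv.
have : exists s : R, (\prod_(i < n) lebesgue_measure (`[(- r)%R, r]%classic : set R))%E = s%:E; last first.
 by move=> [s ->]; rewrite ltry.
apply: (big_ind (fun x : \bar R => exists r, x = r%:E)); first by exists 1.
 by move=> _ _ [a ->] [b ->]; exists (a * b).
move=> i _; rewrite lebesgue_measure_itv /=; case: ifP => _; last by exists 0.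
by eexists; rewrite -EFinD.
Qed.

Lemma leb_ball_gt0 n (r : R) : 0 < r -> (0 < leb n [set x : 'rV[R]_n | (enorm x < r)%R])%E.
Proof.
(* Dividing by n + 1 rather than n makes n d < r strict and covers n = 0. *)
move=> r0; pose d := r / n.+1%:R.
have d0 : 0 < d by rewrite divr_gt0.
pose B : set 'rV[R]_n := box (fun=> `](- d)%R, d[%classic).
have mB : measurable B by apply: measurable_box => i; exact: measurable_itv.
apply: (@lt_le_trans _ _ (leb n B)).
 rewrite leb_box; last by move=> i; exact: measurable_itv.
 apply: (big_ind (fun x : \bar R => 0 < x)%E) => [//|x y x0 y0|i _]; first exact: mule_gt0.
 by rewrite lebesgue_measure_itv /= lte_fin gtrN// -EFinD lte_fin subr_gt0 gtrN.
apply: le_measure; rewrite ?inE//.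
 apply: open_measurable_rV; apply: (@open_comp _ _ (@enorm R n) [set x | x < r]).
  by move=> x _; exact: enorm_continuous.
 exact: open_lt.
move=> x Bx /=; apply: le_lt_trans (enorm_le_norm _) _.
have xd : `|x| < d by apply/mx_norm_ltP => // i; have := Bx i; rewrite /= in_itv /= -ltr_norml.
apply: (@le_lt_trans _ _ (n%:R * d)); first by rewrite ler_wpM2l// ltW.
by rewrite /d mulrA ltr_pdivrMr// mulrC ltr_pM2l// ltr_nat.
Qed.

Local Open Scope ereal_scope.

(* Uniqueness of Haar measure: comparing the two iterated measures of the set of pairs
  (x, y) with x Q in A and x Q + y in B gives m(A) leb(B) = m(B) leb(A) for m(A) = leb(A Q^-1). *)
Lemma leb_orthogonal n (Q : 'M[R]_n) (A : set 'rV[R]_n) : orthogonal_mx Q -> measurable A ->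
 leb n ((fun x => x *m Q) @^-1` A) = leb n A.
Proof.
move=> oQ mA.
have key (C B : set 'rV[R]_n) : measurable C -> measurable B ->
  leb n ((fun x => x *m Q) @^-1` C) * leb n B = leb n ((fun x => x *m Q) @^-1` B) * leb n C.
 move: C => {}A {}mA mB. have mQ : measurable_fun [set: 'rV[R]_n] (fun x : 'rV[R]_n => x *m Q).
  by apply: continuous_measurable_rV_rV; exact: continuous_mulmx.
 have mcomb (a b : R) : measurable_fun [set: 'rV[R]_n * 'rV[R]_n]
   (fun z => (a *: (z.1 *m Q) + b *: z.2)%R).
  apply: measurable_fun_rVP => i; under eq_fun do rewrite !mxE.
  apply: measurable_funD; apply: measurable_funM => //.
   apply: measurable_sum => j.
   by apply: measurable_funM => //; exact: (measurableT_comp (measurable_rV_coord j) measurable_fst).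
  exact: (measurableT_comp (measurable_rV_coord i) measurable_snd).
 pose S1 := [set z : 'rV[R]_n * 'rV[R]_n | A (z.1 *m Q) /\ B (z.1 *m Q + z.2)%R].
 pose S2 := [set z : 'rV[R]_n * 'rV[R]_n | A (z.1 *m Q - z.2)%R /\ B (z.1 *m Q)].
 have mS (C : set 'rV[R]_n) (a b : R) : measurable C ->
   measurable [set z : 'rV[R]_n * 'rV[R]_n | C (a *: (z.1 *m Q) + b *: z.2)%R].
  by move=> mC; rewrite -[X in measurable X]setTI; exact: mcomb.
 have mS1 : measurable S1.
  have -> : S1 = [set z | A (1 *: (z.1 *m Q) + 0 *: z.2)%R] `&` [set z | B (1 *: (z.1 *m Q) + 1 *: z.2)%R].
   by apply/seteqP; split => z /=; rewrite !scale1r scale0r addr0.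
  by apply: measurableI; exact: mS.
 have mS2 : measurable S2.
  have -> : S2 = [set z | A (1 *: (z.1 *m Q) + (-1) *: z.2)%R] `&` [set z | B (1 *: (z.1 *m Q) + 0 *: z.2)%R].
   by apply/seteqP; split => z /=; rewrite !scale1r scale0r addr0 scaleN1r.
  by apply: measurableI; exact: mS.
 have fub (S : set ('rV[R]_n * 'rV[R]_n)) : measurable S -> \int[leb n]_x leb n (xsection S x) = \int[leb n]_y leb n (ysection S y).
  by move=> mS'; have := @indic_fubini_tonelli _ _ 'rV[R]_n 'rV[R]_n R (leb n) (leb n) S mS'; rewrite indic_fubini_tonelli_FE// indic_fubini_tonelli_GE.
 have mpre C : measurable C -> measurable ((fun x => x *m Q) @^-1` C).
  by move=> mC; rewrite -[X in measurable X]setTI; exact: mQ.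
 have E1 : \int[leb n]_x leb n (xsection S1 x) = leb n ((fun x => x *m Q) @^-1` A) * leb n B.
  rewrite [RHS]muleC -integral_cst; last exact: mpre.
  rewrite [RHS]integral_mkcond; apply: eq_integral => x _; rewrite patchE. case: ifPn => [|] xA.
   rewrite inE /= in xA; rewrite -[RHS](leb_translate (x *m Q) mB); congr (leb n _).
   by apply/seteqP; split => y; rewrite /xsection /= inE /S1 /= addrC => // -[].
  rewrite notin_setE /= in xA; rewrite (_ : xsection _ _ = set0) ?measure0//.
  by apply/seteqP; split => y //; rewrite /xsection /= inE /S1 /= => -[].
 have E2 : \int[leb n]_x leb n (xsection S2 x) = leb n ((fun x => x *m Q) @^-1` B) * leb n A.
  rewrite [RHS]muleC -integral_cst; last exact: mpre.
  rewrite [RHS]integral_mkcond; apply: eq_integral => x _; rewrite patchE. case: ifPn => [|] xA.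
   rewrite inE /= in xA; rewrite -[RHS](leb_reflect (x *m Q) mA); congr (leb n _).
   by apply/seteqP; split => y; rewrite /xsection /= inE /S2 /= => // -[].
  rewrite notin_setE /= in xA; rewrite (_ : xsection _ _ = set0) ?measure0//.
  by apply/seteqP; split => y //; rewrite /xsection /= inE /S2 /= => -[].
 rewrite -E1 -E2 !fub//; apply: eq_integral => y _.
 rewrite -(leb_translate (- (y *m Q^T))%R (measurable_ysection y mS1)); congr (leb n _).
 apply/seteqP; split => x; rewrite /ysection /= !inE /S1 /S2 /=;
  by rewrite mulmxDl mulNmx -mulmxA (mulmx1C oQ) mulmx1 subrK.
(* The unit ball is invariant under Q and has finite positive measure, so it can be cancelled from
   [key]. *)
pose B := [set x : 'rV[R]_n | (enorm x < 1)%R].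
have mB : measurable B.
 apply: open_measurable_rV; apply: (@open_comp _ _ (@enorm R n) [set x | (x < 1)%R]).
  by move=> x _; exact: enorm_continuous.
 exact: open_lt.
have QB : (fun x => x *m Q) @^-1` B = B.
 by apply/seteqP; split => x /=; rewrite /B /= enorm_orthogonal.
have := key _ _ mA mB; rewrite QB muleC => BA.
have B0 : leb n B != 0 by rewrite gt_eqF// leb_ball_gt0.
have Bfin : leb n B \is a fin_num.
 rewrite ge0_fin_numE//; apply: (@leb_bounded_lty _ _ 1) => // x Bx.
 by apply: le_trans (norm_le_enorm x) (ltW Bx).
have Bgt0 : 0 < leb n B by exact: leb_ball_gt0.
by apply/le_anti; rewrite -(lee_pmul2l Bfin Bgt0 (leb n A)) -BA lexx andbT
 -(lee_pmul2l Bfin Bgt0 _ (leb n A)) BA.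
Qed.

End euclidean_norm.

Ltac ctn := lazymatch goal with
 | |- continuous (fun _ => ?c) => exact: cont_cst
 | |- continuous (fun x => fun_of_matrix x _ _) => exact: continuous_coord
 | |- continuous (fun x => @GRing.add _ (@?f x) (@GRing.opp _ (@?g x))) => apply: (@contB _ _ f g); ctn
 | |- continuous (fun x => @GRing.add _ (@?f x) (@?g x)) => apply: (@contD _ _ f g); ctn
 | |- continuous (fun x => @GRing.opp _ (@?f x)) => apply: (@contN _ _ f); ctn
 | |- continuous (fun x => @GRing.mul _ (@?f x) (@?g x)) => apply: (@contM _ _ f g); ctn
 | |- continuous (fun x => @GRing.exp _ (@?f x) ?k) => apply: (@contX _ _ f k); ctn
 | |- continuous (fun x => \sum_(i <- _ | _) _) => apply: cont_sum => ? _; ctn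
 | |- _ => try solve [eauto 2]
 end.

Lemma eqW (R : realDomainType) (x y : R) : x = y -> x <= y.
Proof. by move=> ->. Qed.

#[local] Hint Resolve powR_ge0 enorm_ge0 : core.
#[local] Hint Immediate ltW : core.

(** * Integrals under dilations, rotations and shears *)

Section change_of_variables.
Context {R : realType}.
Implicit Types n : nat.
Local Open Scope ereal_scope.

Lemma ge0_integral_scaled n (c : R) (Phi : 'rV[R]_n -> 'rV[R]_n) (f : 'rV[R]_n -> \bar R) :
 (0 <= c)%R -> continuous Phi ->
 (forall A, measurable A -> leb n (Phi @^-1` A) = c%:E * leb n A) ->
 measurable_fun setT f -> (forall x, 0 <= f x) ->
 \int[leb n]_x f (Phi x) = c%:E * \int[leb n]_x f x.
Proof.
move=> c0 cPhi hPhi mf f0.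
have mPhi : measurable_fun setT Phi by exact: continuous_measurable_rV_rV.
have -> : \int[leb n]_x f (Phi x) = \int[pushforward (leb n) Phi]_x f x.
 by rewrite (ge0_integral_pushforward mPhi)// preimage_setT.
rewrite (_ : c%:E = (NngNum c0)%:num%:E)// -ge0_integral_mscale//.
by apply: eq_measure_integral => A mA _; exact: hPhi.
Qed.

Lemma integral_mp n (Phi : 'rV[R]_n -> 'rV[R]_n) (f : 'rV[R]_n -> \bar R) :
 continuous Phi -> (forall A, measurable A -> leb n (Phi @^-1` A) = leb n A) ->
 measurable_fun setT f -> \int[leb n]_x f (Phi x) = \int[leb n]_x f x.
Proof.
move=> cPhi hPhi mf.
have h1 A : measurable A -> leb n (Phi @^-1` A) = 1%:E * leb n A by move=> mA; rewrite mul1e hPhi.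
rewrite [LHS]integralE [RHS]integralE.
rewrite -[in RHS](mul1e (\int[leb n]_x f^\+ x)) -[in RHS](mul1e (\int[leb n]_x f^\- x)).
rewrite -(ge0_integral_scaled ler01 cPhi h1 (measurable_funepos mf))//.
rewrite -(ge0_integral_scaled ler01 cPhi h1 (measurable_funeneg mf))//.
by congr (_ - _); apply: eq_integral => x _; rewrite -?[f^\+ (Phi x)]/((f^\+ \o Phi) x) -?[f^\- (Phi x)]/((f^\- \o Phi) x) -?funepos_comp -?funeneg_comp.
Qed.

Lemma integrable_mp n (Phi : 'rV[R]_n -> 'rV[R]_n) (f : 'rV[R]_n -> \bar R) :
 continuous Phi -> (forall A, measurable A -> leb n (Phi @^-1` A) = leb n A) ->
 (leb n).-integrable setT f -> (leb n).-integrable setT (f \o Phi).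
Proof.
move=> cPhi hPhi /integrableP[mf fi]; apply/integrableP; split.
 by apply: measurableT_comp => //; exact: continuous_measurable_rV_rV.
have -> : \int[leb n]_x `|(f \o Phi) x| = \int[leb n]_x `|f x|; last by [].
apply: (integral_mp (f := fun x => `|f x|) cPhi hPhi); exact: measurableT_comp.
Qed.

Lemma translate_continuous n (b : 'rV[R]_n) : continuous (fun x : 'rV[R]_n => (x + b)%R).
Proof.
have -> : (fun x : 'rV[R]_n => (x + b)%R) = (fun x => (1 *: x + b)%R).
 by apply/funext => x; rewrite scale1r.
exact: continuous_affine_rV.
Qed.

Lemma integral_translate n (b : 'rV[R]_n) (f : 'rV[R]_n -> \bar R) :
 measurable_fun setT f -> \int[leb n]_x f (x + b)%R = \int[leb n]_x f x.
Proof.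
move=> mf; apply: (integral_mp (Phi := fun x => (x + b)%R)) => //.
 exact: translate_continuous.
by move=> A mA; exact: leb_translate.
Qed.

Lemma integral_orthogonal n (Q : 'M[R]_n) (f : 'rV[R]_n -> \bar R) : orthogonal_mx Q ->
 measurable_fun setT f -> \int[leb n]_x f (x *m Q)%R = \int[leb n]_x f x.
Proof.
move=> oQ mf; apply: (integral_mp (Phi := fun x => (x *m Q)%R)) => //.
 exact: continuous_mulmx.
by move=> A mA; exact: leb_orthogonal.
Qed.

Lemma integrable_orthogonal n (Q : 'M[R]_n) (f : 'rV[R]_n -> \bar R) : orthogonal_mx Q ->
 (leb n).-integrable setT f -> (leb n).-integrable setT (fun x => f (x *m Q)%R).
Proof.
move=> oQ fi; apply: (integrable_mp (Phi := fun x => (x *m Q)%R)) => //.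
 exact: continuous_mulmx.
by move=> A mA; exact: leb_orthogonal.
Qed.

Lemma ge0_integral_dilate n (a : R) (b : 'rV[R]_n) (f : 'rV[R]_n -> \bar R) : a != 0%R ->
 measurable_fun setT f -> (forall x, 0 <= f x) ->
 \int[leb n]_x f (a *: x + b)%R = (`|a| ^- n)%:E * \int[leb n]_x f x.
Proof.
move=> a0 mf f0; apply: (ge0_integral_scaled (Phi := fun x => (a *: x + b)%R)) => //.
- exact: continuous_affine_rV.
- by move=> A mA; exact: leb_affine.
Qed.

Lemma integrable_dilate n (a : R) (b : 'rV[R]_n) (f : 'rV[R]_n -> \bar R) : a != 0%R ->
 (leb n).-integrable setT f -> (leb n).-integrable setT (fun x => f (a *: x + b)%R).
Proof.
move=> a0 /integrableP[mf fi]; apply/integrableP; split.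
 by apply: measurableT_comp => //; apply: continuous_measurable_rV_rV; exact: continuous_affine_rV.
rewrite (ge0_integral_dilate b a0 (f := fun x => `|f x|))//; last exact: measurableT_comp.
by rewrite lte_mul_pinfty// lee_fin invr_ge0 exprn_ge0.
Qed.

Lemma integral_dilate n (a : R) (b : 'rV[R]_n) (f : 'rV[R]_n -> \bar R) : a != 0%R ->
 (leb n).-integrable setT f ->
 \int[leb n]_x f (a *: x + b)%R = (`|a| ^- n)%:E * \int[leb n]_x f x.
Proof.
move=> a0 fi; have mf := measurable_int _ fi.
rewrite [LHS]integralE [in RHS]integralE.
have pE : (fun x => f (a *: x + b)%R)^\+ = f^\+ \o (fun x => (a *: x + b)%R) by rewrite -funepos_comp.
have nE : (fun x => f (a *: x + b)%R)^\- = f^\- \o (fun x => (a *: x + b)%R) by rewrite -funeneg_comp.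
rewrite pE nE /comp.
have -> := ge0_integral_dilate b a0 (measurable_funepos mf) (funepos_ge0 f).
have -> := ge0_integral_dilate b a0 (measurable_funeneg mf) (funeneg_ge0 f).
have H (c P N : R) : c%:E * P%:E - c%:E * N%:E = c%:E * (P%:E - N%:E).
 by first [rewrite muleBr | rewrite muleDr muleN | exact: (congr1 EFin (esym (mulrBr c P N)))].
by rewrite -(fineK (integrable_pos_fin_num measurableT fi)) -(fineK (integrable_neg_fin_num measurableT fi)) H.
Qed.

(** By Fubini in the variable 0: on each line parallel to the first axis g is constant, so the shear
    acts there as a translation. *)
Lemma leb_shear n (g : 'rV[R]_n.+1 -> R) (A : set 'rV[R]_n.+1) : continuous g ->
 (forall x t, g (x + t *: basis_rV ord0)%R = g x) -> measurable A ->
 leb n.+1 ((fun x => (x - g x *: basis_rV ord0)%R) @^-1` A) = leb n.+1 A.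
Proof.
move=> cg hg mA.
have cPhi : continuous (fun x : 'rV[R]_n.+1 => (x - g x *: basis_rV ord0)%R).
 apply: continuous_rVP => i; under eq_fun do rewrite !mxE.
 by apply: contB; [exact: continuous_coord|apply: contM => //; exact: cont_cst].
have E B : measurable B -> leb n.+1 B =
  \int[leb n]_y (@lebesgue_measure R) (ysection (@cons_rV R n @^-1` B) y).
 move=> mB.
 have mB' : measurable (@cons_rV R n @^-1` B) by rewrite -[X in measurable X]setTI; exact: measurable_cons_rV.
 have := @indic_fubini_tonelli _ _ _ _ R (@lebesgue_measure R) (leb n) _ mB'.
 by rewrite indic_fubini_tonelli_FE// indic_fubini_tonelli_GE.
rewrite !E//; last exact: preimage_measurable.
apply: eq_integral => y _.
have mB' : measurable (@cons_rV R n @^-1` A) by rewrite -[X in measurable X]setTI; exact: measurable_cons_rV.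
pose c : R := g (cons_rV (0%R, y)).
have := @lebesgue_affine R 1 (- c)%R _ (oner_neq0 R) (measurable_ysection y mB').
rewrite normr1 invr1 mul1e => <-; congr (lebesgue_measure _).
have consE s : cons_rV (s, y) = (cons_rV (0%R, y) + s *: basis_rV ord0)%R.
 apply/rowP => i.
 have -> : (cons_rV (0%R, y) + s *: basis_rV ord0)%R 0%R i = (cons_rV (0%R, y) 0 i + s * (i == ord0)%:R)%R.
  by rewrite [LHS]mxE; congr (_ + _)%R; rewrite !mxE.
 case: (unliftP ord0 i) => [j ->|->].
  by rewrite !cons_rVS eq_sym (negPf (neq_lift _ _)) mulr0 addr0.
 by rewrite !cons_rV0 eqxx mulr1 add0r.
have consg s : g (cons_rV (s, y)) = c by rewrite consE hg.
have consB s : (cons_rV (s, y) - c *: basis_rV ord0)%R = cons_rV ((s - c)%R, y).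
 by rewrite [LHS](congr1 (fun z => (z - _)%R) (consE s)) -addrA -scalerBl -consE.
by apply/seteqP; split => s; rewrite /ysection /= !inE /= consg consB mul1r.
Qed.

End change_of_variables.

(** * The integral as a real number *)

Section real_integral.
Context {R : realType} (n : nat).
Implicit Types f g h F : 'rV[R]_n -> R.

Definition mfn f := measurable_fun setT (f : 'rV[R]_n -> measurableTypeR R).
Definition integ f := (leb n).-integrable setT (EFin \o f).
(** [fine] turns an infinite integral into 0, so most rules for [I] carry integrability
    hypotheses. *)
Definition I f : R := fine (\int[leb n]_x (f x)%:E)%E.

Lemma integ_mfn f : integ f -> mfn f.
Proof. by move=> /measurable_int /measurable_EFinP. Qed.

Lemma integE f : integ f -> (\int[leb n]_x (f x)%:E)%E = (I f)%:E.
Proof. by move=> fi; rewrite fineK//; exact: integrable_fin_num. Qed.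

Lemma IE f (a : R) : (\int[leb n]_x (f x)%:E)%E = a%:E -> I f = a.
Proof. by rewrite /I => ->. Qed.

Lemma integ0 : integ (fun=> 0).
Proof. exact: integrable0. Qed.

Lemma I0 : I (fun=> 0) = 0.
Proof. by apply: IE; rewrite integral0. Qed.

Lemma integD f g : integ f -> integ g -> integ (fun x => f x + g x).
Proof. by move=> fi gi; exact: (integrableD measurableT fi gi). Qed.

Lemma integZ c f : integ f -> integ (fun x => c * f x).
Proof. by move=> fi; exact: (integrableZl measurableT c fi). Qed.

Lemma integN f : integ f -> integ (fun x => - f x).
Proof. by move=> fi; exact: integrableN fi. Qed.

Lemma integB f g : integ f -> integ g -> integ (fun x => f x - g x).
Proof. by move=> fi gi; exact: (integrableB measurableT fi gi). Qed.

Lemma integ_abs f : integ f -> integ (fun x => `|f x|).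
Proof. by move=> fi; exact: integrable_norm fi. Qed.

Lemma integ_sum (J : Type) (r : seq J) (P : pred J) (f : J -> 'rV[R]_n -> R) :
 (forall j, P j -> integ (f j)) -> integ (fun x => \sum_(j <- r | P j) f j x).
Proof.
move=> fi; elim: r => [|j r IH]; first by under eq_fun do rewrite big_nil; exact: integ0.
case Pj : (P j); under eq_fun do rewrite big_cons Pj; last exact: IH.
by apply: integD => //; exact: fi.
Qed.

Lemma le_integ f g : mfn f -> (forall x, `|f x| <= g x) -> integ g -> integ f.
Proof.
move=> mf fg gi; apply: (le_integrable measurableT _ _ gi); first exact/measurable_EFinP.
move=> x _; rewrite lee_fin; apply: le_trans (fg x) _; exact: ler_norm.
Qed.

Lemma eq_integ f g : f =1 g -> integ f -> integ g.
Proof. by move=> /funext ->. Qed.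

Lemma mfnM f g : mfn f -> mfn g -> mfn (fun x => f x * g x).
Proof. by move=> mf mg; exact: measurable_funM. Qed.

Lemma mfnD f g : mfn f -> mfn g -> mfn (fun x => f x + g x).
Proof. by move=> mf mg; exact: measurable_funD. Qed.

Lemma mfnB f g : mfn f -> mfn g -> mfn (fun x => f x - g x).
Proof. by move=> mf mg; exact: measurable_funB. Qed.

Lemma mfn_cst c : mfn (fun=> c).
Proof. exact: measurable_cst. Qed.

Lemma mfn_sum (J : Type) (r : seq J) (f : J -> 'rV[R]_n -> R) :
 (forall j, mfn (f j)) -> mfn (fun x => \sum_(j <- r) f j x).
Proof. by move=> mf; exact: measurable_sum. Qed.

Lemma mfn_comp (phi : R -> R) f : continuous phi -> mfn f -> mfn (fun x => phi (f x)).
Proof. by move=> cphi mf; exact: measurableT_comp (continuous_measurable_fun cphi) mf. Qed.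

Lemma mfn_abs f : mfn f -> mfn (fun x => `|f x|).
Proof. by move=> mf; apply: (mfn_comp _ mf); exact: norm_continuous. Qed.

Lemma mfn_powR f a : mfn f -> mfn (fun x => f x `^ a).
Proof. by move=> mf; exact: measurableT_comp (measurable_powR a) mf. Qed.

Lemma mfn_cont f : continuous f -> mfn f.
Proof. exact: continuous_measurable_rV. Qed.

Lemma mfn_indic (A : set 'rV[R]_n) : measurable A -> mfn (fun x => \1_A x).
Proof. by move=> mA; exact: measurable_indic. Qed.

Lemma integMb f h M : integ f -> mfn h -> (forall x, `|h x| <= M) ->
 integ (fun x => f x * h x).
Proof.
move=> fi mh hM; apply: (@le_integ _ (fun x => M * `|f x|)).
- by apply: mfnM => //; exact: integ_mfn.
- by move=> x; rewrite normrM mulrC ler_wpM2r.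
- by apply: integZ; exact: integ_abs.
Qed.

Lemma integ_indic f (A : set 'rV[R]_n) : measurable A -> integ f -> integ (fun x => f x * \1_A x).
Proof.
move=> mA fi; apply: (integMb (M := 1) fi); first exact: mfn_indic.
by move=> x; rewrite indicE; case: (_ \in _); rewrite ?normr1 ?normr0.
Qed.

Lemma ID f g : integ f -> integ g -> I (fun x => f x + g x) = I f + I g.
Proof.
move=> fi gi; apply: IE; under eq_integral do rewrite EFinD.
by rewrite (integralD_EFin measurableT fi gi) !integE.
Qed.

Lemma IZ c f : integ f -> I (fun x => c * f x) = c * I f.
Proof.
move=> fi; apply: IE; under eq_integral do rewrite EFinM.
by rewrite (integralZl measurableT fi) integE.
Qed.

Lemma IN f : integ f -> I (fun x => - f x) = - I f.
Proof.
move=> fi; rewrite (_ : (fun x => - f x) = fun x => (-1) * f x).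
 by rewrite IZ// mulN1r.
by apply/funext => x; rewrite mulN1r.
Qed.

Lemma IB f g : integ f -> integ g -> I (fun x => f x - g x) = I f - I g.
Proof. by move=> fi gi; rewrite ID ?IN//; exact: integN. Qed.

Lemma I_sum (J : Type) (r : seq J) (f : J -> 'rV[R]_n -> R) :
 (forall j, integ (f j)) -> I (fun x => \sum_(j <- r) f j x) = \sum_(j <- r) I (f j).
Proof.
move=> fi; elim: r => [|j r IH]; first by under eq_fun do rewrite big_nil; rewrite I0 big_nil.
under eq_fun do rewrite big_cons.
by rewrite big_cons ID ?IH//; exact: integ_sum.
Qed.

Lemma I_le f g : integ f -> integ g -> (forall x, f x <= g x) -> I f <= I g.
Proof.
move=> fi gi fg; rewrite -lee_fin -!integE//.
by apply: (le_integral measurableT fi gi) => x _; rewrite lee_fin.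
Qed.

Lemma I_ge0 f : (forall x, 0 <= f x) -> 0 <= I f.
Proof. by move=> f0; apply: fine_ge0; apply: integral_ge0 => x _; rewrite lee_fin. Qed.

Lemma I_abs f : integ f -> `|I f| <= I (fun x => `|f x|).
Proof.
move=> fi; rewrite ler_norml -IN; last exact: integ_abs.
have ai := integ_abs fi.
apply/andP; split; apply: I_le => //; first exact: integN.
 by move=> x; rewrite lerNl -normrN ler_norm.
by move=> x; rewrite ler_norm.
Qed.

Lemma eq_I f g : f =1 g -> I f = I g.
Proof. by move=> /funext ->. Qed.

Lemma ae_eq_I f g : integ f -> mfn g -> {ae leb n, forall x, f x = g x} -> integ g /\ I g = I f.
Proof.
move=> fi mg fg.
have mf := integ_mfn fi.
have gi : integ g.
 apply/integrableP; split; first exact/measurable_EFinP.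
 move/integrableP : fi => [_]; apply: le_lt_trans.
 have -> // : (\int[leb n]_x `|(EFin \o g) x| = \int[leb n]_x `|(EFin \o f) x|)%E.
 apply: ae_eq_integral => //.
 - by apply: measurableT_comp => //; exact/measurable_EFinP.
 - by apply: measurableT_comp => //; exact/measurable_EFinP.
 - by move: fg; apply: filterS => x fgx _ /=; rewrite fgx.
split => //; apply: IE; rewrite -integE//.
apply: ae_eq_integral => //; [exact/measurable_EFinP|exact/measurable_EFinP|].
by move: fg; apply: filterS => x fgx _; rewrite fgx.
Qed.

Lemma I_dct (f_ : nat -> 'rV[R]_n -> R) f g : (forall k, mfn (f_ k)) -> mfn f -> integ g ->
 {ae leb n, forall x, (fun k => f_ k x) @ \oo --> f x} ->
 (forall k x, `|f_ k x| <= g x) ->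
 integ f /\ I (f_ k) @[k --> \oo] --> I f.
Proof.
move=> mf_ mf gi ff fg.
have [] := @dominated_convergence _ _ _ (leb n) setT measurableT
 (fun k => EFin \o f_ k) (EFin \o f) (EFin \o g).
- by move=> k; apply/measurable_EFinP; exact: mf_.
- by apply/measurable_EFinP; exact: mf.
- by move: ff; apply: filterS => x fx _; apply: cvg_EFin => //; exact: nearW.
- exact: gi.
- by apply: aeW => x k _ /=; rewrite lee_fin.
move=> fi _ h; split=> //.
have fki k : integ (f_ k) by exact: le_integ (mf_ k) (fg k) gi.
by apply: fine_cvg; rewrite -integE.
Qed.

Lemma I_translate b f : mfn f -> I (fun x => f (x + b)) = I f.
Proof.
by move=> mf; rewrite /I (integral_translate b (f := EFin \o f))//; exact/measurable_EFinP.
Qed.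

Lemma integ_orthogonal Q f : orthogonal_mx Q -> integ f -> integ (fun x => f (x *m Q)).
Proof. by move=> oQ; exact: integrable_orthogonal. Qed.

Lemma I_orthogonal Q f : orthogonal_mx Q -> mfn f -> I (fun x => f (x *m Q)) = I f.
Proof.
by move=> oQ mf; rewrite /I (integral_orthogonal oQ (f := EFin \o f))//; exact/measurable_EFinP.
Qed.

Lemma integ_dilate a b f : a != 0 -> integ f -> integ (fun x => f (a *: x + b)).
Proof. by move=> a0; exact: integrable_dilate. Qed.

Lemma I_dilate a b f : a != 0 -> integ f -> I (fun x => f (a *: x + b)) = `|a| ^- n * I f.
Proof.
move=> a0 fi; apply: IE.
by rewrite (integral_dilate b a0 (f := EFin \o f))// integE.
Qed.

End real_integral.

(** * Classical partial derivatives and functions of class C^k *)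

Section partial_calculus.
Context {R : realType} (n : nat).
Local Notation rV := 'rV[R]_n.
Implicit Types (f g : rV -> R) (i : 'I_n).

(** A relational form of [partial] that records existence and value together, so that derivation
    rules compose without side conditions. *)
Definition pd i f x (d : R) := is_derive x (basis_rV i) (f : rV -> R^o) d.

(** This reduction to one real variable gives access to the chain rule and the mean value
    theorem. *)
Lemma pd_line i f x d :
 pd i f x d <-> is_derive (0 : R) (1 : R) ((fun t : R => f (x + t *: basis_rV i)) : R -> R^o) d.
Proof.
have E : (fun h : R => h^-1 *: ((f : rV -> R^o) \o shift x) (h *: basis_rV i) - h^-1 *: f x) =
 (fun h : R => h^-1 *: (((fun t : R => f (x + t *: basis_rV i)) : R -> R^o) \o shift 0) (h *: 1)
   - h^-1 *: f (x + 0 *: basis_rV i)).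
 apply/funext => h /=; rewrite scale0r addr0; congr (_ - _); last by rewrite addr0.
 by rewrite [h%:A]mulr1 addrC.
have E' : (fun h : R => h^-1 *: (((f : rV -> R^o) \o shift x) (h *: basis_rV i) - f x)) =
 (fun h : R => h^-1 *: ((((fun t : R => f (x + t *: basis_rV i)) : R -> R^o) \o shift 0) (h *: 1)
   - f (x + 0 *: basis_rV i))).
 apply/funext => h /=; rewrite scale0r addr0; congr (_ *: (_ - _)); last by rewrite addr0.
 by rewrite [h%:A]mulr1 addrC.
split=> -[h1 h2].
 by split; [rewrite /derivable -E'|rewrite /derive -E'].
by split; [rewrite /derivable E'|rewrite /derive E'].
Qed.

Lemma pd_partial i f x d : pd i f x d -> partial i f x = d.
Proof. by case. Qed.

Lemma pd_derivable i f x d : pd i f x d -> derivable (f : rV -> R^o) x (basis_rV i).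
Proof. by case. Qed.

Lemma derivable_pd i f x : derivable (f : rV -> R^o) x (basis_rV i) -> pd i f x (partial i f x).
Proof. by []. Qed.

Lemma pd_unique i f x d d' : pd i f x d -> pd i f x d' -> d = d'.
Proof. by move=> /pd_partial <- /pd_partial <-. Qed.

Lemma pd_eq i f x d d' : pd i f x d -> d = d' -> pd i f x d'.
Proof. by move=> h <-. Qed.

Lemma pd_cst i (c : R) x : pd i (fun=> c) x 0.
Proof. exact: is_derive_cst. Qed.

Lemma pdD i f g x a b : pd i f x a -> pd i g x b -> pd i (fun y => f y + g y) x (a + b).
Proof. by move=> ? ?; exact: is_deriveD. Qed.

Lemma pdN i f x a : pd i f x a -> pd i (fun y => - f y) x (- a).
Proof. by move=> ?; exact: is_deriveN. Qed.

Lemma pdB i f g x a b : pd i f x a -> pd i g x b -> pd i (fun y => f y - g y) x (a - b).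
Proof. by move=> ? ?; exact: is_deriveB. Qed.

Lemma pdM i f g x a b : pd i f x a -> pd i g x b ->
 pd i (fun y => f y * g y) x (f x * b + g x * a).
Proof. by move=> ? ?; exact: is_deriveM. Qed.

Lemma pdZ i c f x a : pd i f x a -> pd i (fun y => c * f y) x (c * a).
Proof. by move=> h; apply: pd_eq (pdM (pd_cst i c x) h) _; rewrite mulr0 addr0. Qed.

Lemma pd_sum i (J : Type) (r : seq J) (f : J -> rV -> R) (d : J -> R) x :
 (forall j, pd i (f j) x (d j)) -> pd i (fun y => \sum_(j <- r) f j y) x (\sum_(j <- r) d j).
Proof.
move=> h; elim: r => [|j r IH].
 by under eq_fun do rewrite big_nil; rewrite big_nil; exact: pd_cst.
by under eq_fun do rewrite big_cons; rewrite big_cons; exact: pdD.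
Qed.

Lemma pd_comp i (phi : R -> R) f x a b : is_derive (f x) (1 : R) phi b -> pd i f x a ->
 pd i (fun y => phi (f y)) x (b * a).
Proof.
move=> hphi /pd_line hf; apply/pd_line.
rewrite -[X in is_derive X _ _ _]/(0 : R).
have hphi' : is_derive ((fun t : R => f (x + t *: basis_rV i)) 0) (1 : R) phi b by rewrite scale0r addr0.
exact: (@is_derive1_comp R phi (fun t : R => f (x + t *: basis_rV i)) 0 b a hphi' hf).
Qed.

Lemma pd_coord i j (x : rV) : pd i (fun y : rV => y 0 j) x (i == j)%:R.
Proof.
apply/pd_line.
have -> : (fun t : R => (x + t *: basis_rV i) 0 j) = (fun t : R => x 0 j + t * (i == j)%:R).
 by apply/funext => t; rewrite !mxE eqxx eq_sym.
have h : is_derive (0 : R) (1 : R) (fun t : R => x 0 j + t * (i == j)%:R) (0 + (0 * 0 + (i == j)%:R * 1)).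
 by apply: is_deriveD; apply: is_deriveM.
by apply: is_derive_eq; rewrite mul0r mulr1 !add0r.
Qed.

Lemma pdX i f x a k : pd i f x a -> pd i (fun y => f y ^+ k.+1) x (k.+1%:R * f x ^+ k * a).
Proof.
move=> h; elim: k => [|k IH].
 by under eq_fun do rewrite expr1; rewrite expr0 !mul1r.
have -> : (fun y => f y ^+ k.+2) = fun y => f y * f y ^+ k.+1 by [].
by apply: pd_eq (pdM h IH) _; rewrite exprS -[k.+2%:R]natr1; ring.
Qed.

Lemma pdV i f x a : f x != 0 -> pd i f x a -> pd i (fun y => (f y)^-1) x (- (f x) ^- 2 * a).
Proof.
move=> f0 h; apply: (pd_comp (phi := GRing.inv)) h.
by apply: is_derive_eq; [apply: is_deriveV; exact: f0|rewrite /GRing.scale /= mulr1].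
Qed.

Lemma pd_near i f g x d : (\forall y \near x, f y = g y) -> pd i f x d -> pd i g x d.
Proof.
by move=> fg; exact: near_eq_is_derive.
Qed.

Lemma C_S k f : C_ k.+1 f -> C_ k f.
Proof.
elim: k f => [|k IH] f; first by move=> [].
by move=> [cf h]; split => // i; have [h1 h2] := h i; split => //; exact: IH.
Qed.

Lemma C_cont k f : C_ k f -> continuous f.
Proof. by case: k => [|k] []. Qed.

Lemma C_D k f g : C_ k f -> C_ k g -> C_ k (fun x => f x + g x).
Proof.
elim: k f g => [|k IH] f g; first by move=> [cf _] [cg _]; split => //; exact: contD.
move=> [cf hf] [cg hg]; split; first exact: contD.
move=> i; have [f1 f2] := hf i; have [g1 g2] := hg i.
have h x : pd i (fun x => f x + g x) x (partial i f x + partial i g x) by apply: pdD; exact: derivable_pd.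
split; first by move=> x; exact: pd_derivable (h x).
have -> : partial i (fun x => f x + g x) = fun x => partial i f x + partial i g x.
 by apply/funext => x; exact: pd_partial (h x).
exact: IH.
Qed.

Lemma C_M k f g : C_ k f -> C_ k g -> C_ k (fun x => f x * g x).
Proof.
elim: k f g => [|k IH] f g; first by move=> [cf _] [cg _]; split => //; exact: contM.
move=> Cf Cg; move: (Cf) (Cg) => [cf hf] [cg hg]; split; first exact: contM.
move=> i; have [f1 f2] := hf i; have [g1 g2] := hg i.
have h x : pd i (fun x => f x * g x) x (f x * partial i g x + g x * partial i f x).
 by apply: pdM; exact: derivable_pd.
split; first by move=> x; exact: pd_derivable (h x).
have -> : partial i (fun x => f x * g x) = fun x => f x * partial i g x + g x * partial i f x.
 by apply/funext => x; exact: pd_partial (h x).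
by apply: C_D; apply: IH => //; exact: C_S.
Qed.

Lemma C_cst k (c : R) : C_ k (fun _ : rV => c).
Proof.
elim: k c => [|k IH] c; split => //; try exact: cont_cst.
move=> i; split; first by [].
have -> : partial i (fun _ => c) = fun=> 0.
 by apply/funext => x; exact: pd_partial (pd_cst i c x).
by [].
Qed.

Lemma C_prod k (J : Type) (r : seq J) (f : J -> rV -> R) :
 (forall j, C_ k (f j)) -> C_ k (fun x => \prod_(j <- r) f j x).
Proof.
move=> h; elim: r => [|j r IH].
 by under eq_fun do rewrite big_nil; exact: C_cst.
by under eq_fun do rewrite big_cons; exact: C_M.
Qed.

(* A sequence D closed under differentiation makes each D m (a x_j + b) smooth. *)
Lemma C_family k (D : nat -> R -> R) (a b : R) (j : 'I_n) m :
 (forall m t, is_derive t (1 : R) (D m) (D m.+1 t)) ->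
 C_ k (fun x : rV => D m (a * x 0 j + b)).
Proof.
move=> hD.
have cD m' : continuous (D m').
 by move=> t; apply: differentiable_continuous; apply/derivable1_diffP; case: (hD m' t).
have cc m' : continuous (fun x : rV => D m' (a * x 0 j + b)).
 apply: cont_comp (cD m'); apply: contD; last exact: cont_cst. by ctn.
have hp i m' x : pd i (fun x => D m' (a * x 0 j + b)) x (D m'.+1 (a * x 0 j + b) * (a * (i == j)%:R)).
 apply: pd_comp (hD _ _) _.
 by apply: pd_eq (pdD (pdZ a (pd_coord i j x)) (pd_cst i b x)) _; rewrite addr0.
elim: k m => [|k IH] m; split => // i; split; first by move=> x; exact: pd_derivable (hp i m x).
have -> : partial i (fun x => D m (a * x 0 j + b)) =
  fun x => D m.+1 (a * x 0 j + b) * (a * (i == j)%:R).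
 by apply/funext => x; exact: pd_partial (hp i m x).
by apply: C_M => //; exact: C_cst.
Qed.

End partial_calculus.

(** * A smooth step function *)

Section smooth_cutoff.
Context {R : realType}.
Implicit Types (P : {poly R}) (t s : R).

(** The class of functions P(1/t) exp(-1/t), extended by 0, is closed under differentiation, P
    becoming X^2 (P - P'). Carrying the polynomial along yields derivatives of every order at
    once. *)
Definition flat P t : R := if 0 < t then P.[t^-1] * expR (- t^-1) else 0.

Lemma horner_bound P s : 1 <= s -> `|P.[s]| <= (\sum_(i < size P) `|P`_i|) * s ^+ size P.
Proof.
move=> s1; rewrite horner_coef; apply: le_trans (ler_norm_sum _ _ _) _.
rewrite mulr_suml; apply: ler_sum => i _.
rewrite normrM ler_wpM2l// ger0_norm ?exprn_ge0 ?(le_trans ler01)//.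
by rewrite ler_weXn2l// ltnW.
Qed.

Lemma expR_lower s m : 0 <= s -> (s / m.+1%:R) ^+ m.+1 <= expR s.
Proof.
move=> s0; have -> : s = m.+1%:R * (s / m.+1%:R) by rewrite mulrCA mulfV ?mulr1// pnatr_eq0.
rewrite expRM_natl; have -> : m.+1%:R * (s / m.+1%:R) / m.+1%:R = s / m.+1%:R.
 by rewrite mulrAC mulfV ?mul1r// pnatr_eq0.
apply: lerXn2r; rewrite ?nnegrE ?divr_ge0//.
by apply: le_trans (expR_ge1Dx _); rewrite lerDr.
Qed.

Lemma flat_quadratic P : exists C, 0 <= C /\ forall t, `|t| <= 1 -> `|flat P t| <= C * t ^+ 2.
Proof.
(* The exponent m + 1 in [expR_lower] is then [size P] + 2: it absorbs the growth of P(1/t) and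
   leaves t^2, which gives derivative 0 at the origin. *)
have [m hm] : exists m, m = (size P).+1 by exists (size P).+1.
pose A := \sum_(i < size P) `|P`_i|.
have A0 : 0 <= A by apply: sumr_ge0.
exists (A * m.+1%:R ^+ m.+1); split; first by rewrite mulr_ge0// exprn_ge0.
move=> t t1; rewrite /flat; case: ifPn => t0; last first.
 by rewrite normr0 mulr_ge0 ?sqr_ge0// mulr_ge0// exprn_ge0.
have s1 : 1 <= t^-1 by rewrite invf_ge1// (le_trans (ler_norm t)).
have s0 : 0 < t^-1 by rewrite invr_gt0.
rewrite normrM (ger0_norm (expR_ge0 _)) expRN.
have e1 := expR_lower m (ltW s0).
have e0 : 0 < (t^-1 / m.+1%:R) ^+ m.+1 by rewrite exprn_gt0// divr_gt0.
apply: (@le_trans _ _ (A * t^-1 ^+ size P * ((t^-1 / m.+1%:R) ^+ m.+1)^-1)).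
 apply: ler_pM; rewrite//; first exact: horner_bound. by rewrite lef_pV2 ?posrE ?expR_gt0.
rewrite -!mulrA ler_wpM2l//.
have t00 : t != 0 by rewrite gt_eqF.
have -> : (t^-1 / m.+1%:R) ^+ m.+1 = t^-1 ^+ size P * (t^-1 ^+ 2 * m.+1%:R ^- m.+1).
 by rewrite hm expr_div_n mulrA -exprD addn2.
have u0 : t^-1 ^+ size P != 0 by rewrite expf_neq0// invr_neq0.
rewrite invfM mulrA mulfV// mul1r invfM invrK exprVn invrK mulrC.
by [].
Qed.

Lemma is_derive_flat P t : is_derive t (1 : R) (flat P) (flat ('X^2 * (P - P^`())) t).
Proof.
have [t0|t0|t0] := ltgtP t 0.
- rewrite [X in is_derive _ _ _ X](_ : _ = 0); last by rewrite /flat ltNge (ltW t0).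
 apply: (near_eq_is_derive (f := cst (0 : R))).
 near=> u; rewrite /flat /= ifF//; apply/negbTE; rewrite -leNgt ltW//; near: u. exact: lt_nbhsl.
- rewrite [X in is_derive _ _ _ X](_ : _ = (P^`().[t^-1] * (- t ^- 2)) * expR (- t^-1) + P.[t^-1] * (expR (- t^-1) * - (- t ^- 2))); last first.
  by rewrite /flat t0 !hornerE /=; field; rewrite gt_eqF.
 apply: (near_eq_is_derive (f := (fun u : R => P.[u^-1] * expR (- u^-1)) : R -> R)).
  near=> u; rewrite /flat ifT//; near: u; exact: lt_nbhsr.
 have hV : is_derive t (1 : R) (fun u => u^-1) (- t ^- 2).
  by apply: is_derive_eq; [apply: is_deriveV; rewrite gt_eqF|rewrite /GRing.scale /= mulr1].
 have hP : is_derive t (1 : R) (fun u => P.[u^-1]) (P^`().[t^-1] * (- t ^- 2)).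
  exact: (@is_derive1_comp R (horner P) (fun u => u^-1) t _ _ (is_derive_poly P _) hV).
 have hE : is_derive t (1 : R) (fun u => expR (- u^-1)) (expR (- t^-1) * - (- t ^- 2)).
  exact: (@is_derive1_comp R expR (fun u => - u^-1) t _ _ (is_derive_expR _) (is_deriveN hV)).
 have h := @is_deriveM _ _ (fun u : R => P.[u^-1]) (fun u : R => expR (- u^-1)) t 1 _ _ hP hE.
 apply: (is_derive_eq h). by rewrite /GRing.scale /=; ring.
- have [C [C0 hC]] := flat_quadratic P.
 rewrite t0 [X in is_derive _ _ _ X](_ : _ = 0); last by rewrite /flat ltxx.
 have h : (fun h : R => h^-1 *: ((flat P \o shift 0) (h *: 1) - flat P 0)) @ 0^' --> (0 : R).
  apply/cvgrPdist_lt => e e0; near=> u. have u1 : `|u| <= 1 by near: u; apply: dnbhs0_le.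
  have ue : `|u| < e / (C + 1) by near: u; apply: dnbhs0_lt; rewrite divr_gt0// ltr_wpDl.
  have u0 : u != 0 by near: u; exact: nbhs_dnbhs_neq.
  rewrite /GRing.scale /= mulr1 addr0 [flat P 0]/flat ltxx subr0 sub0r normrN normrM normfV.
  rewrite mulrC ltr_pdivrMr ?normr_gt0//. apply: le_lt_trans (hC _ u1) _.
  have -> : C * u ^+ 2 = (C * `|u|) * `|u| by rewrite -mulrA -expr2 real_normK ?num_real.
  rewrite ltr_pM2r ?normr_gt0//.
  apply: (@le_lt_trans _ _ ((C + 1) * `|u|)); first by rewrite ler_wpM2r// lerDl.
  by rewrite mulrC -ltr_pdivlMr// ltr_wpDl.
 split; first by apply/cvg_ex; exists 0. exact/cvg_lim.
Unshelve. all: by end_near. Qed.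

Definition step : R -> R := flat 1.

Definition step_family : nat -> R -> R := fun m => flat (iter m (fun P : {poly R} => 'X^2 * (P - P^`())) 1).

Lemma step_familyP m t : is_derive t (1 : R) (step_family m) (step_family m.+1 t).
Proof. exact: is_derive_flat. Qed.

Lemma stepE t : step t = if 0 < t then expR (- t^-1) else 0.
Proof. by rewrite /step /flat hornerC mul1r. Qed.

Lemma step_ge0 t : 0 <= step t.
Proof. by rewrite stepE; case: ifP => // _; exact: expR_ge0. Qed.

Lemma step_le1 t : step t <= 1.
Proof.
rewrite stepE; case: ifPn => // t0; rewrite -expR0 ler_expR oppr_le0 invr_ge0; exact: ltW.
Qed.

Lemma step0 t : t <= 0 -> step t = 0.
Proof. by rewrite stepE leNgt => /negbTE ->. Qed.

Lemma cvg_step (t : R) : (fun k : nat => step (k.+1%:R * t)) @ \oo --> ((0 < t)%R%:R : R).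
Proof.
have [t0|t0] := ltP 0 t; last first.
 have -> : (fun k : nat => step (k.+1%:R * t)) = cst 0.
  by apply/funext => k; rewrite step0// mulr_ge0_le0.
 exact: cvg_cst.
have -> : (fun k : nat => step (k.+1%:R * t)) = fun k : nat => expR (- (t^-1 * k.+1%:R^-1)).
 by apply/funext => k; rewrite stepE mulr_gt0// invfM mulrC.
have -> : (true%:R : R) = expR (- (t^-1 * 0)) by rewrite mulr0 oppr0 expR0.
apply: (@cvg_comp _ _ _ (fun k : nat => - (t^-1 * k.+1%:R^-1)) expR _ (nbhs (- (t^-1 * 0)))).
 by apply: cvgN; apply: cvgM; [exact: cvg_cst|exact: cvg_harmonic].
exact: continuous_expR.
Qed.

End smooth_cutoff.

(** Open boxes are the generators to use against test functions, since their indicators are limits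
    of smooth bumps. *)
Lemma measurable_rV_obox (R : realType) n :
 @measurable _ 'rV[R]_n = <<s [set A : set 'rV[R]_n | exists a b, A = obox a b] >>.
Proof.
set G := [set A | _].
have oG (A : set 'rV[R]_n) : open A -> <<s G >> A.
 move=> /open_bigcup_obox ->.
 apply: (@countable_bigcupT_measurable _ (g_sigma_algebraType G)); first exact: countableP.
 move=> c; case: asboolP => _; last exact: (@measurable0 _ (g_sigma_algebraType G)).
 by apply: sub_sigma_algebra; eexists; eexists.
apply/seteqP; split; last first.
 apply: smallest_sub; first exact: sigma_algebra_measurable.
 by move=> _ [a [b ->]]; apply: measurable_box => i; exact: measurable_itv.
apply: smallest_sub; first exact: smallest_sigma_algebra.
case: n @G oG => [|n] G oG; first by rewrite big_ord0.
rewrite -bigcup_mkord_ord; apply: bigcup_sub => i Ii A [B mB <-].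
have mc : measurable_fun setT (fun x : g_sigma_algebraType G => (x) 0 (inord i) : measurableTypeR R).
 apply: (measurability _ (measurable_realfun.RGenOpens.measurableE R)).
 move=> _ [_ [a [b ->] <-]]; rewrite setTI; apply: oG.
 by apply: open_comp => [x _|]; [exact: continuous_coord|exact: interval_open].
exact: mc.
Qed.

(** * Functions of bounded support and the fundamental lemma of the calculus of variations *)

Section bounded_support.
Context {R : realType} (n : nat).
Local Notation rV := 'rV[R]_n.
Implicit Types (f g u F phi : rV -> R) (r : R).

(** An explicit radius instead of a compact support: radii simply add up under convolution and
    translation. *)
Definition bsupp r F := forall x, r < `|x| -> F x = 0.

Definition cball r : set rV := [set x | `|x| <= r].

Lemma closed_cball r : closed (cball r).
Proof.
apply: (@closed_comp _ _ (fun x : rV => `|x|) [set y | y <= r]).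
 by move=> x _; exact: norm_continuous.
by [].
Qed.

Lemma compact_cball r : compact (cball r).
Proof.
apply: bounded_closed_compact; last exact: closed_cball.
by exists r; split; [exact: num_real|move=> M rM x /le_trans; apply; exact: ltW].
Qed.

Lemma measurable_cball r : measurable (cball r).
Proof. by apply: closed_measurable_rV; exact: closed_cball. Qed.

Lemma compact_sub_cball (K : set rV) : compact K -> exists r, K `<=` cball r.
Proof.
move=> /compact_bounded[M [_ hM]]; exists (M + 1) => x Kx.
by apply: (hM (M + 1)) => //; rewrite ltrDl.
Qed.

Lemma bsupp_test r F : smooth F -> bsupp r F -> test_function F.
Proof.
move=> sF hF; split => //.
have sub : closure [set x | F x != 0] `<=` cball r.
 rewrite ((closure_id (cball r)).1 (@closed_cball r)).
 apply: closure_subset => x /eqP Fx; rewrite /cball /= leNgt; apply/negP => /hF. by [].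
exact: subclosed_compact (@closed_closure _ _) (@compact_cball r) sub.
Qed.

Lemma test_bsupp F : test_function F -> exists r, bsupp r F.
Proof.
move=> [_ /compact_sub_cball[r hr]]; exists r => x rx; apply: contrapT => Fx.
have : cball r x by apply/hr/subset_closure; exact/eqP.
by rewrite /cball /= leNgt rx.
Qed.

Lemma bsupp_le r s F : r <= s -> bsupp r F -> bsupp s F.
Proof. by move=> rs h x sx; apply: h; apply: le_lt_trans sx. Qed.

Lemma cont_bounded_cball F r : continuous F -> exists2 M, 0 <= M & forall x, `|x| <= r -> `|F x| <= M.
Proof.
move=> cF; have /compact_bounded[M [_ hM]] : compact (F @` cball r).
 by apply: continuous_compact; [exact: continuous_subspaceT|exact: compact_cball].
exists (`|M| + 1) => [|x xr]; first by [].
apply: (hM (`|M| + 1)); last by [].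
by rewrite (le_lt_trans (ler_norm M))// ltrDl.
Qed.

Lemma cs_bounded F r : continuous F -> bsupp r F -> exists2 M, 0 <= M & forall x, `|F x| <= M.
Proof.
move=> cF hF; have [M M0 hM] := cont_bounded_cball r cF; exists M => // x.
by have [/hM//|/hF ->] := leP `|x| r; rewrite normr0.
Qed.

Lemma loc_integ u r : loc_integrable u -> integ (fun x => u x * \1_(cball r) x).
Proof.
move=> [mu /(_ _ (@compact_cball r))]; rewrite integrable_mkcond; last exact: measurable_cball.
apply: eq_integrable => // x _; rewrite patchE /= indicE; case: ifP => _; by rewrite ?mulr1 ?mulr0.
Qed.

Lemma loc_integP u : mfn u -> (forall r, integ (fun x => u x * \1_(cball r) x)) -> loc_integrable u.
Proof.
move=> mu h; split => // K cK; have [r Kr] := compact_sub_cball cK.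
apply: (@integrableS _ _ _ _ (cball r)) => //; [exact: measurable_cball|apply: closed_measurable_rV; exact: compact_closed|].
rewrite integrable_mkcond; last exact: measurable_cball.
apply: eq_integrable (h r) => // x _; rewrite patchE /= indicE; case: ifP => _; by rewrite ?mulr1 ?mulr0.
Qed.

Lemma loc_mfn u : loc_integrable u -> mfn u. Proof. by case. Qed.

Lemma loc_cs_integ u F r : loc_integrable u -> continuous F -> bsupp r F ->
 integ (fun x => u x * F x).
Proof.
move=> lu cF hF; have [M M0 hM] := cs_bounded cF hF.
have -> : (fun x => u x * F x) = (fun x => (u x * \1_(cball r) x) * F x).
 apply/funext => x; rewrite indicE; case: (boolP (x \in _)) => [_|]; first by rewrite mulr1.
 by rewrite notin_setE /cball => /negP; rewrite -ltNge => /hF ->; rewrite !mulr0.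
by apply: integMb hM; [exact: loc_integ|exact: mfn_cont].
Qed.

Lemma integ_indic_fin (A : set rV) : measurable A -> (leb n A < +oo)%E -> integ (\1_A : rV -> R).
Proof.
move=> mA fA; apply/integrableP; split; first by apply/measurable_EFinP; exact: mfn_indic.
under eq_integral do rewrite /= ger0_norm//.
by rewrite integral_indic// setIT.
Qed.

Lemma integ_cball r : integ (\1_(cball r) : rV -> R).
Proof.
apply: integ_indic_fin; first exact: measurable_cball.
by apply: (@leb_bounded_lty _ _ _ r) => //; exact: measurable_cball.
Qed.

Lemma cont_loc F : continuous F -> loc_integrable F.
Proof.
move=> cF; apply: loc_integP => [|r]; first exact: mfn_cont.
have [M M0 hM] := cont_bounded_cball r cF.
apply: (@le_integ _ _ _ (fun x => M * \1_(cball r) x)).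
- by apply: mfnM; [exact: mfn_cont|apply: mfn_indic; exact: measurable_cball].
- move=> x; rewrite indicE; case: (boolP (x \in _)); last by rewrite !mulr0 normr0.
 by rewrite inE => /hM; rewrite !mulr1.
- by apply: integZ; exact: integ_cball.
Qed.

Lemma cs_integ F r : continuous F -> bsupp r F -> integ F.
Proof.
move=> cF hF; have : integ (fun x => 1 * F x).
 by apply: loc_cs_integ hF => //; apply: cont_loc; exact: cont_cst.
by apply: eq_integ => x; rewrite mul1r.
Qed.

Lemma locD u g : loc_integrable u -> loc_integrable g -> loc_integrable (fun x => u x + g x).
Proof.
move=> lu lg; apply: loc_integP => [|r]; first by apply: mfnD; exact: loc_mfn.
by under eq_fun do rewrite mulrDl; apply: integD; exact: loc_integ.
Qed.

Lemma locMc u F : loc_integrable u -> continuous F -> loc_integrable (fun x => F x * u x).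
Proof.
move=> lu cF; apply: loc_integP => [|r].
 by apply: mfnM; [exact: mfn_cont|exact: loc_mfn].
have [M M0 hM] := cont_bounded_cball r cF.
apply: (@le_integ _ _ _ (fun x => M * `|u x * \1_(cball r) x|)).
- apply: mfnM; last by apply: mfn_indic; exact: measurable_cball.
 by apply: mfnM; [exact: mfn_cont|exact: loc_mfn].
- move=> x; rewrite indicE; case: (boolP (x \in _)); last by rewrite !mulr0 normr0 mulr0.
 by rewrite inE => /hM h; rewrite !mulr1 normrM ler_wpM2r.
- by apply: integZ; apply: integ_abs; exact: loc_integ.
Qed.

Lemma locMb u F M : loc_integrable u -> mfn F -> (forall x, `|F x| <= M) ->
 loc_integrable (fun x => F x * u x).
Proof.
move=> lu mF hM; apply: loc_integP => [|r]; first by apply: mfnM => //; exact: loc_mfn.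
apply: eq_integ (integMb (loc_integ r lu) mF hM) => x; by ring.
Qed.

Lemma locZ u c : loc_integrable u -> loc_integrable (fun x => c * u x).
Proof. by move=> lu; apply: (locMc lu); exact: cont_cst. Qed.

Definition bump (a b : rV) (k : nat) (x : rV) : R :=
 \prod_(i < n) (step (k.+1%:R * (x 0 i - a 0 i)) * step (k.+1%:R * (b 0 i - x 0 i))).

Lemma bump_smooth a b k : smooth (bump a b k).
Proof.
move=> m; apply: C_prod => i; apply: C_M.
 rewrite (_ : (fun x => _) = fun x : rV => step_family 0 (k.+1%:R * x 0 i + (- (k.+1%:R * a 0 i)))).
  by apply: C_family; exact: step_familyP.
 by apply/funext => x; rewrite mulrBr.
rewrite (_ : (fun x => _) = fun x : rV => step_family 0 (- k.+1%:R * x 0 i + (k.+1%:R * b 0 i))).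
 by apply: C_family; exact: step_familyP.
by apply/funext => x; rewrite mulrBr mulNr addrC.
Qed.

Lemma bump_ge0 a b k x : 0 <= bump a b k x.
Proof. by apply: prodr_ge0 => i _; rewrite mulr_ge0 ?step_ge0. Qed.

Lemma bump_le1 a b k x : bump a b k x <= 1.
Proof.
suff /andP[] : 0 <= bump a b k x <= 1 by [].
apply: (big_ind (fun y : R => 0 <= y <= 1)) => [|y z /andP[y0 y1] /andP[z0 z1]|i _].
- by rewrite ler01 lexx.
- by rewrite mulr_ge0//= mulr_ile1.
- by rewrite mulr_ge0 ?step_ge0//= mulr_ile1 ?step_ge0 ?step_le1.
Qed.

Lemma bump_out a b k x : ~ obox a b x -> bump a b k x = 0.
Proof.
move=> /existsNP[i]; rewrite /= in_itv => /negP; rewrite negb_and -!leNgt => h.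
suff e : step (k.+1%:R * (x 0 i - a 0 i)) * step (k.+1%:R * (b 0 i - x 0 i)) = 0.
 by rewrite /bump (bigD1 i) //= e mul0r.
case/orP: h => h; first by rewrite step0 ?mul0r// mulr_ge0_le0// subr_le0.
by rewrite [X in _ * X]step0 ?mulr0// mulr_ge0_le0// subr_le0.
Qed.

Lemma obox_bounded (a b x : rV) : obox a b x -> `|x| <= `|a| + `|b|.
Proof.
move=> h; apply/mx_norm_leP => [|i]; first exact: addr_ge0.
have := h i; rewrite /= in_itv /= => /andP[h1 h2].
have := coord_le_norm a i; have := coord_le_norm b i; rewrite !ler_norml => /andP[? ?] /andP[? ?].
have := normr_ge0 a; have := normr_ge0 b => ? ?; apply/andP; split; lra.
Qed.

Lemma bump_bsupp a b k : bsupp (`|a| + `|b|) (bump a b k).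
Proof. by move=> x xab; apply: bump_out => /obox_bounded; rewrite leNgt xab. Qed.

Lemma bump_test a b k : test_function (bump a b k).
Proof. by apply: (bsupp_test (bump_smooth a b k)); exact: bump_bsupp. Qed.

Lemma measurable_obox (a b : rV) : measurable (obox a b).
Proof. by apply: measurable_box => i; exact: measurable_itv. Qed.

Lemma cvg_prod (J : Type) (r : seq J) (f : J -> nat -> R) (l : J -> R) :
 (forall j, f j @ \oo --> l j) -> (fun k => \prod_(j <- r) f j k) @ \oo --> \prod_(j <- r) l j.
Proof.
move=> h; elim: r => [|j r IH].
 by under eq_fun do rewrite big_nil; rewrite big_nil; exact: cvg_cst.
by under eq_fun do rewrite big_cons; rewrite big_cons; apply: cvgM.
Qed.

Lemma cvg_bump a b x : (fun k => bump a b k x) @ \oo --> (\1_(obox a b) x : R).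
Proof.
have -> : (\1_(obox a b) x : R) = \prod_(i < n) (((0 < x 0 i - a 0 i)%R)%:R * ((0 < b 0 i - x 0 i)%R)%:R).
 rewrite indicE; case: (boolP (x \in _)).
  rewrite inE => h; rewrite big1// => i _; have := h i.
  by rewrite /= in_itv /= !subr_gt0 => /andP[-> ->]; rewrite mulr1.
 rewrite notin_setE => /existsNP[i]; rewrite /= in_itv /= => /negP.
 rewrite (bigD1 i)//= !subr_gt0 negb_and => /orP[]/negbTE ->; by rewrite ?(mul0r,mulr0).
by apply: cvg_prod => i; apply: cvgM; exact: cvg_step.
Qed.

(** Bumps converge to indicators of boxes, so g has integral 0 over every open box. Dynkin's
    induction extends this to all measurable parts of a cube, where g must then vanish almost
    everywhere. *)
Lemma fundamental_lemma g : loc_integrable g ->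
 (forall phi, test_function phi -> I (fun x => g x * phi x) = 0) ->
 {ae leb n, forall x, g x = 0}.
Proof.
move=> lg hg; have mg := loc_mfn lg.
have hbox a b : I (fun x => g x * \1_(obox a b) x) = 0.
 have [] := @I_dct R n (fun k x => g x * bump a b k x) (fun x => g x * \1_(obox a b) x)
  (fun x => `|g x * \1_(cball (`|a| + `|b|)) x|).
 - by move=> k; apply: mfnM => //; apply: mfn_cont; exact: (C_cont (bump_smooth a b k 0)).
 - by apply: mfnM => //; apply: mfn_indic; exact: measurable_obox.
 - by apply: integ_abs; exact: loc_integ.
 - by apply: aeW => x; apply: cvgM; [exact: cvg_cst|exact: cvg_bump].
 - move=> k x; rewrite !normrM ler_wpM2l// ger0_norm ?bump_ge0// indicE.
  case: (boolP (x \in _)); first by rewrite normr1 bump_le1.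
  rewrite notin_setE normr0 => h; rewrite bump_out// => /obox_bounded; exact: h.
 move=> _; have -> : (fun k => I (fun x => g x * bump a b k x)) = cst 0.
  by apply/funext => k; apply: hg; exact: bump_test.
 by move=> /cvg_lim <-//; rewrite lim_cst.
pose cube (k : nat) := obox (const_mx (- k%:R)) (const_mx k%:R) : set 'rV[R]_n.
pose G : set (set rV) := [set A | exists a b, A = obox a b].
have cubeG k : G (cube k) by exists (const_mx (- k%:R)), (const_mx k%:R).
have GI : setI_closed G.
 move=> _ _ [a [b ->]] [c [d ->]].
 exists (\row_i Num.max (a 0 i) (c 0 i)), (\row_i Num.min (b 0 i) (d 0 i)).
 apply/seteqP; split => x /=.
  by move=> [h1 h2] i; have := h1 i; have := h2 i; rewrite /= !in_itv /= !mxE gt_max lt_min => /andP[-> ->] /andP[-> ->].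
 by move=> h; split => i; have := h i; rewrite /= !in_itv /= !mxE gt_max lt_min => /andP[/andP[h1 h2] /andP[h3 h4]]; rewrite ?h1 ?h2.
have mG : @measurable _ rV = <<s G >>.
 exact: measurable_rV_obox.
have gk k : integ (fun x => g x * \1_(cube k) x).
 apply: eq_integ (integ_indic (measurable_obox (const_mx (- k%:R)) (const_mx k%:R)) (loc_integ (`|const_mx (- k%:R) : rV| + `|const_mx k%:R : rV|) lg)) => x.
 rewrite -/(cube k) !indicE -mulrA; congr (_ * _).
 case: (boolP (x \in cube k)); last by rewrite mulr0.
 by rewrite inE => /obox_bounded h; rewrite mem_set//= mulr1.
(* The fixed factor [\1_(cube k)] makes the integrand integrable, so that complements and countable
   disjoint unions can be handled. *)
have key k A : measurable A -> I (fun x => g x * \1_(cube k) x * \1_A x) = 0.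
 rewrite [measurable]mG; move: A.
 apply: (@dynkin_induction _ _ G (fun A => I (fun x => g x * \1_(cube k) x * \1_A x) = 0)) => //.
 - under eq_fun do rewrite indicT mulr1; exact: hbox.
 - move=> A GA; have [a [b eab]] := GI _ _ (cubeG k) GA.
  rewrite -(hbox a b) -eab; apply: eq_I => x; rewrite -mulrA; congr (_ * _). by rewrite indicI.
 - move=> A mA hA; rewrite (eq_I (g := fun x => g x * \1_(cube k) x - g x * \1_(cube k) x * \1_A x)).
   by rewrite IB ?hA ?hbox ?subr0//; exact: integ_indic.
  by move=> x; rewrite !indicE in_setC; case: (x \in A); rewrite ?mulr1 ?mulr0 ?subr0 ?subrr.
 - move=> F mF tF hF.
  have mUF : measurable (\bigcup_i F i) by exact: bigcupT_measurable.
  have conv A : measurable A -> (\int[leb n]_(x in A) (g x * \1_(cube k) x)%:E)%E =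
    (I (fun x => g x * \1_(cube k) x * \1_A x))%:E.
   move=> mA; rewrite -integE; last exact: integ_indic mA (gk k).
   rewrite integral_mkcond; apply: eq_integral => x _; rewrite patchE (indicE _ A).
   by case: ifP; rewrite ?mulr1 ?mulr0.
  apply/EFin_inj; rewrite -conv// integral_bigcup//.
   by rewrite eseries0// => i _ _; rewrite conv// hF.
  by apply: integrableS (gk k).
have ae_k k : {ae leb n, forall x, g x * \1_(cube k) x = 0}.
 have h : ae_eq (leb n) setT (EFin \o (fun x => g x * \1_(cube k) x)) (cst 0%E).
  have gkk := gk k; apply: integral_ae_eq => // E _ mE.
  rewrite integral0 integral_mkcond -[RHS]/(0%:E) -(key k E mE) -integE; last exact: integ_indic mE (gk k).
  by apply: eq_integral => x _; rewrite patchE (indicE _ E); case: ifP; rewrite ?mulr1 ?mulr0.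
 by move: h; apply: filterS => x /(_ Logic.I) [].
have := ae_foralln ae_k; apply: filterS => x h.
have := h (Num.truncn `|x|).+1; rewrite indicE mem_set ?mulr1// => i /=.
have hx := truncnS_gt `|x|.
have := le_lt_trans (coord_le_norm x i) hx.
by rewrite in_itv !mxE ltr_norml.
Qed.

End bounded_support.

Lemma cont_at_eps (R : realType) (T : topologicalType) (f : T -> R) (x : T) :
 (forall e, 0 < e -> \forall y \near x, `|f x - f y| <= e) -> {for x, continuous f}.
Proof. by move=> h; apply/cvgrPdist_le. Qed.

Lemma cont_near_eps (R : realType) (T : topologicalType) (f : T -> R) (x : T) e :
 {for x, continuous f} -> 0 < e -> \forall y \near x, `|f x - f y| <= e.
Proof. by move=> /cvgrPdist_le; apply. Qed.

(** * Convolution with functions of bounded support *)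

Section mollification.
Context {R : realType} (n : nat).
Implicit Types (f g u F psi : 'rV[R]_n -> R) (r : R) (i : 'I_n).

Lemma cs_unif F r e : continuous F -> bsupp r F -> 0 < e ->
 exists2 d, 0 < d & forall x y, `|x - y| <= d -> `|F x - F y| <= e.
Proof.
move=> cF hF e0.
have := @compact_cball R n (r + 1); rewrite compact_near_coveringP => /(_ R (0 : R)^'+
 (fun d x => forall z : 'rV[R]_n, `|z| <= d -> `|F (x + z) - F x| <= e) _).
case.
 move=> x _; have /cvgrPdist_lt/(_ (e / 2)) := cF x.
 rewrite divr_gt0// => /(_ isT) /nbhs_ballP[d /= d0 hd]. have d20 : 0 < d / 2 by rewrite divr_gt0.
 exists (ball x (d / 2), [set t | t < d / 2]) => /=.
  split; first exact: nbhsx_ballx. exact: nbhs_right_lt.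
 move=> [x' t] /= [hx' ht] z zt. have h1 : `|F x - F (x' + z)| < e / 2.
  apply: hd; move: hx'; rewrite -!ball_normE /= => hx'.
  rewrite opprD addrA (le_lt_trans (ler_normB _ _))// (splitr d) ltrD//. exact: le_lt_trans ht.
 have h2 : `|F x - F x'| < e / 2.
  apply: hd; move: hx'; rewrite -!ball_normE => /lt_le_trans; apply; lra.
 have -> : F (x' + z) - F x' = (F x - F x') - (F x - F (x' + z)) by ring.
 by rewrite (le_trans (ler_normB _ _))// (splitr e) lerD// ltW.
move=> d0 /= d00 hd.
(* With d <= 1, a point y outside the ball of radius r + 1 has all its neighbours at distance d
   outside the support of F. *)
pose d := Num.min (d0 / 2) 1.
have dpos : 0 < d by rewrite lt_min ltr01 divr_gt0.
exists d => // x y xy.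
have hd' : cball (r + 1) `<=` (fun x => forall z : 'rV[R]_n, `|z| <= d -> `|F (x + z) - F x| <= e).
 apply: hd => //=; rewrite sub0r normrN gtr0_norm//. by rewrite gt_min; apply/orP; left; lra.
have [yr|yr] := leP `|y| (r + 1).
 by have := hd' _ yr _ xy; rewrite (addrC y (x - y)) subrK.
have xr : r < `|x|.
 have : `|y| <= `|x| + `|x - y|.
  by rewrite -{1}(subKr x y) (le_trans (ler_normB _ _)).
 have : d <= 1 by rewrite ge_min lexx orbT. lra.
by rewrite hF// hF ?subr0 ?normr0; lra.
Qed.

Lemma norm_basis i : `|basis_rV i : 'rV[R]_n| = 1.
Proof.
apply/eqP; rewrite eq_le; apply/andP; split.
 apply/mx_norm_leP => // j; rewrite !mxE eqxx; case: (j == i); by rewrite ?normr1 ?normr0.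
by have := coord_le_norm (basis_rV i : 'rV[R]_n) i; rewrite !mxE !eqxx normr1.
Qed.

Lemma bsupp_pd r psi dpsi i : bsupp r psi -> (forall x, pd i psi x (dpsi x)) -> bsupp r dpsi.
Proof.
move=> hpsi hd x rx; apply: (pd_unique (hd x)).
apply: pd_near (pd_cst i 0 x); near=> y; rewrite hpsi//; near: y.
have : continuous (fun y : 'rV[R]_n => `|y|) by exact: norm_continuous.
by move=> /(_ x) /cvgr_gt/(_ _ rx).
Unshelve. all: by end_near. Qed.

Lemma pd_shift psi i x c d : pd i psi (x + c) d -> pd i (fun y => psi (y + c)) x d.
Proof.
move=> /pd_line h; apply/pd_line.
by have -> : (fun t : R => psi (x + t *: basis_rV i + c)) = (fun t => psi (x + c + t *: basis_rV i))
 by apply/funext => t; rewrite addrAC.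
Qed.

Lemma pd_MVT psi dpsi i x h : (forall x, pd i psi x (dpsi x)) ->
 exists2 t, `|t| <= `|h| & psi (x + h *: basis_rV i) - psi x = h * dpsi (x + t *: basis_rV i).
Proof.
move=> hd.
have hline t : is_derive t (1 : R) ((fun t : R => psi (x + t *: basis_rV i)) : R -> R^o) (dpsi (x + t *: basis_rV i)).
 have /pd_line := hd (x + t *: basis_rV i).
 have -> : (fun s : R => psi (x + t *: basis_rV i + s *: basis_rV i)) =
   ((fun t : R => psi (x + t *: basis_rV i)) \o shift t).
  by apply/funext => s /=; rewrite scalerDl addrA addrAC.
 move=> H. have E : (fun t : R => psi (x + t *: basis_rV i)) =
   (fun s : R => ((fun t : R => psi (x + t *: basis_rV i)) \o shift t) (s - t)).
  by apply/funext => s /=; rewrite subrK.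
 rewrite E; have -> : dpsi (x + t *: basis_rV i) = dpsi (x + t *: basis_rV i) * 1 by rewrite mulr1.
 apply: (@is_derive1_comp R ((fun t : R => psi (x + t *: basis_rV i)) \o shift t) (fun s => s - t) t).
  by rewrite subrr.
 by apply: is_derive_eq; rewrite subr0.
have cont t : {for t, continuous (fun t : R => psi (x + t *: basis_rV i))}.
 by apply: differentiable_continuous; apply/derivable1_diffP; case: (hline t).
have psi0 : psi x = psi (x + 0 *: basis_rV i) by rewrite scale0r addr0.
have [h0|h0|->] := ltgtP h 0; last by exists 0; rewrite ?mul0r // -psi0 subrr.
 have [|t] := MVT h0 (fun t _ => hline t).
  by apply: continuous_subspaceT => t; exact: cont.
 rewrite in_itv /= => /andP[t1 t2] E; exists t.
  by rewrite !ltr0_norm// lerN2 ltW.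
 by rewrite psi0 -opprB E sub0r mulrN opprK mulrC.
have [|t] := MVT h0 (fun t _ => hline t).
 by apply: continuous_subspaceT => t; exact: cont.
rewrite in_itv /= => /andP[t1 t2] E; exists t; first by rewrite !gtr0_norm// ltW.
by rewrite psi0 E subr0 mulrC.
Qed.

Definition conv u psi x := I (fun y => u y * psi (x - y)).

Lemma bsupp_conv r psi x : bsupp r psi -> bsupp (`|x| + r) (fun y => psi (x - y)).
Proof.
move=> h y xy; apply: h; have : `|y| <= `|x| + `|x - y|.
 by rewrite -{1}(subKr x y) (le_trans (ler_normB _ _)).
lra.
Qed.

Lemma cont_conv psi (x : 'rV[R]_n) : continuous psi -> continuous (fun y : 'rV[R]_n => psi (x - y)).
Proof.
move=> cpsi; apply: cont_comp cpsi; apply: continuous_rVP => i; under eq_fun do rewrite !mxE.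
by apply: contB; [exact: cont_cst|exact: continuous_coord].
Qed.

Lemma conv_integ u psi x r : loc_integrable u -> continuous psi -> bsupp r psi ->
 integ (fun y => u y * psi (x - y)).
Proof.
move=> lu cpsi hpsi; apply: (loc_cs_integ lu (cont_conv (x := x) cpsi)).
exact: bsupp_conv hpsi.
Qed.

Lemma conv_continuous u psi r : loc_integrable u -> continuous psi -> bsupp r psi ->
 continuous (conv u psi).
Proof.
move=> lu cpsi hpsi x; apply: cont_at_eps => e e0.
pose K := I (fun y => `|u y * \1_(cball (`|x| + r + 1)) y|).
have K0 : 0 <= K by apply: I_ge0.
have iK : integ (fun y => `|u y * \1_(cball (`|x| + r + 1)) y|) by apply: integ_abs; exact: loc_integ.
have [d d0 hd] := cs_unif cpsi hpsi (divr_gt0 e0 (ltr_wpDl K0 ltr01)).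
near=> z.
have zx1 : `|x - z| <= 1 by near: z; apply: cvgr_dist_le => //; exact: ltr01.
have zxd : `|x - z| <= d by near: z; apply: cvgr_dist_le.
have hz : `|z| <= `|x| + 1 by rewrite -{1}(subKr x z) (le_trans (ler_normB _ _))// lerD2l.
rewrite /conv -IB; [|exact: conv_integ hpsi|exact: conv_integ hpsi].
apply: (le_trans (I_abs _)); first by apply: integB; exact: conv_integ hpsi.
apply: (@le_trans _ _ (I (fun y => e / (K + 1) * `|u y * \1_(cball (`|x| + r + 1)) y|))).
 apply: I_le.
 - by apply: integ_abs; apply: integB; exact: conv_integ hpsi.
 - exact: integZ. move=> y; rewrite -mulrBr !normrM mulrCA ler_wpM2l// indicE.
 case: (boolP (y \in _)) => [_|].
  rewrite normr1 mulr1; apply: hd. by rewrite opprB addrA subrK.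
 rewrite notin_setE /cball /= => /negP; rewrite -ltNge => hy. have := normr_ge0 x => x0.
 rewrite (bsupp_conv hpsi (x := x)); last by lra. rewrite (bsupp_conv hpsi (x := z)); last by lra.
 by rewrite subr0 !normr0 mulr0.
rewrite IZ// -/K mulrAC ler_pdivrMr ?ltr_wpDl// ler_wpM2l//; lra.
Unshelve. all: by end_near. Qed.

(* Differentiation under the integral sign, by the mean value theorem in direction e_i and
  uniform continuity of the derivative. *)
Lemma conv_pd u psi dpsi r i x : loc_integrable u -> continuous psi -> bsupp r psi ->
 (forall x, pd i psi x (dpsi x)) -> continuous dpsi ->
 pd i (conv u psi) x (conv u dpsi x).
Proof.
move=> lu cpsi hpsi hd cd.
have hdpsi := bsupp_pd hpsi hd.
pose K := I (fun y => `|u y * \1_(cball (`|x| + r + 1)) y|).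
have K0 : 0 <= K by apply: I_ge0.
have iK : integ (fun y => `|u y * \1_(cball (`|x| + r + 1)) y|) by apply: integ_abs; exact: loc_integ.
apply/pd_line.
have key : (fun h : R => h^-1 *: (((fun t : R => conv u psi (x + t *: basis_rV i)) \o shift 0) (h *: 1) -
  conv u psi (x + 0 *: basis_rV i))) @ 0^' --> (conv u dpsi x : R).
 apply/cvgrPdist_le => e e0. have [d d0 hdd] := cs_unif cd hdpsi (divr_gt0 e0 (ltr_wpDl K0 ltr01)).
 near=> h. have h0 : h != 0 by near: h; exact: nbhs_dnbhs_neq.
 have h1 : `|h| <= 1 by near: h; apply: dnbhs0_le.
 have hd1 : `|h| <= d by near: h; apply: dnbhs0_le. rewrite /= scale0r addr0 [h *: 1]mulr1 addr0.
 rewrite /conv -IB; [|exact: conv_integ hpsi|exact: conv_integ hpsi].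
 rewrite /GRing.scale /= -IZ; last by apply: integB; exact: conv_integ hpsi.
 rewrite -IB; [|exact: conv_integ hdpsi|by apply: integZ; apply: integB; exact: conv_integ hpsi].
 apply: (le_trans (I_abs _)).
  apply: integB; first exact: conv_integ hdpsi.
  by apply: integZ; apply: integB; exact: conv_integ hpsi.
 apply: (@le_trans _ _ (I (fun y => e / (K + 1) * `|u y * \1_(cball (`|x| + r + 1)) y|))).
  apply: I_le.
  - apply: integ_abs; apply: integB; first exact: conv_integ hdpsi.
   by apply: integZ; apply: integB; exact: conv_integ hpsi.
  - exact: integZ. move=> y. have [t th E] := pd_MVT (x - y) h hd.
  have -> : u y * dpsi (x - y) - h^-1 * (u y * psi (x + h *: basis_rV i - y) - u y * psi (x - y)) =
    u y * (dpsi (x - y) - dpsi (x - y + t *: basis_rV i)).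
   by rewrite -(mulrBr (u y) (psi _)) addrAC E; field.
  rewrite !normrM mulrCA ler_wpM2l// indicE.
  have nt : `|t *: (basis_rV i)| = `|t| by rewrite normrZ norm_basis mulr1.
  case: (boolP (y \in _)) => [_|].
   rewrite normr1 mulr1; apply: hdd. by rewrite opprD addrA subrr sub0r normrN nt (le_trans th).
  rewrite notin_setE /cball /= => /negP; rewrite -ltNge => hy.
  have yx : `|y| <= `|x| + `|x - y| by rewrite -{1}(subKr x y) (le_trans (ler_normB _ _)).
  have yxt : `|x - y| <= `|x - y + t *: basis_rV i| + 1.
   rewrite -{1}(addrK (t *: basis_rV i) (x - y)) (le_trans (ler_normB _ _))// lerD2l nt.
   exact: le_trans h1.
  by rewrite hdpsi ?[X in _ - X]hdpsi ?subr0 ?normr0 ?mulr0//; lra.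
 rewrite IZ// -/K mulrAC ler_pdivrMr ?ltr_wpDl// ler_wpM2l//; lra.
split; first by apply/cvg_ex; eexists; exact: key.
exact/cvg_lim.
Unshelve. all: by end_near. Qed.

Lemma conv_C k u psi r : loc_integrable u -> C_ k psi -> bsupp r psi -> C_ k (conv u psi).
Proof.
elim: k psi => [|k IH] psi lu Cpsi hpsi.
 by split => //; apply: conv_continuous hpsi => //; exact: C_cont Cpsi.
have cpsi := C_cont Cpsi.
split; first exact: conv_continuous hpsi.
move=> i; have [d1 d2] := Cpsi.2 i.
have hd x : pd i psi x (partial i psi x) by [].
have hp x := conv_pd x lu cpsi hpsi hd (C_cont d2).
split; first by move=> x; exact: pd_derivable (hp x).
have -> : partial i (conv u psi) = conv u (partial i psi).
 by apply/funext => x; exact: pd_partial (hp x).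
apply: IH => //; exact: bsupp_pd hd.
Qed.

Lemma conv_smooth u psi r : loc_integrable u -> smooth psi -> bsupp r psi -> smooth (conv u psi).
Proof. by move=> lu spsi hpsi k; apply: conv_C hpsi. Qed.

Lemma conv_bsupp r s F psi : bsupp r F -> bsupp s psi -> bsupp (r + s) (conv F psi).
Proof.
move=> hF hpsi x rsx; rewrite /conv (eq_I (g := fun=> 0)) ?I0// => y.
have [yr|yr] := leP `|y| r; last by rewrite hF// mul0r.
rewrite hpsi ?mulr0//; have : `|x| <= `|x - y| + `|y| by rewrite -{1}(subrK y x) ler_normD.
lra.
Qed.

End mollification.

(** * Mollifiers and weak derivatives *)

Section weak_derivative.
Context {R : realType} (n : nat).
Local Notation rV := 'rV[R]_n.
Implicit Types (f g u F psi phi rho : rV -> R) (r d e : R) (i : 'I_n).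

Definition mollifier d rho :=
 [/\ smooth rho, bsupp d rho, forall x, 0 <= rho x & I rho = 1].

(** The integrals of the bumps tend to the volume of the cube, which is positive, so some bump can
    be normalised. *)
Lemma mollifier_exists d : 0 < d -> exists rho, mollifier d rho.
Proof.
move=> d0; pose a : rV := const_mx (- d); pose b : rV := const_mx d.
have fin : (leb n (obox a b) < +oo)%E.
 by apply: (@leb_bounded_lty _ _ _ (`|a| + `|b|)); [exact: measurable_obox|move=> x; exact: obox_bounded].
have iab : integ (\1_(obox a b)) by apply: integ_indic_fin => //; exact: measurable_obox.
have Ipos : 0 < I (\1_(obox a b)).
 rewrite -lte_fin -integE// integral_indic//; last exact: measurable_obox.
 rewrite setIT; apply: lt_le_trans (@leb_ball_gt0 R n d d0) _.
 apply: le_measure; rewrite ?inE; [|exact: measurable_obox|].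
  apply: open_measurable_rV; apply: (@open_comp _ _ (@enorm R n) [set x | x < d]).
   by move=> x _; exact: enorm_continuous.
  by [].
 move=> x /= xd i; rewrite /= in_itv !mxE -ltr_norml.
 by apply: le_lt_trans xd; apply: le_trans (norm_le_enorm x); exact: coord_le_norm.
have [|||||_ cv] := @I_dct R n (fun k x => bump a b k x) (\1_(obox a b)) (\1_(cball (`|a| + `|b|))).
- by move=> k; apply: mfn_cont; exact: (C_cont (bump_smooth a b k 0)).
- by apply: mfn_indic; exact: measurable_obox.
- exact: integ_cball.
- by apply: aeW => x; exact: cvg_bump.
- move=> k x; rewrite ger0_norm ?bump_ge0// indicE.
 case: (boolP (x \in _)); first by rewrite bump_le1.
 by rewrite notin_setE => h; rewrite bump_out// => /obox_bounded; exact: h.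
have [k hk] : exists k, 0 < I (bump a b k).
 have : \forall k \near \oo, 0 < I (bump a b k) by exact: (cvgr_gt _ cv).
 by move=> [k _ /(_ k (leqnn k)) h]; exists k.
have bi : integ (bump a b k) by apply: cs_integ; [exact: C_cont (bump_smooth a b k 0)|exact: bump_bsupp].
exists (fun x => (I (bump a b k))^-1 * bump a b k x); split.
- by move=> m; apply: C_M; [exact: C_cst|exact: bump_smooth].
- move=> x dx; rewrite bump_out ?mulr0// => h; move: dx; rewrite ltNge => /negP; apply.
 apply/mx_norm_leP; first exact: ltW.
 move=> i; have := h i; rewrite /= in_itv /= !mxE => /andP[h1 h2]. by rewrite ler_norml !ltW.
- by move=> x; rewrite mulr_ge0 ?bump_ge0// invr_ge0 ltW.
- by rewrite IZ// mulVf// gt_eqF.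
Qed.

Lemma I_reflect f x : integ f -> I (fun y => f (x - y)) = I f.
Proof.
move=> fi; have N0 : (-1 : R) != 0 by [].
have := I_dilate x N0 fi; rewrite normrN1 expr1n invr1 mul1r => <-.
by apply: eq_I => y; rewrite scaleN1r addrC.
Qed.

Lemma integ_reflect f x : integ f -> integ (fun y => f (x - y)).
Proof.
move=> fi; have N0 : (-1 : R) != 0 by [].
by have := integ_dilate x N0 fi; apply: eq_integ => y; rewrite scaleN1r addrC.
Qed.

Lemma convC F psi r s : continuous F -> bsupp r F -> continuous psi -> bsupp s psi ->
 conv F psi = conv psi F.
Proof.
move=> cF hF cpsi hpsi; apply/funext => x; rewrite /conv -[RHS](@I_reflect _ x).
 by apply: eq_I => y; rewrite subKr mulrC.
by apply: conv_integ hF => //; exact: cont_loc.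
Qed.

Lemma conv_approx F rho d e : continuous F -> (forall x y, `|x - y| <= d -> `|F x - F y| <= e) ->
 mollifier d rho -> forall x, `|conv F rho x - F x| <= e.
Proof.
move=> cF hF [srho hrho rho0 rho1] x.
have crho := C_cont (srho 0).
have ir : integ (fun y => rho (x - y)) by apply: integ_reflect; exact: cs_integ hrho.
have E : F x = I (fun y => F x * rho (x - y)) by rewrite IZ// (I_reflect x (cs_integ crho hrho)) rho1 mulr1.
have i1 : integ (fun y => F y * rho (x - y)) by apply: conv_integ hrho => //; exact: cont_loc.
have i2 : integ (fun y => F x * rho (x - y)) by exact: integZ.
rewrite {1}E /conv -IB//.
apply: (le_trans (I_abs (integB i1 i2))).
apply: (@le_trans _ _ (I (fun y => e * rho (x - y)))); last first.
 by rewrite IZ// (I_reflect x (cs_integ crho hrho)) rho1 mulr1.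
apply: I_le; [by apply: integ_abs; exact: integB|exact: integZ|].
move=> y; rewrite -mulrBl normrM (ger0_norm (rho0 _)).
have [xy|xy] := leP `|x - y| d; first by rewrite ler_wpM2r// hF// -normrN opprB.
by rewrite hrho// !mulr0.
Qed.

Lemma test_density F r e : continuous F -> bsupp r F -> 0 < e ->
 exists psi, [/\ smooth psi, bsupp (r + 1) psi & forall x, `|psi x - F x| <= e].
Proof.
move=> cF hF e0; have [d d0 hd] := cs_unif cF hF e0.
have d1 : 0 < Num.min d 1 by rewrite lt_min d0 ltr01.
have [rho hrho] := mollifier_exists d1; have [srho brho rho0 rho1] := hrho.
exists (conv F rho); split.
- by apply: conv_smooth brho => //; exact: cont_loc.
- apply: bsupp_le (conv_bsupp hF brho); by rewrite lerD2l ge_min lexx orbT.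
- apply: (conv_approx cF _ hrho) => x y xy; apply: hd; apply: le_trans xy _.
 by rewrite ge_min lexx.
Qed.

(** By symmetry of the convolution the derivative falls on F instead of the mollifier, so one
    mollifier approximates both F and [dF]. *)
Lemma test_density_C1 F dF r e i : continuous F -> bsupp r F -> (forall x, pd i F x (dF x)) ->
 continuous dF -> 0 < e ->
 exists psi, [/\ smooth psi, bsupp (r + 1) psi, forall x, `|psi x - F x| <= e &
  forall x, `|partial i psi x - dF x| <= e].
Proof.
move=> cF hF hd cd e0; have bd := bsupp_pd hF hd.
have [d1 d10 hd1] := cs_unif cF hF e0.
have [d2 d20 hd2] := cs_unif cd bd e0.
have d0 : 0 < Num.min (Num.min d1 d2) 1 by rewrite !lt_min d10 d20 ltr01.
have [rho hrho] := mollifier_exists d0; have [srho brho rho0 rho1] := hrho.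
have crho := C_cont (srho 0).
exists (conv F rho); split.
- by apply: conv_smooth brho => //; exact: cont_loc.
- apply: bsupp_le (conv_bsupp hF brho); by rewrite lerD2l ge_min lexx orbT.
- apply: (conv_approx cF _ hrho) => x y xy; apply: hd1; apply: le_trans xy _.
 by rewrite !ge_min lexx.
- move=> x; have -> : partial i (conv F rho) x = conv dF rho x.
  rewrite (convC cF hF crho brho) (convC cd bd crho brho); apply: pd_partial.
  by apply: conv_pd hF _ _ => //; exact: cont_loc.
 apply: (conv_approx cd _ hrho) => z y zy; apply: hd2; apply: le_trans zy _.
 by rewrite !ge_min lexx orbT.
Qed.

(** Compared with [weak_partial], the test functions only have a continuous derivative in the
    direction i. This class survives multiplication by C^1 functions and C^1 changes of
    variables. *)
Definition wd i u g := loc_integrable g /\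
 forall r F dF, continuous F -> bsupp r F -> (forall x, pd i F x (dF x)) -> continuous dF ->
 I (fun x => u x * dF x) = - I (fun x => g x * F x).

Lemma test_pd i phi : smooth phi -> [/\ continuous phi, forall x, pd i phi x (partial i phi x) &
 continuous (partial i phi)].
Proof.
move=> sphi; have [cphi /(_ i)[h1 h2]] := sphi 1%N; by split => //; exact: h2.1.
Qed.

Lemma le_eps (a C : R) : 0 <= C -> (forall e, 0 < e -> a <= e * C) -> a <= 0.
Proof.
move=> C0 h; rewrite leNgt; apply/negP => a0.
have C1 : 0 < C + 1 by lra.
have := h (a / (2 * (C + 1))); rewrite divr_gt0 ?mulr_gt0// => /(_ isT).
have -> : a / (2 * (C + 1)) * C = a / 2 * (C / (C + 1)) by field; lra.
have : C / (C + 1) <= 1 by rewrite ler_pdivrMr; lra.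
move=> h1 h2; have : a / 2 * (C / (C + 1)) <= a / 2 by rewrite ler_piMr; lra.
lra.
Qed.

Lemma I_diff_le u F G r e : loc_integrable u -> continuous F -> continuous G ->
 bsupp r F -> bsupp r G -> (forall x, `|F x - G x| <= e) ->
 `|I (fun x => u x * F x) - I (fun x => u x * G x)| <= e * I (fun x => `|u x * \1_(cball r) x|).
Proof.
move=> lu cF cG hF hG FG.
have iF := loc_cs_integ lu cF hF; have iG := loc_cs_integ lu cG hG.
rewrite -IB// (le_trans (I_abs _))//; first exact: integB.
rewrite -IZ; last by apply: integ_abs; exact: loc_integ.
apply: I_le; [by apply: integ_abs; exact: integB|by apply: integZ; apply: integ_abs; exact: loc_integ|].
move=> x; rewrite -mulrBr !normrM mulrCA ler_wpM2l// indicE.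
case: (boolP (x \in _)) => [_|]; first by rewrite normr1 mulr1.
rewrite notin_setE /cball /= => /negP; rewrite -ltNge => rx.
by rewrite hF// hG// subr0 normr0 mulr0.
Qed.

(* Continuously differentiable test functions suffice: mollify them. *)
Lemma weak_partialP i u g : loc_integrable u -> weak_partial i u g <-> wd i u g.
Proof.
move=> lu; split=> -[lg h]; split => //.
 move=> r F dF cF hF hd cd; have bd := bsupp_pd hF hd.
 apply/eqP; rewrite -subr_eq0 opprK -normr_le0.
 pose A (v : rV -> R) := I (fun x => `|v x * \1_(cball (r + 1)) x|).
 apply: (@le_eps _ (A u + A g)) => [|e e0]; first by rewrite addr_ge0//; apply: I_ge0.
 have [psi [spsi bpsi p1 p2]] := test_density_C1 cF hF hd cd e0.
 have [cpsi hpsi cdpsi] := test_pd i spsi. have tpsi : test_function psi by exact: bsupp_test bpsi.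
 have r1 : r <= r + 1 by lra. have bdpsi := bsupp_pd bpsi hpsi.
 have E : I (fun x => u x * partial i psi x) = - I (fun x => g x * psi x).
  apply: EFin_inj; rewrite EFinN -!integE; first exact: h.
   exact: loc_cs_integ bpsi.
  exact: loc_cs_integ bdpsi.
 have h1 := I_diff_le lu cdpsi cd bdpsi (bsupp_le r1 bd) p2.
 have h2 := I_diff_le lg cpsi cF bpsi (bsupp_le r1 hF) p1.
 rewrite E in h1; rewrite -/(A u) in h1; rewrite -/(A g) in h2; rewrite mulrDr.
 move: h1 h2; set a := I _; set b := I _; set c := I _ => h1 h2.
 have -> : b + c = - (- a - b) - (a - c) by ring.
 by rewrite (le_trans (ler_normB _ _))// normrN lerD.
move=> phi tphi; have [r bphi] := test_bsupp tphi; have [cphi hphi cdphi] := test_pd i tphi.1.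
have bd := bsupp_pd bphi hphi.
rewrite !integE; [|exact: loc_cs_integ bphi|exact: loc_cs_integ bd].
by rewrite -EFinN (h r phi (partial i phi)).
Qed.

Lemma wd_unique i u g g' : wd i u g -> wd i u g' -> {ae leb n, forall x, g x = g' x}.
Proof.
move=> [lg h] [lg' h'].
have lN : loc_integrable (fun x => g x + (-1) * g' x) by apply: locD => //; exact: locZ.
have : {ae leb n, forall x, g x + (-1) * g' x = 0}.
 apply: fundamental_lemma => // phi tphi.
 have [r bphi] := test_bsupp tphi; have [cphi hphi cdphi] := test_pd i tphi.1.
 have i1 := loc_cs_integ lg cphi bphi; have i2 := loc_cs_integ lg' cphi bphi.
 rewrite (eq_I (g := fun x => g x * phi x - g' x * phi x)); last by move=> x; ring.
 rewrite IB//; have := h r phi _ cphi bphi hphi cdphi; rewrite (h' r phi _ cphi bphi hphi cdphi).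
 by move=> /oppr_inj ->; rewrite subrr.
by apply: filterS => x; rewrite mulN1r => /eqP; rewrite subr_eq0 => /eqP.
Qed.

Definition diffq i h u x := u (x + h *: basis_rV i) - u x.

Lemma shift_cont u (c : rV) : continuous u -> continuous (fun x : rV => u (x + c)).
Proof. by move=> cu; apply: cont_comp cu; exact: translate_continuous. Qed.

Lemma diffq_cont i h u : continuous u -> continuous (diffq i h u).
Proof. by move=> cu; apply: contB => //; exact: shift_cont. Qed.

Lemma norm_scale_basis i h : `|h *: (basis_rV i : rV)| = `|h|.
Proof. by rewrite normrZ norm_basis mulr1. Qed.

Lemma bsupp_shift r F (c : rV) : bsupp r F -> bsupp (r + `|c|) (fun x => F (x + c)).
Proof.
move=> hF x h; apply: hF; have : `|x| <= `|x + c| + `|c| by rewrite -{1}(addrK c x) ler_normB.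
lra.
Qed.

Lemma diffq_swap i h u F r : continuous u -> continuous F -> bsupp r F ->
 I (fun x => diffq i h u x * F x) = I (fun x => u x * F (x - h *: basis_rV i)) - I (fun x => u x * F x).
Proof.
move=> cu cF hF; have lu := cont_loc cu.
have i1 : integ (fun x => u (x + h *: basis_rV i) * F x).
 by apply: loc_cs_integ hF => //; apply: cont_loc; exact: shift_cont.
have i2 := loc_cs_integ lu cF hF.
rewrite (eq_I (g := fun x => u (x + h *: basis_rV i) * F x - u x * F x)); last first.
 by move=> x; rewrite -mulrBl.
rewrite IB//; congr (_ - _).
rewrite -[RHS](I_translate (h *: basis_rV i)).
 by apply: eq_I => x; rewrite addrK.
by apply: mfnM; apply: mfn_cont => //; exact: shift_cont.
Qed.

(** This is the mean value theorem for the integral of u(x) psi(x - s e_i) as a function of s, which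
    is the convolution of u with the reflection [psi'] of psi, evaluated at s e_i. *)
Lemma diffq_smooth i h u g psi r : continuous u -> wd i u g -> smooth psi -> bsupp r psi ->
 exists2 t, `|t| <= `|h| & I (fun x => diffq i h u x * psi x) = h * I (fun x => g x * psi (x + t *: basis_rV i)).
Proof.
move=> cu [lg wg] spsi bpsi; have [cpsi hpsi cdpsi] := test_pd i spsi.
have lu := cont_loc cu.
pose psi' z := psi (- z).
have cN : continuous (fun z : rV => - z).
 by apply: continuous_rVP => j; under eq_fun do rewrite mxE; apply: contN; exact: continuous_coord.
have cpsi' : continuous psi' by exact: cont_comp cpsi.
have bpsi' : bsupp r psi' by move=> z rz; rewrite /psi' bpsi// normrN.
have hpsi' z : pd i psi' z (- partial i psi (- z)).
 apply/pd_line. have h0 := (pd_line i psi (- z) _).1 (hpsi (- z)).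
 have -> : (fun t : R => psi' (z + t *: basis_rV i)) = (fun t => psi (- z + (- t) *: basis_rV i)).
  by apply/funext => t; rewrite /psi' opprD scaleNr.
 have hN : is_derive (0 : R) (1 : R) (fun t : R => - t) (-1) by apply: is_deriveNid.
 have h1 : is_derive (- 0 : R) (1 : R) ((fun t : R => psi (- z + t *: basis_rV i)) : R -> R) (partial i psi (- z)).
  by rewrite oppr0.
 have := @is_derive1_comp R (fun t : R => psi (- z + t *: basis_rV i)) (fun t : R => - t) 0 _ (-1) h1 hN.
 by rewrite mulrN1.
have cd' : continuous (fun z : rV => - partial i psi (- z)) by apply: contN; exact: cont_comp cdpsi.
have hc x : pd i (conv u psi') x (conv u (fun z => - partial i psi (- z)) x) by exact: conv_pd bpsi' _ _.
have [t th E] := pd_MVT 0 h hc.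
exists (- t); first by rewrite normrN.
rewrite (diffq_swap _ _ cu cpsi bpsi).
have e1 s : conv u psi' (0 + s *: basis_rV i) = I (fun x => u x * psi (x - s *: basis_rV i)).
 by apply: eq_I => x; rewrite /psi' add0r opprB.
have e0 : conv u psi' 0 = I (fun x => u x * psi x) by apply: eq_I => x; rewrite /psi' sub0r opprK.
rewrite -e1 -e0 E; congr (_ * _).
have bs := bsupp_shift (c := - t *: basis_rV i) bpsi.
have cds : continuous (fun x : rV => partial i psi (x + - t *: basis_rV i)) by exact: shift_cont.
have hds x : pd i (fun x => psi (x + - t *: basis_rV i)) x (partial i psi (x + - t *: basis_rV i)).
 by apply: pd_shift; exact: hpsi.
rewrite -[RHS]opprK -(wg _ _ _ (shift_cont (c := - t *: basis_rV i) cpsi) bs hds cds).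
rewrite -IN; last exact: loc_cs_integ (bsupp_pd bs hds).
by rewrite /conv; apply: eq_I => x; rewrite add0r opprB scaleNr mulrN.
Qed.

End weak_derivative.

(** * Difference quotients and the weak chain rule *)

Section difference_quotients.
Context {R : realType} (n : nat).
Implicit Types (f g u F psi phi rho : 'rV[R]_n -> R) (r d e h : R) (i : 'I_n).

Lemma cb_integ_ball u r : loc_integrable u -> integ (fun x => `|u x * \1_(cball r) x|).
Proof. by move=> lu; apply: integ_abs; exact: loc_integ. Qed.

Lemma I_cball_bound u F M r : loc_integrable u -> continuous F -> bsupp r F ->
 (forall x, `|F x| <= M) -> `|I (fun x => u x * F x)| <= M * I (fun x => `|u x * \1_(cball r) x|).
Proof.
move=> lu cF hF hM.
have := I_diff_le lu cF (@cont_cst R _ 0) hF (fun _ _ => erefl) (e := M) _.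
rewrite (eq_I (f := fun x => u x * 0) (g := fun=> 0)) ?I0; last by move=> x; rewrite mulr0.
by rewrite subr0; apply => x; rewrite subr0.
Qed.

Lemma I_cball_le u r s : loc_integrable u -> r <= s ->
 I (fun x => `|u x * \1_(cball r) x|) <= I (fun x => `|u x * \1_(cball s) x|).
Proof.
move=> lu rs; apply: I_le; [exact: cb_integ_ball|exact: cb_integ_ball|].
move=> x; rewrite !normrM ler_wpM2l// !indicE.
case: (boolP (x \in cball r)); last by rewrite normr0.
by rewrite inE => h; rewrite mem_set//= /cball /= (le_trans h).
Qed.

Lemma bsupp_shift_le r s F (c : 'rV[R]_n) : bsupp r F -> r + `|c| <= s -> bsupp s (fun x => F (x + c)).
Proof. by move=> hF rs; apply: bsupp_le rs _; exact: bsupp_shift. Qed.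

(** F may depend on h, and in [chain_rule] it contains the increment of u itself; this is why only
    the bound M on F enters. *)
Lemma diffq_bound i h u g F r M : continuous u -> wd i u g -> continuous F -> bsupp r F ->
 (forall x, `|F x| <= M) ->
 `|I (fun x => diffq i h u x * F x)| <=
  M * `|h| * I (fun x => `|g x * \1_(cball (r + 1 + `|h|)) x|).
Proof.
move=> cu wu cF hF hM; have [lg _] := wu.
have M0 : 0 <= M by apply: le_trans (hM 0).
pose K := I (fun x => `|diffq i h u x * \1_(cball (r + 1)) x|).
pose L := I (fun x => `|g x * \1_(cball (r + 1 + `|h|)) x|).
have L0 : 0 <= L by apply: I_ge0.
have K0 : 0 <= K by apply: I_ge0.
rewrite -subr_le0; apply: (@le_eps R _ (K + `|h| * L)); first by rewrite addr_ge0// mulr_ge0.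
move=> e e0; have [psi [spsi bpsi hpsi]] := test_density cF hF e0.
have cpsi := C_cont (spsi 0).
have [t th E] := diffq_smooth h cu wu spsi bpsi.
have h1 : `|I (fun x => diffq i h u x * psi x) - I (fun x => diffq i h u x * F x)| <= e * K.
 apply: I_diff_le => //; first by apply: cont_loc; exact: diffq_cont. by apply: bsupp_le hF; lra.
have h2 : `|I (fun x => g x * psi (x + t *: basis_rV i))| <= (M + e) * L.
 apply: I_cball_bound => //; first exact: shift_cont.
  by apply: bsupp_shift_le bpsi _; rewrite norm_scale_basis lerD2l.
 move=> x; have := hpsi (x + t *: basis_rV i); have := hM (x + t *: basis_rV i).
 set a := F _; set b := psi _ => ha hb. have -> : b = (b - a) + a by rewrite subrK.
 by rewrite (le_trans (ler_normD _ _))// addrC lerD.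
have h3 : `|I (fun x => diffq i h u x * psi x)| <= `|h| * ((M + e) * L) by rewrite E normrM ler_wpM2l.
move: h1 h3; rewrite -/K; set a := I _; set b := I _ => h1 h3.
have : `|b| <= `|a| + `|a - b| by rewrite -{1}(subKr a b) ler_normB.
rewrite -/L; lra.
Qed.

(** The difference quotients converge to g even when tested by functions that are merely continuous,
    with an error governed by the modulus of continuity of F. *)
Lemma diffq_cvg i h u g F r e d : continuous u -> wd i u g -> continuous F -> bsupp r F ->
 0 <= e -> (forall x y, `|x - y| <= d -> `|F x - F y| <= e) -> `|h| <= d -> `|h| <= 1 ->
 `|I (fun x => diffq i h u x * F x) - h * I (fun x => g x * F x)| <=
  `|h| * (e * I (fun x => `|g x * \1_(cball (r + 2)) x|)).
Proof.
move=> cu wu cF hF e0 hd hhd hh1; have [lg _] := wu.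
pose K := I (fun x => `|diffq i h u x * \1_(cball (r + 1)) x|).
pose L := I (fun x => `|g x * \1_(cball (r + 2)) x|).
have L0 : 0 <= L by apply: I_ge0.
have K0 : 0 <= K by apply: I_ge0.
rewrite -subr_le0; apply: (@le_eps R _ (K + `|h| * L)); first by rewrite addr_ge0// mulr_ge0.
move=> e1 e10; have [psi [spsi bpsi hpsi]] := test_density cF hF e10.
have cpsi := C_cont (spsi 0).
have [t th E] := diffq_smooth h cu wu spsi bpsi.
have h1 : `|I (fun x => diffq i h u x * psi x) - I (fun x => diffq i h u x * F x)| <= e1 * K.
 apply: I_diff_le => //; first by apply: cont_loc; exact: diffq_cont. by apply: bsupp_le hF; lra.
have h2 : `|I (fun x => g x * psi (x + t *: basis_rV i)) - I (fun x => g x * F x)| <= (e1 + e) * L.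
 apply: I_diff_le => //; first exact: shift_cont.
 - by apply: bsupp_shift_le bpsi _; rewrite norm_scale_basis; lra.
 - by apply: bsupp_le hF; lra. move=> x; have := hpsi (x + t *: basis_rV i).
 have : `|F (x + t *: basis_rV i) - F x| <= e.
  by apply: hd; rewrite addrAC subrr add0r norm_scale_basis; lra.
 set a := F x; set b := F _; set c := psi _ => hb hc. have -> : c - a = (c - b) + (b - a) by ring.
 by rewrite (le_trans (ler_normD _ _))// lerD.
rewrite E -/K in h1; move: h1 h2; set a := I _; set b := I _; set c := I _ => h1 h2.
have -> : b - h * c = - (h * a - b) + h * (a - c) by ring.
rewrite -/L.
have h4 : `|- (h * a - b) + h * (a - c)| <= e1 * K + `|h| * ((e1 + e) * L).
 rewrite (le_trans (ler_normD _ _))// normrN lerD// normrM ler_wpM2l//.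
have e4 : `|h| * ((e1 + e) * L) = e1 * (`|h| * L) + `|h| * (e * L) by ring.
by rewrite e4 in h4; lra.
Qed.

(* Converse: the limit of the difference quotients is a weak derivative. *)
Lemma wd_of_diffq i u G : continuous u -> loc_integrable G ->
 (forall r F e, continuous F -> bsupp r F -> 0 < e -> exists2 d, 0 < d &
   forall h, 0 < h -> h <= d -> `|I (fun x => diffq i h u x * F x) - h * I (fun x => G x * F x)| <= h * e) ->
 wd i u G.
Proof.
move=> cu lG hG; split => // r F dF cF hF hd cd.
have lu := cont_loc cu; have bd := bsupp_pd hF hd.
pose A := I (fun x => `|u x * \1_(cball (r + 1)) x|).
have A0 : 0 <= A by apply: I_ge0.
apply/eqP; rewrite -subr_eq0 opprK -normr_le0.
apply: (@le_eps R _ (A + 1)); first by lra.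
move=> e e0.
have [d1 d10 hd1] := hG r F e cF hF e0.
have [d2 d20 hd2] := cs_unif cd bd e0.
pose h := Num.min (Num.min d1 (d2 / 2)) 1.
have h0 : 0 < h by rewrite !lt_min d10 divr_gt0// ltr01.
have hh1 : h <= d1 by rewrite !ge_min lexx.
have hh2 : h <= d2 / 2 by rewrite !ge_min lexx orbT.
have hh3 : h <= 1 by rewrite ge_min lexx orbT.
have k1 := hd1 h h0 hh1.
have cs : continuous (fun x : 'rV[R]_n => F (x - h *: basis_rV i)) := (shift_cont (c := - (h *: basis_rV i)) cF).
have bs : bsupp (r + 1) (fun x => F (x - h *: basis_rV i)).
 apply: (@bsupp_shift_le r _ F (- (h *: basis_rV i)) hF).
 by rewrite normrN norm_scale_basis gtr0_norm// lerD2l.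
have bF : bsupp (r + 1) F by apply: bsupp_le hF; lra.
have bdF : bsupp (r + 1) dF by apply: bsupp_le bd; lra.
rewrite (diffq_swap _ _ cu cF hF) in k1.
have i1 := loc_cs_integ lu cs bs; have i2 := loc_cs_integ lu cF hF; have i3 := loc_cs_integ lu cd bd.
have k2 : `|(I (fun x => u x * F (x - h *: basis_rV i)) - I (fun x => u x * F x)) + h * I (fun x => u x * dF x)| <= h * (e * A).
 rewrite -IB// -IZ// -ID; [|exact: integB|exact: integZ].
 rewrite (le_trans (I_abs _))//; first by apply: integD; [exact: integB|exact: integZ].
 rewrite /A -[X in _ <= _ * X]IZ; last exact: cb_integ_ball.
 rewrite -[X in _ <= X]IZ; last by apply: integZ; exact: cb_integ_ball. apply: I_le.
 - by apply: integ_abs; apply: integD; [exact: integB|exact: integZ].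
 - by apply: integZ; apply: integZ; exact: cb_integ_ball. move=> x.
 have [t th E] := pd_MVT (x - h *: basis_rV i) h hd; rewrite subrK in E.
 have -> : u x * F (x - h *: basis_rV i) - u x * F x + h * (u x * dF x) =
   u x * (h * dF x - (F x - F (x - h *: basis_rV i))) by ring.
 rewrite indicE; case: (boolP (x \in _)) => [_|].
  rewrite mulr1 E -mulrBr !normrM (gtr0_norm h0) mulrCA ler_wpM2l ?(ltW h0)// mulrC ler_wpM2r//.
  apply: hd2; have -> : x - (x - h *: basis_rV i + t *: basis_rV i) = (h - t) *: basis_rV i.
   by apply/rowP => k; rewrite !mxE; ring.
  rewrite norm_scale_basis. rewrite (gtr0_norm h0) in th; rewrite (le_trans (ler_normB _ _))//.
  by rewrite (gtr0_norm h0); lra.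
 rewrite notin_setE /cball /= => /negP; rewrite -ltNge => rx.
 by rewrite bdF// bF// bs// mulr0 !subr0 !mulr0 !normr0 !mulr0.
move: k1 k2; set a := I _; set b := I _; set c := I _; set dd := I _ => k1 k2.
have k3 : `|h * (dd + c)| <= h * (e * (A + 1)).
 have -> : h * (dd + c) = (a - b + h * dd) - (a - b - h * c) by ring.
 rewrite (le_trans (ler_normB _ _))//; lra.
by move: k3; rewrite normrM (gtr0_norm h0) ler_pM2l.
Qed.

Definition cutoff r (x : 'rV[R]_n) : R := Num.max 0 (Num.min 1 (r + 1 - `|x|)).

Lemma contMax f g : continuous f -> continuous g -> continuous (fun x : 'rV[R]_n => Num.max (f x) (g x)).
Proof.
move=> cf cg; under eq_fun do rewrite maxr_absE.
by apply: contM; [apply: contD; [exact: contD|apply: cont_norm; exact: contB]|exact: cont_cst].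
Qed.

Lemma contMin f g : continuous f -> continuous g -> continuous (fun x : 'rV[R]_n => Num.min (f x) (g x)).
Proof.
move=> cf cg; under eq_fun do rewrite minr_absE.
by apply: contM; [apply: contB; [exact: contD|apply: cont_norm; exact: contB]|exact: cont_cst].
Qed.

Lemma cutoff_cont r : continuous (cutoff r).
Proof.
apply: contMax; first exact: cont_cst.
apply: contMin; first exact: cont_cst.
by ctn; exact: norm_continuous.
Qed.

Lemma cutoff_bsupp r : bsupp (r + 1) (cutoff r).
Proof.
move=> x h; rewrite /cutoff max_l// ge_min; apply/orP; right; lra.
Qed.

Lemma cutoff1 r x : `|x| <= r -> cutoff r x = 1.
Proof. by move=> h; rewrite /cutoff min_l ?max_r; lra. Qed.

Lemma cont_unif_ball u r e : continuous u -> 0 < e -> exists2 d, 0 < d &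
 forall x y, `|x| <= r -> `|x - y| <= d -> `|u x - u y| <= e.
Proof.
move=> cu e0.
have cF : continuous (fun x => u x * cutoff (r + 1) x) by apply: contM => //; exact: cutoff_cont.
have bF : bsupp (r + 1 + 1) (fun x => u x * cutoff (r + 1) x) by move=> x /cutoff_bsupp ->; rewrite mulr0.
have [d d0 hd] := cs_unif cF bF e0.
exists (Num.min d 1) => [|x y xr]; first by rewrite lt_min d0 ltr01.
rewrite le_min => /andP[xyd xy1]; have := hd x y xyd.
rewrite !cutoff1 ?mulr1//; last by lra.
have : `|y| <= `|x| + `|x - y| by rewrite -{1}(subKr x y) ler_normB.
lra.
Qed.

(** The increment of j(u) is [dj (u)] times the increment of u, up to L times its square. The first
    term tests the increment with the continuous function [dj (u)] F. The second tests it with [F2],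
    the increment times |F|, which is uniformly small, so [diffq_bound] makes it o(h). *)
Lemma chain_rule i u g (j dj : R -> R) (B L : R) : continuous u -> wd i u g ->
 continuous j -> continuous dj -> (forall s, `|dj s| <= B) ->
 (forall a b, `|j b - j a - dj a * (b - a)| <= L * (b - a) ^+ 2) ->
 wd i (fun x => j (u x)) (fun x => dj (u x) * g x).
Proof.
move=> cu wu cj cdj hB hL; have [lg _] := wu.
have L0 : 0 <= L by have := hL 0 1; rewrite subr0 mulr1 expr1n mulr1; apply: le_trans.
have cju : continuous (fun x => j (u x)) by exact: cont_comp cj.
have cdju : continuous (fun x => dj (u x)) by exact: cont_comp cdj.
apply: wd_of_diffq => //; first exact: locMc.
move=> r F e cF hF e0.
have [M M0 hM] := cs_bounded cF hF.
have cG : continuous (fun x => dj (u x) * F x) by exact: contM.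
have hG : bsupp r (fun x => dj (u x) * F x) by move=> x /hF ->; rewrite mulr0.
pose C1 := I (fun x => `|g x * \1_(cball (r + 2)) x|).
pose C2 := I (fun x => `|g x * \1_(cball (r + 2 + 1)) x|).
have C10 : 0 <= C1 by apply: I_ge0.
have C20 : 0 <= C2 by apply: I_ge0.
pose e1 := e / (2 * (C1 + 1)).
have e10 : 0 < e1 by rewrite divr_gt0// mulr_gt0//; lra.
have [d1 d10 hd1] := cs_unif cG hG e10.
pose e2 := e / (2 * (L * M * C2 + 1)).
have LMC : 0 <= L * M * C2 by rewrite !mulr_ge0.
have e20 : 0 < e2 by rewrite divr_gt0// mulr_gt0//; lra.
have [d2 d20 hd2] := cont_unif_ball r cu e20.
exists (Num.min (Num.min d1 d2) 1); first by rewrite !lt_min d10 d20 ltr01.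
move=> h h0; rewrite !le_min => /andP[/andP[hh1 hh2] hh3].
have nh : `|h| = h by rewrite gtr0_norm.
have k1 : `|I (fun x => diffq i h u x * (dj (u x) * F x)) - h * I (fun x => g x * (dj (u x) * F x))| <= h * (e1 * C1).
 have := diffq_cvg cu wu cG hG (ltW e10) hd1; rewrite -{1 2}nh in hh1 hh3.
 by move=> /(_ h hh1 hh3); rewrite nh.
have cdu := diffq_cont (i := i) (h := h) cu.
have k2 : `|I (fun x => diffq i h (fun x => j (u x)) x * F x) - I (fun x => diffq i h u x * (dj (u x) * F x))| <= h * (L * M * e2 * C2).
 have iju : integ (fun x => diffq i h (fun x => j (u x)) x * F x).
  by apply: cs_integ (_ : bsupp r _); [apply: contM => //; exact: diffq_cont|move=> x /hF ->; rewrite mulr0].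
 have idu : integ (fun x => diffq i h u x * (dj (u x) * F x)).
  by apply: cs_integ (_ : bsupp r _); [exact: contM|move=> x /hG ->; rewrite mulr0].
 pose F2 x := diffq i h u x * `|F x|.
 have cF2 : continuous F2 by apply: contM => //; exact: cont_norm.
 have bF2 : bsupp r F2 by move=> x /hF; rewrite /F2 => ->; rewrite normr0 mulr0.
 have ub x : `|F2 x| <= e2 * M.
  have [xr|xr] := leP `|x| r; last by rewrite bF2// normr0 mulr_ge0// ltW.
  rewrite /F2 normrM normr_id ler_pM// /diffq distrC; apply: hd2 => //.
  by rewrite opprD addrA subrr add0r normrN norm_scale_basis nh.
 have iF2 : integ (fun x => diffq i h u x * F2 x).
  by apply: cs_integ (_ : bsupp r _); [exact: contM|move=> x /bF2 ->; rewrite mulr0].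
 have E2 := diffq_bound h cu wu cF2 bF2 ub.
 rewrite -IB// (le_trans (I_abs _))//; first exact: integB.
 apply: (@le_trans _ _ (L * I (fun x => diffq i h u x * F2 x))).
  rewrite -IZ//; apply: I_le; [by apply: integ_abs; exact: integB|exact: integZ|].
  move=> x; have := hL (u x) (u (x + h *: basis_rV i)).
  rewrite /F2 /diffq; set a := u x; set b := u _ => hab.
  have -> : (j b - j a) * F x - (b - a) * (dj a * F x) = (j b - j a - dj a * (b - a)) * F x by ring.
  have -> : L * ((b - a) * ((b - a) * `|F x|)) = L * (b - a) ^+ 2 * `|F x| by ring.
  by rewrite normrM ler_wpM2r.
 have -> : h * (L * M * e2 * C2) = L * (e2 * M * h * C2) by ring.
 rewrite ler_wpM2l// (le_trans (ler_norm _))// (le_trans E2)// nh ler_wpM2l//.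
  by apply: mulr_ge0; [apply: mulr_ge0|]; rewrite // ltW.
 apply: I_cball_le => //; lra.
have e1C : e1 * C1 <= e / 2.
 rewrite /e1 mulrAC ler_pdivrMr//; last by lra.
 have -> : e / 2 * (2 * (C1 + 1)) = e * C1 + e by field. lra.
have e2C : L * M * e2 * C2 <= e / 2.
 have -> : L * M * e2 * C2 = e * (L * M * C2) / (2 * (L * M * C2 + 1)) by rewrite /e2; field; lra.
 rewrite ler_pdivrMr//; last by lra.
 have -> : e / 2 * (2 * (L * M * C2 + 1)) = e * (L * M * C2) + e by field. lra.
have E : I (fun x => dj (u x) * g x * F x) = I (fun x => g x * (dj (u x) * F x)) by apply: eq_I => x; ring.
rewrite E; move: k1 k2; set a := I _; set b := I _; set c := I _ => k1 k2.
have -> : c - h * b = (c - a) + (a - h * b) by ring.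
rewrite (le_trans (ler_normD _ _))//.
have : h * (L * M * e2 * C2) <= h * (e / 2) by rewrite ler_wpM2l// ltW.
have : h * (e1 * C1) <= h * (e / 2) by rewrite ler_wpM2l// ltW.
have -> : h * e = h * (e / 2) + h * (e / 2) by field.
lra.
Qed.

End difference_quotients.

(** * Uniform first order expansions and the chain rule *)

Section C1_functions.
Context {R : realType} (n : nat).
Implicit Types (f g u F : 'rV[R]_n -> R) (r e : R).

Lemma is_derive_eps (g : R -> R) (l : R) :
 (forall e, 0 < e -> exists2 d, 0 < d & forall h, `|h| <= d -> `|g h - g 0 - h * l| <= e * `|h|) ->
 is_derive (0 : R) (1 : R) (g : R -> R^o) l.
Proof.
move=> hg.
have key : (fun h : R => h^-1 *: (((g : R -> R^o) \o shift 0) (h *: 1) - g 0)) @ 0^' --> (l : R^o).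
 apply/(@cvgrPdist_le R R^o) => e e0; have [d d0 hd] := hg e e0. near=> h.
 have h0 : h != 0 by near: h; exact: nbhs_dnbhs_neq.
 have hd1 : `|h| <= d by near: h; apply: dnbhs0_le.
 have := hd h hd1; rewrite /= addr0 [h *: 1]mulr1 /GRing.scale /= => H.
 rewrite -(ler_pM2l (_ : 0 < `|h|)) ?normr_gt0// -normrM mulrBr mulrA mulfV// mul1r.
 by rewrite -normrN opprB (mulrC _ e).
split; first by apply/cvg_ex; eexists; exact: key.
exact/cvg_lim.
Unshelve. all: by end_near. Qed.

Lemma is_derive_epsP (g : R -> R) (l : R) : is_derive (0 : R) (1 : R) (g : R -> R^o) l ->
 forall e, 0 < e -> exists2 d, 0 < d & forall h, `|h| <= d -> `|g h - g 0 - h * l| <= e * `|h|.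
Proof.
move=> [/cvg_ex[l' hl] hl'] e e0.
have ll : l' = l by rewrite -hl'; apply/esym/(cvg_lim _ hl).
rewrite {}ll in hl; move/(@cvgrPdist_le R R^o) : hl => /(_ e e0) [d /= d0 hd].
exists (d / 2) => [|h hh]; first by rewrite divr_gt0.
have [->|h0] := eqVneq h 0; first by rewrite mul0r subr0 subrr normr0 mulr0.
have := hd h; rewrite /= sub0r normrN => /(_ _ h0).
rewrite addr0 [h *: 1]mulr1 /GRing.scale /= => H.
have -> : g h - g 0 - h * l = - (h * (l - h^-1 * (g h - g 0))) by field.
by rewrite normrN normrM mulrC ler_wpM2r//; apply: H; lra.
Qed.

Lemma unif_fam (df : 'I_n -> 'rV[R]_n -> R) r e : (forall i, continuous (df i)) -> 0 < e ->
 exists2 d, 0 < d & forall i x y, `|x| <= r -> `|x - y| <= d -> `|df i x - df i y| <= e.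
Proof.
move=> cdf e0.
have : \forall d \near (0 : R)^'+, forall i, forall x y, `|x| <= r -> `|x - y| <= d -> `|df i x - df i y| <= e.
 apply: filter_forall => i; have [d d0 hd] := cont_unif_ball r (cdf i) e0.
 near=> d' => x y xr xy; apply: hd => //; apply: le_trans xy _; near: d'; exact: nbhs_right_le.
move=> H.
have [d [d0 hd]] : exists d : R, 0 < d /\ forall i, forall x y, `|x| <= r -> `|x - y| <= d -> `|df i x - df i y| <= e.
 by near (0:R)^'+ => d; exists d; split => //; near: d.
by exists d.
Unshelve. all: by end_near. Qed.

Definition trunc_rV (v : 'rV[R]_n) k : 'rV[R]_n := \row_j (if (j < k)%N then v 0 j else 0).

Lemma trunc_norm v k : `|trunc_rV v k| <= `|v|.
Proof.
apply/mx_norm_leP => // i; rewrite mxE; case: ifP => _; first exact: coord_le_norm.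
by rewrite normr0.
Qed.

(** The coordinates of v are added one at a time through [trunc_rV]; each step is a mean value
    theorem along one axis, and uniform continuity of the partial derivatives on a ball gives
    uniformity in x. *)
Lemma C1_taylor f (df : 'I_n -> 'rV[R]_n -> R) r e :
 (forall i x, pd i f x (df i x)) -> (forall i, continuous (df i)) -> 0 < e ->
 exists2 d, 0 < d & forall x v, `|x| <= r -> `|v| <= d ->
  `|f (x + v) - f x - \sum_i v 0 i * df i x| <= e * `|v|.
Proof.
move=> hd cdf e0.
have e1 : 0 < e / (n%:R + 1) by rewrite divr_gt0// ltr_wpDl.
have [d d0 hdd] := unif_fam r cdf e1.
exists (d / 2) => [|x v xr vd]; first by rewrite divr_gt0.
pose g k := f (x + trunc_rV v k).
have gn : g n = f (x + v) by rewrite /g; congr (f (_ + _)); apply/rowP => j; rewrite mxE ltn_ord.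
have g0 : g 0%N = f x.
 rewrite /g (_ : trunc_rV v 0 = 0) ?addr0//; by apply/rowP => j; rewrite !mxE.
have -> : f (x + v) - f x = \sum_(i < n) (g i.+1 - g i).
 by rewrite -gn -g0 -(telescope_sumr g (leq0n n)) big_mkord.
rewrite -sumrB (le_trans (ler_norm_sum _ _ _))//.
apply: (@le_trans _ _ (\sum_(i < n) (e / (n%:R + 1) * `|v|))); last first.
 have -> : \sum_(i < n) (e / (n%:R + 1) * `|v|) = n%:R * (e / (n%:R + 1)) * `|v|.
  by rewrite sumr_const card_ord -[LHS]mulr_natl mulrA.
 rewrite ler_wpM2r// mulrC mulrAC ler_pdivrMr//; rewrite ler_pM2l; lra.
apply: ler_sum => i _.
have -> : g i.+1 = f (x + trunc_rV v i + v 0 i *: basis_rV i).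
 rewrite /g -addrA; congr (f (_ + _)); apply/rowP => j; rewrite !mxE eqxx /= ltnS leq_eqVlt.
 have [ij|ij] := eqVneq (j : nat) i.
  by have -> : j = i by [apply: val_inj]; rewrite ltnn eqxx add0r mulr1.
 have -> : (j == i) = false by apply/negbTE; apply: contra ij => /eqP ->. by rewrite mulr0 addr0.
have [t th ->] := pd_MVT (x + trunc_rV v i) (v 0 i) (hd i).
rewrite -mulrBr normrM mulrC ler_pM//; last exact: coord_le_norm.
rewrite distrC; apply: hdd => //.
rewrite -addrA opprD addrA subrr add0r normrN (le_trans (ler_normD _ _))//.
have := trunc_norm v i; have := coord_le_norm v i; rewrite norm_scale_basis; lra.
Qed.

End C1_functions.

Section chain.
Context {R : realType}.

Lemma pd_chain n m (f : 'rV[R]_m -> R) (df : 'I_m -> 'rV[R]_m -> R) (T : 'rV[R]_n -> 'rV[R]_m)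
  (dT : 'I_m -> R) i x :
 (forall j y, pd j f y (df j y)) -> (forall j, continuous (df j)) ->
 (forall j, pd i (fun x => T x 0 j) x (dT j)) ->
 pd i (fun x => f (T x)) x (\sum_j dT j * df j (T x)).
Proof.
move=> hf cdf hT; apply/pd_line; apply: is_derive_eps => e e0.
rewrite scale0r addr0.
pose A := \sum_j `|df j (T x)|; have A0 : 0 <= A by apply: sumr_ge0.
pose B := \sum_j `|dT j|; have B0 : 0 <= B by apply: sumr_ge0.
have e1 : 0 < e / (2 * (B + 1)) by rewrite divr_gt0// mulr_gt0; lra.
have [d1 d10 hd1] := C1_taylor `|T x| hf cdf e1.
pose e2 := Num.min 1 (e / (2 * (A + 1))).
have e20 : 0 < e2 by rewrite lt_min ltr01 divr_gt0// mulr_gt0//; lra.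
have : \forall d \near (0 : R)^'+, forall j : 'I_m, forall h, `|h| <= d ->
  `|T (x + h *: basis_rV i) 0 j - T x 0 j - h * dT j| <= e2 * `|h|.
 apply: filter_forall => j. have [d d0 hd] := is_derive_epsP ((pd_line i _ x _).1 (hT j)) e20.
 near=> d' => h hh.
 have := hd h; rewrite scale0r addr0; apply; apply: le_trans hh _; near: d'; exact: nbhs_right_le.
move=> H.
have [d [d0 hd dd1]] : exists d : R, [/\ 0 < d, forall j : 'I_m, forall h, `|h| <= d ->
  `|T (x + h *: basis_rV i) 0 j - T x 0 j - h * dT j| <= e2 * `|h| & d * (B + 1) <= d1].
 near (0:R)^'+ => d; exists d; split => //; first by near: d. rewrite -ler_pdivlMr; last by lra.
 by near: d; apply: nbhs_right_le; rewrite divr_gt0//; lra.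
exists d => // h hh; pose v := T (x + h *: basis_rV i) - T x.
have vj j : `|v 0 j - h * dT j| <= e2 * `|h| by have := hd j h hh; rewrite !mxE.
have vn : `|v| <= (B + 1) * `|h|.
 apply/mx_norm_leP => [|j]; first by rewrite mulr_ge0//; lra. have := vj j; set a := v 0 j => aj.
 have : `|a| <= `|a - h * dT j| + `|h * dT j| by rewrite -{1}(subrK (h * dT j) a) ler_normD.
 rewrite normrM; have : `|h| * `|dT j| <= `|h| * B.
  by rewrite ler_wpM2l// /B (bigD1 j)//= ler_wpDr// sumr_ge0.
 have : e2 * `|h| <= 1 * `|h| by rewrite ler_wpM2r// ge_min lexx.
 rewrite mulrDl mul1r (mulrC B); lra.
have vd : `|v| <= d1.
 apply: le_trans vn _; apply: le_trans dd1; rewrite mulrC ler_wpM2r//; lra.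
have := hd1 (T x) v (lexx _) vd; rewrite {1}/v (addrC (T x)) subrK => k1.
have k2 : `|\sum_j v 0 j * df j (T x) - h * \sum_j dT j * df j (T x)| <= e2 * A * `|h|.
 rewrite mulr_sumr -sumrB (le_trans (ler_norm_sum _ _ _))// mulrAC mulr_sumr ler_sum// => j _.
 by rewrite mulrA -mulrBl normrM ler_wpM2r.
have e2A : e2 * A <= e / 2.
 apply: (@le_trans _ _ (e / (2 * (A + 1)) * A)); first by rewrite ler_wpM2r// ge_min lexx orbT.
 rewrite mulrAC ler_pdivrMr//; last by lra. have -> : e / 2 * (2 * (A + 1)) = e * A + e by field.
 lra.
have k3 : e / (2 * (B + 1)) * `|v| <= e / 2 * `|h|.
 apply: (@le_trans _ _ (e / (2 * (B + 1)) * ((B + 1) * `|h|))); first by rewrite ler_wpM2l// ltW.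
 have -> : e / (2 * (B + 1)) * ((B + 1) * `|h|) = e / 2 * `|h| by field; lra. by [].
have k4 : e2 * A * `|h| <= e / 2 * `|h| by rewrite ler_wpM2r.
move: k1 k2; set a := \sum_j _; set b := \sum_j _; set c := f _ => k1 k2.
have -> : c - f (T x) - h * b = (c - f (T x) - a) + (a - h * b) by ring.
rewrite (le_trans (ler_normD _ _))//; lra.
Unshelve. all: by end_near. Qed.

End chain.

(** * Algebra and limits of weak derivatives *)

Section weak_calculus.
Context {R : realType} (n : nat).
Implicit Types (f g u F : 'rV[R]_n -> R) (r e : R) (i : 'I_n).

Lemma wd_loc i u g : wd i u g -> loc_integrable g. Proof. by case. Qed.

Lemma wd_eq i u g g' : g =1 g' -> wd i u g -> wd i u g'.
Proof. by move=> /funext ->. Qed.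

Lemma locB u v : loc_integrable u -> loc_integrable v -> loc_integrable (fun x => u x - v x).
Proof. by move=> lu lv; have := locD lu (locZ (-1) lv); under eq_fun do rewrite mulN1r. Qed.

Lemma wdD i u v g h : loc_integrable u -> loc_integrable v -> wd i u g -> wd i v h ->
 wd i (fun x => u x + v x) (fun x => g x + h x).
Proof.
move=> lu lv [lg hg] [lh hh]; split; first exact: locD.
move=> r F dF cF bF hF cdF; have bd := bsupp_pd bF hF.
have i1 := loc_cs_integ lu cdF bd; have i2 := loc_cs_integ lv cdF bd.
have i3 := loc_cs_integ lg cF bF; have i4 := loc_cs_integ lh cF bF.
rewrite (eq_I (g := fun x => u x * dF x + v x * dF x)); last by move=> x; ring.
rewrite [in RHS](eq_I (g := fun x => g x * F x + h x * F x)); last by move=> x; ring.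
by rewrite !ID// (hg r F dF)// (hh r F dF)// opprD.
Qed.

Lemma wdZ i u g c : loc_integrable u -> wd i u g -> wd i (fun x => c * u x) (fun x => c * g x).
Proof.
move=> lu [lg hg]; split; first exact: locZ.
move=> r F dF cF bF hF cdF; have bd := bsupp_pd bF hF.
rewrite (eq_I (g := fun x => c * (u x * dF x))); last by move=> x; ring.
rewrite [in RHS](eq_I (g := fun x => c * (g x * F x))); last by move=> x; ring.
by rewrite !IZ; [rewrite (hg r F dF)// mulrN|exact: loc_cs_integ bF|exact: loc_cs_integ bd].
Qed.

Lemma wdB i u v g h : loc_integrable u -> loc_integrable v -> wd i u g -> wd i v h ->
 wd i (fun x => u x - v x) (fun x => g x - h x).
Proof.
move=> lu lv hu hv; have := wdD lu (locZ (-1) lv) hu (wdZ (-1) lv hv).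
by under eq_fun do rewrite mulN1r; under [X in wd _ _ X -> _]eq_fun do rewrite mulN1r.
Qed.

(** Integration by parts for f and F says that the derivative of f F has integral 0, that is, that
    the constant 1 has weak derivative 0; the latter is clear from difference quotients. *)
Lemma pd_wd i f df : (forall x, pd i f x (df x)) -> continuous f -> continuous df -> wd i f df.
Proof.
move=> hf cf cdf; split; first exact: cont_loc.
move=> r F dF cF bF hF cdF; have bd := bsupp_pd bF hF.
have [lf ldf] := (cont_loc cf, cont_loc cdf).
have i1 := loc_cs_integ lf cdF bd; have i2 := loc_cs_integ ldf cF bF.
have hM x : pd i (fun x => f x * F x) x (f x * dF x + F x * df x) by exact: pdM.
have bM : bsupp r (fun x => f x * F x) by move=> x /bF ->; rewrite mulr0.
have cM : continuous (fun x => f x * dF x + F x * df x) by ctn.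
have Z : wd i (fun _ => 1 : R) (fun=> 0).
 apply: wd_of_diffq; [exact: cont_cst|exact: cont_loc (@cont_cst _ _ 0)|].
 move=> r' F' e _ _ e0; exists 1 => // h h0 _. under eq_I do rewrite /diffq subrr mul0r.
 by under [X in h * X]eq_I do rewrite mul0r; rewrite !I0 mulr0 subrr normr0 mulr_ge0// ltW.
have := Z.2 r _ _ (contM cf cF) bM hM cM.
under eq_I do rewrite mul1r; under [X in _ = - X]eq_I do rewrite mul0r.
rewrite I0 oppr0 ID//; last by apply: eq_integ i2 => x; rewrite mulrC.
move=> /eqP; rewrite addr_eq0 => /eqP ->; congr (- _); by apply: eq_I => x; rewrite mulrC.
Qed.

Lemma wd_prod i u g f df : loc_integrable u -> wd i u g -> (forall x, pd i f x (df x)) ->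
 continuous f -> continuous df -> wd i (fun x => u x * f x) (fun x => g x * f x + u x * df x).
Proof.
move=> lu [lg hg] hf cf cdf.
have l1 : loc_integrable (fun x => g x * f x) by under eq_fun do rewrite mulrC; exact: locMc.
have l2 : loc_integrable (fun x => u x * df x) by under eq_fun do rewrite mulrC; exact: locMc.
split; first exact: locD.
move=> r F dF cF bF hF cdF; have bd := bsupp_pd bF hF.
have hM x : pd i (fun x => f x * F x) x (f x * dF x + F x * df x) by exact: pdM.
have bM : bsupp r (fun x => f x * F x) by move=> x /bF ->; rewrite mulr0.
have cM : continuous (fun x => f x * dF x + F x * df x) by ctn.
have := hg r _ _ (contM cf cF) bM hM cM.
rewrite (eq_I (g := fun x => u x * f x * dF x + u x * df x * F x)); last by move=> x; ring.
have i2 := loc_cs_integ l2 cF bF; have i3 := loc_cs_integ l1 cF bF.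
have lf : loc_integrable (fun x => u x * f x) by under eq_fun do rewrite mulrC; exact: locMc.
have i1 := loc_cs_integ lf cdF bd.
rewrite ID// => /eqP; rewrite -subr_eq0 opprK => /eqP E.
rewrite (eq_I (f := fun x => (g x * f x + u x * df x) * F x) (g := fun x => g x * f x * F x + u x * df x * F x)); last by move=> x; ring.
rewrite ID//; move: E; rewrite (eq_I (f := fun x => g x * (f x * F x)) (g := fun x => g x * f x * F x)); last by move=> x; ring.
lra.
Qed.

Lemma wd_lim i u g : loc_integrable u -> loc_integrable g ->
 (forall r e, 0 < e -> exists u' g', [/\ loc_integrable u', wd i u' g',
   I (fun x => `|(u' x - u x) * \1_(cball r) x|) <= e &
   I (fun x => `|(g' x - g x) * \1_(cball r) x|) <= e]) -> wd i u g.
Proof.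
move=> lu lg H; split => // r F dF cF bF hF cdF; have bd := bsupp_pd bF hF.
have [M M0 hM] := cs_bounded cF bF; have [M' M'0 hM'] := cs_bounded cdF bd.
apply/eqP; rewrite -subr_eq0 opprK -normr_le0; apply: (@le_eps R _ (M + M')); first exact: addr_ge0.
move=> e e0; have [u' [g' [lu' [lg' hg'] Hu Hg]]] := H r e e0.
have lBu := locB lu' lu; have lBg := locB lg' lg.
have k1 := I_cball_bound lBu cdF bd hM'; have k2 := I_cball_bound lBg cF bF hM.
have := hg' r F dF cF bF hF cdF.
have i1 := loc_cs_integ lu cdF bd; have i1' := loc_cs_integ lu' cdF bd.
have i2 := loc_cs_integ lg cF bF; have i2' := loc_cs_integ lg' cF bF.
rewrite (eq_I (g := fun x => u' x * dF x - u x * dF x)) in k1; last by move=> x; ring.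
rewrite (eq_I (g := fun x => g' x * F x - g x * F x)) in k2; last by move=> x; ring.
rewrite IB in k1; rewrite IB// in k2 => E; rewrite E in k1.
have k3 := le_trans k1 (ler_wpM2l M'0 Hu); have k4 := le_trans k2 (ler_wpM2l M0 Hg).
move: k3 k4; set a := I _; set b := I _; set c := I _ => k3 k4.
have -> : b + c = - (- a - b) - (a - c) by ring.
by rewrite (le_trans (ler_normB _ _))// normrN; lra.
Qed.

End weak_calculus.

(** * Weak derivatives under changes of variables *)

Section change_of_variables.
Context {R : realType} (n : nat).
Implicit Types (f g u F : 'rV[R]_n -> R) (r e : R) (i : 'I_n).

Lemma smooth_wd i u g : loc_integrable u -> loc_integrable g ->
 (forall r F, smooth F -> bsupp r F -> I (fun x => u x * partial i F x) = - I (fun x => g x * F x)) ->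
 wd i u g.
Proof.
move=> lu lg H; apply/weak_partialP => //; split => // phi tphi.
have [r bphi] := test_bsupp tphi; have [cphi hphi cdphi] := test_pd i tphi.1.
have bd := bsupp_pd bphi hphi.
rewrite !integE; [|exact: loc_cs_integ bphi|exact: loc_cs_integ bd].
by rewrite -EFinN (H r phi tphi.1 bphi).
Qed.

Lemma bsupp_comp (S T : 'rV[R]_n -> 'rV[R]_n) F r : continuous T -> cancel S T ->
 bsupp r F -> exists r', bsupp r' (fun y => F (S y)).
Proof.
move=> cT ST bF.
have [M M0 hM] := @cont_bounded_cball R n (fun x => `|T x|) r (cont_comp cT (@norm_continuous _ _)).
exists M => y My; apply: bF; rewrite ltNge; apply/negP => /hM.
by rewrite ST normr_id leNgt My.
Qed.

(* The hypothesis on a says that the coefficients of the Jacobian matrix are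
  constant in the direction in which they are differentiated in the
  integration by parts, so that no zero order term appears. *)
Lemma wd_comp i u (G : 'I_n -> 'rV[R]_n -> R) (T S : 'rV[R]_n -> 'rV[R]_n) (c : R)
  (a : 'I_n -> 'rV[R]_n -> R) (dS : 'I_n -> 'I_n -> 'rV[R]_n -> R) :
 loc_integrable u -> (forall j, wd j u (G j)) ->
 continuous T -> continuous S -> cancel T S -> cancel S T ->
 (forall f, mfn f -> mfn (fun x => f (T x))) ->
 (forall f, integ f -> integ (fun x => f (T x))) ->
 (forall f, integ f -> I (fun x => f (T x)) = c * I f) ->
 (forall j x, pd i (fun x => T x 0 j) x (a j (T x))) ->
 (forall j k y, pd j (fun y => S y 0 k) y (dS j k y)) -> (forall j k, continuous (dS j k)) ->
 (forall j, continuous (a j)) -> (forall j y t, a j (y + t *: basis_rV j) = a j y) ->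
 wd i (fun x => u (T x)) (fun x => \sum_j a j (T x) * G j (T x)).
Proof.
move=> lu wu cT cS TS ST mT iT IT hT hS cdS ca ha.
have locT g : loc_integrable g -> loc_integrable (fun x => g (T x)).
 move=> lg; apply: loc_integP => [|r]; first by apply: mT; exact: loc_mfn.
 have [M M0 hM] := @cont_bounded_cball R n (fun x => `|T x|) r (cont_comp cT (@norm_continuous _ _)).
 apply: (@le_integ _ _ _ (fun x => `|g (T x) * \1_(cball M) (T x)|)).
 - by apply: mfnM; [apply: mT; exact: loc_mfn|apply: mfn_indic; exact: measurable_cball].
 - move=> x; rewrite !normrM ler_wpM2l// !indicE; case: (boolP (x \in cball r)) => [|_].
   by rewrite inE => /hM; rewrite normr_id => h; rewrite mem_set.
  by rewrite normr0.
 - by apply: (iT (fun y => `|g y * \1_(cball M) y|)); exact: cb_integ_ball.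
have lG : loc_integrable (fun y => \sum_j a j y * G j y).
 elim: (index_enum _) => [|j l IH].
  by under eq_fun do rewrite big_nil; exact: cont_loc (@cont_cst _ _ 0).
 under eq_fun do rewrite big_cons; apply: locD => //. by apply: locMc => //; exact: (wu j).1.
apply: smooth_wd; [exact: locT|exact: locT _ lG|].
move=> r F sF bF; have cF := C_cont (sF 0).
have hF j x : pd j F x (partial j F x) by have [_ h _] := test_pd j sF.
have cdF j : continuous (partial j F) by have [_ _ h] := test_pd j sF.
pose F' y := F (S y); have cF' : continuous F' by exact: cont_comp cF.
have [r' bF'] := bsupp_comp cT ST bF.
pose dF' j y := \sum_k dS j k y * partial k F (S y).
have hF' j y : pd j F' y (dF' j y) by apply: (pd_chain (df := fun k => partial k F)).
have cdF' j : continuous (dF' j) by apply: cont_sum => k _; apply: contM => //; apply: cont_comp (cdF k).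
have E x : partial i F x = \sum_j a j (T x) * dF' j (T x).
 apply: (pd_unique (hF i x)).
 have := @pd_chain R n n F' dF' T (fun j => a j (T x)) i x hF' cdF' (fun j => hT j x).
 by under eq_fun do rewrite /F' TS.
have bdF' j : bsupp r' (dF' j) by exact: bsupp_pd bF' (hF' j).
have haF j y : pd j (fun y => a j y * F' y) y (a j y * dF' j y).
 apply: (pd_line j _ y _).2.
 rewrite (_ : (fun t : R => _) = fun t => a j y * F' (y + t *: basis_rV j)); last first.
  by apply/funext => t; rewrite ha.
 by apply: (pd_line j (fun z => a j y * F' z) y _).1; exact: pdZ.
have baF j : bsupp r' (fun y => a j y * F' y) by move=> y /bF'; rewrite /F' => ->; rewrite mulr0.
have badF j : bsupp r' (fun y => a j y * dF' j y) by move=> y /bdF' ->; rewrite mulr0.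
have key j : I (fun y => u y * (a j y * dF' j y)) = - I (fun y => G j y * (a j y * F' y)).
 by apply: (wu j).2 (baF j) _ _ => //; exact: contM.
have i1 j : integ (fun y => u y * (a j y * dF' j y)) by apply: loc_cs_integ (badF j) => //; exact: contM.
have i2 j : integ (fun y => G j y * (a j y * F' y)).
 by apply: loc_cs_integ (baF j) => //; [exact: (wu j).1|exact: contM].
rewrite (eq_I (g := fun x => (fun y => \sum_j u y * (a j y * dF' j y)) (T x))); last first.
 by move=> x; rewrite E mulr_sumr.
rewrite (IT (fun y => \sum_j u y * (a j y * dF' j y))); last exact: integ_sum.
rewrite I_sum//; under eq_bigr do rewrite key.
rewrite [in RHS](eq_I (g := fun x => (fun y => \sum_j G j y * (a j y * F' y)) (T x))); last first.
 by move=> x; rewrite mulr_suml; apply: eq_bigr => j _; rewrite /F' TS; ring.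
rewrite (IT (fun y => \sum_j G j y * (a j y * F' y))); last exact: integ_sum.
by rewrite I_sum// sumrN mulrN.
Qed.

End change_of_variables.

(** * Weak derivative of the positive part *)

Section positive_part.
Context {R : realType} (n : nat).
Implicit Types (f g u F : 'rV[R]_n -> R) (r e : R) (i : 'I_n).

Lemma near_natSinv (d : R) : 0 < d -> \forall k \near \oo, k.+1%:R^-1 <= d.
Proof. by move=> d0; near=> k; apply: ltW; near: k; exact: (near_infty_natSinv_lt (PosNum d0)).
Unshelve. all: by end_near. Qed.

Definition pp (s : R) : R := Num.max 0 s.

Lemma pp_ge0 s : 0 <= pp s. Proof. by rewrite le_max lexx. Qed.

Lemma pp_pos s : 0 <= s -> pp s = s. Proof. by move=> h; rewrite /pp max_r. Qed.

Lemma pp_neg s : s <= 0 -> pp s = 0. Proof. by move=> h; rewrite /pp max_l. Qed.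

Lemma pp_lip a b : `|pp a - pp b| <= `|a - b|.
Proof.
have h1 := ler_norm (a - b); have := ler_norm (b - a); rewrite distrC => h2; rewrite ler_norml.
by have [a0|a0] := leP 0 a; have [b0|b0] := leP 0 b; rewrite ?(pp_pos a0) ?(pp_pos b0)
 ?(pp_neg (ltW a0)) ?(pp_neg (ltW b0)); apply/andP; split; lra.
Qed.

Lemma cont_pp (T : topologicalType) (f : T -> R) : continuous f -> continuous (fun x => pp (f x)).
Proof.
move=> cf; under eq_fun do rewrite /pp maxr_absE.
by apply: contM; [apply: contD; [apply: contD => //; exact: cont_cst|
 apply: cont_norm; apply: contB => //; exact: cont_cst]|exact: cont_cst].
Qed.

(** The square of the positive part has a Lipschitz derivative, so it is the building block for all
    the C^1 profiles used below. *)
Lemma pp_sqr_quad a b : `|pp b ^+ 2 - pp a ^+ 2 - 2 * pp a * (b - a)| <= (b - a) ^+ 2.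
Proof.
have s1 := sqr_ge0 b; have s2 := sqr_ge0 (b - a).
have [a0|a0] := leP 0 a; have [b0|b0] := leP 0 b; rewrite ?(pp_pos a0) ?(pp_pos b0)
 ?(pp_neg (ltW a0)) ?(pp_neg (ltW b0)) ?expr0n /= ?mulr0 ?mul0r ?subr0 ?sub0r ler_norml.
- by rewrite (_ : b ^+ 2 - a ^+ 2 - 2 * a * (b - a) = (b - a) ^+ 2) ?lexx ?andbT; [lra|ring].
- by have := mulr_ge0 a0 (ltW (_ : 0 < - b)); rewrite oppr_gt0 => /(_ b0) h; apply/andP; split; nra.
- have := mulr_ge0 b0 (ltW (_ : 0 < - a)); rewrite oppr_gt0 => /(_ a0) h.
 by have := sqr_ge0 a; move=> ?; apply/andP; split; nra.
- by apply/andP; split; lra.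
Qed.

Lemma is_derive_pp_sqr s : is_derive s (1 : R) ((fun s => pp s ^+ 2) : R -> R^o) (2 * pp s).
Proof.
suff h : is_derive (0 : R) (1 : R) ((fun t => pp (s + t) ^+ 2) : R -> R^o) (2 * pp s).
 have hB : is_derive s (1 : R) (fun t : R => t - s) 1 by apply: is_derive_eq; rewrite subr0.
 have h' : is_derive (s - s) (1 : R) ((fun t => pp (s + t) ^+ 2) : R -> R^o) (2 * pp s) by rewrite subrr.
 have := @is_derive1_comp R (fun t => pp (s + t) ^+ 2) (fun t : R => t - s) s _ 1 h' hB.
 rewrite mulr1; set F := (F in is_derive _ _ F _); have -> // : F = (fun s => pp s ^+ 2).
 by apply/funext => t; rewrite /F /= addrC subrK.
apply: is_derive_eps => e e0; exists e => // h he.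
rewrite addr0; have := pp_sqr_quad s (s + h).
have -> : s + h - s = h by ring.
move=> H.
have -> : h * (2 * pp s) = 2 * pp s * h by ring.
by rewrite (le_trans H)// -real_normK ?num_real// expr2 ler_wpM2r.
Qed.

(** A C^1 approximation of the positive part: the difference quotient of [pp s ^+ 2 / 2]. Its
    derivative is [djpp]. *)
Definition jpp e s : R := (pp s ^+ 2 - pp (s - e) ^+ 2) / (2 * e).
Definition djpp e s : R := (pp s - pp (s - e)) / e.

Lemma djpp_itv e s : 0 < e -> 0 <= djpp e s <= 1.
Proof.
move=> e0; rewrite /djpp divr_ge0 ?(ltW e0)//=; last first.
 rewrite subr_ge0; have := ltW e0; rewrite /pp => e1.
 by rewrite ge_max le_max lexx/= le_max; apply/orP; right; lra.
by rewrite ler_pdivrMr// mul1r (le_trans (ler_norm _))// (le_trans (pp_lip _ _))// subKr gtr0_norm.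
Qed.

Lemma jpp_approx e s : 0 < e -> `|jpp e s - pp s| <= e.
Proof.
move=> e0; rewrite /jpp; have [s0|s0] := leP s 0.
 by rewrite !pp_neg//; [rewrite expr0n subrr mul0r subrr normr0 ltW|lra].
have [se|se] := leP s e.
 rewrite (pp_neg (_ : s - e <= 0)) ?(pp_pos (ltW s0)); last by lra.
 rewrite expr0n subr0; have -> : s ^+ 2 / (2 * e) - s = - (s * ((2 * e - s) / (2 * e))) by field; lra.
 have h : 0 <= (2 * e - s) / (2 * e) <= 1 by rewrite divr_ge0 ?ler_pdivrMr/=; lra.
 rewrite normrN ger0_norm; last by rewrite mulr_ge0; lra.
 have : s * ((2 * e - s) / (2 * e)) <= s * 1 by rewrite ler_wpM2l; lra. lra.
rewrite (pp_pos (_ : 0 <= s - e)) ?(pp_pos (ltW s0)); last by lra.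
have -> : (s ^+ 2 - (s - e) ^+ 2) / (2 * e) - s = - (e / 2) by field; lra.
by rewrite normrN ger0_norm; lra.
Qed.

(** The chain rule for [jpp] with e = 1/(k+1), followed by dominated convergence. [djpp] tends to
    the indicator of positive numbers at every s, including the value 0 at s = 0, which settles the
    set where u vanishes. *)
Lemma wd_pp i u g : continuous u -> wd i u g ->
 wd i (fun x => pp (u x)) (fun x => (if 0 < u x then 1 else 0) * g x).
Proof.
move=> cu wu; have lg := wd_loc wu; have mg := loc_mfn lg.
pose s x : R := if 0 < u x then 1 else 0.
have ms : mfn s.
 rewrite (_ : s = \1_[set x | 0 < u x]); last first.
  apply/funext => x; rewrite /s indicE; case: (boolP (_ \in _)); first by rewrite inE /= => ->.
  by rewrite notin_setE /= => /negP/negbTE ->.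
 apply: mfn_indic; apply: open_measurable_rV.
 by apply: (@open_comp _ _ u [set y | 0 < y]); [move=> x _; exact: cu|exact: open_gt].
have s1 x : `|s x| <= 1 by rewrite /s; case: ifP; rewrite ?normr1 ?normr0.
have lsg : loc_integrable (fun x => s x * g x) by exact: locMb ms s1.
have cpu : continuous (fun x => pp (u x)) by exact: cont_pp.
apply: wd_lim => //; first exact: cont_loc.
move=> r e e0.
have cdj e' : continuous (djpp e').
 have cid : continuous (fun x : R => x) by move=> x.
 by apply: contM; [apply: contB; apply: cont_pp => //; apply: contB => //; exact: cont_cst|exact: cont_cst].
have cj e' : continuous (jpp e').
 have cid : continuous (fun x : R => x) by move=> x.
 by apply: contM; [apply: contB; apply: contX; apply: cont_pp => //; apply: contB => //; exact: cont_cst|exact: cont_cst].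
have W k : wd i (fun x => jpp k.+1%:R^-1 (u x)) (fun x => djpp k.+1%:R^-1 (u x) * g x).
 have k0 : 0 < k.+1%:R^-1 :> R by []. apply: (chain_rule (B := 1) (L := k.+1%:R)) => //.
  by move=> t; have /andP[h1 h2] := djpp_itv t k0; rewrite ger0_norm.
 move=> a b; move: k0; rewrite -[X in _ <= X * _]invrK.
 set q := k.+1%:R^-1 => k0; rewrite /jpp /djpp.
 have := pp_sqr_quad a b; have := pp_sqr_quad (a - q) (b - q).
 have -> : b - q - (a - q) = b - a by ring.
 set A := pp a; set B := pp b; set A' := pp (a - q); set B' := pp (b - q) => h1 h2.
 have -> : (B ^+ 2 - B' ^+ 2) / (2 * q) - (A ^+ 2 - A' ^+ 2) / (2 * q) - (A - A') / q * (b - a) =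
  (2 * q)^-1 * ((B ^+ 2 - A ^+ 2 - 2 * A * (b - a)) - (B' ^+ 2 - A' ^+ 2 - 2 * A' * (b - a))) by field; lra.
 rewrite normrM gtr0_norm ?invr_gt0 ?mulr_gt0//.
 have -> : q^-1 * (b - a) ^+ 2 = (2 * q)^-1 * ((b - a) ^+ 2 + (b - a) ^+ 2) by field; lra.
 rewrite ler_wpM2l ?invr_ge0 ?mulr_ge0// ?(ltW k0)//. by rewrite (le_trans (ler_normB _ _))// lerD.
have Ib : integ (\1_(cball r) : 'rV[R]_n -> R) by exact: integ_cball.
have [||||_ c1] := @I_dct R n (fun k x => `|(jpp k.+1%:R^-1 (u x) - pp (u x)) * \1_(cball r) x|)
  (fun=> 0) (\1_(cball r)) _ _ Ib.
- move=> k; apply: mfn_abs; apply: mfnM; last by apply: mfn_indic; exact: measurable_cball.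
 by apply: mfn_cont; apply: contB => //; apply: cont_comp (cj _).
- exact: mfn_cst.
- apply: aeW => x; apply/(@cvgrPdist_le _ R) => d d0; near=> k.
 rewrite sub0r normrN normr_id normrM. apply: (@le_trans _ _ (k.+1%:R^-1 * 1)).
  rewrite ler_pM// ?jpp_approx ?invr_gt0// indicE; case: (_ \in _); by rewrite ?normr1 ?normr0.
 rewrite mulr1; near: k; exact: near_natSinv.
- move=> k x; rewrite normr_id normrM indicE.
 case: (_ \in _); last by rewrite normr0 mulr0.
 rewrite normr1 mulr1 (le_trans (jpp_approx _ _)) ?invr_gt0// invf_le1//. by rewrite ler1n.
have [||||_ c2] := @I_dct R n (fun k x => `|(djpp k.+1%:R^-1 (u x) * g x - s x * g x) * \1_(cball r) x|)
  (fun=> 0) (fun x => `|g x * \1_(cball r) x|) _ _ (cb_integ_ball r lg).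
- move=> k; apply: mfn_abs; apply: mfnM; last by apply: mfn_indic; exact: measurable_cball.
 apply: mfnB; apply: mfnM => //; apply: mfn_cont; exact: cont_comp (cdj _).
- exact: mfn_cst.
- apply: aeW => x; apply/(@cvgrPdist_le _ R) => d d0.
 have [u0|u0] := ltP 0 (u x); near=> k.
  have ku : k.+1%:R^-1 <= u x by near: k; exact: near_natSinv.
  have -> : djpp k.+1%:R^-1 (u x) = s x.
   by rewrite /djpp /s u0 !pp_pos ?subr_ge0 ?(ltW u0)// subKr mulfV.
  by rewrite subrr mul0r normr0 subrr normr0 ltW.
 have -> : djpp k.+1%:R^-1 (u x) = s x.
  rewrite /djpp /s ltNge u0 /= !pp_neg ?subrr ?mul0r// (le_trans _ u0)// gerBl invr_ge0//.
 by rewrite subrr mul0r normr0 subrr normr0 ltW.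
- move=> k x; rewrite normr_id -mulrBl -mulrA normrM ler_piMl//.
 have k0 : 0 < k.+1%:R^-1 :> R by []. have /andP[h1 h2] := djpp_itv (u x) k0.
 by rewrite ler_norml /s; case: ifP => _; apply/andP; split; lra.
rewrite I0 in c1; rewrite I0 in c2.
have [k [h1 h2]] : exists k, I (fun x => `|(jpp k.+1%:R^-1 (u x) - pp (u x)) * \1_(cball r) x|) <= e /\
  I (fun x => `|(djpp k.+1%:R^-1 (u x) * g x - s x * g x) * \1_(cball r) x|) <= e.
 near \oo => k; exists k; split; apply: (le_trans (ler_norm _)); rewrite -normrN -sub0r; near: k.
  by move/(@cvgrPdist_le _ R) : c1; exact.
 by move/(@cvgrPdist_le _ R) : c2; exact.
by exists (fun x => jpp k.+1%:R^-1 (u x)), (fun x => djpp k.+1%:R^-1 (u x) * g x); split => //;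
 apply: cont_loc; apply: cont_comp (cj _).
Unshelve. all: by end_near. Qed.

End positive_part.

(** * Weak gradients of continuous functions *)

Section weak_gradients.
Context {R : realType} (n : nat).
Local Notation rV := 'rV[R]_n.
Implicit Types (f g u F : rV -> R) (r e : R) (i : 'I_n) (G : rV -> rV).

(* Continuous functions with their weak gradient: all the admissible functions
  are of this kind. *)
Definition W u G := continuous u /\ forall i, wd i u (fun x => G x 0 i).

Lemma W_loc_grad u G i : W u G -> loc_integrable (fun x => G x 0 i).
Proof. by case=> _ /(_ i) []. Qed.

Lemma WD u v G H : W u G -> W v H -> W (fun x => u x + v x) (fun x => G x + H x).
Proof.
move=> [cu wu] [cv wv]; split=> [|i]; first exact: contD.
by apply: wd_eq (wdD (cont_loc cu) (cont_loc cv) (wu i) (wv i)) => x; rewrite !mxE.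
Qed.

Lemma WZ u G c : W u G -> W (fun x => c * u x) (fun x => c *: G x).
Proof.
move=> [cu wu]; split=> [|i]; first by apply: contM => //; exact: cont_cst.
by apply: wd_eq (wdZ c (cont_loc cu) (wu i)) => x; rewrite !mxE.
Qed.

Lemma WB u v G H : W u G -> W v H -> W (fun x => u x - v x) (fun x => G x - H x).
Proof.
move=> [cu wu] [cv wv]; split=> [|i]; first exact: contB.
by apply: wd_eq (wdB (cont_loc cu) (cont_loc cv) (wu i) (wv i)) => x; rewrite !mxE.
Qed.

Lemma W_smooth u (du : 'I_n -> rV -> R) : (forall i x, pd i u x (du i x)) -> continuous u ->
 (forall i, continuous (du i)) -> W u (fun x => \row_i du i x).
Proof.
by move=> hu cu cdu; split=> // i; apply: wd_eq (pd_wd (hu i) cu (cdu i)) => x; rewrite mxE.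
Qed.

Lemma W_prod u G f (df : 'I_n -> rV -> R) : W u G -> (forall i x, pd i f x (df i x)) ->
 continuous f -> (forall i, continuous (df i)) ->
 W (fun x => u x * f x) (fun x => f x *: G x + u x *: \row_i df i x).
Proof.
move=> [cu wu] hf cf cdf; split=> [|i]; first exact: contM.
by apply: wd_eq (wd_prod (cont_loc cu) (wu i) (hf i) cf (cdf i)) => x; rewrite !mxE; ring.
Qed.

Lemma W_pp u G : W u G -> W (fun x => pp (u x)) (fun x => (if 0 < u x then 1 else 0) *: G x).
Proof.
move=> [cu wu]; split=> [|i]; first exact: cont_pp.
by apply: wd_eq (wd_pp cu (wu i)) => x; rewrite !mxE.
Qed.

Lemma W_affine u G (A A' : 'M[R]_n) (b : rV) c : W u G -> A *m A' = 1%:M ->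
 (forall f, integ f -> integ (fun x => f (x *m A + b))) ->
 (forall f, integ f -> I (fun x => f (x *m A + b)) = c * I f) ->
 W (fun x => u (x *m A + b)) (fun x => G (x *m A + b) *m A^T).
Proof.
move=> [cu wu] AA' iT IT; have A'A : A' *m A = 1%:M by exact: mulmx1C.
have cT : continuous (fun x : rV => x *m A + b).
 by apply: cont_comp (@translate_continuous _ _ b); exact: continuous_mulmx.
have cS : continuous (fun x : rV => (x - b) *m A').
 by apply: cont_comp (@continuous_mulmx _ _ _ A'); exact: translate_continuous.
have hlin m (B : 'M[R]_(n, m)) k i (x c0 : rV) : pd i (fun x => ((x + c0) *m B) 0 k) x (B i k).
 apply: (@pd_shift _ _ (fun x => (x *m B) 0 k)). under eq_fun do rewrite mxE.
 apply: pd_eq (_ : pd i _ _ (\sum_j ((i == j)%:R * B j k))) _.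
  apply: pd_sum => j; under eq_fun do rewrite mulrC; rewrite mulrC.
  by apply: pdZ; exact: pd_coord.
 rewrite (bigD1 i)//= eqxx mul1r big1 ?addr0// => j /negbTE; by rewrite eq_sym => ->; rewrite mul0r.
split=> [|i]; first exact: cont_comp cu.
have := @wd_comp R n i u (fun j x => G x 0 j) (fun x => x *m A + b) (fun x => (x - b) *m A') c
 (fun j _ => A i j) (fun j k _ => A' j k) (cont_loc cu) wu cT cS.
have -> : (fun x => \sum_j A i j * G (x *m A + b) 0 j) = fun x => (G (x *m A + b) *m A^T) 0 i.
 by apply/funext => x; rewrite mxE; apply: eq_bigr => j _; rewrite mxE mulrC.
apply => //.
- by move=> x /=; rewrite addrK -mulmxA AA' mulmx1.
- by move=> x /=; rewrite -mulmxA A'A mulmx1 subrK.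
- by move=> f mf; exact: (measurableT_comp mf (continuous_measurable_rV_rV cT)).
- move=> j x; have := @hlin n A j i x 0; under eq_fun do rewrite addr0.
 by move=> h; under eq_fun do rewrite mxE; apply: pd_eq (pdD h (pd_cst i _ x)) _; rewrite addr0.
- by move=> j k; exact: cont_cst.
- by move=> j; exact: cont_cst.
Qed.

Lemma W_dilate u G a b : a != 0 -> W u G ->
 W (fun x => u (a *: x + b)) (fun x => a *: G (a *: x + b)).
Proof.
move=> a0 WG.
have E x : x *m a%:M + b = a *: x + b :> rV by rewrite mul_mx_scalar.
have := @W_affine u G a%:M a^-1%:M b (`|a| ^- n) WG.
have -> : (fun x => u (x *m a%:M + b)) = (fun x => u (a *: x + b)) by apply/funext => x; rewrite E.
have -> : (fun x => G (x *m a%:M + b) *m (a%:M)^T) = (fun x => a *: G (a *: x + b)).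
 by apply/funext => x; rewrite E tr_scalar_mx mul_mx_scalar.
apply.
- by rewrite -scalar_mxM mulfV.
- by move=> f fi; under eq_fun do rewrite E; exact: integ_dilate.
- by move=> f fi; under eq_I do rewrite E; exact: I_dilate.
Qed.

Lemma W_orthogonal u G Q : orthogonal_mx Q -> W u G ->
 W (fun x => u (x *m Q)) (fun x => G (x *m Q) *m Q^T).
Proof.
move=> oQ WG; have := @W_affine u G Q Q^T 0 1 WG oQ.
under [X in W X _]eq_fun do rewrite addr0; under [X in W _ X]eq_fun do rewrite addr0.
apply=> f fi; first by under eq_fun do rewrite addr0; exact: integ_orthogonal.
by under eq_I do rewrite addr0; rewrite I_orthogonal ?mul1r//; exact: integ_mfn.
Qed.

Lemma mfn_enorm G : (forall i, mfn (fun x => G x 0 i)) -> mfn (fun x => enorm (G x)).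
Proof.
move=> mG; apply: (@measurableT_comp _ _ _ _ _ _ (@enorm R n)); last exact: measurable_fun_rVP.
apply: mfn_cont; exact: enorm_continuous.
Qed.

Lemma W_mfn u G : W u G -> forall i, mfn (fun x => G x 0 i).
Proof. by move=> WG i; apply: loc_mfn; exact: W_loc_grad WG. Qed.

End weak_gradients.

(** * Weighted means of a function with p-integrable gradient *)

Section morrey.
Context {R : realType} (n : nat).
Local Notation rV := 'rV[R]_n.
Implicit Types (u : rV -> R) (G : rV -> rV) (A a : R -> R).

(* Primitive of a tent function: a C^1 step from 0 to 1 on the unit interval. *)
Definition ramp t : R := 2 * pp t ^+ 2 - 4 * pp (t - 2^-1) ^+ 2 + 2 * pp (t - 1) ^+ 2.
Definition tent t : R := 4 * pp t - 8 * pp (t - 2^-1) + 4 * pp (t - 1).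

Lemma is_derive_ramp t : is_derive t (1 : R) (ramp : R -> R^o) (tent t).
Proof.
have h c : is_derive t (1 : R) ((fun t => pp (t - c) ^+ 2) : R -> R^o) (2 * pp (t - c)).
 have hB : is_derive t (1 : R) (fun t : R => t - c) 1 by apply: is_derive_eq; rewrite subr0.
 have := @is_derive1_comp R (fun t => pp t ^+ 2) (fun t : R => t - c) t _ 1 (is_derive_pp_sqr (t - c)) hB.
 by rewrite mulr1.
have h0 := is_derive_pp_sqr t.
rewrite /ramp /tent.
have -> : 4 * pp t - 8 * pp (t - 2^-1) + 4 * pp (t - 1) =
 2 * (2 * pp t) - 4 * (2 * pp (t - 2^-1)) + 2 * (2 * pp (t - 1)) by ring.
have hZ (k : R) (f : R -> R) d : is_derive t (1 : R) (f : R -> R^o) d -> is_derive t (1 : R) ((fun t => k * f t) : R -> R^o) (k * d).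
 by move=> H; exact: (is_deriveZ (f := (f : R -> R^o)) (v := 1) k).
have H1 := hZ 2 _ _ h0; have H2 := hZ 4 _ _ (h 2^-1); have H3 := hZ 2 _ _ (h 1).
exact: is_deriveD (is_deriveB H1 H2) H3.
Qed.

Lemma ramp0 t : t <= 0 -> ramp t = 0.
Proof. by move=> t0; rewrite /ramp !pp_neg; [ring|lra..]. Qed.

Lemma ramp1 t : 1 <= t -> ramp t = 1.
Proof. by move=> t0; rewrite /ramp !pp_pos; [field|lra..]. Qed.

Lemma tent_out t : t <= 0 \/ 1 <= t -> tent t = 0.
Proof. by case=> t0; rewrite /tent; [rewrite !pp_neg; [ring|lra..]|rewrite !pp_pos; [field|lra..]]. Qed.

Lemma tent_itv t : 0 <= tent t <= 2.
Proof.
rewrite /tent; have [t0|t0] := leP t 0; first by rewrite !pp_neg; [apply/andP; split|..]; lra.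
rewrite (pp_pos (ltW t0)); have [t1|t1] := leP t 2^-1.
 by rewrite !pp_neg; [apply/andP; split|..]; lra.
rewrite (pp_pos (_ : 0 <= t - 2^-1)); last by lra.
have [t2|t2] := leP t 1; first by rewrite pp_neg; [apply/andP; split|]; lra.
by rewrite pp_pos; [apply/andP; split|]; lra.
Qed.

Lemma cont_tent : continuous tent.
Proof.
have cid : continuous (fun x : R => x) by move=> x.
by apply: contD; [apply: contB|]; (apply: contM; [exact: cont_cst|apply: cont_pp => //;
 apply: contB => //; exact: cont_cst]).
Qed.

Lemma ramp_itv t : 0 <= ramp t <= 1.
Proof.
rewrite /ramp; have [t0|t0] := leP t 0; first by rewrite !pp_neg; [apply/andP; split|..]; lra.
rewrite (pp_pos (ltW t0)); have [t1|t1] := leP t 2^-1.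
 by rewrite !pp_neg; [apply/andP; split|..]; nra.
rewrite (pp_pos (_ : 0 <= t - 2^-1)); last by lra.
have [t2|t2] := leP t 1; first by rewrite pp_neg; [apply/andP; split|]; nra.
by rewrite pp_pos; [apply/andP; split|]; nra.
Qed.

Lemma cont_prod (T : topologicalType) (J : Type) (r : seq J) (P : pred J) (f : J -> T -> R) :
 (forall j, continuous (f j)) -> continuous (fun x => \prod_(j <- r | P j) f j x).
Proof.
move=> cf; elim: r => [|j r IH]; first by under eq_fun do rewrite big_nil; exact: cont_cst.
by under eq_fun do rewrite big_cons; case: (P j) => //; exact: contM.
Qed.

Lemma pd_prod_indep (P : pred 'I_n) i (f : 'I_n -> R -> R) x (t : R) : (forall j, P j -> j != i) ->
 \prod_(j | P j) f j ((x + t *: basis_rV i) 0 j) = \prod_(j | P j) f j (x 0 j).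
Proof.
move=> hP; apply: eq_bigr => j /hP ji.
by rewrite !mxE eqxx (negbTE ji) mulr0 addr0.
Qed.

(* Telescoping over the coordinates: replacing one profile by another in one
  variable changes the product by a partial derivative. *)
Lemma profile_change u G (A a B b : 'I_n -> R -> R) (M : R) : W u G ->
 (forall j t, is_derive t (1 : R) (A j : R -> R^o) (a j t)) -> (forall j, continuous (a j)) ->
 (forall j t, is_derive t (1 : R) (B j : R -> R^o) (b j t)) -> (forall j, continuous (b j)) ->
 (forall j t, t <= -1 \/ 2 <= t -> [/\ A j t = B j t, a j t = 0 & b j t = 0]) ->
 (forall j t, [/\ `|a j t| <= M, `|b j t| <= M & `|A j t - B j t| <= M]) ->
 `|I (fun z => u z * \prod_j a j (z 0 j)) - I (fun z => u z * \prod_j b j (z 0 j))| <=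
  M ^+ n * \sum_i I (fun z => `|G z 0 i * \1_(cball 2) z|).
Proof.
move=> [cu wu] hA ca hB cb hout hM.
have lu := cont_loc cu.
have out2 (t : R) : ~ (`|t| <= 2) -> t <= -1 \/ 2 <= t.
 by move=> /negP; rewrite ler_norml negb_and -!ltNge => /orP[h|h]; [left|right]; lra.
pose P (k : nat) (z : rV) : R := \prod_(j < n) (if (j < k)%N then b j (z 0 j) else a j (z 0 j)).
have cP k : continuous (P k).
 by apply: cont_prod => j; case: (j < k)%N; [exact: cont_comp (@continuous_coord _ _ j) (cb j)|
  exact: cont_comp (@continuous_coord _ _ j) (ca j)].
have bP k : bsupp 2 (P k).
 move=> z hz; have [j hj] : exists j, ~ (`|z 0 j| <= 2).
  apply: contrapT => H; move: hz; rewrite ltNge => /negP; apply; apply/mx_norm_leP => // j.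
  by apply: contrapT => h; apply: H; exists j.
 have [_ h1 h2] := hout j _ (out2 _ hj). by rewrite /P (bigD1 j)//= h1 h2 if_same mul0r.
have iP k := loc_cs_integ lu (cP k) (bP k).
pose g k := I (fun z => u z * P k z).
have g0 : g 0%N = I (fun z => u z * \prod_j a j (z 0 j)) by [].
have gn : g n = I (fun z => u z * \prod_j b j (z 0 j)).
 by apply: eq_I => z; congr (_ * _); apply: eq_bigr => j _; rewrite ltn_ord.
rewrite -g0 -gn distrC -(telescope_sumr g (leq0n n)) big_mkord (le_trans (ler_norm_sum _ _ _))//.
rewrite mulr_sumr; apply: ler_sum => i _.
pose Q (z : rV) : R := \prod_(j < n | j != i) (if (j < i)%N then b j (z 0 j) else a j (z 0 j)).
have cQ : continuous Q.
 by apply: cont_prod => j; case: (j < i)%N; [exact: cont_comp (@continuous_coord _ _ j) (cb j)|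
  exact: cont_comp (@continuous_coord _ _ j) (ca j)].
have Pi z : P i z = a i (z 0 i) * Q z by rewrite /P (bigD1 i)//= ltnn.
have PiS z : P i.+1 z = b i (z 0 i) * Q z.
 rewrite /P (bigD1 i)//= ltnSn; congr (_ * _); apply: eq_bigr => j ji.
 by rewrite ltnS leq_eqVlt (_ : (val j == val i) = false)//; apply/negbTE.
pose F (z : rV) : R := (B i (z 0 i) - A i (z 0 i)) * Q z.
have cAB (D d : R -> R) : (forall t, is_derive t (1 : R) (D : R -> R^o) (d t)) -> continuous D.
 move=> hD t; apply: differentiable_continuous; apply/derivable1_diffP. by [].
have cF : continuous F.
 apply: contM => //; apply: contB; apply: cont_comp (@continuous_coord _ _ i) _.
  by ctn.
 by ctn.
have bF : bsupp 2 F.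
 move=> z hz; have [zi|/negP zi] := boolP (`|z 0 i| <= 2); last first.
  by rewrite /F; have [-> _ _] := hout i _ (out2 _ zi); rewrite subrr mul0r.
 have [j [ji hj]] : exists j, j != i /\ ~ (`|z 0 j| <= 2).
  apply: contrapT => H; move: hz; rewrite ltNge => /negP; apply; apply/mx_norm_leP => // j.
  have [->//|ji] := eqVneq j i. by apply: contrapT => h; apply: H; exists j.
 have [_ h1 h2] := hout j _ (out2 _ hj). by rewrite /F /Q (bigD1 j)//= h1 h2 if_same mul0r mulr0.
have hF z : pd i F z (P i.+1 z - P i z).
 rewrite Pi PiS -mulrBl.
 have hd : pd i (fun z => Q z * (B i (z 0 i) - A i (z 0 i))) z (Q z * (b i (z 0 i) - a i (z 0 i))).
  have h1 : pd i (fun z => B i (z 0 i) - A i (z 0 i)) z (b i (z 0 i) - a i (z 0 i)).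
   by apply: pdB; apply: pd_eq (pd_comp _ (pd_coord i i z)) _ => //; rewrite eqxx mulr1.
  apply: (pd_line i _ z _).2.
  rewrite (_ : (fun t : R => _) = fun t => Q z * (B i ((z + t *: basis_rV i) 0 i) - A i ((z + t *: basis_rV i) 0 i))).
   by apply: (pd_line i (fun y => Q z * (B i (y 0 i) - A i (y 0 i))) z _).1; exact: pdZ.
  apply/funext => t; congr (_ * _).
  by rewrite /Q (pd_prod_indep (fun j s => if (j < i)%N then b j s else a j s)).
 rewrite mulrC; have -> : F = (fun z => Q z * (B i (z 0 i) - A i (z 0 i))) by apply/funext => y; rewrite /F mulrC.
 by [].
have cdF : continuous (fun z => P i.+1 z - P i z) by exact: contB.
have := (wu i).2 2 F _ cF bF hF cdF.
rewrite (eq_I (g := fun z => u z * P i.+1 z - u z * P i z)); last by move=> z; ring.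
rewrite IB// => E; rewrite /g E normrN.
apply: I_cball_bound => //; first exact: W_loc_grad (conj cu wu).
move=> z; rewrite /F normrM /Q -[X in M ^+ X](card_ord n) -[X in _ ^+ X]/(#|_|) -prodr_const [X in _ <= X](bigD1 i)//=.
rewrite ler_pM//; first by have [_ _ h] := hM i (z 0 i); rewrite distrC.
rewrite normr_prod ler_prod// => j ji; rewrite normr_ge0 /=.
by have [h1 h2 _] := hM j (z 0 j); case: ifP.
Qed.

Definition psi0 (z : rV) : R := \prod_(j < n) tent (z 0 j).

Lemma psi0_ge0 z : 0 <= psi0 z.
Proof. by apply: prodr_ge0 => j _; have /andP[] := tent_itv (z 0 j). Qed.

Lemma psi0_cont : continuous psi0.
Proof. by apply: cont_prod => j; apply: cont_comp (@continuous_coord _ _ j) _; exact: cont_tent. Qed.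

Lemma psi0_bsupp : bsupp 1 psi0.
Proof.
move=> z hz; have [j hj] : exists j, ~ (`|z 0 j| <= 1).
 apply: contrapT => H; move: hz; rewrite ltNge => /negP; apply; apply/mx_norm_leP => // j.
 by apply: contrapT => h; apply: H; exists j.
rewrite /psi0 (bigD1 j)//= tent_out ?mul0r//.
by move/negP: hj; rewrite ler_norml negb_and -!ltNge => /orP[h|h]; [left|right]; lra.
Qed.

Lemma integ_psi0 : integ psi0.
Proof. exact: cs_integ psi0_cont psi0_bsupp. Qed.

Lemma I_psi0_gt0 : 0 < I psi0.
Proof.
pose B : set rV := box (fun=> `[4^-1, 3/4]%classic).
have mB : measurable B by apply: measurable_box => i; exact: measurable_itv.
have lB : leb n B = ((2^-1) ^+ n)%:E.
 rewrite /B (@leb_box _ _ (fun=> `[4^-1, 3/4]%classic)); last by [].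
 under eq_bigr do rewrite lebesgue_measure_itv /= lte_fin. rewrite (_ : (4^-1 < 3/4)); last by lra.
 rewrite (_ : (3/4)%:E - (4^-1)%:E = (2^-1 : R)%:E)%E; last by rewrite -EFinB; congr EFin; field.
 by rewrite prodEFin prodr_const card_ord.
have fB : (leb n B < +oo)%E by rewrite lB ltry.
have iB : integ (\1_B) by exact: integ_indic_fin.
apply: (@lt_le_trans _ _ (I (\1_B))).
 have -> : I (\1_B) = 2^-1 ^+ n by apply: IE; rewrite -lB integral_indic// setIT. by [].
apply: I_le => //; first exact: integ_psi0.
move=> z; rewrite indicE; case: (boolP (z \in B)) => [|_]; last exact: psi0_ge0.
rewrite inE => hz; rewrite /psi0; apply: (big_ind (fun x : R => 1%:R <= x)) => //.
 by move=> x y hx hy; rewrite -[1]mulr1 ler_pM.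
move=> j _; have := hz j; rewrite /= in_itv /= => /andP[h1 h2].
rewrite /tent; have [h3|h3] := leP (z 0 j) 2^-1.
 by rewrite (pp_pos (_ : 0 <= z 0 j)) ?pp_neg; lra.
by rewrite (pp_pos (_ : 0 <= z 0 j)) ?(pp_pos (_ : 0 <= z 0 j - 2^-1)) ?pp_neg; lra.
Qed.

(** A substitute for Hoelder's inequality: either g <= S, or the factor (g/S)^(p-1) is at least 1.
    Integrated over a ball it converts a bound S^p on the p-energy into an L^1 bound proportional to
    S. *)
Lemma le_powR_young (p g S : R) : 1 <= p -> 0 <= g -> 0 < S -> g <= S + g `^ p * S `^ (1 - p).
Proof.
move=> p1 g0 S0; have [gS|gS] := leP g S; first by rewrite ler_wpDr// mulr_ge0// powR_ge0.
have gp : 0 < g by apply: lt_trans gS.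
apply: (@le_trans _ _ (g `^ p * S `^ (1 - p))); last by rewrite ler_wpDl// ltW.
rewrite -[X in X <= _](powRr1 g0) -{1}(subrKC p 1) powRD ?(gt_eqF gp) ?implybT//.
rewrite ler_wpM2l ?powR_ge0//.
have -> : 1 - p = - (p - 1) by ring.
have p10 : 0 <= p - 1 by lra.
by rewrite !powRN lef_pV2 ?posrE ?powR_gt0// ge0_ler_powR ?nnegrE// ltW.
Qed.

Lemma I_ball_powR (p S r : R) (g : rV -> R) G : 1 <= p -> 0 < S -> mfn g -> (forall x, `|g x| <= enorm (G x)) ->
 integ (fun x => enorm (G x) `^ p) -> I (fun x => enorm (G x) `^ p) <= S `^ p ->
 I (fun x => `|g x * \1_(cball r) x|) <= S * (I (\1_(cball r) : rV -> R) + 1).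
Proof.
move=> p1 S0 mg hg iG hS.
have i1 : integ (fun x => S * (\1_(cball r) : rV -> R) x) by apply: integZ; exact: integ_cball.
have i2 : integ (fun x => S `^ (1 - p) * enorm (G x) `^ p) by exact: integZ.
have le x : `|g x * \1_(cball r) x| <= S * (\1_(cball r) x) + S `^ (1 - p) * enorm (G x) `^ p.
 rewrite normrM indicE; case: (_ \in _); rewrite ?normr1 ?normr0 ?mulr1 ?mulr0 ?add0r.
  by rewrite (le_trans (hg x))// (mulrC (_ `^ (1 - p))) le_powR_young// enorm_ge0.
 by rewrite mulr_ge0 ?powR_ge0.
apply: (le_trans (I_le _ (integD i1 i2) le)).
 apply: (le_integ _ _ (integD i1 i2)); last by move=> x; rewrite normr_id.
 by apply: mfn_abs; apply: mfnM => //; apply: mfn_indic; exact: measurable_cball.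
rewrite ID// IZ; last exact: integ_cball.
rewrite IZ// mulrDr lerD2l mulr1.
apply: (@le_trans _ _ (S `^ (1 - p) * S `^ p)); first by rewrite ler_wpM2l// powR_ge0.
by rewrite -powRD ?(gt_eqF S0) ?implybT// subrK powRr1// ltW.
Qed.

Lemma coord_le_enorm (x : rV) i : `|x 0 i| <= enorm x.
Proof. by rewrite (le_trans (coord_le_norm x i))// norm_le_enorm. Qed.

(** A mean of u near x at scale r, not normalised: it tends to [u x * I psi0] as r tends to 0. *)
Definition T u (x : rV) (r : R) := I (fun z => u (r *: z + x) * psi0 z).

(** The bound of [profile_change] for profiles at most 4, each of the n gradient components being
    estimated over the cube of radius 2 by [I_ball_powR] with S = 1. *)
Definition C0 : R := 4 ^+ n * (n%:R * (I (\1_(cball 2) : rV -> R) + 1)).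

(** Both means are integrals of u against products of one-variable profiles, the second after a
    change of variables, so [profile_change] applies. The bounds on v and l keep the supports
    between -1 and 2 and the profiles below 4. *)
Lemma T_unit (p S l : R) u G v : 1 <= p -> 0 < S -> W u G ->
 integ (fun x => enorm (G x) `^ p) -> I (fun x => enorm (G x) `^ p) <= S `^ p ->
 `|v| <= 1 -> 2^-1 <= l -> l <= 1 ->
 `|T u 0 1 - T u v l| <= C0 * S.
Proof.
move=> p1 S0 WG iG hS v1 l2 l1; have l0 : 0 < l by lra.
have li : 0 < l^-1 by rewrite invr_gt0.
have li2 : l^-1 <= 2 by rewrite -[2]invrK lef_pV2 ?posrE// invr_gt0.
have vj j : `|v 0 j| <= 1 by rewrite (le_trans (coord_le_norm v j)).
have e1 : T u 0 1 = I (fun z => u z * \prod_j tent (z 0 j)) by apply: eq_I => z; rewrite scale1r addr0.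
have cu := WG.1.
have cb j : continuous (fun t => l^-1 * tent (l^-1 * (t - v 0 j))).
 have cid : continuous (fun x : R => x) by move=> x. apply: contM; first exact: cont_cst.
 apply: (@cont_comp _ _ _ (fun t : R => l^-1 * (t - v 0 j))); last exact: cont_tent. by ctn.
have e2 : T u v l = I (fun z => u z * \prod_j (l^-1 * tent (l^-1 * (z 0 j - v 0 j)))).
 set f := (X in _ = I X).
 have bf : bsupp (l + `|v|) (fun z => \prod_j (l^-1 * tent (l^-1 * (z 0 j - v 0 j)))).
  move=> z hz; have zv : 1 < `|l^-1 *: (z - v)|.
   rewrite normrZ gtr0_norm// ltr_pdivlMl// mulr1.
   have : `|z| <= `|z - v| + `|v| by rewrite -{1}(subrK v z) ler_normD. lra.
  have := psi0_bsupp zv; rewrite /psi0 => /eqP; rewrite prodf_seq_eq0 => /hasP[j _ /andP[_ /eqP H]].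
  by rewrite (bigD1 j)//=; move: H; rewrite !mxE => ->; rewrite mulr0 mul0r.
 have cf : continuous (fun z : rV => \prod_j (l^-1 * tent (l^-1 * (z 0 j - v 0 j)))).
  by apply: cont_prod => j; apply: cont_comp (@continuous_coord _ _ j) (cb j).
 have fi : integ f := loc_cs_integ (cont_loc cu) cf bf.
 have := I_dilate v (lt0r_neq0 l0) fi; rewrite gtr0_norm// => E.
 have -> : I f = l ^+ n * I (fun x => f (l *: x + v)).
  by rewrite E mulrA mulfV ?mul1r// expf_neq0// gt_eqF.
 rewrite -IZ; last by apply: integ_dilate => //; rewrite gt_eqF.
 apply: eq_I => z; rewrite /f big_split /= prodr_const card_ord mulrCA; congr (_ * _).
 rewrite mulrA -exprMn mulfV ?gt_eqF// expr1n mul1r; apply: eq_bigr => j _.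
 by rewrite !mxE addrK mulrA mulVf ?gt_eqF// mul1r.
have := @profile_change u G (fun=> ramp) (fun=> tent) (fun j t => ramp (l^-1 * (t - v 0 j)))
 (fun j t => l^-1 * tent (l^-1 * (t - v 0 j))) 4 WG.
rewrite -e1 -e2 => H; apply: le_trans (H _ _ _ _ _ _) _.
- by move=> j t; exact: is_derive_ramp.
- by move=> j; exact: cont_tent.
- move=> j t.
 have hB : is_derive t (1 : R) ((fun t : R => l^-1 * (t - v 0 j)) : R -> R^o) l^-1.
  have hc : is_derive t (1 : R) ((fun t : R => t - v 0 j) : R -> R^o) 1 by apply: is_derive_eq; rewrite subr0.
  by have := is_deriveZ l^-1 hc; rewrite /GRing.scale /= mulr1.
 have := @is_derive1_comp R ramp (fun t : R => l^-1 * (t - v 0 j)) t _ l^-1 (is_derive_ramp _) hB.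
 by rewrite mulrC.
by ctn.
- move=> j t ht; have := vj j; rewrite ler_norml => /andP[h1 h2].
 have ll : l^-1 * l = 1 by rewrite mulVf// gt_eqF. case: ht => ht.
  have h3 : l^-1 * (t - v 0 j) <= 0 by rewrite pmulr_rle0//; lra.
  by split; rewrite ?(ramp0 h3) ?ramp0 ?tent_out ?mulr0//; try (left; lra); lra.
 have h3 : 1 <= l^-1 * (t - v 0 j) by rewrite -ll ler_pM2l//; lra.
 by split; rewrite ?(ramp1 h3) ?ramp1 ?tent_out ?mulr0//; try (right; lra); lra.
- move=> j t; have /andP[h1 h2] := tent_itv t; have /andP[h3 h4] := tent_itv (l^-1 * (t - v 0 j)).
 have /andP[h5 h6] := ramp_itv t; have /andP[h7 h8] := ramp_itv (l^-1 * (t - v 0 j)).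
 split; first by rewrite ger0_norm; lra.
  rewrite ger0_norm ?mulr_ge0 ?(ltW li)//.
  by apply: (@le_trans _ _ (2 * 2)); [rewrite ler_pM// ltW|lra].
 by rewrite ler_norml; apply/andP; split; lra.
rewrite /C0 -mulrA ler_wpM2l//.
rewrite (_ : n%:R * _ * S = \sum_(i < n) (S * (I (\1_(cball 2) : rV -> R) + 1))); last first.
 by rewrite sumr_const card_ord -[RHS]mulr_natl; ring.
apply: ler_sum => i _; apply: (I_ball_powR 2 p1 S0 _ _ iG hS); first exact: W_mfn WG i.
by move=> x; exact: coord_le_enorm.
Qed.

End morrey.

(** * Morrey's inequality *)

Section morrey_inequality.
Context {R : realType} (n : nat).
Implicit Types (u : 'rV[R]_n -> R) (G : 'rV[R]_n -> 'rV[R]_n) (p S r l : R).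

Lemma I_psi_sub u x r e : continuous u -> (forall z, `|z| <= 1 -> `|u (r *: z + x) - u x| <= e) ->
 `|T u x r - u x * I (@psi0 R n)| <= e * I (@psi0 R n).
Proof.
move=> cu h.
have c1 : continuous (fun z : 'rV[R]_n => u (r *: z + x)) by apply: cont_comp cu; exact: continuous_affine_rV.
have i1 : integ (fun z => u (r *: z + x) * psi0 z) := loc_cs_integ (cont_loc c1) (@psi0_cont _ _) (@psi0_bsupp _ _).
have i0 := @integ_psi0 R n.
rewrite /T -IZ// -IB//; last exact: integZ.
rewrite (le_trans (I_abs _))//; first by apply: integB => //; exact: integZ.
rewrite -IZ//; apply: I_le; [by apply: integ_abs; apply: integB => //; exact: integZ|exact: integZ|].
move=> z; rewrite -mulrBl normrM (ger0_norm (psi0_ge0 z)).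
have [z1|z1] := leP `|z| 1; first by rewrite ler_wpM2r ?psi0_ge0// h.
by rewrite psi0_bsupp// !mulr0.
Qed.

Lemma I_enorm_dilate G p a b : a != 0 -> integ (fun x => enorm (G x) `^ p) ->
 integ (fun x => enorm (a *: G (a *: x + b)) `^ p) /\
 I (fun x => enorm (a *: G (a *: x + b)) `^ p) = `|a| `^ (p - n%:R) * I (fun x => enorm (G x) `^ p).
Proof.
move=> a0 iG.
have E x : enorm (a *: G (a *: x + b)) `^ p = `|a| `^ p * enorm (G (a *: x + b)) `^ p.
 by rewrite enormZ powRM// enorm_ge0.
have iD := integ_dilate b a0 iG.
split; first by under eq_fun do rewrite E; exact: integZ.
by rewrite (eq_I E) (IZ _ iD) (I_dilate b a0 iG) mulrA powRB ?normr_eq0 ?a0 ?implybT// powR_mulrn.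
Qed.

Lemma C0_ge0 : 0 <= @C0 R n.
Proof.
rewrite /C0 mulr_ge0// mulr_ge0// addr_ge0//; apply: I_ge0 => x.
by [].
Qed.

Opaque C0.

Lemma al_gt0 p : n%:R < p -> 0 < 1 - n%:R / p.
Proof.
move=> np; have p0 : 0 < p by rewrite (le_lt_trans _ np).
by rewrite subr_gt0 ltr_pdivrMr// mul1r.
Qed.

Lemma theta_lt1 p : n%:R < p -> 0 < 2^-1 `^ (1 - n%:R / p) < 1.
Proof.
move=> np; rewrite powR_gt0//=; have := @gt0_ltr_powR R _ (al_gt0 np) 2^-1 1.
by rewrite powR1; apply; rewrite ?nnegrE; lra.
Qed.

Section fixed_function.
Variables (p S : R) (u : 'rV[R]_n -> R) (G : 'rV[R]_n -> 'rV[R]_n).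
Hypotheses (p1 : 1 <= p) (np : n%:R < p) (S0 : 0 < S) (WG : W u G).
Hypotheses (iG : integ (fun x => enorm (G x) `^ p)) (hS : I (fun x => enorm (G x) `^ p) <= S `^ p).

Let al := 1 - n%:R / p.
Let p0 : 0 < p. Proof. exact: lt_le_trans ltr01 p1. Qed.

(** This is [T_unit] for the function u(r z + x), whose p-energy is r^(p-n) times that of u, so that
    S is replaced by S r^al. *)
Lemma T_step x r l v : 0 < r -> `|v| <= 1 -> 2^-1 <= l -> l <= 1 ->
 `|T u x r - T u (r *: v + x) (r * l)| <= @C0 R n * S * r `^ al.
Proof.
move=> r0 v1 l2 l1; have rn : r != 0 by rewrite gt_eqF.
have WG' := W_dilate x rn WG.
have [iG' IG'] := I_enorm_dilate x rn iG.
have S'0 : 0 < S * r `^ al by rewrite mulr_gt0// powR_gt0.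
have hS' : I (fun y => enorm (r *: G (r *: y + x)) `^ p) <= (S * r `^ al) `^ p.
 rewrite IG' powRM ?(ltW S0)// -powRrM gtr0_norm//.
 have -> : al * p = p - n%:R by rewrite /al mulrBl mul1r mulfVK// gt_eqF.
 by rewrite mulrC ler_wpM2r// powR_ge0.
have := T_unit p1 S'0 WG' iG' hS' v1 l2 l1.
have -> : T (fun y => u (r *: y + x)) 0 1 = T u x r.
 by apply: eq_I => z; rewrite scale1r addr0.
have -> : T (fun y => u (r *: y + x)) v l = T u (r *: v + x) (r * l).
 by apply: eq_I => z; rewrite scalerDr scalerA addrA.
by rewrite mulrA.
Qed.

Let th := 2^-1 `^ al.

(** Halving the radius costs a multiple of r^al, so the successive costs form a geometric series of
    ratio [th] < 1; here p > n is used. *)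
Lemma T_dyadic x r k : 0 < r ->
 `|T u x r - T u x (r * 2^-1 ^+ k)| <= @C0 R n * S / (1 - th) * r `^ al.
Proof.
have /andP[th0 th1] := theta_lt1 np; have C00 := C0_ge0; rewrite -/al -/th in th0 th1.
elim: k r => [|k IH] r r0.
 rewrite expr0 mulr1 subrr normr0; apply: mulr_ge0; last exact: powR_ge0.
 by apply: divr_ge0; [apply: mulr_ge0 => //; exact: ltW|lra].
have h1 := @T_step x r 2^-1 0 r0; rewrite normr0 scaler0 add0r in h1.
have {}h1 : `|T u x r - T u x (r * 2^-1)| <= @C0 R n * S * r `^ al by apply: h1 => //; lra.
have h2 := IH (r * 2^-1) (_ : 0 < r * 2^-1); rewrite mulr_gt0// in h2.
have {}h2 := h2 isT.
have -> : r * 2^-1 ^+ k.+1 = r * 2^-1 * 2^-1 ^+ k by rewrite exprS mulrA.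
have -> : T u x r - T u x (r * 2^-1 * 2^-1 ^+ k) = (T u x r - T u x (r * 2^-1)) + (T u x (r * 2^-1) - T u x (r * 2^-1 * 2^-1 ^+ k)) by ring.
rewrite (le_trans (ler_normD _ _))// (le_trans (lerD h1 h2))//.
rewrite powRM ?(ltW r0)// -/th.
apply: eqW; field; lra.
Qed.

Lemma T_value x r : 0 < r ->
 `|T u x r - u x * I (@psi0 R n)| <= @C0 R n * S / (1 - th) * r `^ al.
Proof.
move=> r0; rewrite -subr_le0; apply: (@le_eps R _ (I (@psi0 R n))); first by apply/ltW/I_psi0_gt0.
move=> e e0; have [d d0 hd] := cont_unif_ball `|x| WG.1 e0.
have [k hk] : exists k, r * 2^-1 ^+ k <= d.
 have : (fun k => r * (2^-1 : R) ^+ k) @ \oo --> (r * 0 : R).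
  by apply: cvgM; [exact: cvg_cst|apply: cvg_expr; rewrite ger0_norm; lra].
 rewrite mulr0 => /cvgrPdist_le /(_ _ d0)[k _ /(_ k (leqnn k))].
 rewrite sub0r normrN ger0_norm; last by rewrite mulr_ge0// ltW. by exists k.
have h1 := T_dyadic x k r0.
have rk : 0 < r * 2^-1 ^+ k by rewrite mulr_gt0.
have := @I_psi_sub u x (r * 2^-1 ^+ k) e WG.1; move=> /(_ _) h2.
have {}h2 : `|T u x (r * 2^-1 ^+ k) - u x * I (@psi0 R n)| <= e * I (@psi0 R n).
 apply: h2 => z z1; rewrite distrC; apply: hd => //.
 rewrite opprD addrCA subrr addr0 normrN normrZ gtr0_norm//.
 by apply: le_trans hk; rewrite ler_piMr// ltW.
rewrite lerBlDr; have -> : T u x r - u x * I (@psi0 R n) =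
 (T u x (r * 2^-1 ^+ k) - u x * I (@psi0 R n)) + (T u x r - T u x (r * 2^-1 ^+ k)) by ring.
by rewrite (le_trans (ler_normD _ _))// lerD.
Qed.

(** The values at x and y are compared through the means of scale |x - y|: the two dyadic series
    account for 2 / (1 - th), the passage from one centre to the other for 1. *)
Lemma morrey_fixed x y : `|u x - u y| <=
 (@C0 R n * (2 / (1 - th) + 1) / I (@psi0 R n)) * S * `|x - y| `^ al.
Proof.
have /andP[th0 th1] := theta_lt1 np; rewrite -/al -/th in th0 th1; have C00 := C0_ge0; have k0 := @I_psi0_gt0 R n.
have [->|xy] := eqVneq x y.
 rewrite !subrr !normr0; apply: mulr_ge0; last exact: powR_ge0. apply: mulr_ge0; last exact: ltW.
 by apply: divr_ge0; [apply: mulr_ge0 => //; rewrite addr_ge0// divr_ge0; lra|exact: ltW].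
have r0 : 0 < `|x - y| by rewrite normr_gt0 subr_eq0.
have := @T_step x `|x - y| 1 (`|x - y|^-1 *: (y - x)) r0.
have -> : `|x - y| *: (`|x - y|^-1 *: (y - x)) + x = y.
 by rewrite scalerA mulfV ?gt_eqF// scale1r subrK.
rewrite normrZ normfV normr_id (distrC y) mulVf ?gt_eqF// mulr1 => /(_ (lexx _) _ (lexx _)) h.
have {}h : `|T u x `|x - y| - T u y `|x - y| | <= @C0 R n * S * `|x - y| `^ al by apply: h; lra.
have h1 := T_value x r0; have h2 := T_value y r0.
rewrite -(ler_pM2r k0) -[in X in X <= _](gtr0_norm k0) -normrM.
move: h h1 h2; set tx := T _ _ _; set ty := T _ _ _; set K := I _ => h h1 h2.
have -> : (u x - u y) * K = (tx - ty) - (tx - u x * K) + (ty - u y * K) by ring.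
rewrite (le_trans (ler_normD _ _))// (le_trans (lerD (ler_normB _ _) (lexx _)))//.
apply: (le_trans (lerD (lerD h h1) h2)).
apply: eqW; field; apply/andP; split; first by rewrite gt_eqF.
by rewrite subr_eq0 gt_eqF.
Qed.

End fixed_function.

Lemma morrey p : 1 <= p -> n%:R < p -> exists2 C, 0 < C & forall u G S, W u G -> 0 < S ->
 integ (fun x => enorm (G x) `^ p) -> I (fun x => enorm (G x) `^ p) <= S `^ p ->
 forall x y, `|u x - u y| <= C * S * `|x - y| `^ (1 - n%:R / p).
Proof.
move=> p1 np; pose th : R := 2^-1 `^ (1 - n%:R / p).
exists (@C0 R n * (2 / (1 - th) + 1) / I (@psi0 R n) + 1).
 have C00 := C0_ge0; have k0 := @I_psi0_gt0 R n.
 have := theta_lt1 np; rewrite -/th => /andP[t0 t1].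
 rewrite ltr_wpDl//; apply: divr_ge0; last exact: ltW.
 by apply: mulr_ge0 => //; rewrite addr_ge0// divr_ge0; lra.
move=> u G S WG S0 iG hS x y; have := morrey_fixed p1 np S0 WG iG hS x y.
move=> h; apply: (le_trans h); rewrite ler_wpM2r// ler_wpM2r ?(ltW S0)// lerDl.
by [].
Qed.

End morrey_inequality.

(** * Convexity inequalities for powers and for |.|^p on vectors *)

Section power_inequalities.
Context {R : realType}.
Implicit Types p x y t : R.

Lemma powRS x s : 0 <= x -> s + 1 != 0 -> x `^ s * x = x `^ (s + 1).
Proof.
move=> x0 s1; rewrite powRD; last by rewrite (negbTE s1).
by rewrite powRr1.
Qed.

Lemma powR_sqr x q : 0 <= x -> (x ^+ 2) `^ q = x `^ (2 * q).
Proof. by move=> x0; rewrite -[x ^+ 2](powR_mulrn 2 x0) -powRrM. Qed.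

Lemma powR_tangent p x y : 1 < p -> 0 <= x -> 0 <= y -> y `^ p + p * y `^ (p - 1) * (x - y) <= x `^ p.
Proof.
move=> p1 x0 y0; have p0 : 0 < p by lra.
have p10 : 0 < p - 1 by lra.
have pn : p != 0 by rewrite gt_eqF.
have p1n : p - 1 != 0 by rewrite gt_eqF.
have := @conjugate_powR R x (y `^ (p - 1)) p (p / (p - 1)) x0 (powR_ge0 _ _) p0.
rewrite divr_gt0// => /(_ isT); have -> : p^-1 + (p / (p - 1))^-1 = 1 by field; rewrite pn p1n.
move=> /(_ erefl); rewrite -powRrM; have -> : (p - 1) * (p / (p - 1)) = p by field.
have -> : y `^ p / (p / (p - 1)) = (p - 1) * y `^ p / p by field; rewrite pn p1n.
move=> h; have : p * (x * y `^ (p - 1)) <= x `^ p + (p - 1) * y `^ p.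
 apply: (@le_trans _ _ (p * (x `^ p / p + (p - 1) * y `^ p / p))); first by rewrite ler_pM2l.
 by apply: eqW; field.
have : y `^ (p - 1) * y = y `^ p by rewrite powRS ?subrK.
move=> E h2; have -> : p * y `^ (p - 1) * (x - y) = p * (x * y `^ (p - 1)) - p * (y `^ (p - 1) * y) by ring.
rewrite E; lra.
Qed.

Lemma powR_mean p x y : 1 < p -> 0 <= x -> 0 <= y -> ((x + y) / 2) `^ p <= (x `^ p + y `^ p) / 2.
Proof.
move=> p1 x0 y0; have m0 : 0 <= (x + y) / 2 by rewrite divr_ge0 ?addr_ge0.
have := powR_tangent p1 x0 m0; have := powR_tangent p1 y0 m0.
set m := (x + y) / 2; set A := m `^ p; set B := p * _.
have -> : x - m = (x - y) / 2 by rewrite /m; field.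
have -> : y - m = - ((x - y) / 2) by rewrite /m; field.
lra.
Qed.

Lemma powR_superadd p x y : 1 <= p -> 0 <= x -> 0 <= y -> x `^ p + y `^ p <= (x + y) `^ p.
Proof.
move=> p1 x0 y0; have [z0|z0] := eqVneq (x + y) 0.
 have [-> ->] : x = 0 /\ y = 0 by split; lra. by rewrite addr0 powR0// gt_eqF; lra.
have zp : 0 < x + y by rewrite lt_def z0 addr_ge0.
have h u : 0 <= u -> u <= x + y -> u `^ p <= (u / (x + y)) * (x + y) `^ p.
 move=> u0 ux; have [->|un] := eqVneq u 0; first by rewrite mul0r mul0r powR0// gt_eqF; lra.
 have -> : u `^ p = (u / (x + y)) `^ p * (x + y) `^ p.
  by rewrite -powRM ?divr_ge0 ?(ltW zp)// mulfVK.
 rewrite ler_wpM2r ?powR_ge0// ge1r_powR// divr_gt0 ?ler_pdivrMr ?mul1r//. by rewrite lt_def un.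
have := h x x0; have := h y y0; rewrite lerDl lerDr => /(_ x0) h1 /(_ y0) h2.
have := lerD h2 h1; rewrite -mulrDl -mulrDl mulfV ?mul1r//.
Qed.

Lemma powRD_le p x y : 0 <= p -> 0 <= x -> 0 <= y -> (x + y) `^ p <= 2 `^ p * (x `^ p + y `^ p).
Proof.
move=> p0 x0 y0; wlog xy : x y x0 y0 / x <= y.
 move=> H; have [xy|/ltW xy] := leP x y; first exact: H.
 by rewrite addrC (addrC (x `^ p)); exact: H.
apply: (@le_trans _ _ ((2 * y) `^ p)); first by rewrite ge0_ler_powR ?nnegrE; lra.
by rewrite powRM// ler_wpM2l// lerDr powR_ge0.
Qed.

Lemma young_w p t x y : 1 < p -> 0 < t -> 0 <= x -> 0 <= y ->
 y `^ (p - 1) * x <= t * y `^ p + t `^ (1 - p) * x `^ p.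
Proof.
move=> p1 t0 x0 y0; have pn : p - 1 + 1 != 0 by rewrite subrK gt_eqF; lra.
have [xy|xy] := leP x (t * y).
 rewrite ler_wpDr ?mulr_ge0 ?powR_ge0//. have : y `^ (p - 1) * y = y `^ p by rewrite powRS// subrK.
 by move=> <-; rewrite mulrCA ler_wpM2l// powR_ge0.
rewrite ler_wpDl ?mulr_ge0 ?powR_ge0 ?(ltW t0)//.
have : x `^ (p - 1) * x = x `^ p by rewrite powRS// subrK.
move=> <-; rewrite mulrA ler_wpM2r//.
have -> : 1 - p = - (p - 1) by ring.
rewrite powRN mulrC ler_pdivlMr ?powR_gt0// -powRM ?(ltW t0)// mulrC.
by apply: ge0_ler_powR; rewrite ?nnegrE ?mulr_ge0; lra.
Qed.

(** [powR] has a default value at negative bases, so the positive part is inserted to obtain a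
    function continuous on the whole line. *)
Lemma cont_ppowR p : 0 < p -> continuous (fun t : R => pp t `^ p).
Proof.
move=> p0 t; have [t0|t0|t0] := ltgtP t 0.
- apply: cont_at_eps => e e0; near=> s.
 have s0 : s < 0 by near: s; exact: lt_nbhsl. by rewrite !pp_neg ?subrr ?normr0// ltW.
- have d : {for t, continuous (fun s : R => s `^ p)}.
  apply: differentiable_continuous; apply/derivable1_diffP; apply: derivable_powR.
  by rewrite in_itv /= t0.
 apply: cont_at_eps => e e0; have h := cont_near_eps d e0; near=> s.
 have s0 : 0 < s by near: s; exact: lt_nbhsr. by rewrite !pp_pos ?(ltW s0) ?(ltW t0)//; near: s.
- apply: cont_at_eps => e e0; near=> s.
 rewrite t0 pp_pos// powR0 ?gt_eqF// sub0r normrN ger0_norm ?powR_ge0//.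
 have ss : `|s| <= e `^ p^-1.
  near: s; rewrite t0; have ci : {for (0 : R), continuous (fun s : R => s)} by [].
  by have := cont_near_eps ci (powR_gt0 p^-1 e0); apply: filterS => y; rewrite sub0r normrN.
 have -> : e = (e `^ p^-1) `^ p by rewrite -powRrM mulVf ?gt_eqF// powRr1// ltW.
 rewrite ge0_ler_powR ?nnegrE ?powR_ge0 ?pp_ge0 ?(ltW p0)//.
 by apply: le_trans ss; rewrite /pp ge_max normr_ge0 ler_norm.
Unshelve. all: by end_near. Qed.

(** The vector field of the p-Laplacian: p times it is the gradient of |b|^p. *)
Definition flux n p (b : 'rV[R]_n) : 'rV[R]_n := enorm b `^ (p - 2) *: b.

Lemma enorm_flux n p (b : 'rV[R]_n) : 1 < p -> enorm (flux p b) = enorm b `^ (p - 1).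
Proof.
move=> p1; rewrite /flux enormZ ger0_norm ?powR_ge0// powRS//; last first.
 by rewrite (_ : p - 2 + 1 = p - 1); [rewrite gt_eqF; lra|ring].
by congr (_ `^ _); ring.
Qed.

Lemma powR2_mul n p (b : 'rV[R]_n) : 1 < p -> enorm b `^ (p - 2) * enorm b ^+ 2 = enorm b `^ p.
Proof.
move=> p1; rewrite expr2 mulrA powRS ?powRS//.
- by congr (_ `^ _); ring.
- by rewrite gt_eqF//; lra.
- by rewrite gt_eqF//; lra.
Qed.

Lemma enorm_tangent n p (a b : 'rV[R]_n) : 1 < p ->
 enorm b `^ p + p * dotp (flux p b) (a - b) <= enorm a `^ p.
Proof.
move=> p1; apply: le_trans (powR_tangent p1 (enorm_ge0 a) (enorm_ge0 b)).
rewrite lerD2l -mulrA ler_wpM2l//; first by lra.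
rewrite /flux dotpZl dotpBr -enormE mulrBr powR2_mul//.
have E : enorm b `^ (p - 1) * enorm b = enorm b `^ p by rewrite powRS ?subrK// gt_eqF; lra.
rewrite mulrBr E lerB// (le_trans (ler_wpM2l (powR_ge0 _ _) (ler_norm _)))//.
apply: (le_trans (ler_wpM2l (powR_ge0 _ _) (dotp_le b a))).
rewrite mulrA powRS//; first by have -> : p - 2 + 1 = p - 1 by ring.
by rewrite gt_eqF; lra.
Qed.

(** Superadditivity and then convexity of s^(p/2) are applied to squared lengths, the parallelogram
    law making the link between them. *)
Lemma clarkson n p (a b : 'rV[R]_n) : 2 < p ->
 enorm (2^-1 *: (a + b)) `^ p + enorm (2^-1 *: (a - b)) `^ p <= (enorm a `^ p + enorm b `^ p) / 2.
Proof.
move=> p2; have q1 : 1 < p / 2 by lra.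
have E (c : 'rV[R]_n) : enorm c `^ p = (enorm c ^+ 2) `^ (p / 2).
 by rewrite powR_sqr//; congr (_ `^ _); field.
rewrite !E; apply: (le_trans (powR_superadd (ltW q1) (sqr_ge0 _) (sqr_ge0 _))).
apply: le_trans (powR_mean q1 (sqr_ge0 _) (sqr_ge0 _)).
have -> : enorm (2^-1 *: (a + b)) ^+ 2 + enorm (2^-1 *: (a - b)) ^+ 2 = (enorm a ^+ 2 + enorm b ^+ 2) / 2.
 by rewrite !enormE !(dotpZl, dotpZr, dotpDl, dotpDr, dotpNl, dotpNr) (dotpC b a); field.
by [].
Qed.

(** The tangent inequality is used at b towards the midpoint of a and b; Clarkson's inequality
    between a and b then leaves the p-th power of a - b as a surplus. *)
Lemma enorm_tangent_strong n p (a b : 'rV[R]_n) : 2 < p ->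
 enorm b `^ p + p * dotp (flux p b) (a - b) + 2 `^ (1 - p) * enorm (a - b) `^ p <= enorm a `^ p.
Proof.
move=> p2; have p1 : 1 < p by lra.
have := clarkson a b p2; have := enorm_tangent (2^-1 *: (a + b)) b p1.
have -> : 2^-1 *: (a + b) - b = 2^-1 *: (a - b) by apply/rowP => i; rewrite !mxE; field.
rewrite dotpZr (enormZ _ (a - b)) powRM ?enorm_ge0// ger0_norm ?invr_ge0//.
have -> : (2^-1 : R) `^ p = 2^-1 * 2 `^ (1 - p).
 rewrite -[2^-1]powR_inv1// -powRrM mulN1r -powRD ?pnatr_eq0 ?implybT//; congr (_ `^ _); ring.
set A := enorm (_ *: _) `^ p; set B := _ `^ p; set C := 2 `^ _ ; set D := _ `^ p; set F := _ `^ p; lra.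
Qed.

End power_inequalities.

(** * The p-energy of vector fields *)

Section lp_fields.
Context {R : realType} (n : nat).
Implicit Types (u : 'rV[R]_n -> R) (G H : 'rV[R]_n -> 'rV[R]_n) (p : R).

Lemma rVB (a b : 'rV[R]_n) i : (a - b) 0 i = a 0 i - b 0 i.
Proof. by rewrite !mxE. Qed.

Definition Lp p G := (forall i, mfn (fun x => G x 0 i)) /\ integ (fun x => enorm (G x) `^ p).
Definition energy p G := I (fun x => enorm (G x) `^ p).

Lemma energy_ge0 p G : 0 <= energy p G. Proof. by apply: I_ge0 => x; exact: powR_ge0. Qed.

Lemma Lp_le p (f : 'rV[R]_n -> R) G : (forall i, mfn (fun x => G x 0 i)) ->
 (forall x, enorm (G x) `^ p <= f x) -> integ f -> Lp p G.
Proof.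
move=> mG h fi; split => //; apply: le_integ fi; first by apply: mfn_powR; exact: mfn_enorm.
by move=> x; rewrite ger0_norm ?powR_ge0.
Qed.

Lemma LpZ p c G : Lp p G -> Lp p (fun x => c *: G x).
Proof.
move=> [mG iG]; apply: (@Lp_le p (fun x => `|c| `^ p * enorm (G x) `^ p)).
- by move=> i; under eq_fun do rewrite mxE; apply: mfnM => //; exact: mfn_cst.
- by move=> x; rewrite enormZ powRM// enorm_ge0.
- exact: integZ.
Qed.

Lemma energyZ p c G : Lp p G -> energy p (fun x => c *: G x) = `|c| `^ p * energy p G.
Proof. by move=> [mG iG]; rewrite /energy -IZ//; apply: eq_I => x; rewrite enormZ powRM// enorm_ge0. Qed.

Lemma enormD_powR p (a b : 'rV[R]_n) : 0 <= p ->
 enorm (a + b) `^ p <= 2 `^ p * (enorm a `^ p + enorm b `^ p).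
Proof.
move=> p0; apply: le_trans (powRD_le p0 (enorm_ge0 a) (enorm_ge0 b)).
by rewrite ge0_ler_powR ?nnegrE ?addr_ge0 ?enorm_ge0 ?ler_enormD.
Qed.

Lemma LpD p G H : 0 <= p -> Lp p G -> Lp p H -> Lp p (fun x => G x + H x).
Proof.
move=> p0 [mG iG] [mH iH]; apply: (@Lp_le p (fun x => 2 `^ p * (enorm (G x) `^ p + enorm (H x) `^ p))).
- by move=> i; under eq_fun do rewrite mxE; exact: mfnD.
- by move=> x; exact: enormD_powR.
- by apply: integZ; exact: integD.
Qed.

Lemma LpB p G H : 0 <= p -> Lp p G -> Lp p H -> Lp p (fun x => G x - H x).
Proof.
move=> p0 hG hH; have := LpD p0 hG (LpZ (-1) hH).
by under eq_fun do rewrite scaleN1r.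
Qed.

Lemma energy_clarkson p G H : 2 < p -> Lp p G -> Lp p H ->
 energy p (fun x => 2^-1 *: (G x + H x)) + energy p (fun x => 2^-1 *: (G x - H x)) <=
 (energy p G + energy p H) / 2.
Proof.
move=> p2 hG hH; have p0 : 0 <= p by lra.
have h1 := LpZ 2^-1 (LpD p0 hG hH); have h2 := LpZ 2^-1 (LpB p0 hG hH).
have i2 := integD hG.2 hH.2.
have E2 : I (fun x => 2^-1 * (enorm (G x) `^ p + enorm (H x) `^ p)) = (energy p G + energy p H) / 2.
 by rewrite (IZ _ i2) (ID hG.2 hH.2) mulrC.
rewrite -E2; have E1 := ID h1.2 h2.2; apply: (@le_trans _ _ (I (fun x =>
 enorm (2^-1 *: (G x + H x)) `^ p + enorm (2^-1 *: (G x - H x)) `^ p))); first by rewrite E1.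
apply: I_le; [exact: integD h1.2 h2.2|exact: integZ|].
by move=> x; rewrite mulrC; exact: clarkson.
Qed.

Lemma ae_energy p G H : (forall i, mfn (fun x => H x 0 i)) -> Lp p G -> {ae leb n, forall x, G x = H x} ->
 Lp p H /\ energy p H = energy p G.
Proof.
move=> mH [mG iG] GH.
have [||h1 h2] := @ae_eq_I _ _ _ (fun x => enorm (H x) `^ p) iG.
- by apply: mfn_powR; exact: mfn_enorm.
- by move: GH; apply: filterS => x ->.
exact: conj (conj mH h1) h2.
Qed.

End lp_fields.

(** * Completeness of the space of p-integrable fields *)

Section completeness.
Context {R : realType} (n : nat).
Local Notation rV := 'rV[R]_n.
Implicit Types (u : rV -> R) (G H : rV -> rV) (p : R).

Lemma I_fatou (f_ : nat -> rV -> R) f e : (forall j, integ (f_ j)) -> (forall j x, 0 <= f_ j x) ->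
 (forall j, I (f_ j) <= e) -> mfn f -> (forall x, 0 <= f x) ->
 {ae leb n, forall x, (fun j => f_ j x) @ \oo --> f x} -> integ f /\ I f <= e.
Proof.
move=> if_ f_0 Ie mf f0 cv.
have mE j : measurable_fun setT (EFin \o f_ j) by apply/measurable_EFinP; exact: integ_mfn.
have mfE : measurable_fun setT (EFin \o f) by apply/measurable_EFinP.
have le : (\int[leb n]_x (f x)%:E <= e%:E)%E.
 rewrite (@ae_eq_integral _ _ _ (leb n) setT (fun x => limn_einf (fun j => (f_ j x)%:E))) //.
 - have f0E j x : setT x -> (0 <= (EFin \o f_ j) x)%E by rewrite /= lee_fin.
  apply: le_trans (fatou (leb n) measurableT mE f0E) _.
  rewrite limn_einf_lim; apply: lime_le; first exact: is_cvg_einfs.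
  apply: nearW => k; apply: (@le_trans _ _ (\int[leb n]_x (f_ k x)%:E)%E); last first.
   by rewrite integE// lee_fin.
  by apply: ereal_inf_lbound; exists k => //=.
 - apply: measurableT_comp => //; apply: measurable_fun_limn_esup => k.
  exact: measurableT_comp (mE k).
 - move: cv; apply: filterS => x fx _ /=.
  have : (fun j => (f_ j x)%:E) @ \oo --> (f x)%:E by apply: cvg_EFin => //; exact: nearW.
  by move=> /cvg_limn_einf_sup[-> _].
have fi : integ f.
 apply/integrableP; split => //; apply: le_lt_trans (ltry e).
 by under eq_integral do rewrite /= ger0_norm//.
by split => //; rewrite -lee_fin -integE.
Qed.

Lemma cvg_sumr (J : Type) (r : seq J) (f : J -> nat -> R) (l : J -> R) :
 (forall j, f j @ \oo --> l j) -> (fun k => \sum_(j <- r) f j k) @ \oo --> \sum_(j <- r) l j.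
Proof.
move=> h; elim: r => [|j r IH].
 by under eq_fun do rewrite big_nil; rewrite big_nil; exact: cvg_cst.
by under eq_fun do rewrite big_cons; rewrite big_cons; exact: cvgD.
Qed.

Definition dy (j : nat) : R := 1 / (2 ^ (j + 1))%:R.

Lemma dy_gt0 j : 0 < dy j. Proof. by rewrite /dy divr_gt0// ltr0n expn_gt0. Qed.

Lemma dy_sum : (\sum_(j <oo) (dy j)%:E = 1%:E :> \bar R)%E.
Proof.
have := @cvg_geometric_eseries_half R 1 0; rewrite expr0 divr1 => /cvg_lim; apply; exact: ereal_hausdorff.
Qed.

Lemma dy_cvg : cvgn (series dy).
Proof. by have := @cvg_geometric_series_half R 1 0; rewrite expr0 divr1 => /cvgP. Qed.

Lemma ae_summable (f_ : nat -> rV -> R) : (forall j, integ (f_ j)) -> (forall j x, 0 <= f_ j x) ->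
 (forall j, I (f_ j) <= dy j) -> {ae leb n, forall x, cvgn (series (f_ ^~ x))}.
Proof.
move=> if_ f_0 Ie.
have mE j : measurable_fun setT (EFin \o f_ j) by apply/measurable_EFinP; exact: integ_mfn.
pose s x := (\sum_(j <oo) (f_ j x)%:E)%E.
have s0 x : (0 <= s x)%E by apply: nneseries_ge0 => j _ _; rewrite lee_fin.
have ms : measurable_fun setT s.
 have := @ge0_emeasurable_sum _ _ R setT (fun j x => (f_ j x)%:E) xpredT.
 by apply=> [k x _ _|k _]; [rewrite lee_fin|exact: mE].
have si : (leb n).-integrable setT s.
 apply/integrableP; split => //. under eq_integral do rewrite gee0_abs//.
 rewrite integral_nneseries//; last by move=> j x _; rewrite lee_fin.
 apply: (@le_lt_trans _ _ 1%:E); last exact: ltry.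
 rewrite -dy_sum; apply: lee_nneseries => [j _ _|j _].
  by apply: integral_ge0 => x _; rewrite lee_fin.
 by rewrite integE// lee_fin.
have := integrable_ae measurableT si; apply: filterS => x /(_ Logic.I) sx.
apply: nondecreasing_is_cvgn; first by apply: nondecreasing_series => k _ _.
exists (fine (s x)) => _ [k _ <-].
rewrite -lee_fin fineK// /s /series -sumEFin.
by apply: nneseries_lim_ge => j _ _; rewrite lee_fin.
Qed.

Definition energy_cauchy p (G_ : nat -> rV -> rV) :=
 forall e, 0 < e -> exists K, forall k l, (K <= k)%N -> (K <= l)%N -> energy p (fun x => G_ k x - G_ l x) <= e.

(** The argument of Riesz and Fischer. By [le_powR_young] with S = [dy j], the increments of a fast
    subsequence are at most [dy j + f_ j], which is summable almost everywhere; Fatou's lemma then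
    handles the whole sequence. *)
Lemma Lp_complete p (G_ : nat -> rV -> rV) : 2 < p -> (forall k, Lp p (G_ k)) ->
 energy_cauchy p G_ ->
 exists G, Lp p G /\ forall e, 0 < e -> exists K, forall k, (K <= k)%N -> energy p (fun x => G_ k x - G x) <= e.
Proof.
move=> p2 LG cau; have p0 : 0 <= p by lra.
have dp j : 0 < dy j `^ p by rewrite powR_gt0// dy_gt0.
have [N hN] : exists N : nat -> nat, forall j k l, (N j <= k)%N -> (N j <= l)%N ->
  energy p (fun x => G_ k x - G_ l x) <= dy j `^ p.
 have := fun j => cau _ (dp j); move=> H; exists (fun j => projT1 (cid (H j))) => j.
 exact: (projT2 (cid (H j))).
(* The sum makes [phi j] at least N i for all i <= j without any monotonicity of N. *)
pose phi j := (j + \sum_(i < j.+1) N i)%N.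
have phiN j i : (i <= j)%N -> (N i <= phi j)%N.
 move=> ij; have ij' : (i < j.+1)%N by [].
 by rewrite /phi (bigD1 (Ordinal ij'))//= addnCA leq_addr.
have phij j : (j <= phi j)%N by exact: leq_addr.
pose g j := G_ (phi j).
pose f_ j x := dy j `^ (1 - p) * enorm (g j.+1 x - g j x) `^ p.
have LB k l : Lp p (fun x => G_ k x - G_ l x) by exact: LpB.
have if_ j : integ (f_ j) by apply: integZ; exact: (LB _ _).2.
have f_0 j x : 0 <= f_ j x by rewrite mulr_ge0 ?powR_ge0.
have Ie j : I (f_ j) <= dy j.
 rewrite IZ; last exact: (LB _ _).2. apply: (@le_trans _ _ (dy j `^ (1 - p) * dy j `^ p)).
  by rewrite ler_wpM2l ?powR_ge0//; apply: hN; apply: phiN.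
 by rewrite -powRD ?(gt_eqF (dy_gt0 j)) ?implybT// subrK powRr1// ltW ?dy_gt0.
have aes := ae_summable if_ f_0 Ie.
have cvg_x x : cvgn (series (f_ ^~ x)) -> forall i, cvgn (fun j => g j x 0 i).
 move=> sx i; have c1 : cvgn (series (fun j => dy j + f_ j x)) by have := is_cvg_seriesD dy_cvg sx.
 have c2 : cvgn (series (fun j => g j.+1 x 0 i - g j x 0 i)).
  apply: normed_cvg; apply: series_le_cvg c1 => j; first exact: normr_ge0.
   by rewrite addr_ge0// ltW// dy_gt0.
  have := coord_le_enorm (g j.+1 x - g j x) i; rewrite !mxE => /le_trans; apply.
  rewrite /f_ mulrC; apply: le_powR_young; [lra|exact: enorm_ge0|exact: dy_gt0].
 have -> : (fun j => g j x 0 i) = (fun j => series (fun j => g j.+1 x 0 i - g j x 0 i) j + g 0%N x 0 i).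
  by apply/funext => j; rewrite /series /= telescope_sumr// subrK.
 by apply: is_cvgD => //; exact: is_cvg_cst.
(* The upper limit is measurable on the whole space and equals the limit at almost every point. *)
pose G x : rV := \row_i fine (limn_esup (fun j => (g j x 0 i)%:E)).
have mG i : mfn (fun x => G x 0 i).
 under eq_fun do rewrite mxE.
 apply: (measurableT_comp (@fine_measurable R setT measurableT)); apply: measurable_fun_limn_esup => j; apply/measurable_EFinP.
 exact: (LG _).1.
have cG x : cvgn (series (f_ ^~ x)) -> forall i, (fun j => g j x 0 i) @ \oo --> G x 0 i.
 move=> sx i; have /cvg_ex[l hl] := cvg_x x sx i.
 have : (fun j => (g j x 0 i)%:E) @ \oo --> l%:E by apply: cvg_EFin => //; exact: nearW.
 by move=> /cvg_limn_einf_sup[_ E]; rewrite mxE E.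
(* Shifting the subsequence by k makes its index [phi (j + k)] at least k, hence past the Cauchy
   threshold. *)
have key k e : (forall j, energy p (fun x => G_ k x - g (j + k)%N x) <= e) ->
  Lp p (fun x => G_ k x - G x) /\ energy p (fun x => G_ k x - G x) <= e.
 move=> hk. have mB i : mfn (fun x => (G_ k x - G x) 0 i).
  by under eq_fun do rewrite rVB; apply: mfnB => //; exact: (LG k).1.
 have [||||||h1 h2] := @I_fatou (fun j x => enorm (G_ k x - g (j + k)%N x) `^ p) (fun x => enorm (G_ k x - G x) `^ p) e.
 - by move=> j; exact: (LB _ _).2.
 - by move=> j x; exact: powR_ge0.
 - exact: hk.
 - by apply: mfn_powR; exact: mfn_enorm.
 - by move=> x; exact: powR_ge0.
 - move: aes; apply: filterS => x sx.
  have c1 i : (fun j => g (j + k)%N x 0 i) @ \oo --> G x 0 i by have := cG x sx i; rewrite -(cvg_shiftn k).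
  have c2 : (fun j => enorm (G_ k x - g (j + k)%N x)) @ \oo --> enorm (G_ k x - G x).
   have c3 : (fun j => \sum_i ((G_ k x - g (j + k)%N x) 0 i) ^+ 2) @ \oo --> \sum_i ((G_ k x - G x) 0 i) ^+ 2.
    apply: (cvg_sumr (f := fun i j => ((G_ k x - g (j + k)%N x) 0 i) ^+ 2)) => i.
    under eq_fun do rewrite rVB expr2; rewrite rVB expr2.
    by apply: cvgM; apply: cvgB => //; exact: cvg_cst.
   exact: continuous_cvg _ (@sqrt_continuous R _) c3.
  have cp : continuous (fun t : R => pp t `^ p) by apply: cont_ppowR; lra.
  have c4 := continuous_cvg _ (cp _) c2; rewrite pp_pos// in c4.
  have -> : (fun j => enorm (G_ k x - g (j + k)%N x) `^ p) =
   (fun t : R => pp t `^ p) \o (fun j => enorm (G_ k x - g (j + k)%N x)).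
   by apply/funext => j /=; rewrite pp_pos.
  exact: c4.
 by [].
have [K0 hK0] := cau 1 ltr01.
have [h0 _] : Lp p (fun x => G_ K0 x - G x) /\ energy p (fun x => G_ K0 x - G x) <= 1.
 by apply: key => j; apply: hK0 => //; rewrite (leq_trans (leq_addl j K0))// phij.
exists G; split.
 have := LpB p0 (LG K0) h0.
 have -> // : (fun x => G_ K0 x - (G_ K0 x - G x)) = G by apply/funext => x; rewrite subKr.
move=> e e0; have [K hK] := cau e e0; exists K => k Kk.
apply: (key k e _).2 => j; apply: hK => //; apply: leq_trans Kk _; apply: leq_trans (phij _).
by rewrite leq_addl.
Qed.

End completeness.

(** * The space D^{1,p} in terms of continuous functions with weak gradients *)

Section sobolev_space.
Context {R : realType} (n : nat).
Local Notation rV := 'rV[R]_n.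
Implicit Types (u : rV -> R) (G H : rV -> rV) (p : R).

Lemma uniform_limit (u_ : nat -> rV -> R) : (forall k, continuous (u_ k)) ->
 (forall r e, 0 < e -> exists K, forall k l x, (K <= k)%N -> (K <= l)%N -> `|x| <= r -> `|u_ k x - u_ l x| <= e) ->
 exists u, continuous u /\ forall r e, 0 < e -> exists K, forall k x, (K <= k)%N -> `|x| <= r -> `|u_ k x - u x| <= e.
Proof.
move=> cu cau.
have cv x : cvgn (u_ ^~ x).
 apply/cauchy_cvgP; apply: cauchy_exP => e e0.
 have [K hK] := cau `|x| (e / 2) (divr_gt0 e0 (ltr0Sn _ 1)).
 exists (u_ K x); exists K => // k /= Kk; rewrite /ball /=.
 by apply: le_lt_trans (hK _ _ _ (leqnn K) Kk (lexx _)) _; lra.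
exists (fun x => limn (u_ ^~ x)).
have unif r e : 0 < e -> exists K, forall k x, (K <= k)%N -> `|x| <= r -> `|u_ k x - limn (u_ ^~ x)| <= e.
 move=> e0; have [K hK] := cau r e e0; exists K => k x Kk xr.
 have h : (fun l => `|u_ k x - u_ l x|) @ \oo --> `|u_ k x - limn (u_ ^~ x)|.
  by apply: cvg_norm; apply: cvgB; [exact: cvg_cst|exact: cv].
 rewrite -(cvg_lim _ h)//; apply: limr_le; first by apply/cvg_ex; eexists; exact: h.
 by exists K => // l Kl; exact: hK.
split=> // x; apply: cont_at_eps => e e0.
have e3 : 0 < e / 3 by rewrite divr_gt0.
have [K hK] := unif (`|x| + 1) _ e3.
have h := cont_near_eps (cu K x) e3; near=> y.
have yx : `|y| <= `|x| + 1.
 have : `| `|x| - `|y| | <= 1 by near: y; exact: (cont_near_eps (@norm_continuous _ _ x) ltr01).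
 by rewrite ler_norml => /andP[]; lra.
have h1 := hK K x (leqnn K) (_ : `|x| <= `|x| + 1); have h2 := hK K y (leqnn K) yx.
have h3 : `|u_ K x - u_ K y| <= e / 3 by near: y.
have {}h1 : `|u_ K x - limn (u_ ^~ x)| <= e / 3 by apply: h1; rewrite lerDl.
move: h1 h2 h3; rewrite (distrC _ (limn (u_ ^~ x))).
set a := limn _; set b := limn _; set c := u_ _ _; set d := u_ _ _ => h1 h2 h3.
have -> : a - b = (a - c) + (c - d) + (d - b) by ring.
by rewrite (le_trans (ler_normD _ _))// (le_trans (lerD (ler_normD _ _) (lexx _)))//; lra.
Unshelve. all: by end_near. Qed.

Lemma morrey_energy p : 2 < p -> n%:R < p -> exists2 C, 0 < C & forall u G, W u G -> Lp p G ->
 forall x y, `|u x - u y| <= C * energy p G `^ p^-1 * `|x - y| `^ (1 - n%:R / p).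
Proof.
move=> p2 np; have p1 : 1 <= p by lra.
have pn0 : p != 0 by rewrite gt_eqF; lra.
have [C C0 hC] := @morrey R n p p1 np; exists C => // u G WG LG x y.
pose D := `|x - y| `^ (1 - n%:R / p).
rewrite -subr_le0; apply: (@le_eps R _ (C * D)); first by rewrite mulr_ge0 ?powR_ge0// ltW.
move=> e e0; have S0 : 0 < energy p G `^ p^-1 + e by rewrite ltr_wpDl ?powR_ge0.
have := hC u G _ WG S0 LG.2 _ x y; rewrite -/D => h.
rewrite lerBlDr; apply: (le_trans (h _)).
 apply: (@le_trans _ _ ((energy p G `^ p^-1) `^ p)).
  by rewrite -powRrM mulVf// powRr1// energy_ge0.
 by rewrite ge0_ler_powR ?nnegrE ?powR_ge0 ?(ltW S0)//; lra.
apply: eqW; rewrite /D; ring.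
Qed.

(** The common value at x0 removes the additive constants, so Morrey's inequality turns convergence
    of the gradients into locally uniform convergence of the functions. *)
Lemma W_complete p (u_ : nat -> rV -> R) (G_ : nat -> rV -> rV) (x0 : rV) c0 :
 2 < p -> n%:R < p -> (forall k, W (u_ k) (G_ k)) -> (forall k, Lp p (G_ k)) ->
 energy_cauchy p G_ ->
 (forall k, u_ k x0 = c0) ->
 exists u G, [/\ W u G, Lp p G,
   forall e, 0 < e -> exists K, forall k, (K <= k)%N -> energy p (fun x => G_ k x - G x) <= e &
   forall r e, 0 < e -> exists K, forall k x, (K <= k)%N -> `|x| <= r -> `|u_ k x - u x| <= e].
Proof.
move=> p2 np WG LG cau hx0; have p0 : 0 < p by lra.
have [G [hG cG]] := Lp_complete p2 LG cau.
have [C C0 hC] := morrey_energy p2 np.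
have cu k : continuous (u_ k) by exact: (WG k).1.
have [|u [cu' hu]] := uniform_limit cu.
 move=> r e e0; pose D := (r + `|x0|) `^ (1 - n%:R / p). have D0 : 0 <= D by exact: powR_ge0.
 have CD : 0 < C * (D + 1) by rewrite mulr_gt0; lra.
 have [K hK] := cau ((e / (C * (D + 1))) `^ p) (powR_gt0 _ (divr_gt0 e0 CD)).
 exists K => k l x Kk Kl xr. have := hC _ _ (WB (WG k) (WG l)) (LpB (ltW p0) (LG k) (LG l)) x x0.
 rewrite !hx0 subrr subr0 => h; apply: (le_trans h).
 have h1 : energy p (fun x => G_ k x - G_ l x) `^ p^-1 <= e / (C * (D + 1)).
  have : energy p (fun x => G_ k x - G_ l x) `^ p^-1 <= ((e / (C * (D + 1))) `^ p) `^ p^-1.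
   by rewrite ge0_ler_powR ?nnegrE ?powR_ge0 ?invr_ge0 ?energy_ge0 ?(ltW p0)// hK.
  by rewrite -powRrM mulfV ?gt_eqF// powRr1// divr_ge0// ltW.
 have h2 : `|x - x0| `^ (1 - n%:R / p) <= D + 1.
  apply: (@le_trans _ _ D); last by lra. rewrite ge0_ler_powR ?nnegrE ?(ltW (al_gt0 np))//.
   by rewrite (le_trans (normr_ge0 (x - x0)))// (le_trans (ler_normB _ _))// lerD2r.
  by rewrite (le_trans (ler_normB _ _))// lerD2r.
 apply: (@le_trans _ _ (C * (e / (C * (D + 1))) * (D + 1))).
  by rewrite ler_pM ?mulr_ge0 ?powR_ge0 ?(ltW C0)// ler_wpM2l// ltW.
 apply: eqW; field; apply/andP; split; rewrite gt_eqF//; lra.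
exists u, G; split=> //; split=> // i.
have lG : loc_integrable (fun x => G x 0 i).
 apply: loc_integP => [|r]; first exact: hG.1.
 apply: (@le_integ _ _ _ (fun x => 1 * \1_(cball r) x + 1 `^ (1 - p) * enorm (G x) `^ p)).
 - by apply: mfnM; [exact: hG.1|apply: mfn_indic; exact: measurable_cball].
 - move=> x; rewrite normrM indicE; case: (_ \in _); rewrite ?normr1 ?normr0 ?mulr1 ?mulr0 ?add0r.
   rewrite (le_trans (coord_le_enorm _ _))// (mulrC (_ `^ (1 - p))) le_powR_young//; lra.
  by rewrite mulr_ge0 ?powR_ge0.
 - by apply: integD; apply: integZ; [exact: integ_cball|exact: hG.2].
apply: wd_lim => //; first exact: cont_loc.
move=> r e e0; pose V := I (\1_(cball r) : rV -> R).
have V0 : 0 <= V by apply: I_ge0 => x; rewrite indicE.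
have eV : 0 < e / (V + 1) by rewrite divr_gt0; lra.
have [K hK] := hu r _ eV; have [K' hK'] := cG ((e / (V + 1)) `^ p) (powR_gt0 _ eV).
pose k := maxn K K'; exists (u_ k), (fun x => G_ k x 0 i); split.
- exact: cont_loc.
- exact: (WG k).2.
- apply: (@le_trans _ _ (I (fun x => e / (V + 1) * \1_(cball r) x))).
  apply: I_le; [by apply: cb_integ_ball; apply: cont_loc; exact: contB|by apply: integZ; exact: integ_cball|].
  move=> x; rewrite normrM indicE; case: (boolP (x \in _)) => [|_]; last by rewrite normr0 !mulr0.
  by rewrite inE => xr; rewrite normr1 !mulr1 hK// leq_maxl.
 rewrite IZ; last exact: integ_cball. rewrite -/V mulrAC ler_pdivrMr; last by lra.
 by rewrite ler_pM2l; lra.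
- have p1 : 1 <= p by lra.
 have m1 : mfn (fun x => G_ k x 0 i - G x 0 i) by apply: mfnB; [exact: (LG k).1|exact: hG.1].
 have m2 x : `|G_ k x 0 i - G x 0 i| <= enorm (G_ k x - G x) by rewrite -rVB; exact: coord_le_enorm.
 have m3 : (K' <= k)%N by exact: leq_maxr.
 apply: (le_trans (I_ball_powR r p1 eV m1 m2 (LpB (ltW p0) (LG k) hG).2 (hK' k m3))).
 rewrite -/V; apply: eqW; field; lra.
Qed.

Lemma LfunE p (f : rV -> R) : 0 < p ->
 f \in Lfun (leb n) p%:E <-> mfn f /\ integ (fun x => `|f x| `^ p).
Proof.
move=> p0; have E : (('N[leb n]_p%:E[EFin \o f]) `^ p = \int[leb n]_x (`|f x| `^ p)%:E)%E.
 by rewrite poweR_Lnorm ?gt_eqF//; apply: eq_integral => x _; rewrite poweR_EFin.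
rewrite /Lfun inE /finite_norm; split.
 move=> /andP[]; rewrite !inE /= => mf fin; split=> //. apply/integrableP; split.
  by apply/measurable_EFinP; apply: mfn_powR; exact: mfn_abs.
 under eq_integral do rewrite /= ger0_norm//. by rewrite -E poweR_lty.
move=> [mf /integrableP[_ fi]]; apply/andP; split; rewrite inE //=.
rewrite /finite_norm ltey; apply/eqP => N; move: fi.
under eq_integral do rewrite /= ger0_norm//.
by rewrite -E N poweRyr ?gt_eqF// ltxx.
Qed.

Lemma hoelder_cont (a : R) u : 0 < a -> Defs.hoelder a u -> continuous u.
Proof.
move=> a0 [C hC] x; apply: cont_at_eps => e e0.
have d0 : 0 < (e / (`|C| + 1)) `^ a^-1 by rewrite powR_gt0// divr_gt0// ltr_wpDl.
have ce : {for x, continuous (fun y : rV => enorm (x - y))}.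
 apply: (@cont_comp _ _ _ (fun y : rV => x - y)); last exact: enorm_continuous.
 have -> : (fun y : rV => x - y) = (fun y => -1 *: y + x) by apply/funext => y; rewrite scaleN1r addrC.
 exact: continuous_affine_rV.
have h := cont_near_eps ce d0; near=> y.
have := hC x y; move=> hxy; apply: (le_trans hxy).
have : enorm (x - y) <= (e / (`|C| + 1)) `^ a^-1.
 have : `|enorm (x - x) - enorm (x - y)| <= (e / (`|C| + 1)) `^ a^-1 by near: y.
 by rewrite subrr enorm0 sub0r normrN ger0_norm ?enorm_ge0.
move=> hd; have : enorm (x - y) `^ a <= e / (`|C| + 1).
 apply: (@le_trans _ _ (((e / (`|C| + 1)) `^ a^-1) `^ a)).
  by rewrite ge0_ler_powR ?nnegrE ?enorm_ge0// ltW.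
 by rewrite -powRrM mulVf ?gt_eqF// powRr1// divr_ge0// ltW.
rewrite ler_pdivlMr// => h2.
apply: (@le_trans _ _ (enorm (x - y) `^ a * (`|C| + 1))); last exact: h2.
by rewrite mulrC ler_wpM2l ?powR_ge0// (le_trans (ler_norm C))// lerDl.
Unshelve. all: by end_near. Qed.

Lemma Lp_coord p G : 1 < p -> Lp p G <-> (forall i, (fun x => G x 0 i) \in Lfun (leb n) p%:E).
Proof.
move=> p1; have p0 : 0 < p by lra.
split=> [[mG iG] i|h].
 apply/LfunE => //; split=> //; apply: le_integ iG; first by apply: mfn_powR; exact: mfn_abs.
 by move=> x; rewrite ger0_norm// ge0_ler_powR ?nnegrE ?enorm_ge0 ?(ltW p0)// coord_le_enorm.
have {}h i : mfn (fun x => G x 0 i) /\ integ (fun x => `|G x 0 i| `^ p) by apply/LfunE.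
apply: (@Lp_le _ _ _ (fun x => n%:R `^ p * \sum_i `|G x 0 i| `^ p)).
- by move=> i; exact: (h i).1.
- move=> x; apply: (@le_trans _ _ ((n%:R * `|G x|) `^ p)).
  by rewrite ge0_ler_powR ?nnegrE ?enorm_ge0 ?enorm_le_norm// ltW.
 rewrite powRM// ler_wpM2l//.
 have [z|z] := eqVneq `|G x| 0; first by rewrite z powR0 ?gt_eqF// sumr_ge0// => i _; exact: powR_ge0.
 have [i hi] : exists i, `|G x| <= `|G x 0 i|.
  apply: contrapT => H; have : `|G x| < `|G x|; last by rewrite ltxx.
  apply/mx_norm_ltP; first by rewrite lt_def z normr_ge0.
  by move=> i; rewrite ltNge; apply/negP => hi; apply: H; exists i.
 rewrite (bigD1 i)//= ler_wpDr//; first by rewrite sumr_ge0// => j _; exact: powR_ge0.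
 by rewrite ge0_ler_powR ?nnegrE// ltW.
- by apply: integZ; apply: integ_sum => i _; exact: (h i).2.
Qed.

Lemma weak_gradientP u G : continuous u -> weak_gradient u G <-> W u G.
Proof.
move=> cu; split=> [h|[_ h] i]; last by apply/weak_partialP => //; exact: cont_loc.
by split=> // i; apply/weak_partialP; [exact: cont_loc|exact: h].
Qed.

(** Morrey's inequality supplies the Hoelder clause of [D1p]; conversely that clause gives the
    continuity required by [W]. *)
Lemma D1pP p u : 2 < p -> n%:R < p -> D1p p u <-> exists G, W u G /\ Lp p G.
Proof.
move=> p2 np; have p1 : 1 < p by lra.
split=> [[_ hu [G [wG LG]]]|[G [WG LG]]].
 have cu := hoelder_cont (al_gt0 np) hu. by exists G; split; [exact/weak_gradientP|exact/Lp_coord].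
have cu := WG.1; split; first exact: cont_loc.
 have [C C0 hC] := morrey_energy p2 np; exists (C * energy p G `^ p^-1) => x y.
 apply: (le_trans (hC u G WG LG x y)).
 rewrite ler_wpM2l ?mulr_ge0 ?powR_ge0 ?(ltW C0)// ge0_ler_powR ?nnegrE ?enorm_ge0 ?norm_le_enorm//.
 by rewrite ltW// al_gt0.
by exists G; split; [exact/weak_gradientP|exact/Lp_coord].
Qed.

Lemma W_ae u G H : W u G -> W u H -> {ae leb n, forall x, G x = H x}.
Proof.
move=> WG WH; have : {ae leb n, forall x, forall i, G x 0 i = H x 0 i}.
 apply: filter_forall => i; exact: wd_unique (WG.2 i) (WH.2 i).
by apply: filterS => x h; apply/rowP.
Qed.

Lemma W_unique p u G H : W u G -> W u H -> Lp p G -> Lp p H /\ energy p H = energy p G.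
Proof. by move=> WG WH LG; exact: ae_energy (W_mfn WH) LG (W_ae WG WH). Qed.

Lemma norm_DwE p u G : 1 < p -> W u G -> Lp p G -> norm_Dw p u `^ p = energy p G.
Proof.
move=> p1 WG LG; have p0 : 0 < p by lra.
have WD : W u (Dw u).
 apply/weak_gradientP; first exact: WG.1.
 rewrite /Dw; case: xgetP => [H _ //|/(_ G)] h; exfalso; apply: h; exact/(weak_gradientP _ WG.1).
have [LD <-] := W_unique WG WD LG.
have E : ('N[leb n]_p%:E[EFin \o (fun x => enorm (Dw u x))] = (energy p (Dw u) `^ p^-1)%:E)%E.
 rewrite unlock; have -> : (\int[leb n]_x (`|(EFin \o (fun x => enorm (Dw u x))) x| `^ p) = (energy p (Dw u))%:E)%E.
  rewrite -integE; last exact: LD.2.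
  apply: eq_integral => x _; rewrite -[in RHS](ger0_norm (enorm_ge0 _)) -poweR_EFin. by [].
 by [].
by rewrite /norm_Dw E -powRrM mulVf ?gt_eqF// powRr1// energy_ge0.
Qed.

End sobolev_space.

(* Energies are abstracted first: they are costly to compare up to
  conversion. *)
Ltac gen_energy := repeat match goal with
 | H : context [energy ?p ?G] |- _ => let e := fresh "en" in set (e := energy p G) in *; clearbody e
 | |- context [energy ?p ?G] => let e := fresh "en" in set (e := energy p G) in *; clearbody e
 | H : context [powR ?p ?G] |- _ => let e := fresh "en" in set (e := powR p G) in *; clearbody e
 | |- context [powR ?p ?G] => let e := fresh "en" in set (e := powR p G) in *; clearbody e
 end.
Ltac elra := gen_energy; lra.

Lemma p2_ge0 (R : realType) (p : R) : 2 < p -> 0 <= p. Proof. by lra. Qed.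
Lemma p2_gt0 (R : realType) (p : R) : 2 < p -> 0 < p. Proof. by lra. Qed.
Lemma p2_gt1 (R : realType) (p : R) : 2 < p -> 1 < p. Proof. by lra. Qed.

(** * The capacity of a point *)

Section capacity.
Context {R : realType} (n : nat).
Local Notation rV := 'rV[R]_n.
Implicit Types (u v : rV -> R) (G H : rV -> rV) (p c e : R) (U V : set rV) (x y : rV).

Definition comp p U x u G := [/\ W u G, Lp p G, forall y, ~ U y -> u y = 0 & u x = 1].

(** A real infimum, equal to 0 when there is no competitor; the lemmas that bound it from below
    therefore assume that one exists. *)
Definition cap p U x := inf [set c | exists u G, comp p U x u G /\ c = energy p G].

Lemma cap_has_lb p U x : has_lbound [set c | exists u G, comp p U x u G /\ c = energy p G].
Proof. by exists 0 => _ [u [G [_ ->]]]; exact: energy_ge0. Qed.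

Lemma cap_le p U x u G : comp p U x u G -> cap p U x <= energy p G.
Proof. by move=> h; apply: ge_inf; [exact: cap_has_lb|exists u, G]. Qed.

Lemma cap_approx p U x e : (exists u G, comp p U x u G) -> 0 < e ->
 exists u G, comp p U x u G /\ energy p G <= cap p U x + e.
Proof.
move=> [u [G h]] e0.
have hi : has_inf [set c | exists u G, comp p U x u G /\ c = energy p G].
 by split; [exists (energy p G), u, G|exact: cap_has_lb].
have [_ [v [H [h1 ->]]] h2] := inf_adherent e0 hi.
by exists v, H; split=> //; exact: ltW.
Qed.

Lemma cap_ge p U x c : (exists u G, comp p U x u G) -> (forall u G, comp p U x u G -> c <= energy p G) ->
 c <= cap p U x.
Proof.
move=> ex h; rewrite -subr_le0; apply: (@le_eps R _ 1) => // e e0.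
have [u [G [h1 h2]]] := cap_approx ex e0; have := h u G h1; lra.
Qed.

Lemma comp_subset p U V x u G : U `<=` V -> comp p U x u G -> comp p V x u G.
Proof. by move=> UV [h1 h2 h3 h4]; split=> // y Vy; apply: h3 => /UV. Qed.

Lemma comp_mid p U x u v G H : 0 <= p -> comp p U x u G -> comp p U x v H ->
 comp p U x (fun y => 2^-1 * (u y + v y)) (fun y => 2^-1 *: (G y + H y)).
Proof.
move=> p0 [h1 h2 h3 h4] [k1 k2 k3 k4]; split.
- by apply: WZ; exact: WD.
- by apply: LpZ; exact: LpD.
- by move=> y Uy; rewrite h3// k3// addr0 mulr0.
- by rewrite h4 k4; field.
Qed.

(** The tangent inequality at G bounds the energy of G by that of H plus a linear term in H - G,
    which Young's inequality with parameter t splits. *)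
Lemma energy_lsc p G c : 1 < p -> Lp p G ->
 (forall e, 0 < e -> exists H, [/\ Lp p H, energy p (fun x => H x - G x) <= e & energy p H <= c + e]) ->
 energy p G <= c.
Proof.
move=> p1 LG hH; have p0 : 0 <= p by lra.
have key t e : 0 < t -> 0 < e -> energy p G <= c + e + p * (t * energy p G + t `^ (1 - p) * e).
 move=> t0 e0; have [H [LH h1 h2]] := hH e e0. have LB := LpB p0 LH LG.
 have pt x : enorm (G x) `^ p <= enorm (H x) `^ p + p * (t * enorm (G x) `^ p + t `^ (1 - p) * enorm (H x - G x) `^ p).
  have := enorm_tangent (H x) (G x) p1; have := young_w p1 t0 (enorm_ge0 (H x - G x)) (enorm_ge0 (G x)).
  have := dotp_le (flux p (G x)) (H x - G x); rewrite enorm_flux//.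
  set a := dotp _ _; set b := _ * enorm (_ - _); set d := t * _ + _ => k1 k2 k3.
  have : - a <= d by rewrite (le_trans _ k2)// (le_trans _ k1)// -normrN ler_norm.
  move=> k4; have := ler_wpM2l p0 k4; move: k3; clearbody a d.
  set A := enorm (H x) `^ p; set B := enorm (G x) `^ p; clearbody A B; clear; lra.
 have i1 : integ (fun x => t * enorm (G x) `^ p) by apply: integZ; exact: LG.2.
 have i2 : integ (fun x => t `^ (1 - p) * enorm (H x - G x) `^ p) by apply: integZ; exact: LB.2.
 have i3 := integD i1 i2; have i4 := integZ p i3. have := I_le LG.2 (integD LH.2 i4) pt.
 rewrite (ID LH.2 i4) (IZ _ i3) (ID i1 i2) (IZ _ LG.2) (IZ _ LB.2) => h; apply: (le_trans h).
 by apply: lerD => //; rewrite ler_wpM2l// lerD2l ler_wpM2l// powR_ge0.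
have E0 := energy_ge0 p G.
rewrite -subr_le0; apply: (@le_eps R _ (p * energy p G + 1 + p)); first by rewrite !addr_ge0 ?mulr_ge0.
move=> t t0; have tp : 0 < t `^ (1 - p) by exact: powR_gt0.
(* Chosen after t, so that both e and the term t^(1-p) e are at most t. *)
pose e := Num.min t (t / t `^ (1 - p)).
have e0 : 0 < e by rewrite lt_min t0 divr_gt0.
have := key t e t0 e0.
have e1 : e <= t by rewrite ge_min lexx.
have e2 : t `^ (1 - p) * e <= t by rewrite mulrC -ler_pdivlMr// ge_min lexx orbT.
have := ler_wpM2l p0 e2; set E := energy _ _ in E0 *; set X := _ * e.
move=> h3 h4; have := h4; rewrite mulrDr => {}h4; clearbody X E e; clear - e1 h3 h4 t0 p0 E0.
nra.
Qed.

(** Energies are compared with those of midpoints rather than with one infimum, because the domain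
    of the competitors may vary along the sequence, as in [cap_Wk_cvg]. *)
Definition almost_minimizing p (G_ : nat -> rV -> rV) :=
 forall e, 0 < e -> exists K, forall k l, (K <= k)%N -> (K <= l)%N ->
   (energy p (G_ k) + energy p (G_ l)) / 2 <= energy p (fun x => 2^-1 *: (G_ k x + G_ l x)) + e.

(* Clarkson's inequality makes almost minimizing sequences Cauchy. *)
Lemma cauchy_mid p (G_ : nat -> rV -> rV) : 2 < p -> (forall k, Lp p (G_ k)) ->
 almost_minimizing p G_ ->
 energy_cauchy p G_.
Proof.
move=> p2 LG h e e0; have p0 : 0 <= p by lra.
have c0 : 0 < (2^-1 : R) `^ p by [].
have [K hK] := h (2^-1 `^ p * e) (mulr_gt0 c0 e0); exists K => k l Kk Kl.
have := energy_clarkson p2 (LG k) (LG l); have := hK k l Kk Kl.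
rewrite (energyZ 2^-1 (LpB p0 (LG k) (LG l))) ger0_norm// => h1 h2.
rewrite -(ler_pM2l c0); elra.
Qed.

Lemma limit_comp p (U_ : nat -> set rV) x (u_ : nat -> rV -> R) (G_ : nat -> rV -> rV) c :
 2 < p -> n%:R < p -> (forall k, comp p (U_ k) x (u_ k) (G_ k)) ->
 almost_minimizing p G_ ->
 (forall e, 0 < e -> exists K, forall k, (K <= k)%N -> energy p (G_ k) <= c + e) ->
 exists u G, [/\ W u G, Lp p G, energy p G <= c, u x = 1 &
  forall y, (exists K, forall k, (K <= k)%N -> ~ U_ k y) -> u y = 0].
Proof.
move=> p2 np hc mid hE.
have LG k : Lp p (G_ k) by have [] := hc k.
have [||u [G [WG LG' hG hu]]] := @W_complete R n p u_ G_ x 1 p2 np _ LG (cauchy_mid p2 LG mid).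
- by move=> k; have [] := hc k.
- by move=> k; have [] := hc k.
exists u, G; split=> //.
- apply: energy_lsc => //; first by lra.
 move=> e e0; have [K hK] := hE e e0; have [K' hK'] := hG e e0.
 exists (G_ (maxn K K')); split=> //; first by apply: hK'; exact: leq_maxr.
 by apply: hK; exact: leq_maxl.
- apply/eqP; rewrite -subr_eq0 -normr_le0; apply: (@le_eps R _ 1) => // e e0.
 have [K hK] := hu `|x| e e0; have := hK K x (leqnn K) (lexx _).
 by have [_ _ _ ->] := hc K; rewrite distrC mulr1.
- move=> y [K0 hK0]; apply/eqP; rewrite -normr_le0; apply: (@le_eps R _ 1) => // e e0.
 have [K hK] := hu `|y| e e0; have := hK (maxn K K0) y (leq_maxl _ _) (lexx _).
 have -> : u_ (maxn K K0) y = 0.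
  by have [_ _ h _] := hc (maxn K K0); apply: h; apply: hK0; exact: leq_maxr.
 by rewrite sub0r normrN mulr1.
Qed.

Lemma cap_attained p U x : 2 < p -> n%:R < p -> (exists u G, comp p U x u G) ->
 exists u G, comp p U x u G /\ energy p G = cap p U x.
Proof.
move=> p2 np ex; have p0 : 0 <= p by lra.
have H k : exists uG : (rV -> R) * (rV -> rV),
  comp p U x uG.1 uG.2 /\ energy p uG.2 <= cap p U x + k.+1%:R^-1.
 by have [|u [G h]] := @cap_approx p U x k.+1%:R^-1 ex; [rewrite invr_gt0|exists (u, G)].
have [uG huG] := choice H.
have small e : 0 < e -> exists K, forall k, (K <= k)%N -> k.+1%:R^-1 <= e.
 by move=> e0; have [K _ hK] := near_natSinv e0; exists K => k Kk; exact: hK.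
have [|||u [G [WG LG hE u1 u0]]] := @limit_comp p (fun=> U) x (fun k => (uG k).1) (fun k => (uG k).2) (cap p U x) p2 np.
- by move=> k; exact: (huG k).1.
- move=> e e0; have [K hK] := small e e0; exists K => k l Kk Kl.
 have h1 := cap_le (comp_mid p0 (huG k).1 (huG l).1).
 have h2 := (huG k).2; have h3 := (huG l).2; have h4 := hK k Kk; have h5 := hK l Kl.
 apply: (@le_trans _ _ (cap p U x + e)); last by rewrite lerD2r; exact: h1.
 rewrite ler_pdivrMr// (_ : (cap p U x + e) * 2 = (cap p U x + e) + (cap p U x + e)); last by ring.
 by apply: lerD; [apply: (le_trans h2)|apply: (le_trans h3)]; rewrite lerD2l.
- move=> e e0; have [K hK] := small e e0; exists K => k /hK h.
 by apply: (le_trans (huG k).2); rewrite lerD2l.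
have hc : comp p U x u G by split=> // y Uy; apply: u0; exists 0%N.
by exists u, G; split=> //; apply/eqP; rewrite eq_le hE (cap_le hc).
Qed.

Lemma W_energy0 p u G : 2 < p -> n%:R < p -> W u G -> Lp p G -> energy p G = 0 -> forall x y, u x = u y.
Proof.
move=> p2 np WG LG E x y; have [C C0 hC] := morrey_energy p2 np.
have := hC u G WG LG x y; rewrite E powR0 ?mulr0 ?mul0r; last by rewrite invr_eq0 gt_eqF; lra.
by rewrite normr_le0 subr_eq0 => /eqP.
Qed.

(** The midpoint is a competitor, so Clarkson's inequality forces the energy of G - H to vanish.
    Then u - v is constant, and it is 0 at x. *)
Lemma cap_unique p U x u v G H : 2 < p -> n%:R < p -> comp p U x u G -> comp p U x v H ->
 energy p G = cap p U x -> energy p H = cap p U x -> u = v.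
Proof.
move=> p2 np hu hv EG EH; have p0 := p2_ge0 p2.
have LG : Lp p G by have [] := hu.
have LH : Lp p H by have [] := hv.
have h1 := energy_clarkson p2 LG LH; have h2 := cap_le (comp_mid p0 hu hv).
rewrite EG EH in h1; have LB := LpB p0 LG LH.
have E0 : energy p (fun y => G y - H y) = 0.
 have := energy_ge0 p (fun y => 2^-1 *: (G y - H y)); rewrite (energyZ 2^-1 LB) => h3.
 have : `|2^-1 : R| `^ p * energy p (fun y => G y - H y) = 0.
  rewrite (energyZ 2^-1 LB) in h1; apply/eqP; rewrite eq_le h3 andbT.
  rewrite -(lerD2l (energy p (fun x => 2^-1 *: (G x + H x)))) addr0; apply: (le_trans h1).
  have -> : (cap p U x + cap p U x) / 2 = cap p U x by field. by [].
 move=> /eqP; rewrite mulf_eq0 powR_eq0 normr_eq0 invr_eq0 pnatr_eq0 => /eqP //.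
have WGH : W (fun y => u y - v y) (fun y => G y - H y) by apply: WB; [have [] := hu|have [] := hv].
apply/funext => y; have := W_energy0 p2 np WGH LB E0 y x.
by have [_ _ _ ->] := hu; have [_ _ _ ->] := hv; rewrite subrr => /eqP; rewrite subr_eq0 => /eqP.
Qed.

Lemma cs_W_Lp p u (du : 'I_n -> rV -> R) r : 0 < p -> bsupp r u -> continuous u ->
 (forall i x, pd i u x (du i x)) -> (forall i, continuous (du i)) ->
 W u (fun x => \row_i du i x) /\ Lp p (fun x => \row_i du i x).
Proof.
move=> p0 bu cu hu cdu; split; first exact: W_smooth.
have bdu i : bsupp r (du i) by exact: bsupp_pd bu (hu i).
have cG : continuous (fun x => \row_i du i x).
 by apply: continuous_rVP => i; under eq_fun do rewrite mxE; exact: cdu.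
have bG x : r < `|x| -> \row_i du i x = 0 :> rV by move=> h; apply/rowP => i; rewrite !mxE bdu.
split; first by move=> i; under eq_fun do rewrite mxE; exact: mfn_cont.
apply: cs_integ (_ : bsupp r _).
 have -> : (fun x => enorm (\row_i du i x) `^ p) = (fun x => pp (enorm (\row_i du i x)) `^ p).
  by apply/funext => x; rewrite pp_pos.
 exact: (cont_comp (cont_comp cG (@enorm_continuous R n)) (cont_ppowR p0)).
by move=> x /bG ->; rewrite enorm0 powR0// gt_eqF.
Qed.

Lemma comp_exists p U x : 0 < p -> open U -> U x -> exists u G, comp p U x u G.
Proof.
move=> p0 oU Ux; have /nbhs_ballP[d d0 hd] : nbhs x U by exact: open_nbhs_nbhs.
pose a := x - const_mx (d / 2); pose b := x + const_mx (d / 2).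
have ax i : 0 < x 0 i - a 0 i by rewrite !mxE subKr divr_gt0.
have bx i : 0 < b 0 i - x 0 i by rewrite !mxE addrAC subrr add0r divr_gt0.
have B0 : 0 < bump a b 0 x.
 apply: prodr_gt0 => i _; rewrite !stepE !mul1r ax bx mulr_gt0 ?expR_gt0//.
have [||||WG LG] := @cs_W_Lp p (fun y => (bump a b 0 x)^-1 * bump a b 0 y)
  (fun i y => (bump a b 0 x)^-1 * partial i (bump a b 0) y) (`|a| + `|b|) p0.
- by move=> y h; rewrite (@bump_bsupp _ _ a b 0 y h) mulr0.
- by apply: contM; [exact: cont_cst|exact: (C_cont (bump_smooth a b 0 0))].
- by move=> i y; apply: pdZ; have [_ h _] := test_pd i (bump_smooth a b 0).
- by move=> i; apply: contM; [exact: cont_cst|have [_ _ h] := test_pd i (bump_smooth a b 0)].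
exists (fun y => (bump a b 0 x)^-1 * bump a b 0 y), (fun y => \row_i ((bump a b 0 x)^-1 * partial i (bump a b 0) y)).
split=> //; last by rewrite mulVf// gt_eqF.
move=> y Uy; rewrite (@bump_out _ _ a b 0 y) ?mulr0// => hy; apply: Uy; apply: hd.
move: d0 => /= d0; rewrite -ball_normE; apply: (@le_lt_trans _ _ (d / 2)); last by lra.
apply/mx_norm_leP => [|i]; first by rewrite divr_ge0// ltW.
by have := hy i; rewrite /= in_itv /= !mxE ler_norml => /andP[h1 h2]; apply/andP; split; lra.
Qed.

Lemma comp_dilate p U V x y u G a b : a != 0 -> comp p U x u G -> (forall z, U (a *: z + b) -> V z) ->
 a *: y + b = x ->
 comp p V y (fun z => u (a *: z + b)) (fun z => a *: G (a *: z + b)) /\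
 energy p (fun z => a *: G (a *: z + b)) = `|a| `^ (p - n%:R) * energy p G.
Proof.
move=> a0 [WG LG u0 u1] UV yx.
have WG' := W_dilate b a0 WG; have [iG IG] := I_enorm_dilate b a0 LG.2.
split; last exact: IG.
split; [exact: WG'|by split; [exact: W_mfn WG'|exact: iG]| |by rewrite yx].
by move=> z Vz; apply: u0 => /UV.
Qed.

Lemma comp_orthogonal p U V x y u G Q : orthogonal_mx Q -> comp p U x u G -> (forall z, U (z *m Q) -> V z) ->
 y *m Q = x ->
 comp p V y (fun z => u (z *m Q)) (fun z => G (z *m Q) *m Q^T) /\
 energy p (fun z => G (z *m Q) *m Q^T) = energy p G.
Proof.
move=> oQ [WG LG u0 u1] UV yx.
have WG' := W_orthogonal oQ WG.
have E z : enorm (G (z *m Q) *m Q^T) `^ p = (fun w => enorm (G w) `^ p) (z *m Q).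
 by rewrite enorm_orthogonal//; exact: orthogonal_tr.
split; last by rewrite /energy (eq_I E) (I_orthogonal oQ (integ_mfn LG.2)).
split; [exact: WG'| | |by rewrite yx].
- split; first exact: W_mfn WG'.
 by apply: eq_integ (integ_orthogonal oQ LG.2) => z; rewrite E.
- by move=> z Vz; apply: u0 => /UV.
Qed.

Lemma compZ p U x y u G : u y != 0 -> comp p U x u G -> comp p U y (fun z => (u y)^-1 * u z) (fun z => (u y)^-1 *: G z).
Proof.
move=> uy [WG LG u0 _]; split; [exact: WZ|exact: LpZ| |by rewrite mulVf].
by move=> z /u0 ->; rewrite mulr0.
Qed.

Lemma cap_gt0 p U x : 2 < p -> n%:R < p -> (exists u G, comp p U x u G) -> (exists z, ~ U z) -> 0 < cap p U x.
Proof.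
move=> p2 np ex [z Uz]; have [u [G [hu <-]]] := cap_attained p2 np ex.
rewrite lt_def energy_ge0 andbT; apply/eqP => E.
have [WG LG u0 u1] := hu; have := W_energy0 p2 np WG LG E x z.
by rewrite u1 u0// => /eqP; rewrite oner_eq0.
Qed.

End capacity.

(** * Rayleigh quotients and weighted capacities *)

Section rayleigh.
Context {R : realType} (n : nat).
Implicit Types (u v : 'rV[R]_n -> R) (G H : 'rV[R]_n -> 'rV[R]_n) (p c e : R) (Om : set 'rV[R]_n) (x y : 'rV[R]_n).

Lemma dist_compl_le Om x y : ~ Om y -> dist_compl Om x <= enorm (x - y).
Proof.
move=> h; apply: ge_inf; last by exists y.
by exists 0 => _ [z _ <-]; exact: enorm_ge0.
Qed.

Lemma dist_compl_ge Om x c : (exists y, ~ Om y) -> (forall y, ~ Om y -> c <= enorm (x - y)) -> c <= dist_compl Om x.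
Proof.
move=> [y0 h0] h; apply: lb_le_inf; first by exists (enorm (x - y0)), y0.
by move=> _ [y hy <-]; exact: h.
Qed.

Lemma dist_compl_lip Om x y : (exists z, ~ Om z) -> dist_compl Om x <= dist_compl Om y + enorm (x - y).
Proof.
move=> ex; rewrite -lerBlDr; apply: dist_compl_ge => // z hz.
rewrite lerBlDr (le_trans (dist_compl_le _ hz))//.
by rewrite -(subrK y x) -addrA [X in _ <= X]addrC subrK ler_enormD.
Qed.

Lemma dist_compl_attained Om x : open Om -> (exists z, ~ Om z) ->
 exists2 y, ~ Om y & dist_compl Om x = enorm (x - y).
Proof.
move=> oOm [z0 hz0].
pose r := `|x| + enorm (x - z0).
pose K := ~` Om `&` @cball R n r.
have cK : compact K.
 apply: bounded_closed_compact.
  by exists r; split; [exact: num_real|move=> M rM y [_ /le_trans]; apply; exact: ltW].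
 by apply: closedI; [exact: open_closedC|exact: closed_cball].
have Kz0 : K z0.
 split=> //; rewrite /cball /= /r; have : `|z0| <= `|x| + `|x - z0| by rewrite -{1}(subKr x z0) ler_normB.
 have := norm_le_enorm (x - z0); lra.
pose f y := enorm (x - y).
have cf : continuous f.
 apply: (@cont_comp _ _ _ (fun y => x - y)); last exact: enorm_continuous.
 have -> : (fun y => x - y) = (fun y => -1 *: y + x) by apply/funext => y; rewrite scaleN1r addrC.
 exact: continuous_affine_rV.
have cfK : compact (f @` K) by apply: continuous_compact => //; exact: continuous_subspaceT.
have [y [Ky hy]] : exists y, K y /\ forall z, K z -> f y <= f z.
 have hi : has_inf (f @` K) by split; [exists (f z0), z0|exists 0 => _ [w _ <-]; exact: enorm_ge0].
 have : closure (f @` K) (inf (f @` K)).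
  move=> B /nbhs_ballP[e /= e0 hB]; have [a Aa ai] := inf_adherent e0 hi.
  exists a; split=> //; apply: hB; rewrite -ball_normE /= distrC ger0_norm; first by rewrite ltrBlDl.
  by rewrite subr_ge0; apply: ge_inf => //; exact: hi.2.
 have clK : closed (f @` K) by apply: compact_closed => //; exact: Rhausdorff.
 rewrite -((closure_id _).1 clK) => -[y Ky Ey]; exists y; split=> // z Kz; rewrite Ey.
 by apply: ge_inf; [exact: hi.2|exists z].
exists y; first exact: Ky.1.
apply/eqP; rewrite eq_le (dist_compl_le x Ky.1); apply: dist_compl_ge; first by exists z0.
move=> z hz; have [zr|zr] := leP `|z| r; first exact: hy.
apply: (le_trans (hy _ Kz0)); rewrite /f; have := norm_le_enorm (x - z); rewrite /r in zr.
have : `|z| <= `|x| + `|x - z| by rewrite -{1}(subKr x z) ler_normB.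
lra.
Qed.

Lemma dist_compl_gt0 Om x : open Om -> (exists z, ~ Om z) -> Om x -> 0 < dist_compl Om x.
Proof.
move=> oOm ex Ox; have [y hy ->] := dist_compl_attained x oOm ex.
by rewrite enorm_gt0 subr_eq0; apply: contra_notN hy => /eqP <-.
Qed.

Section fixed.
Variables (p : R) (Om : set 'rV[R]_n).
Hypotheses (p2 : 2 < p) (np : n%:R < p) (oOm : open Om) (ex : exists z, ~ Om z).
Let al := 1 - n%:R / p.

Lemma al_p : al * p = p - n%:R.
Proof. by rewrite /al mulrBl mul1r mulfVK// gt_eqF// (p2_gt0 p2). Qed.

(** Morrey's inequality between x and a nearest point of the complement; it makes the supremum in
    [hardy_norm] a genuine one. *)
Lemma hardy_ub u G : W u G -> Lp p G -> (forall y, ~ Om y -> u y = 0) ->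
 has_ubound [set `|u x / dist_compl Om x `^ al| | x in Om].
Proof.
move=> WG LG u0; have [C C0 hC] := morrey_energy p2 np.
exists (C * energy p G `^ p^-1) => _ [x Ox <-].
have d0 := dist_compl_gt0 oOm ex Ox.
have [y hy Ey] := dist_compl_attained x oOm ex.
rewrite normrM normfV (ger0_norm (powR_ge0 _ _)) ler_pdivrMr ?powR_gt0//.
have := hC u G WG LG x y; rewrite (u0 y hy) subr0 => h; apply: (le_trans h).
rewrite ler_wpM2l ?mulr_ge0 ?powR_ge0 ?(ltW C0)// Ey.
by rewrite ge0_ler_powR ?nnegrE ?enorm_ge0 ?norm_le_enorm// ltW// al_gt0.
Qed.

Lemma hardy_ge u G x : W u G -> Lp p G -> (forall y, ~ Om y -> u y = 0) -> Om x ->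
 `|u x| <= hardy_norm p Om u * dist_compl Om x `^ al.
Proof.
move=> WG LG u0 Ox; have d0 := dist_compl_gt0 oOm ex Ox.
rewrite -ler_pdivrMr ?powR_gt0//.
apply: (@le_trans _ _ `|u x / dist_compl Om x `^ al|).
 by rewrite normrM normfV (ger0_norm (powR_ge0 _ _)).
by apply: ub_le_sup; [exact: hardy_ub WG LG u0|exists x].
Qed.

Lemma hardy_gt0 u G : W u G -> Lp p G -> (forall y, ~ Om y -> u y = 0) -> u <> (fun=> 0) ->
 0 < hardy_norm p Om u.
Proof.
move=> WG LG u0 un; have [x ux] : exists x, u x <> 0.
 by apply: contrapT => H; apply: un; apply/funext => x; apply: contrapT => h; apply: H; exists x.
have Ox : Om x by apply: contrapT => h; apply: ux; exact: u0.
have := hardy_ge WG LG u0 Ox; have d0 := dist_compl_gt0 oOm ex Ox.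
move=> h; rewrite -(@pmulr_lgt0 _ (dist_compl Om x `^ al)) ?powR_gt0//.
by apply: lt_le_trans h; rewrite normr_gt0; apply/eqP.
Qed.

Lemma rayleigh_le u G x : W u G -> Lp p G -> (forall y, ~ Om y -> u y = 0) -> Om x -> u x != 0 ->
 rayleigh p Om u <= dist_compl Om x `^ (p - n%:R) * (energy p G / `|u x| `^ p).
Proof.
move=> WG LG u0 Ox ux; have d0 := dist_compl_gt0 oOm ex Ox.
have p1 := p2_gt1 p2; have p0 := p2_gt0 p2.
have h := hardy_ge WG LG u0 Ox.
have upos : 0 < `|u x| by rewrite normr_gt0.
have h0 : 0 < hardy_norm p Om u.
 by rewrite -(@pmulr_lgt0 _ (dist_compl Om x `^ al)) ?powR_gt0//; exact: lt_le_trans h.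
rewrite /rayleigh (norm_DwE p1 WG LG) powRN mulrCA mulrC ler_wpM2l ?energy_ge0//.
rewrite ler_pdivlMr ?powR_gt0// ler_pdivrMl ?powR_gt0//.
rewrite -al_p powRrM -powRM ?(ltW h0)//.
by rewrite ge0_ler_powR ?nnegrE ?mulr_ge0 ?powR_ge0 ?(ltW h0) ?(ltW p0).
Qed.

Lemma rayleigh_ge u G c : W u G -> Lp p G -> (forall y, ~ Om y -> u y = 0) -> u <> (fun=> 0) -> 0 <= c ->
 (forall x, Om x -> u x != 0 -> c * `|u x| `^ p <= dist_compl Om x `^ (p - n%:R) * energy p G) ->
 c <= rayleigh p Om u.
Proof.
move=> WG LG u0 un c0 h.
have p1 := p2_gt1 p2; have p0 := p2_gt0 p2; have pn : p != 0 by rewrite gt_eqF.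
have h0 := hardy_gt0 WG LG u0 un.
rewrite /rayleigh (norm_DwE p1 WG LG) powRN ler_pdivlMl ?powR_gt0//.
have [->|cn] := eqVneq c 0; first by rewrite mulr0 energy_ge0.
have cp : 0 < c by rewrite lt_def cn.
rewrite mulrC -ler_pdivlMl//.
have : hardy_norm p Om u <= (c^-1 * energy p G) `^ p^-1.
 apply: ge_sup.
  have [x [Ox _]] : exists x, Om x /\ u x <> 0.
   apply: contrapT => H; apply: un; apply/funext => x; apply: contrapT => hx; apply: H; exists x.
   by split=> //; apply: contrapT => hO; apply: hx; exact: u0.
  by exists `|u x / dist_compl Om x `^ al|, x.
 move=> _ [x Ox <-]; have d0 := dist_compl_gt0 oOm ex Ox.
 rewrite normrM normfV (ger0_norm (powR_ge0 _ _)).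
 have [->|ux] := eqVneq (u x) 0; first by rewrite normr0 mul0r powR_ge0.
 have := h x Ox ux; rewrite -al_p powRrM -ler_pdivlMl// => hx.
 have q0 : 0 <= `|u x| / dist_compl Om x `^ al by rewrite divr_ge0 ?powR_ge0.
 have -> : `|u x| / dist_compl Om x `^ al = ((`|u x| / dist_compl Om x `^ al) `^ p) `^ p^-1.
  by rewrite -powRrM mulfV// powRr1.
 rewrite ge0_ler_powR ?nnegrE ?powR_ge0 ?invr_ge0 ?(ltW p0) ?mulr_ge0 ?invr_ge0 ?energy_ge0//.
 rewrite powRM ?invr_ge0 ?powR_ge0// -(powR_inv1 (powR_ge0 _ al)) -(powRrM _ (-1)) mulN1r powRN ler_pdivrMr ?powR_gt0//.
 by apply: (le_trans hx); rewrite mulrA mulrAC.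
move=> hh; have : hardy_norm p Om u `^ p <= ((c^-1 * energy p G) `^ p^-1) `^ p.
 by rewrite ge0_ler_powR ?nnegrE ?powR_ge0 ?(ltW h0) ?(ltW p0).
by rewrite -powRrM mulVf// powRr1// mulr_ge0 ?invr_ge0 ?energy_ge0// ltW.
Qed.

Definition ccap x := dist_compl Om x `^ (p - n%:R) * cap p Om x.

Lemma lambda_le_ccap x : Om x -> (lambda p Om <= (ccap x)%:E)%E.
Proof.
move=> Ox; have [u [G [[WG LG u0 u1] E]]] := cap_attained p2 np (comp_exists (p2_gt0 p2) oOm Ox).
apply: (@le_trans _ _ (rayleigh p Om u)%:E).
 apply: ereal_inf_lbound; exists u => //; split.
  by split=> //; apply/D1pP => //; exists G.
 by move=> h; move: u1; rewrite h => /eqP; rewrite eq_sym oner_eq0.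
rewrite lee_fin; have := rayleigh_le WG LG u0 Ox; rewrite u1 normr1 powR1 divr1 E; apply; exact: oner_neq0.
Qed.

Lemma admissible_ccap u c : admissible p Om u -> 0 <= c -> (forall x, Om x -> c <= ccap x) -> c <= rayleigh p Om u.
Proof.
move=> [[Du u0] un] c0 h; have [G [WG LG]] := (D1pP u p2 np).1 Du.
apply: (rayleigh_ge WG LG u0 un c0) => x Ox ux.
have hc : comp p Om x (fun z => (u x)^-1 * u z) (fun z => (u x)^-1 *: G z).
 split; [exact: WZ|exact: LpZ| |by rewrite mulVf]. by move=> z /u0 ->; rewrite mulr0.
have := cap_le hc; rewrite energyZ// => k.
apply: (le_trans (ler_wpM2r (powR_ge0 _ _) (h x Ox))).
rewrite /ccap -mulrA ler_wpM2l ?powR_ge0//.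
apply: (le_trans (ler_wpM2r (powR_ge0 _ _) k)).
by rewrite mulrAC -powRM// normfV mulVf ?normr_eq0// powR1 mul1r.
Qed.

(** The capacitary function of an optimal point is an extremal: its quotient is at most [ccap x0],
    which bounds every admissible quotient from below. *)
Lemma extremal_of_min x0 : Om x0 -> (forall x, Om x -> ccap x0 <= ccap x) -> exists u, extremal p Om u.
Proof.
move=> Ox h; have [u [G [[WG LG u0 u1] E]]] := cap_attained p2 np (comp_exists (p2_gt0 p2) oOm Ox).
have au : admissible p Om u.
 split; first by split=> //; apply/D1pP => //; exists G.
 by move=> hu; move: u1; rewrite hu => /eqP; rewrite eq_sym oner_eq0.
exists u; split=> //; apply/eqP; rewrite eq_le; apply/andP; split.
 apply: le_ereal_inf_tmp => _ [v av <-]; rewrite lee_fin. apply: (@le_trans _ _ (ccap x0)).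
  have := rayleigh_le WG LG u0 Ox; rewrite u1 normr1 powR1 divr1 E; apply; exact: oner_neq0.
 apply: admissible_ccap => //; rewrite /ccap mulr_ge0 ?powR_ge0//. by rewrite -E energy_ge0.
by apply: ereal_inf_lbound; exists u.
Qed.

End fixed.

End rayleigh.

(** * Householder reflections *)

Section householder.
Context {R : realType} (n : nat).
Implicit Types x v a b : 'rV[R]_n.

(** The reflection in the hyperplane orthogonal to v. For v = 0 it is the identity, so that [hh_map]
    includes the case a = b. *)
Definition hh v : 'M[R]_n := 1%:M - (2 / dotp v v) *: (v^T *m v).

Lemma hhE v x : x *m hh v = x - (2 * dotp x v / dotp v v) *: v.
Proof.
rewrite /hh mulmxBr mulmx1 -scalemxAr mulmxA; congr (_ - _).
rewrite [x *m v^T]mx11_scalar -dotpE mul_scalar_mx scalerA; congr (_ *: _); ring.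
Qed.

Lemma hhK v x : x *m hh v *m hh v = x.
Proof.
rewrite !hhE dotpBl dotpZl; have [/eqP|v0] := eqVneq (dotp v v) 0.
 by rewrite dotp_eq0 => /eqP ->; rewrite !scaler0 !subr0.
by rewrite -addrA -opprD -scalerDl [X in X *: v](_ : _ = 0) ?scale0r ?subr0//; field.
Qed.

Lemma hh_orthogonal v : orthogonal_mx (hh v).
Proof.
have T : (hh v)^T = hh v by rewrite /hh linearB /= tr_scalar_mx linearZ /= trmx_mul trmxK.
by rewrite /orthogonal_mx T; apply/row_matrixP => i; rewrite row_mul !rowE hhK mulmx1.
Qed.

Lemma hh_map a b : dotp a a = dotp b b -> a *m hh (a - b) = b.
Proof.
move=> ab; rewrite hhE; have [/eqP|v0] := eqVneq (dotp (a - b) (a - b)) 0.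
 by rewrite dotp_eq0 subr_eq0 => /eqP ->; rewrite subrr scaler0 subr0.
have -> : 2 * dotp a (a - b) = dotp (a - b) (a - b).
 by rewrite !(dotpBl, dotpBr) (dotpC b a) -ab; ring.
by rewrite mulfV// scale1r subKr.
Qed.

Lemma dotp_basis x i : dotp x (basis_rV i) = x 0 i.
Proof.
rewrite /dotp (bigD1 i)//= mxE !eqxx mulr1 big1 ?addr0// => j ji.
by rewrite mxE eqxx (negbTE ji) mulr0.
Qed.

Lemma hh_flip i x : x *m hh (basis_rV i) = x - (2 * x 0 i) *: basis_rV i.
Proof. by rewrite hhE !dotp_basis mxE !eqxx divr1. Qed.

Lemma hh_swap i j x : i != j -> x *m hh (basis_rV i - basis_rV j) = x - (x 0 i - x 0 j) *: (basis_rV i - basis_rV j).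
Proof.
move=> ij; rewrite hhE !(dotpBl, dotpBr) !dotp_basis !mxE !eqxx /= (eq_sym j i) (negbTE ij).
rewrite mulr0n.
rewrite mulr1n.
by congr (_ - _ *: _); field.
Qed.

End householder.

(** * The capacity of the half space *)

Section half_space_capacity.
Context {R : realType} (n : nat).
Local Notation rV := 'rV[R]_n.+1.
Implicit Types (u v : rV -> R) (G H : rV -> rV) (p c e : R) (x y : rV).

Definition ev : rV := basis_rV ord0.
Definition Hs : set rV := [set x | 0 < x 0 ord0].
(** What is known to contain a blow-up of a C^2 domain at a boundary point: inside the cube of
    radius k + 1 it lies in the half space up to a layer of width 1/(k+1), and outside the cube
    nothing is known. *)
Definition Wk (k : nat) : set rV :=
 [set x : rV | - k.+1%:R^-1 < x 0 ord0 \/ k.+1%:R < `|x|].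
Definition lstar p := cap p Hs ev.

Lemma ev_0 : ev 0 ord0 = 1. Proof. by rewrite /ev mxE !eqxx. Qed.

Lemma open_Hs : open Hs.
Proof.
apply: (@open_comp _ _ (fun x => x 0 ord0) [set y | 0 < y]); last exact: open_gt.
by move=> x _; exact: continuous_coord.
Qed.

Lemma Hs_ev : Hs ev. Proof. by rewrite /Hs /= ev_0. Qed.

Lemma Hs_ex p : 2 < p -> exists u G, comp p Hs ev u G.
Proof. by move=> p2; apply: comp_exists; [exact: p2_gt0|exact: open_Hs|exact: Hs_ev]. Qed.

Lemma Hs_compl : exists z, ~ Hs z.
Proof. by exists 0; rewrite /Hs /= mxE ltxx. Qed.

Lemma lstar_gt0 p : 2 < p -> n.+1%:R < p -> 0 < lstar p.
Proof. by move=> p2 np; apply: cap_gt0 => //; [exact: Hs_ex|exact: Hs_compl]. Qed.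

Lemma Wk_Hs k : Hs `<=` Wk k.
Proof. by move=> x hx; left; apply: lt_trans hx; rewrite oppr_lt0 invr_gt0. Qed.

Lemma Wk_dec k l : (k <= l)%N -> Wk l `<=` Wk k.
Proof.
move=> kl x [h|h]; [left|right].
 by apply: le_lt_trans h; rewrite lerN2 lef_pV2 ?posrE// ler_nat.
by apply: le_lt_trans h; rewrite ler_nat.
Qed.

Lemma Wk_ex p k : 2 < p -> exists u G, comp p (Wk k) ev u G.
Proof.
by move=> /Hs_ex[u [G h]]; exists u, G; apply: comp_subset h; exact: Wk_Hs.
Qed.

Lemma cap_Wk_mono p k l : 2 < p -> (k <= l)%N -> cap p (Wk k) ev <= cap p (Wk l) ev.
Proof.
by move=> p2 kl; apply: cap_ge; [exact: Wk_ex|move=> u G h; apply: cap_le; apply: comp_subset h; exact: Wk_dec].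
Qed.

(** If the capacities stayed below c, the minimizers for [Wk k] would converge to a function of
    energy at most c vanishing at negative heights and, by continuity, at height 0: a competitor in
    the half space. *)
Lemma cap_Wk_cvg p c : 2 < p -> n.+1%:R < p -> c < lstar p -> exists K, forall k, (K <= k)%N -> c < cap p (Wk k) ev.
Proof.
move=> p2 np cl; apply: contrapT => H.
have le k : cap p (Wk k) ev <= c.
 rewrite leNgt; apply/negP => h; apply: H; exists k => l kl.
 by apply: lt_le_trans h _; exact: cap_Wk_mono.
have ex k : exists uG : (rV -> R) * (rV -> rV),
  comp p (Wk k) ev uG.1 uG.2 /\ energy p uG.2 = cap p (Wk k) ev.
 by have [u [G h]] := cap_attained p2 np (Wk_ex k p2); exists (u, G).
have [uG huG] := choice ex.
pose m k := cap p (Wk k) ev.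
have [l hl] : exists l : R, forall e, 0 < e -> exists K, forall k, (K <= k)%N -> l - e <= m k /\ m k <= l.
 exists (sup (range m)) => e e_gt0.
 have hs : has_sup (range m) by split; [exists (m 0%N), 0%N|exists c => _ [k _ <-]; exact: le].
 have [_ [K _ <-] hK] := sup_adherent e_gt0 hs; exists K => k Kk; split.
  by apply: ltW; apply: lt_le_trans hK _; exact: cap_Wk_mono.
 by apply: ub_le_sup; [exact: hs.2|exists k].
have p0 := p2_ge0 p2.
have [|||u [G [WG LG hE u1 u0]]] := @limit_comp R n.+1 p Wk ev (fun k => (uG k).1) (fun k => (uG k).2) c p2 np.
- by move=> k; exact: (huG k).1.
- move=> e e_gt0; have [K hK] := hl e e_gt0; exists K => i j Ki Kj.
 (* The midpoint is a competitor for the larger of the two sets, which has the smaller index. *)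
 have h1 : m (minn i j) <= energy p (fun x => 2^-1 *: ((uG i).2 x + (uG j).2 x)).
  apply: cap_le; apply: comp_mid => //; apply: comp_subset (huG _).1; apply: Wk_dec; [exact: geq_minl|exact: geq_minr].
 rewrite (huG i).2 (huG j).2 -/(m i) -/(m j).
 apply: (@le_trans _ _ (m (minn i j) + e)); last by rewrite lerD2r; exact: h1.
 have [h2 h3] := hK i Ki; have [h4 h5] := hK j Kj.
 have Kij : (K <= minn i j)%N by rewrite leq_min Ki Kj. have [h6 h7] := hK _ Kij.
 clear - h2 h3 h4 h5 h6 h7 e_gt0; set a := m i in h2 h3 *; set b := m j in h4 h5 *.
 set d := m (minn i j) in h6 h7 *; clearbody a b d; lra.
- move=> e e_gt0; exists 0%N => k _; rewrite (huG k).2.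
 by apply: (le_trans (le k)); rewrite lerDl ltW.
have neg y : y 0 ord0 < 0 -> u y = 0.
 move=> y0; apply: u0. have ny0 : 0 < - y 0 ord0 by rewrite oppr_gt0.
 have [K1 _ hK1] := near_natSinv ny0. have [K2 hK2] : exists K2 : nat, `|y| <= K2.+1%:R.
  exists (Num.truncn `|y|); apply: ltW; rewrite -truncn_le_nat//.
 exists (maxn K1 K2) => k Kk; case.
  have := hK1 k (leq_trans (leq_maxl _ _) Kk) => h; by rewrite ltrNl ltNge h.
 apply/negP; rewrite -leNgt (le_trans hK2)// ler_nat ltnS. by apply: leq_trans Kk; exact: leq_maxr.
have : comp p Hs ev u G.
 split=> // y; rewrite /Hs => /negP; rewrite -leNgt => hy.
 apply/eqP; rewrite -normr_le0; apply: (@le_eps R _ 1) => // e e_gt0.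
 have h := cont_near_eps (WG.1 y) e_gt0.
 (* A point of height 0 is approached from below, where u is already known to vanish. *)
 have [d d0 hd] : exists2 d : R, 0 < d & `|u y - u (y - d *: ev)| <= e.
  have /nbhs_ballP[d /= d0 hd] := h; exists (d / 2); first by rewrite divr_gt0.
  apply: hd; rewrite -ball_normE /= opprB addrC subrK norm_scale_basis ger0_norm; lra.
 by move: hd; rewrite (neg (y - d *: ev)) ?subr0 ?mulr1// !mxE !eqxx mulr1; lra.
move=> /cap_le; rewrite -/(lstar p) => h.
by move: (lt_le_trans cl h); rewrite ltNge hE.
Qed.

(* Competitors are rescaled: x is at height d above the boundary point b. *)
Lemma lstar_scaling p (Q : 'M[R]_n.+1) (b x : rV) d V u G : 2 < p -> orthogonal_mx Q -> 0 < d ->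
 comp p V x u G -> (forall z, V (d *: (z *m Q) + b) -> Hs z) -> d *: (ev *m Q) + b = x ->
 lstar p <= d `^ (p - n.+1%:R) * energy p G.
Proof.
move=> p2 oQ d0 hc hV hx; have dn : d != 0 by rewrite gt_eqF.
have [h1 E1] := @comp_dilate R n.+1 p V [set z | V (d *: z + b)] x (ev *m Q) u G d b dn hc (fun z h => h) hx.
have [h2 E2] := @comp_orthogonal R n.+1 p _ Hs (ev *m Q) ev _ _ Q oQ h1 hV erefl.
by have := cap_le h2; rewrite E2 E1 gtr0_norm.
Qed.

Lemma lstar_le_lambda p : 2 < p -> n.+1%:R < p -> ((lstar p)%:E <= lambda p (half_space n))%E.
Proof.
move=> p2 np; apply: le_ereal_inf_tmp => _ [u [[Du u0] un] <-]; rewrite lee_fin.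
have [G [WG LG]] := (D1pP u p2 np).1 Du.
have ex : exists z : rV, ~ half_space n z by exists 0; rewrite /half_space /= mxE ltxx.
have oH : open (half_space n : set rV).
 apply: (@open_comp _ _ (fun x => x 0 ord_max) [set y | 0 < y]); last exact: open_gt.
 by move=> x _; exact: continuous_coord.
apply: (rayleigh_ge p2 np oH ex WG LG u0 un); first by apply: ltW; exact: lstar_gt0.
move=> x hx ux; have d0 : 0 < x 0 ord_max by [].
have hc : comp p (half_space n) x (fun z => (u x)^-1 * u z) (fun z => (u x)^-1 *: G z).
 split; [exact: WZ|exact: LpZ| |by rewrite mulVf]. by move=> z /u0 ->; rewrite mulr0.
(* This reflection exchanges the first and the last axis, which are the normals of [Hs] and
   [half_space]. *)
pose S := hh (ev - basis_rV ord_max).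
have := @lstar_scaling p S (x - x 0 ord_max *: (ev *m S)) x (x 0 ord_max) _ _ _ p2 (hh_orthogonal _) d0 hc.
move=> h.
have sw (z : rV) : (z *m S) 0 ord_max = z 0 ord0.
 have [E|E] := eqVneq (@ord0 n) ord_max.
  by rewrite /S /ev E subrr /hh mulmx0 scaler0 subr0 mulmx1 -E.
 rewrite /S /ev hh_swap// !mxE !eqxx /= eq_sym (negbTE E). rewrite mulr0n. rewrite mulr1n. by ring.
have {}h : lstar p <= x 0 ord_max `^ (p - n.+1%:R) * energy p (fun z => (u x)^-1 *: G z).
 apply: h; last by rewrite addrC subrK. move=> z; rewrite /half_space /Hs /=.
 have -> : (x 0 ord_max *: (z *m S) + (x - x 0 ord_max *: (ev *m S))) 0 ord_max =
  x 0 ord_max * (z *m S) 0 ord_max + (x 0 ord_max - x 0 ord_max * (ev *m S) 0 ord_max).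
  by move: (z *m S) (ev *m S) => A B; rewrite !mxE.
 by rewrite !sw ev_0 mulr1 subrr addr0 pmulr_rgt0.
rewrite energyZ// in h.
apply: (le_trans (ler_wpM2r (powR_ge0 _ _) h)).
rewrite -mulrA mulrAC -powRM// normfV mulVf ?normr_eq0// powR1 mul1r.
rewrite ler_wpM2r ?energy_ge0// ge0_ler_powR ?nnegrE ?subr_ge0 ?(ltW np) ?(ltW d0)//.
 by apply: dist_compl_ge => // y _; exact: enorm_ge0.
apply: dist_compl_ge => // y; rewrite /half_space => /negP; rewrite -leNgt => hy.
apply: le_trans (coord_le_enorm _ ord_max); rewrite rVB (le_trans _ (ler_norm _)); lra.
Qed.

End half_space_capacity.

Arguments ev {R n}.
Arguments Hs {R n}.
Arguments Wk {R n} k.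

(** * C^2 boundaries in local coordinates *)

Section local_geometry.
Context {R : realType}.

(** Strict differentiability: the base point moves while the derivative stays frozen at x0. The
    blow-ups are centred at varying points near a fixed boundary point, so plain differentiability
    there would not suffice. *)
Lemma C1_strict m (f : 'rV[R]_m -> R) (df : 'I_m -> 'rV[R]_m -> R) x0 e :
 (forall i x, pd i f x (df i x)) -> (forall i, continuous (df i)) -> 0 < e ->
 exists2 d, 0 < d & forall x v, `|x - x0| <= d -> `|v| <= d ->
  `|f (x + v) - f x - \sum_i v 0 i * df i x0| <= e * `|v|.
Proof.
move=> hf cdf e_gt0.
have e1 : 0 < e / 2 by rewrite divr_gt0.
have e2 : 0 < e / (2 * (m%:R + 1)) by rewrite divr_gt0// mulr_gt0 ltr_wpDl.
have [d1 d10 h1] := C1_taylor (`|x0| + 1) hf cdf e1.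
have [d2 d20 h2] := unif_fam `|x0| cdf e2.
exists (Num.min (Num.min d1 d2) 1); first by rewrite !lt_min d10 d20 ltr01.
move=> x v; rewrite !le_min => /andP[/andP[x1 x2] x3] /andP[/andP[v1 v2] v3].
have xr : `|x| <= `|x0| + 1.
 have : `|x| <= `|x0| + `|x - x0| by rewrite addrC -{1}(subrK x0 x) ler_normD. lra.
have k1 := h1 x v xr v1.
have k2 : `|\sum_i v 0 i * df i x - \sum_i v 0 i * df i x0| <= e / 2 * `|v|.
 rewrite -sumrB (le_trans (ler_norm_sum _ _ _))//.
 apply: (@le_trans _ _ (\sum_(i < m) (e / (2 * (m%:R + 1)) * `|v|))).
  apply: ler_sum => i _; rewrite -mulrBr normrM mulrC ler_pM//; last exact: coord_le_norm.
  by rewrite distrC; apply: h2 => //; rewrite distrC.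
 rewrite sumr_const card_ord -[X in X <= _]mulr_natl mulrA ler_wpM2r//.
 rewrite mulrA ler_pdivrMr//. have -> : e / 2 * (2 * (m%:R + 1)) = e * m%:R + e by field.
 by rewrite mulrC; lra.
move: k1 k2; set a := \sum_i _; set b := \sum_i _ => k1 k2.
have -> : f (x + v) - f x - b = (f (x + v) - f x - a) + (a - b) by ring.
by rewrite (le_trans (ler_normD _ _)); lra.
Qed.

Variable n : nat.
Local Notation rV := 'rV[R]_n.+1.
Implicit Types (Om : set rV) (x y v xi : rV) (f : 'rV[R]_n -> R).

Definition defun f (xi : rV) : R := xi 0 ord_max - f (horizontal xi).

Definition ddefun f i (xi : rV) : R :=
 (i == ord_max)%:R - \sum_j (i == widen_ord (leqnSn n) j)%:R * partial j f (horizontal xi).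

Lemma C_pd m k (f : 'rV[R]_m -> R) i : C_ k.+1 f -> (forall x : 'rV[R]_m, pd i f x (partial i f x)) /\ C_ k (partial i f).
Proof. by move=> [_ /(_ i)[h1 h2]]; split=> // x; exact: derivable_pd. Qed.

Lemma horizontal_cont : continuous (@horizontal R n).
Proof. by apply: continuous_rVP => j; under eq_fun do rewrite mxE; exact: continuous_coord. Qed.

Lemma pd_defun f i xi : C_ 1 f -> pd i (defun f) xi (ddefun f i xi).
Proof.
move=> Cf; apply: pdB; first exact: pd_coord.
apply: (pd_chain (df := fun j => partial j f)).
- by move=> j y; have [] := C_pd j Cf.
- by move=> j; have [_ h] := C_pd j Cf; exact: C_cont h.
- by move=> j; under eq_fun do rewrite mxE; exact: pd_coord.
Qed.

Lemma cont_ddefun f i : C_ 1 f -> continuous (ddefun f i).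
Proof.
move=> Cf; apply: contB; first exact: cont_cst.
apply: cont_sum => j _; apply: contM; first exact: cont_cst.
by apply: cont_comp horizontal_cont _; have [_ h] := C_pd j Cf; exact: C_cont h.
Qed.

Definition grad_defun f (xi : rV) : rV := \row_i ddefun f i xi.

Lemma grad_defun_max f xi : grad_defun f xi 0 ord_max = 1.
Proof.
rewrite mxE /ddefun eqxx big1 ?subr0// => j _.
by rewrite (_ : (ord_max == widen_ord _ j) = false) ?mul0r//; apply/negbTE; rewrite neq_ltn /= ltn_ord orbT.
Qed.

Lemma grad_defun_gt0 f xi : 0 < enorm (grad_defun f xi).
Proof.
rewrite enorm_gt0; apply/eqP => h; have := grad_defun_max f xi.
by rewrite h mxE => /eqP; rewrite eq_sym oner_eq0.
Qed.

(* The rotation taking the vertical direction to the inner normal. *)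
Definition frame f (Q : 'M[R]_n.+1) (xi : rV) : 'M[R]_n.+1 :=
 hh (ev - (enorm (grad_defun f xi))^-1 *: grad_defun f xi) *m Q^T.

Lemma orthogonalM (A B : 'M[R]_n.+1) : orthogonal_mx A -> orthogonal_mx B -> orthogonal_mx (A *m B).
Proof.
by move=> oA oB; rewrite /orthogonal_mx trmx_mul mulmxA -(mulmxA A) oB mulmx1.
Qed.

Lemma frame_orthogonal f Q xi : orthogonal_mx Q -> orthogonal_mx (frame f Q xi).
Proof. by move=> oQ; apply: orthogonalM; [exact: hh_orthogonal|exact: orthogonal_tr]. Qed.

Lemma frame_normal f xi : ev *m hh (ev - (enorm (grad_defun f xi))^-1 *: grad_defun f xi) =
 (enorm (grad_defun f xi))^-1 *: grad_defun f xi.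
Proof.
apply: hh_map; rewrite dotpZl dotpZr /ev dotp_basis mxE !eqxx -enormE.
rewrite mulr1n.
have := grad_defun_gt0 f xi; set a := enorm _ => a0; field; by rewrite gt_eqF.
Qed.

Lemma frame_dotp f Q xi v : orthogonal_mx Q ->
 dotp (grad_defun f xi) (v *m frame f Q xi *m Q) = enorm (grad_defun f xi) * v 0 ord0.
Proof.
move=> oQ; have QQ : Q^T *m Q = 1%:M by exact: mulmx1C.
rewrite /frame !mulmxA -(mulmxA _ Q^T) QQ mulmx1.
set M := hh _; set g := grad_defun f xi.
have g0 : enorm g != 0 by rewrite gt_eqF// grad_defun_gt0.
have E : g = enorm g *: (ev *m M) by rewrite frame_normal scalerA mulfV// scale1r.
have -> : dotp g (v *m M) = enorm g * dotp (ev *m M) (v *m M) by rewrite {1}E dotpZl.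
rewrite dotp_orthogonal; last exact: hh_orthogonal.
by congr (_ * _); rewrite /ev dotpC dotp_basis.
Qed.

Lemma sumE_dotp (a : 'I_n.+1 -> R) v : \sum_i v 0 i * a i = dotp (\row_i a i) v.
Proof. by apply: eq_bigr => i _; rewrite mxE mulrC. Qed.

(** One frame, taken at z, serves all y outside the domain near z: leaving y in a direction that
    points outwards with slope e, up to the factor g0, one stays outside. *)
Lemma local_frame Om z : C2_set Om -> boundary Om z -> exists Q (g0 : R), [/\ orthogonal_mx Q, 0 < g0 &
 forall e, 0 < e -> exists2 r, 0 < r & forall y v, `|y - z| <= r -> `|v| <= r -> ~ Om y ->
  g0 * v 0 ord0 + e * enorm v <= 0 -> ~ Om (y + v *m Q)].
Proof.
move=> C2 bz; have [T [f [[Q [b [oQ TE]]] C2f nz]]] := C2 z bz.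
have C1f : C_ 1 f by exact: C_S.
exists (frame f Q (T z)), (enorm (grad_defun f (T z))); split; [exact: frame_orthogonal|exact: grad_defun_gt0|].
move=> e e_gt0.
have [d d0 hd] := @C1_strict n.+1 (defun f) (ddefun f) (T z) e (fun i x => @pd_defun f i x C1f) (fun i => @cont_ddefun f i C1f) e_gt0.
have /nbhs_ballP[rz /= rz0 hrz] := nz.
pose N : R := n.+1%:R; have N1 : 1 <= N by rewrite ler1n.
have mulO (v) (S : 'M[R]_n.+1) : orthogonal_mx S -> `|v *m S| <= N * `|v|.
 by move=> oS; rewrite (le_trans (norm_le_enorm _))// enorm_orthogonal// enorm_le_norm.
(* The factor N = n + 1 converts between the sup norm, which defines neighbourhoods, and the
   Euclidean norm, which rotations preserve. *)
pose r := Num.min (rz / (4 * N)) (d / N).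
have r0 : 0 < r by rewrite lt_min !divr_gt0//; lra.
exists r => // y v yz vr Oy hv.
have oF : orthogonal_mx (frame f Q (T z)) by exact: frame_orthogonal.
have rle : N * r <= rz / 4.
 rewrite mulrC -ler_pdivlMr; last by lra.
 have -> : rz / 4 / N = rz / (4 * N) by rewrite invfM mulrA. by rewrite /r ge_min lexx.
have rle2 : N * r <= d by rewrite mulrC -ler_pdivlMr; [rewrite /r ge_min lexx orbT|lra].
have rN : r <= N * r by rewrite ler_peMl// ltW.
have vF : `|v *m frame f Q (T z)| <= N * r by apply: (le_trans (mulO v _ oF)); rewrite ler_wpM2l//; lra.
have h1 : ball z rz y by rewrite -ball_normE /= distrC; lra.
have h2 : ball z rz (y + v *m frame f Q (T z)).
 rewrite -ball_normE /= opprD addrA (le_lt_trans (ler_normB _ _))// (distrC z). lra.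
have {}h1 := hrz _ h1; have {}h2 := hrz _ h2.
have Ty : T (y + v *m frame f Q (T z)) = T y + v *m frame f Q (T z) *m Q by rewrite !TE mulmxDl addrAC.
have yz' : `|T y - T z| <= d.
 rewrite !TE opprD addrACA subrr addr0 -mulmxBl (le_trans (mulO _ _ oQ))//.
 by apply: le_trans rle2; rewrite ler_wpM2l//; lra.
pose w := v *m frame f Q (T z) *m Q.
have ew : enorm w = enorm v by rewrite /w !enorm_orthogonal.
have wd' : `|w| <= d.
 rewrite (le_trans (norm_le_enorm _))// ew (le_trans (enorm_le_norm _))//.
 by apply: le_trans rle2; rewrite ler_wpM2l//; lra.
have := hd (T y) w yz' wd'.
rewrite sumE_dotp -/(grad_defun f (T z)) frame_dotp// => k.
have k2 : defun f (T y) <= 0.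
 rewrite leNgt; apply/negP => h; apply: Oy; apply/h1; by rewrite -subr_gt0.
have k3 : e * `|w| <= e * enorm v by rewrite ler_wpM2l ?(ltW e_gt0)// -ew norm_le_enorm.
move=> /h2; rewrite Ty -/w -subr_gt0 -/(defun f (T y + w)) => k4.
have := le_trans (ler_norm _) k; move: hv k2 k3 k4.
set A := _ * v 0 ord0; set B := e * enorm v; set C := e * `|w|; set D := defun _ _; set E := defun _ _.
clear; lra.
Qed.

End local_geometry.

(** * Existence of an extremal below the half space level *)

Section existence.
Context {R : realType} (n : nat).
Local Notation rV := 'rV[R]_n.+1.
Implicit Types (Om : set rV) (x y z : rV) (p : R).

Lemma compact_lower_bound (K : set rV) (f : rV -> R) (P : set rV) m : compact K ->
 (forall z, K z -> exists d r, [/\ 0 < d, 0 < r & forall x, `|x - z| < r -> P x -> m + d <= f x]) ->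
 exists2 d, 0 < d & forall x, K x -> P x -> m + d <= f x.
Proof.
move=> cK h; move: cK; rewrite compact_near_coveringP => /(_ R (0 : R)^'+
 (fun d x => P x -> m + d <= f x) _).
case.
 move=> z /h[d [r [d0 r0 hd]]].
 exists (ball z r, [set t | t < d]) => /=; first by split; [exact: nbhsx_ballx|exact: nbhs_right_lt].
 move=> [x t] /= [hx ht] Px; apply: le_trans (hd x _ Px); first by rewrite lerD2l ltW.
 by move: hx; rewrite -ball_normE distrC.
move=> d /= d0 hd; exists (d / 2); first by rewrite divr_gt0.
move=> x Kx; apply: (hd (d / 2)) => //=; last by rewrite divr_gt0.
by rewrite sub0r normrN gtr0_norm; lra.
Qed.

(** By Morrey's inequality a competitor for x is at least 1 - eta at y; divided by its value there
    it becomes a competitor for y. *)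
Lemma cap_near p : 2 < p -> n.+1%:R < p -> exists2 C, 0 < C &
 forall (U : set rV) x y u G eta, comp p U x u G ->
  C * energy p G `^ p^-1 * `|x - y| `^ (1 - n.+1%:R / p) <= eta ->
  cap p U y * pp (1 - eta) `^ p <= energy p G.
Proof.
move=> p2 np; have [C C0 hC] := morrey_energy p2 np; exists C => // U x y u G eta hc hn.
have [WG LG u0 u1] := hc; have p0 := p2_gt0 p2.
have [e1|e1] := leP (1 - eta) 0; first by rewrite pp_neg// powR0 ?gt_eqF// mulr0 energy_ge0.
have := le_trans (hC u G WG LG x y) hn; rewrite u1 => h.
have uy : 1 - eta <= u y by move: h; rewrite ler_norml => /andP[_]; lra.
have uy0 : 0 < u y by apply: lt_le_trans uy.
have := cap_le (compZ (lt0r_neq0 uy0) hc); rewrite energyZ// normfV => k.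
rewrite pp_pos; last exact: ltW.
apply: (le_trans (ler_wpM2r (powR_ge0 _ _) k)); rewrite mulrAC ler_piMl ?energy_ge0//.
rewrite -powRM ?(ltW e1)// (gtr0_norm uy0) mulrC.
have q1 : (1 - eta) / u y <= 1 by rewrite ler_pdivrMr// mul1r.
have q0 : 0 <= (1 - eta) / u y by rewrite divr_ge0 ?ltW.
rewrite -[X in _ <= X](_ : 1 `^ p = 1); last by rewrite powR1.
by rewrite ge0_ler_powR ?nnegrE// ltW.
Qed.

Lemma cont_near_lt (h : R -> R) c : continuous h -> c < h 0 -> exists2 r, 0 < r & forall t, 0 <= t -> t <= r -> c < h t.
Proof.
move=> ch hc; have e0 : 0 < (h 0 - c) / 2 by rewrite divr_gt0// subr_gt0.
have := cont_near_eps (ch 0) e0 => /nbhs_ballP[r /= r0 hr]; exists (r / 2); first by rewrite divr_gt0.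
move=> t t0 tr; have := hr t; rewrite -ball_normE /= sub0r normrN ger0_norm// => /(_ _) k.
have {}k : `|h 0 - h t| <= (h 0 - c) / 2 by apply: k; lra.
by have := le_trans (ler_norm _) k; lra.
Qed.

Lemma bounded_complement Om : bounded_set Om -> exists z, ~ Om z.
Proof.
move=> [M [_ hM]]; exists ((`|M| + 2) *: ev) => Oe.
have h1 := ler_norm M; have h2 := normr_ge0 M.
have MM : M < `|M| + 1 by lra.
by have := hM _ MM _ Oe; rewrite /= /ev norm_scale_basis ger0_norm; lra.
Qed.

Section attained.
Variables (p : R) (Om : set rV).
Hypotheses (p2 : 2 < p) (np : n.+1%:R < p) (oOm : open Om) (ex : exists z, ~ Om z).
Let al := 1 - n.+1%:R / p.
Let al0 : 0 < al := al_gt0 np.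
Let p0 : 0 < p := p2_gt0 p2.
Let np0 : 0 < p - n.+1%:R. Proof. by rewrite subr_gt0. Qed.
Let N : R := n.+1%:R.

Lemma ccap_ge0 x : Om x -> 0 <= ccap p Om x.
Proof.
move=> Ox; rewrite /ccap mulr_ge0 ?powR_ge0//.
by have [v [H [_ <-]]] := cap_attained p2 np (comp_exists p0 oOm Ox); exact: energy_ge0.
Qed.

Lemma ccap_lsc z c : Om z -> 0 <= c -> c < ccap p Om z ->
 exists2 r, 0 < r & forall x, `|x - z| < r -> Om x -> c <= ccap p Om x.
Proof.
move=> Oz c0 cz; have [C C0 hC] := cap_near p2 np.
have D0 := dist_compl_gt0 oOm ex Oz; set D := dist_compl Om z in D0.
pose E1 := c / (D / 2) `^ (p - N).
have DD : 0 < D / 2 by rewrite divr_gt0.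
have E10 : 0 <= E1 by rewrite divr_ge0 ?powR_ge0.
(* A lower bound for [ccap] at distance t from z, valid where [ccap] is below c: there the capacity
   is at most [E1], because the distance to the complement is at least D/2. As h exceeds c near t =
   0, this is absurd. *)
pose h t := pp ((D - N * t) / D) `^ (p - N) * pp (1 - C * E1 `^ p^-1 * pp t `^ al) `^ p * ccap p Om z.
have cid : continuous (fun t : R => t) by move=> t.
have ch : continuous h.
 have c1 : continuous (fun t : R => (D - N * t) / D) by ctn.
 have c2 : continuous (fun t : R => 1 - C * E1 `^ p^-1 * pp t `^ al) by ctn; exact: cont_ppowR.
 by rewrite /h; ctn; [exact: cont_comp c1 (cont_ppowR np0)|exact: cont_comp c2 (cont_ppowR p0)].
have h0 : c < h 0.
 rewrite /h mulr0 subr0 mulfV ?gt_eqF// (pp_pos (lexx 0)) powR0 ?gt_eqF// mulr0 subr0.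
 by rewrite !(pp_pos ler01) !powR1 !mul1r.
have [r r0 hr] := cont_near_lt ch h0.
have N1 : 1 <= N by rewrite ler1n.
pose r' := Num.min r (D / (2 * N)).
have r'0 : 0 < r' by rewrite lt_min r0 divr_gt0// mulr_gt0//; lra.
exists r' => // x xz Ox; rewrite leNgt; apply/negP => hx.
have d0 := dist_compl_gt0 oOm ex Ox; set d := dist_compl Om x in d0.
pose t := `|x - z|; have t0 : 0 <= t by exact: normr_ge0.
have tr : t <= r by apply: ltW; apply: lt_le_trans xz _; rewrite ge_min lexx.
have tD : N * t <= D / 2.
 have : t <= D / (2 * N) by apply: ltW; apply: lt_le_trans xz _; rewrite ge_min lexx orbT.
 rewrite ler_pdivlMr//; lra.
have dD : D - N * t <= d.
 rewrite lerBlDr (le_trans (dist_compl_lip z x ex))// lerD2l enormB enorm_le_norm//.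
have [u [G [hc E]]] := cap_attained p2 np (comp_exists p0 oOm Ox).
have dpow : 0 < d `^ (p - N) by exact: powR_gt0.
have capx : cap p Om x <= E1.
 have : (D / 2) `^ (p - N) <= d `^ (p - N).
  by rewrite ge0_ler_powR ?nnegrE ?(ltW np0) ?(ltW DD) ?(ltW d0)//; lra.
 move: hx; rewrite /ccap -/d -/N => hx h1; rewrite /E1 ler_pdivlMr ?powR_gt0//.
 apply: le_trans (ltW hx); rewrite mulrC ler_wpM2r//. by rewrite -E energy_ge0.
have := hC Om x z u G (C * E1 `^ p^-1 * pp t `^ al) hc.
rewrite E (pp_pos t0) -/al => /(_ _) k.
have {}k : cap p Om z * pp (1 - C * E1 `^ p^-1 * t `^ al) `^ p <= cap p Om x.
 apply: k; rewrite ler_wpM2r// ler_wpM2l ?(ltW C0)//.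
 by rewrite ge0_ler_powR ?nnegrE ?invr_ge0 ?(ltW p0)// -E energy_ge0.
have := hr t t0 tr; rewrite ltNge => /negP; apply.
apply: le_trans (ltW hx); rewrite /h (pp_pos t0) /ccap -/d -/D -/N.
have q0 : 0 <= (D - N * t) / D by rewrite divr_ge0 ?(ltW D0)//; lra.
rewrite (pp_pos q0).
set X := pp _ `^ p in k *; set A := _ `^ (p - N); set B := D `^ _; set F := cap p Om z in k *.
have -> : A * X * (B * F) = (A * B) * (F * X) by ring.
rewrite ler_pM ?mulr_ge0 ?powR_ge0//.
 by rewrite /F; have [v [H [_ <-]]] := cap_attained p2 np (comp_exists p0 oOm Oz); exact: energy_ge0.
rewrite /A /B -powRM ?(ltW D0)// mulfVK ?gt_eqF//.
by rewrite ge0_ler_powR ?nnegrE ?(ltW np0) ?(ltW d0)//; lra.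
Qed.

(** Blow-up: centred at a nearest point y of the complement and scaled by the distance d, the domain
    fits in [Wk k], and x becomes a unit vector [px] close to [ev]. The weight in [ccap] is exactly
    the scaling factor of the energy. *)
Lemma ccap_boundary z c : C2_set Om -> boundary Om z -> 0 <= c -> c < lstar n p ->
 exists2 r, 0 < r & forall x, `|x - z| < r -> Om x -> c <= ccap p Om x.
Proof.
move=> C2 bz c0 cl; have [C C0 hC] := cap_near p2 np.
pose c2 := (c + lstar n p) / 2.
have cc2 : c < c2 by rewrite /c2; lra.
have c2l : c2 < lstar n p by rewrite /c2; lra.
have [K hK] := cap_Wk_cvg p2 np c2l.
(* Used at t = 1/q: moving the pole from [px] to [ev], at squared distance at most 2 t, costs the
   first factor, and [c2] lies strictly between c and the limit of the capacities of the sets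
   [Wk k]. *)
pose h t := pp (1 - C * c `^ p^-1 * pp (2 * t) `^ (al / 2)) `^ p * c2.
have cid : continuous (fun t : R => t) by move=> t.
have al2 : 0 < al / 2 by rewrite divr_gt0.
have ch : continuous h.
 have c3 : continuous (fun t : R => 2 * t) by ctn.
 have c1 : continuous (fun t : R => 1 - C * c `^ p^-1 * pp (2 * t) `^ (al / 2)).
  by ctn; exact: cont_comp c3 (cont_ppowR al2).
 by rewrite /h; ctn; exact: cont_comp c1 (cont_ppowR p0).
have h0 : c < h 0 by rewrite /h mulr0 (pp_pos (lexx 0)) powR0 ?gt_eqF// mulr0 subr0 (pp_pos ler01) powR1 mul1r.
have [r r0 hr] := cont_near_lt ch h0.
have [K1 _ hK1] := near_natSinv r0.
(* k >= 1 gives q >= 2, so the unit ball around a unit vector stays in the cube of radius q. *)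
pose k := maxn (maxn K K1) 1.
have kK : (K <= k)%N by rewrite !leq_max leqnn.
have kr : k.+1%:R^-1 <= r by apply: hK1; rewrite /= !leq_max leqnn orbT.
have k1 : (1 <= k)%N by rewrite leq_max leqnn orbT.
pose q : R := k.+1%:R; have q0 : 0 < q by [].
have q2 : 2 <= q by rewrite ler_nat.
have [Q [g0 [oQ g00 hQ]]] := local_frame C2 bz.
(* In the cube of radius q the Euclidean norm is at most N q, so this slope displaces the boundary
   by at most 1/q, the width of the layer in [Wk k]. *)
have e_gt0 : 0 < g0 / (N * q ^+ 2) by rewrite divr_gt0// mulr_gt0 ?exprn_gt0// ltr0n.
have [rho rho0 hrho] := hQ _ e_gt0.
have N1 : 1 <= N by rewrite ler1n.
(* Then d <= N r' and y is within (N + 1) r' of z, while the window of radius q, scaled by d, still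
   has radius at most [rho]. *)
pose r' := rho / ((N + 1) * (q + 1)).
have r'0 : 0 < r' by rewrite divr_gt0// mulr_gt0//; lra.
exists r' => // x xz Ox; rewrite leNgt; apply/negP => hx.
have d0 := dist_compl_gt0 oOm ex Ox; have [y Oy dy] := dist_compl_attained x oOm ex.
set d := dist_compl Om x in d0 dy.
have Oz : ~ Om z by move=> Ozz; apply: bz.2; rewrite (interior_id Om).1.
have dN : d <= N * r'.
 rewrite (le_trans (dist_compl_le x Oz))// (le_trans (enorm_le_norm _))// ler_wpM2l// ltW//.
have rr : (N + 1) * r' * (q + 1) = rho by rewrite /r'; field; apply/andP; split; rewrite gt_eqF//; lra.
have yz : `|y - z| <= rho.
 have : `|y - z| <= `|x - z| + `|x - y|.
  have -> : y - z = (x - z) - (x - y) by apply/rowP => j; rewrite !mxE; ring. exact: ler_normB.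
 have := norm_le_enorm (x - y); rewrite -dy => h1 h2. have q1 : 1 <= q + 1 by rewrite lerDr ltW.
 have NN : 0 <= N + 1 by rewrite addr_ge0// (le_trans ler01).
 have h3 : (N + 1) * r' <= (N + 1) * r' * (q + 1) by rewrite ler_peMr// mulr_ge0// ltW.
 rewrite -rr; apply: le_trans h3; rewrite mulrDl mul1r [X in _ <= X]addrC; apply: (le_trans h2).
 by rewrite lerD//; [exact: ltW|exact: le_trans dN].
pose b := y; pose U := [set xi | Om (d *: (xi *m Q) + y)].
have UW : U `<=` Wk k.
 move=> xi Uxi; apply: contrapT; rewrite /Wk => /not_orP[/negP + /negP].
 rewrite -!leNgt => xi1 xi2.
 have := hrho y (d *: xi) yz; rewrite -scalemxAl [y + _]addrC => /(_ _ Oy _) H; apply: H Uxi.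
  rewrite normrZ gtr0_norm// -rr.
  apply: (@le_trans _ _ (N * r' * q)); first by rewrite ler_pM ?(ltW d0).
  have h5 : N * r' <= (N + 1) * r' by rewrite ler_wpM2r ?(ltW r'0)// lerDl.
  apply: ler_pM => //; last by rewrite lerDl. by rewrite mulr_ge0 ?(ltW r'0)// (le_trans ler01).
 rewrite enormZ gtr0_norm// mxE.
 have en : enorm xi <= N * q by rewrite (le_trans (enorm_le_norm _))// ler_wpM2l.
 have -> : g0 * (d * xi 0 ord0) + g0 / (N * q ^+ 2) * (d * enorm xi) =
   d * g0 * (xi 0 ord0 + enorm xi / (N * q ^+ 2)).
  by field; rewrite !gt_eqF// (lt_le_trans ltr01 N1).
 rewrite pmulr_rle0 ?mulr_gt0//. have : enorm xi / (N * q ^+ 2) <= q^-1.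
  rewrite ler_pdivrMr ?mulr_gt0//. by rewrite (le_trans en)//; apply: eqW; field; rewrite gt_eqF.
 move=> h6; move: xi1; rewrite -/q -(lerD2r (enorm xi / (N * q ^+ 2))) => /le_trans; apply.
 by rewrite addrC subr_le0.
pose px := d^-1 *: ((x - y) *m Q^T).
have oQT := orthogonal_tr oQ.
have QQ : Q^T *m Q = 1%:M by exact: mulmx1C.
have pxQ : d *: (px *m Q) + y = x.
 by rewrite /px -scalemxAl scalerA mulfV ?gt_eqF// scale1r -mulmxA QQ mulmx1 subrK.
have epx : enorm px = 1.
 by rewrite /px enormZ enorm_orthogonal// -dy ger0_norm ?invr_ge0 ?(ltW d0)// mulVf// gt_eqF.
(* The open unit ball around [px] lies in the rescaled domain, hence in [Wk k]; testing its points
   [px - (1 - t) *: ev] bounds the height of [px] from below. *)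
have sp : 1 - q^-1 <= px 0 ord0.
 suff st t : 0 < t -> t < 1 -> 1 - q^-1 - px 0 ord0 <= t.
  rewrite leNgt; apply/negP => hlt.
  pose dd := 1 - q^-1 - px 0 ord0; have dd0 : 0 < dd by rewrite subr_gt0.
  have := st (Num.min (dd / 2) (1 / 2)); rewrite lt_min !divr_gt0// gt_min => /(_ isT).
  have -> : (1 / 2 < 1 :> R) by lra. by rewrite orbT le_min => /(_ isT)/andP[]; rewrite -/dd; lra.
 move=> t0 t1. have Up : U (px - (1 - t) *: ev).
  rewrite /U /= mulmxBl scalerBr addrAC pxQ; apply: contrapT => hn.
  have := dist_compl_le x hn; rewrite opprB addrC subrK enormZ enorm_orthogonal// enormZ.
  rewrite [enorm ev](_ : _ = 1); last by rewrite enorm_sqrt /ev dotp_basis mxE !eqxx sqrtr1.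
  rewrite mulr1 -/d !ger0_norm; [|lra|exact: ltW]. rewrite -[X in X <= _]mulr1 ler_pM2l//; lra.
 have [] := UW _ Up.
  rewrite rVB [((1 - t) *: ev) 0 ord0]mxE ev_0 mulr1 -/q.
  move: (px 0 ord0) (q^-1) => X Y hXY; rewrite -subr_ge0.
  have -> : t - (1 - Y - X) = (X - (1 - t)) - (- Y) by ring. by rewrite subr_ge0 ltW.
 have : `|px - (1 - t) *: ev| <= 2.
  rewrite (le_trans (ler_normB _ _))// norm_scale_basis ger0_norm; last by lra.
  have := norm_le_enorm px; rewrite epx; lra.
 rewrite -/q; lra.
(* Both are unit vectors, so the squared distance is 2 (1 - px_0). *)
have pe : enorm (px - ev) ^+ 2 <= 2 / q.
 have e1 : dotp (@ev R n) ev = 1 by rewrite {2}/ev dotp_basis ev_0.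
 have e2 : dotp px ev = px 0 ord0 by exact: dotp_basis.
 rewrite enormE !(dotpBl, dotpBr) -enormE epx e1 (dotpC ev) e2 expr1n.
 move: sp; move: (px 0 ord0) (q^-1) => X Y; rewrite -subr_ge0 => hXY; rewrite -subr_ge0.
 have -> : 2 * Y - (1 - X - (X - 1)) = 2 * (X - (1 - Y)) by ring. by rewrite mulr_ge0.
have [u [G [hc E]]] := cap_attained p2 np (comp_exists p0 oOm Ox).
have E3 : `|d| `^ (p - n.+1%:R) * energy p G = ccap p Om x by rewrite (gtr0_norm d0) E.
have dn : d != 0 by rewrite gt_eqF.
have [h1 E1] := @comp_dilate R n.+1 p Om [set z | Om (d *: z + y)] x (px *m Q) u G d y dn hc (fun z h => h) pxQ.
have [h2 E2] := @comp_orthogonal R n.+1 p _ U (px *m Q) px _ _ Q oQ h1 (fun z h => h) erefl.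
have h3 := comp_subset UW h2.
move: E2; set G' := (fun z => _ *m Q^T) => E2.
have EG : energy p G' < c := eq_ind_r (fun t => t < c) hx (etrans E2 (etrans E1 E3)).
have := hC (Wk k) px ev _ G' (C * c `^ p^-1 * (2 / q) `^ (al / 2)) h3; rewrite -/al.
move: EG (energy_ge0 p G'); move: (energy p G') => EE EG EE0 H.
clear - H EG EE0 C0 p0 pe al2 al0 q0 hK kK kr hr c0.
have {}H : cap p (Wk k) (@ev R n) * pp (1 - C * c `^ p^-1 * (2 / q) `^ (al / 2)) `^ p <= EE.
 apply: H; apply: ler_pM; rewrite ?mulr_ge0 ?powR_ge0 ?(ltW C0)//.
  by rewrite ler_wpM2l ?(ltW C0)// ge0_ler_powR ?invr_ge0 ?(ltW p0) ?(ltW EG).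
 apply: (@le_trans _ _ ((enorm (px - ev) ^+ 2) `^ (al / 2))).
  rewrite powR_sqr// mulrCA mulfV ?mulr1//.
  by rewrite ge0_ler_powR ?nnegrE ?enorm_ge0 ?norm_le_enorm// ltW.
 have z2 : 0 <= 2 / q by rewrite divr_ge0// ltW.
 by apply: ge0_ler_powR; rewrite ?nnegrE ?sqr_ge0 ?(ltW al2).
have q10 : 0 <= q^-1 by rewrite invr_ge0 ltW.
have := hr q^-1 q10 kr; rewrite ltNge => /negP; apply.
apply: le_trans (ltW EG); apply: le_trans H; rewrite /h mulrC.
rewrite (@pp_pos _ (2 / q)) ?mulr_ge0//; apply: ler_wpM2r; first exact: powR_ge0.
by apply: ltW; exact: hK.
Qed.

(** Without an extremal no point attains the infimum m of [ccap]. Then every point of the compact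
    closure has a neighbourhood where [ccap] exceeds m by a fixed amount, which contradicts the
    definition of m. *)
Theorem extremal_exists : Om !=set0 -> bounded_set Om -> C2_set Om -> (lambda p Om < (lstar n p)%:E)%E ->
 exists u, extremal p Om u.
Proof.
move=> [x1 Ox1] bO C2 hl.
pose S := [set c | exists2 x, Om x & c = ccap p Om x].
have hi : has_inf S by split; [exists (ccap p Om x1), x1|exists 0 => _ [x Ox ->]; exact: ccap_ge0].
pose m := inf S.
have mle x : Om x -> m <= ccap p Om x by move=> Ox; apply: ge_inf; [exact: hi.2|exists x].
have m0 : 0 <= m by apply: lb_le_inf; [exact: hi.1|move=> _ [x Ox ->]; exact: ccap_ge0].
have ml : m < lstar n p.
 rewrite ltNge; apply/negP => h; move: hl; rewrite ltNge => /negP; apply.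
 apply: le_ereal_inf_tmp => _ [u au <-]; rewrite lee_fin.
 apply: (admissible_ccap p2 np oOm ex au); first by apply: ltW; exact: lstar_gt0.
 by move=> x Ox; apply: le_trans h (mle x Ox).
apply: contrapT => H.
have strict x : Om x -> m < ccap p Om x.
 move=> Ox; rewrite ltNge; apply/negP => h; apply: H; apply: (extremal_of_min p2 np oOm ex Ox) => y Oy.
 by apply: le_trans h (mle y Oy).
have cK : compact (closure Om).
 apply: bounded_closed_compact; last exact: closed_closure.
 have [M [Mr hM]] := bO; exists M; split=> // M' MM'; have hc : closed (@cball R n.+1 M') by exact: closed_cball.
 have : closure Om `<=` cball M' by rewrite (closure_id (cball M')).1//; apply: closure_subset => x Ox; exact: hM Ox.
 by [].
have fin z c : m < c -> (exists2 r, 0 < r & forall x, `|x - z| < r -> Om x -> c <= ccap p Om x) ->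
  exists d r, [/\ 0 < d, 0 < r & forall x, `|x - z| < r -> Om x -> m + d <= ccap p Om x].
 move=> mc [r r0 hr]; exists (c - m), r; split; rewrite ?subr_gt0// => x xz Ox.
 by rewrite addrC subrK; exact: hr.
have [|d d0 hd] := @compact_lower_bound (closure Om) (ccap p Om) Om m cK.
 move=> z cz; have [Oz|Oz] := pselect (Om z).
  have mz := strict z Oz; pose c := (m + ccap p Om z) / 2.
  by apply: (fin z c); [|apply: ccap_lsc => //]; rewrite /c; lra.
 have bz : boundary Om z by split=> // h; apply: Oz; exact: interior_subset h.
 pose c := (m + lstar n p) / 2.
 by apply: (fin z c); [|apply: ccap_boundary => //]; rewrite /c; lra.
have : m + d <= m.
 apply: lb_le_inf; first exact: hi.1.
 by move=> _ [x Ox ->]; apply: hd => //; exact: subset_closure.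
by lra.
Qed.

End attained.

End existence.

(** * Radial cutoffs and weights *)

Section weights.
Context {R : realType} (n : nat).
Implicit Types (x y : 'rV[R]_n) (i : 'I_n) (r a t : R).

Lemma pd_sqn i x : pd i (fun y : 'rV[R]_n => dotp y y) x (2 * x 0 i).
Proof.
have := @pd_sum R n i _ (index_enum 'I_n) (fun j (y : 'rV[R]_n) => y 0 j * y 0 j)
 (fun j => x 0 j * (i == j)%:R + x 0 j * (i == j)%:R) x.
move=> /(_ (fun j => pdM (pd_coord i j x) (pd_coord i j x))) h.
apply: pd_eq h _; rewrite (bigD1 i)//= eqxx big1 ?addr0.
 by rewrite mulr1n; ring.
move=> j ji; rewrite eq_sym (negbTE ji); by rewrite mulr0n; ring.
Qed.

Lemma cont_sqn : continuous (fun y : 'rV[R]_n => dotp y y).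
Proof. by apply: cont_sum => i _; apply: contM; exact: continuous_coord. Qed.

Lemma sqn_ge0 x : 0 <= dotp x x. Proof. exact: dotp_ge0. Qed.

(** A C^1 radial cutoff: 1 for |x| <= r and 0 for |x|^2 >= 2 r^2, in particular for |x| >= 3r/2. *)
Definition zet r x : R := ramp (2 - r ^- 2 * dotp x x).
Definition dzet r i x : R := tent (2 - r ^- 2 * dotp x x) * - (r ^- 2 * (2 * x 0 i)).

Lemma pd_zet r i x : pd i (zet r) x (dzet r i x).
Proof.
apply: (@pd_comp R n i (ramp : R -> R)); first exact: is_derive_ramp.
apply: (@pd_eq _ _ _ _ _ (0 - r ^- 2 * (2 * x 0 i))); last by rewrite sub0r.
by apply: pdB; [exact: pd_cst|apply: pdZ; exact: pd_sqn].
Qed.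

Lemma cont_ramp : continuous (ramp : R -> R).
Proof.
move=> t; have h := @is_derive_ramp R t.
apply: differentiable_continuous; apply/derivable1_diffP; exact: ex_derive.
Qed.

Let cont_arg r : continuous (fun x : 'rV[R]_n => 2 - r ^- 2 * dotp x x).
Proof. by ctn; exact: cont_sqn. Qed.

Lemma cont_zet r : continuous (zet r).
Proof.
have h := cont_comp (@cont_arg r) cont_ramp.

by ctn. Qed.

Lemma cont_dzet r i : continuous (dzet r i).
Proof.
have h := cont_comp (@cont_arg r) (@cont_tent R).
apply: contM; first exact: h.
by ctn.
Qed.

Lemma zet_itv r x : 0 <= zet r x <= 1. Proof. exact: ramp_itv. Qed.

Lemma zet_in r x : 0 < r -> enorm x <= r -> zet r x = 1 /\ forall i, dzet r i x = 0.
Proof.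
move=> r0 xr; have h : 1 <= 2 - r ^- 2 * dotp x x.
 rewrite -enormE lerBrDr -lerBrDl (_ : 2 - 1 = 1); last by ring.
 by rewrite mulrC ler_pdivrMr ?exprn_gt0// mul1r ler_sqr ?nnegrE ?enorm_ge0// ltW.
by split=> [|i]; [rewrite /zet ramp1|rewrite /dzet tent_out ?mul0r//; right].
Qed.

Lemma zet_out r x : 0 < r -> 3 / 2 * r <= enorm x -> zet r x = 0 /\ forall i, dzet r i x = 0.
Proof.
move=> r0 xr; have h : 2 - r ^- 2 * dotp x x <= 0.
 rewrite -enormE subr_le0 mulrC ler_pdivlMr ?exprn_gt0//.
 have h1 : (3 / 2 * r) ^+ 2 <= enorm x ^+ 2 by rewrite ler_sqr ?nnegrE ?enorm_ge0// mulr_ge0 ?ltW// divr_gt0.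
 by apply: le_trans h1; rewrite exprMn; have := sqr_ge0 r; set A := r ^+ 2; clear; lra.
by split=> [|i]; [rewrite /zet ramp0|rewrite /dzet tent_out ?mul0r//; left].
Qed.

Lemma zet_bsupp r : 0 < r -> bsupp (2 * r) (zet r) /\ forall i, bsupp (2 * r) (dzet r i).
Proof.
move=> r0; suff h x : 2 * r < `|x| -> 3 / 2 * r <= enorm x.
 by split=> [x /h k|i x /h k]; have [h1 h2] := zet_out r0 k.
by move=> h; have := norm_le_enorm x; lra.
Qed.

Lemma dzet_le r x : 0 < r -> enorm (\row_i dzet r i x) <= 6 / r.
Proof.
move=> r0; have [xr|xr] := leP (3 / 2 * r) (enorm x).
 have [_ h] := zet_out r0 xr; rewrite (_ : \row_i _ = 0) ?enorm0 ?divr_ge0 ?ltW//.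
 by apply/rowP => i; rewrite !mxE h.
have -> : \row_i dzet r i x = (- (tent (2 - r ^- 2 * dotp x x) * (r ^- 2 * 2))) *: x.
 by apply/rowP => i; rewrite !mxE /dzet; ring.
rewrite enormZ normrN; have /andP[t0 t2] := @tent_itv R (2 - r ^- 2 * dotp x x).
rewrite ger0_norm; last by rewrite mulr_ge0// mulr_ge0// invr_ge0 exprn_ge0// ltW.
have r2 : 0 <= r ^- 2 by rewrite invr_ge0 exprn_ge0// ltW.
apply: (@le_trans _ _ (2 * (r ^- 2 * 2) * (3 / 2 * r))).
 by rewrite ler_pM ?enorm_ge0 ?mulr_ge0 ?(ltW xr)// ler_wpM2r// mulr_ge0.
by apply: eqW; field; rewrite gt_eqF.
Qed.

(** A differentiable substitute for max(1, |x|). *)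
Definition rho x : R := Num.sqrt (1 + dotp x x).

Lemma rho_sqr x : rho x ^+ 2 = 1 + dotp x x.
Proof. by rewrite sqr_sqrtr// addr_ge0// sqn_ge0. Qed.

Lemma rho_ge1 x : 1 <= rho x.
Proof. by rewrite -[X in X <= _]sqrtr1 ler_wsqrtr// lerDl sqn_ge0. Qed.

Lemma rho_gt0 x : 0 < rho x. Proof. exact: lt_le_trans ltr01 (rho_ge1 x). Qed.

Lemma enorm_le_rho x : enorm x <= rho x.
Proof. by rewrite enorm_sqrt ler_wsqrtr// lerDr. Qed.

Lemma rho_le x : rho x <= 1 + enorm x.
Proof.
rewrite -(@ler_sqr R) ?nnegrE ?(ltW (rho_gt0 _)) ?addr_ge0 ?enorm_ge0// rho_sqr -enormE.
by have := enorm_ge0 x; nra.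
Qed.

Lemma pd_rho i x : pd i rho x (x 0 i / rho x).
Proof.
have h : 0 < 1 + dotp x x by rewrite ltr_pwDl// sqn_ge0.
have := @pd_comp R n i (@Num.sqrt R) (fun y => 1 + dotp y y) x _ _ (is_derive1_sqrt h)
 (pdD (pd_cst i 1 x) (pd_sqn i x)).
move=> k; apply: pd_eq k _; rewrite add0r -/(rho x); field.
by rewrite gt_eqF// rho_gt0.
Qed.

Lemma cont_rho : continuous rho.
Proof.
have h : continuous (fun x => 1 + dotp x x) by apply: contD; [exact: cont_cst|exact: cont_sqn].
exact: cont_comp h (@sqrt_continuous R).
Qed.

Lemma powR_anti a s t : 0 <= a -> 0 < s -> s <= t -> t `^ (- a) <= s `^ (- a).
Proof.
move=> a0 s0 st; have t0 := lt_le_trans s0 st; rewrite !powRN lef_pV2 ?posrE ?powR_gt0//.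
by rewrite ge0_ler_powR ?nnegrE// ltW.
Qed.

Lemma powR_le1 a s : 0 <= a -> 1 <= s -> s `^ (- a) <= 1.
Proof. by move=> a0 s1; have := powR_anti a0 ltr01 s1; rewrite powR1. Qed.

(** Scaling replaces polar coordinates: the integrals over the cubes of radius 2^j satisfy I_{j+1}
    <= c + th I_j with th = 2^(n-a) < 1, hence stay bounded. *)
Lemma integ_rho a : n%:R < a -> integ (fun x => rho x `^ (- a)).
Proof.
move=> na; have a0 : 0 <= a by apply: le_trans (ltW na).
(* Unlike [rho], this function is homogeneous where |x| > 2: g x = 2 g (x/2). *)
pose g x : R := Num.max 1 (enorm x).
have g1 x : 1 <= g x by rewrite le_max lexx.
have mg : mfn (fun x => g x `^ (- a)).
 by apply: mfn_powR; apply: mfn_cont; apply: contMax; [exact: cont_cst|exact: enorm_continuous].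
pose f (j : nat) x := g x `^ (- a) * \1_(cball (2 ^+ j)) x.
have ifj j : integ (f j).
 apply: (@le_integ _ _ _ (\1_(cball (2 ^+ j)))); last exact: integ_cball.
  by apply: mfnM => //; apply: mfn_indic; exact: measurable_cball.
 by move=> x; rewrite ger0_norm ?mulr_ge0 ?powR_ge0// ler_piMl// powR_le1.
pose c := I (\1_(cball 2) : 'rV[R]_n -> R).
have c0 : 0 <= c by apply: I_ge0 => x; rewrite indicE ler0n.
pose th : R := 2 `^ (- a) * 2 ^+ n.
have th1 : th < 1.
 have -> : th = (2 `^ (a - n%:R))^-1.
  by rewrite /th -powR_mulrn// -powRD ?pnatr_eq0 ?implybT// -powRN opprB addrC.
 have an : 0 < a - n%:R by rewrite subr_gt0. rewrite invf_lt1//; have := @gt0_ltr_powR R _ an 1 2.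
 by rewrite powR1 !nnegrE; apply => //; lra.
have th0 : 0 <= th by rewrite mulr_ge0.
have step j : I (f j.+1) <= c + th * I (f j).
 have hh : (2^-1 : R) != 0 by []. have i2 := integZ (2 `^ (- a)) (integ_dilate (0) hh (ifj j)).
 have -> : th * I (f j) = I (fun x => 2 `^ (- a) * f j (2^-1 *: x + 0)).
  rewrite IZ; last exact: integ_dilate. by rewrite I_dilate// ger0_norm// -exprVn invrK /th; ring.
 rewrite /c -ID; [|exact: integ_cball|exact: i2].
 apply: I_le => //; first by apply: integD; [exact: integ_cball|exact: i2].
 move=> x; have [x2|x2] := leP `|x| 2.
  rewrite (_ : \1_(cball 2) x = 1); last by rewrite indicE mem_set.
  rewrite -[X in X <= _]addr0 lerD//; last by rewrite !mulr_ge0 ?powR_ge0.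
  by rewrite -[X in _ <= X]mulr1 ler_pM ?powR_ge0 ?lern1 ?leq_b1// powR_le1.
 have x2' : 2 < enorm x by apply: lt_le_trans (norm_le_enorm x). have gx : g x = 2 * g (2^-1 *: x).
  rewrite /g enormZ ger0_norm// !max_r; first by rewrite mulrA mulfV ?mul1r.
   by rewrite ler_pdivlMl// mulr1 ltW.
  by lra.
 rewrite -[X in X <= _]add0r lerD// /f addr0 gx powRM ?(le_trans ler01 (g1 _))//.
 rewrite -mulrA ler_wpM2l// ler_wpM2l ?powR_ge0//.
 rewrite !indicE; have [|] := boolP (x \in cball (2 ^+ j.+1)); last by [].
 rewrite inE /cball /= => h; rewrite mem_set//= normrZ ger0_norm//.
 by rewrite ler_pdivrMl// -exprS.
have bnd j : I (f j) <= c / (1 - th).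
 have t1 : 0 < 1 - th by rewrite subr_gt0. elim: j => [|j IH].
  apply: (@le_trans _ _ c).
   apply: I_le => //; first exact: integ_cball.
   move=> x; rewrite /f expr0 -[X in _ <= X]mul1r ler_pM ?powR_ge0 ?indicE ?powR_le1//.
   rewrite ler_nat; have [|//] := boolP (x \in cball 1).
   by rewrite inE /cball => h; rewrite mem_set//=; apply: le_trans h _; lra.
  by rewrite ler_pdivlMr// ler_piMr// lerBlDr lerDl.
 apply: (le_trans (step j)); apply: (@le_trans _ _ (c + th * (c / (1 - th)))).
  by rewrite lerD2l ler_wpM2l.
 by apply: eqW; field; rewrite gt_eqF.
have [] := @I_fatou R n f (fun x => g x `^ (- a)) (c / (1 - th)) ifj _ bnd mg.
- by move=> j x; rewrite mulr_ge0 ?powR_ge0 ?indicE ?ler0n.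
- by move=> x; exact: powR_ge0.
- apply: aeW => x; apply: cvg_near_cst.
 have [K hK] : exists K : nat, `|x| <= K%:R.
  by exists (Num.truncn `|x|).+1; apply: ltW; rewrite -truncn_le_nat.
 exists K => // j /= Kj; rewrite /f (_ : \1_(cball (2 ^+ j)) x = 1) ?mulr1//.
 rewrite indicE mem_set//; rewrite /cball /= (le_trans hK)// -natrX ler_nat.
 by apply: (leq_trans Kj); apply: ltnW; exact: ltn_expl.
move=> ig _; apply: le_integ ig.
 by apply: mfn_powR; apply: mfn_cont; exact: cont_rho.
move=> x; rewrite ger0_norm ?powR_ge0// powR_anti//; first exact: lt_le_trans ltr01 (g1 x).
by rewrite ge_max rho_ge1 enorm_le_rho.
Qed.

End weights.

Lemma le_cancel (R : realType) (a b c : R) : a <= a - b + c -> b <= c.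
Proof. by lra. Qed.

(** * Caccioppoli inequalities for capacitary functions *)

Section caccioppoli.
Context {R : realType} (n : nat).
Local Notation rV := 'rV[R]_n.
Implicit Types (a b : rV) (p t : R).

Lemma enorm_convex p t a b : 1 < p -> 0 <= t <= 1 ->
 enorm ((1 - t) *: a + t *: b) `^ p <= (1 - t) * enorm a `^ p + t * enorm b `^ p.
Proof.
move=> p1 /andP[t0 t1]; set m := (1 - t) *: a + t *: b.
have t1' : 0 <= 1 - t by rewrite subr_ge0.
have h1 := ler_wpM2l t1' (enorm_tangent a m p1); have h2 := ler_wpM2l t0 (enorm_tangent b m p1).
apply: le_trans (lerD h1 h2).
have E : (1 - t) * dotp (flux p m) (a - m) + t * dotp (flux p m) (b - m) = 0.
 rewrite -!dotpZr -dotpDr (_ : _ + _ = 0); first by rewrite dotpC dotp0l.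
 by rewrite /m; apply/rowP => i; rewrite !mxE; ring.
set A := enorm m `^ p; rewrite [X in _ <= X](_ : _ = A + p * ((1 - t) * dotp (flux p m) (a - m) + t * dotp (flux p m) (b - m))); last by ring.
by rewrite E mulr0 addr0.
Qed.

Variables (p : R) (U : set rV) (x0 : rV) (u : rV -> R) (G : rV -> rV).
Hypotheses (p2 : 2 < p) (hc : comp p U x0 u G) (hm : energy p G = cap p U x0).
Let p0 : 0 < p := p2_gt0 p2.
Let p1 : 1 < p := p2_gt1 p2.
Implicit Types (h g : rV -> R) (dh : 'I_n -> rV -> R).

(* Convexity applied to (1 - h) u - h (u Dh / h) replaces the usual first
  variation. *)
Lemma caccioppoli_bounded h dh g : (forall i x, pd i h x (dh i x)) -> continuous h ->
 (forall i, continuous (dh i)) -> (forall y, 0 <= h y <= 1) -> h x0 = 0 -> (forall y, 0 <= g y) ->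
 (forall y, enorm (\row_i dh i y) <= g y * h y `^ ((p - 1) / p)) ->
 integ (fun y => (`|u y| * g y) `^ p) ->
 I (fun y => enorm (G y) `^ p * h y) <= I (fun y => (`|u y| * g y) `^ p).
Proof.
move=> hp ch cdh h01 hx0 g0 hg ig; have [WG LG u0 u1] := hc.
have pt y : enorm ((1 - h y) *: G y + u y *: \row_i - dh i y) `^ p <=
  (1 - h y) * enorm (G y) `^ p + (`|u y| * g y) `^ p.
 have -> : \row_i - dh i y = - \row_i dh i y :> rV by apply/rowP => i; rewrite !mxE.
 have := hg y; have := h01 y; set D := \row_i dh i y; set t := h y => t01 hD; have /andP[t0 t1] := t01.
 have [tE|tn] := eqVneq t 0.
  have D0 : D = 0.
   apply/eqP; rewrite -enorm_eq0 eq_le enorm_ge0 andbT (le_trans hD)// tE powR0 ?mulr0//.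
   by rewrite gt_eqF// divr_gt0// subr_gt0.
  by rewrite D0 oppr0 scaler0 addr0 tE subr0 scale1r mul1r lerDl powR_ge0.
 have tp : 0 < t by rewrite lt_def tn.
 have -> : (1 - t) *: G y + u y *: - D = (1 - t) *: G y + t *: (- (u y / t) *: D).
  by rewrite scalerA scalerN mulrN mulrCA mulfV// mulr1 scaleNr.
 apply: (le_trans (enorm_convex _ _ p1 t01)); rewrite lerD2l enormZ normrN.
 have k : `|u y / t| * enorm D <= `|u y| * g y * t `^ (- p^-1).
  rewrite normrM normfV (ger0_norm t0) -!mulrA ler_wpM2l// mulrC.
  apply: (le_trans (ler_wpM2r _ hD)); first by rewrite invr_ge0.
  rewrite -mulrA ler_wpM2l// -(powR_inv1 t0) -powRD ?tn ?implybT//.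
  by apply: eqW; congr (_ `^ _); field; rewrite gt_eqF.
 have k2 : (`|u y / t| * enorm D) `^ p <= (`|u y| * g y) `^ p * t^-1.
  have tI : t^-1 = (t `^ (- p^-1)) `^ p by rewrite -powRrM mulNr mulVf ?gt_eqF// powR_inv1.
  rewrite [X in _ <= _ * X]tI -powRM ?mulr_ge0//.
  by apply: ge0_ler_powR k; rewrite ?nnegrE ?mulr_ge0 ?powR_ge0 ?enorm_ge0// ltW.
 by apply: (le_trans (ler_wpM2l t0 k2)); rewrite mulrCA mulfV// mulr1.
have ph i x : pd i (fun y => 1 - h y) x (- dh i x).
 by apply: (@pd_eq _ _ _ _ _ (0 - dh i x)); [apply: pdB; [exact: pd_cst|exact: hp]|rewrite sub0r].
have c1 : continuous (fun y => 1 - h y) by ctn.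
have cd i : continuous (fun y => - dh i y) by ctn.
have WD := W_prod WG ph c1 cd.
have mh : mfn h by exact: mfn_cont.
have iGh : integ (fun y => enorm (G y) `^ p * h y).
 apply: (@integMb _ _ _ _ 1) LG.2 mh _ => y; have /andP[h0 h1] := h01 y; by rewrite ger0_norm.
have iB : integ (fun y => (1 - h y) * enorm (G y) `^ p) by apply: eq_integ (integB LG.2 iGh) => y; ring.
have iS := integD iB ig.
have LD : Lp p (fun y => (1 - h y) *: G y + u y *: \row_i - dh i y) by apply: Lp_le pt iS; exact: W_mfn WD.
have cD : comp p U x0 (fun y => u y * (1 - h y)) (fun y => (1 - h y) *: G y + u y *: \row_i - dh i y).
 by split; [exact: WD|exact: LD|move=> y /u0 ->; rewrite mul0r|rewrite u1 hx0 subr0 mulr1].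
have := le_trans (cap_le cD) (I_le LD.2 iS pt); rewrite -hm (ID iB ig) /energy.
have -> : I (fun y => (1 - h y) * enorm (G y) `^ p) = I (fun y => enorm (G y) `^ p) - I (fun y => enorm (G y) `^ p * h y).
 by rewrite -(IB LG.2 iGh); apply: eq_I => y; ring.
exact: le_cancel.
Qed.

(** For unbounded h the bounded version is applied to H = d h / (1 + d h), with g replaced by
    d^(1/p) g. Both sides carry a factor d, which cancels, and Fatou's lemma lets d tend to 0. *)
Lemma caccioppoli h dh g : (forall i x, pd i h x (dh i x)) -> continuous h ->
 (forall i, continuous (dh i)) -> (forall y, 0 <= h y) -> h x0 = 0 -> (forall y, 0 <= g y) ->
 (forall y, enorm (\row_i dh i y) <= g y * h y `^ ((p - 1) / p)) ->
 integ (fun y => (`|u y| * g y) `^ p) ->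
 integ (fun y => enorm (G y) `^ p * h y) /\
 I (fun y => enorm (G y) `^ p * h y) <= I (fun y => (`|u y| * g y) `^ p).
Proof.
move=> hp ch cdh h0 hx0 g0 hg ig; have [WG LG u0 u1] := hc.
have mG : mfn (fun y => enorm (G y) `^ p) by apply: mfn_powR; apply: mfn_enorm; exact: LG.1.
have q0 : 0 <= (p - 1) / p by rewrite divr_ge0 ?subr_ge0 ?ltW.
have q1 : (p - 1) / p <= 2 by apply: (@le_trans _ _ 1); [rewrite ler_pdivrMr// mul1r lerBlDr lerDl|lra].
have key d : 0 < d -> I (fun y => enorm (G y) `^ p * (h y / (1 + d * h y))) <= I (fun y => (`|u y| * g y) `^ p).
 move=> d0; pose k y := 1 + d * h y. have k1 y : 1 <= k y by rewrite lerDl mulr_ge0 ?(ltW d0).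
 have k0 y : 0 < k y by exact: lt_le_trans (k1 y). have kn y : k y != 0 by rewrite gt_eqF.
 have pk i y : pd i k y (d * dh i y).
  by apply: (@pd_eq _ _ _ _ _ (0 + d * dh i y)); [apply: pdD; [exact: pd_cst|exact: pdZ]|rewrite add0r].
 have ck : continuous k by apply: contD; [exact: cont_cst|apply: contM => //; exact: cont_cst].
 pose H y := d * (h y * (k y)^-1); pose dH i y := d * (dh i y * (k y)^-1 ^+ 2).
 have pH i y : pd i H y (dH i y).
  apply: pdZ; apply: pd_eq (pdM (hp i y) (pdV (kn y) (pk i y))) _.
  by rewrite /k; field; exact: kn.
 have cV : continuous (fun y => (k y)^-1) by exact: contV.
 have cH : continuous H by apply: contM; [exact: cont_cst|exact: contM].
 have cdH i : continuous (dH i) by apply: contM; [exact: cont_cst|apply: contM => //; exact: contX].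
 have H01 y : 0 <= H y <= 1.
  rewrite /H mulrA mulr_ge0 ?mulr_ge0 ?invr_ge0 ?(ltW d0) ?(ltW (k0 y))//=.
  by rewrite ler_pdivrMr// mul1r /k lerDr.
 have := @caccioppoli_bounded H dH (fun y => d `^ p^-1 * g y) pH cH cdH H01.
 have -> : I (fun y => enorm (G y) `^ p * H y) = d * I (fun y => enorm (G y) `^ p * (h y / (1 + d * h y))).
  rewrite -IZ; first by apply: eq_I => y; rewrite /H /k; ring.
  have i1 : integ (fun y => enorm (G y) `^ p * H y).
   apply: (@integMb _ _ _ _ 1) LG.2 (mfn_cont cH) _ => y; have /andP[a1 a2] := H01 y; by rewrite ger0_norm.
  apply: eq_integ (integZ d^-1 i1) => y; rewrite /H /k; rewrite mulrCA; congr (_ * _).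
  by rewrite mulrA mulVf ?gt_eqF// mul1r.
 have E y : (`|u y| * (d `^ p^-1 * g y)) `^ p = d * (`|u y| * g y) `^ p.
  rewrite mulrCA powRM ?powR_ge0 ?mulr_ge0// -powRrM mulVf ?gt_eqF// powRr1//; exact: ltW.
 rewrite (eq_I E) (IZ _ ig) ler_pM2l// => K; apply: K.
 - by rewrite /H hx0 mul0r mulr0.
 - by move=> y; rewrite mulr_ge0 ?powR_ge0.
 - move=> y; have -> : \row_i dH i y = (d * (k y)^-1 ^+ 2) *: \row_i dh i y.
   by apply/rowP => i; rewrite !mxE /dH; ring.
  have kk : 0 <= (k y)^-1 ^+ 2 by rewrite exprn_ge0// invr_ge0 ltW.
  have dk : 0 <= d * (k y)^-1 ^+ 2 := mulr_ge0 (ltW d0) kk.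
  rewrite enormZ (ger0_norm dk); apply: (le_trans (ler_wpM2l dk (hg y))).
  have ki : 0 <= (k y)^-1 by rewrite invr_ge0 ltW.
  rewrite /H (powRM _ (ltW d0) (mulr_ge0 (h0 y) ki)) (powRM _ (h0 y) ki).
  have dE : d = d `^ p^-1 * d `^ ((p - 1) / p).
   rewrite -powRD ?(gt_eqF d0) ?implybT//; rewrite [X in _ `^ X](_ : _ = 1) ?powRr1 ?ltW//.
   by field; rewrite gt_eqF.
  move: dE; set a := d `^ p^-1; set b := d `^ _; set c := h y `^ _; set e := (k y)^-1 `^ _.
  (* Differentiating h / (1 + d h) produces the square of 1/k, which is at most its power (p-1)/p
     because 0 < 1/k <= 1 and (p-1)/p <= 2. *)
  set f := (k y)^-1 ^+ 2 => dE. have fe : f <= e.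
   have i01 : 0 < (k y)^-1 <= 1 by rewrite invr_gt0 k0 invf_le1 ?k1 ?k0.
   by rewrite /f /e -powR_mulrn ?invr_ge0 ?(ltW (k0 y))//; apply: ger_powR.
  rewrite [X in X <= _](_ : _ = a * g y * (b * c) * f); last by rewrite [X in X * f * _]dE; ring.
  rewrite [X in _ <= X](_ : _ = a * g y * (b * c) * e); last by ring.
  by rewrite ler_wpM2l// !mulr_ge0 ?powR_ge0.
 - by apply: eq_integ (integZ d ig) => y; rewrite E.
pose f (j : nat) y := enorm (G y) `^ p * (h y / (1 + j.+1%:R^-1 * h y)).
have dj (j : nat) : 0 < j.+1%:R^-1 :> R by [].
have pos (j : nat) y : 0 < 1 + j.+1%:R^-1 * h y by rewrite ltr_pwDl// mulr_ge0// ltW.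
have f0 j y : 0 <= f j y by rewrite mulr_ge0 ?powR_ge0// divr_ge0// ltW.
apply: (@I_fatou R n f _ _ _ f0 (fun j => key _ (dj j))).
- move=> j; apply: (@integMb _ _ _ _ j.+1%:R) LG.2 _ _.
  have c1 : continuous (fun y => 1 + j.+1%:R^-1 * h y).
   by ctn.
  apply: mfn_cont; apply: contM => //; apply: contV => // y; by rewrite gt_eqF.
 move=> y; rewrite ger0_norm ?divr_ge0 ?(ltW (pos _ _))// ler_pdivrMr//.
 by rewrite mulrDr mulrA mulfV// mul1r mulr1 lerDr.
- by apply: mfnM => //; exact: mfn_cont.
- by move=> y; rewrite mulr_ge0 ?powR_ge0.
apply: aeW => y; rewrite /f; apply: cvgM; first exact: cvg_cst.
rewrite -[X in _ --> X]divr1; apply: cvgM; first exact: cvg_cst.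
apply: cvgV; first by [].
rewrite -[X in _ --> X]addr0; apply: cvgD; first exact: cvg_cst.
rewrite -[X in _ --> X](mul0r (h y)); apply: cvgM; last exact: cvg_cst.
exact: cvg_harmonic.
Qed.

End caccioppoli.

(** * The capacitary function of the half space *)

Section half_space_minimizer.
Context {R : realType} (n : nat).
Variable p : R.
Hypotheses (p2 : 2 < p) (np : n.+1%:R < p).

(** Taking the positive part does not increase the energy, so by uniqueness the minimizer equals its
    positive part. *)
Lemma minimizer_exists : exists (w : 'rV[R]_n.+1 -> R) G,
 [/\ comp p Hs ev w G, energy p G = lstar n p & forall x, 0 <= w x].
Proof.
have [w [G [hc E]]] := cap_attained p2 np (Hs_ex n p2); have [WG LG u0 u1] := hc.
have pt x : enorm ((if 0 < w x then 1 else 0) *: G x) `^ p <= enorm (G x) `^ p.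
 case: ifP => _; first by rewrite scale1r. by rewrite scale0r enorm0 powR0// gt_eqF// p2_gt0.
have W2 := W_pp WG; have L2 := Lp_le (W_mfn W2) pt LG.2.
have c2 : comp p Hs ev (fun x => pp (w x)) (fun x => (if 0 < w x then 1 else 0) *: G x).
 by split; [exact: W2|exact: L2|move=> x /u0 ->; rewrite pp_pos|rewrite u1 pp_pos].
have E2 : energy p (fun x => (if 0 < w x then 1 else 0) *: G x) = cap p Hs (@ev R n).
 apply/eqP; rewrite eq_le (cap_le c2) andbT -E; exact: I_le L2.2 LG.2 pt.
have w0 x : 0 <= w x by rewrite (cap_unique p2 np hc c2 E E2) pp_ge0.
by exists w, G; exact: And3 hc E w0.
Qed.

End half_space_minimizer.

Lemma is_derive_powR (R : realType) (a z : R) : 0 < z -> is_derive z (1 : R) ((fun s => s `^ a) : R -> R^o) (a * z `^ (a - 1)).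
Proof.
move=> z0; have hz : z \in `]0, +oo[%R by rewrite in_itv /= z0.
apply: DeriveDef; first exact: derivable_powR.
by rewrite -derive1E powR_derive1.
Qed.

Lemma pd_powR (R : realType) m (k : 'I_m) (f : 'rV[R]_m -> R) y d a : 0 < f y -> pd k f y d ->
 pd k (fun y => f y `^ a) y (a * f y `^ (a - 1) * d).
Proof. by move=> f0 hf; apply: (@pd_comp R m k (fun s => s `^ a)) hf; exact: is_derive_powR. Qed.

Lemma cont_powR_pos (R : realType) m (f : 'rV[R]_m -> R) a : continuous f -> (forall y, 0 < f y) -> continuous (fun y => f y `^ a).
Proof.
move=> cf f0 y; apply: (@continuous_comp _ _ _ f (fun s : R => s `^ a)); first exact: cf.
have h := is_derive_powR a (f0 y).
by apply: differentiable_continuous; apply/derivable1_diffP; exact: ex_derive.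
Qed.

Lemma ler_lim_seq (R : realType) (a b : nat -> R) l1 l2 : a @ \oo --> l1 -> b @ \oo --> l2 ->
 (forall k, a k <= b k) -> l1 <= l2.
Proof. by move=> ha hb hab; exact: ler_cvg_to ha hb (nearW _ hab). Qed.

Lemma comparison_arith (R : realType) (A B E S T2 p f : R) : A <= B -> 0 <= E -> 0 <= S -> 0 < T2 -> 0 < p -> 0 < f ->
 B + p * (f * S) + T2 * E <= A -> E = 0.
Proof.
move=> h1 h2 h3 h4 p0 f0 h5; apply/eqP; rewrite eq_le h2 andbT -(pmulr_rle0 _ h4).
have : 0 <= p * (f * S) by rewrite mulr_ge0 ?mulr_ge0// ltW.
lra.
Qed.

(** * A supersolution with a pole near the boundary, and comparison with it *)

Section barrier.
Context {R : realType} (n : nat).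
Implicit Types (x : 'rV[R]_n.+1) (i j : 'I_n.+1).

Variables (p t : R) (y0 : 'rV[R]_n.+1).
Hypotheses (p2 : 2 < p) (np : n.+1%:R < p) (n0 : (0 < n)%N).
Hypotheses (t01 : 0 < t <= 1) (y00 : y0 0 ord0 = 0) (y0n : dotp y0 y0 = 4^-1).

Let t0 : 0 < t. Proof. by have /andP[] := t01. Qed.

(** The barrier is modelled on x_0 / |x|^mm, homogeneous of degree [- kap], and its flux has degree
    [- MM], where MM = (p - 1) mm. With kap = n / (p - 1) the divergence of the flux reduces to a
    single term of constant sign. *)
Definition kap : R := n%:R / (p - 1).
Definition mm : R := 1 + kap.
Definition MM : R := p - 1 + n%:R.
Let c : R := 2 * mm - mm ^+ 2.
Let p10 : 0 < p - 1. Proof. by rewrite subr_gt0; exact: p2_gt1 p2. Qed.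

Lemma kap_itv : 0 < kap < 1.
Proof.
rewrite /kap divr_gt0 ?ltr0n//= ltr_pdivrMr// mul1r ltrBrDr natr1; exact: np.
Qed.

Let k0 : 0 < kap. Proof. by have /andP[] := kap_itv. Qed.
Let k1 : kap < 1. Proof. by have /andP[] := kap_itv. Qed.
Let cE : c = 1 - kap ^+ 2. Proof. by rewrite /c /mm; ring. Qed.

(** A C^1 extension of s + t from s >= 0 that stays positive, so that the barrier is positive and
    C^1 on the whole space. *)
Definition theta (s : R) : R := s + t + t^-1 * pp (- s) ^+ 2.
Definition dtheta (s : R) : R := 1 - 2 * t^-1 * pp (- s).

Lemma theta_gt0 s : 0 < theta s.
Proof.
rewrite /theta; have [s0|s0] := leP 0 s.
 by rewrite pp_neg ?oppr_le0// expr0n mulr0 addr0 ltr_wpDl.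
rewrite pp_pos ?oppr_ge0 ?(ltW s0)// sqrrN.
have -> : s + t + t^-1 * s ^+ 2 = t^-1 * (s * t + t ^+ 2 + s ^+ 2) by field; rewrite gt_eqF.
rewrite mulr_gt0 ?invr_gt0// (_ : _ + _ = (s + t / 2) ^+ 2 + 3 / 4 * t ^+ 2); last by field.
by rewrite ltr_wpDl ?sqr_ge0// mulr_gt0 ?exprn_gt0// divr_gt0.
Qed.

Lemma theta_pos s : 0 <= s -> theta s = s + t /\ dtheta s = 1.
Proof. by move=> s0; rewrite /theta /dtheta pp_neg ?oppr_le0// expr0n !mulr0 addr0 subr0. Qed.

(** In the upper half space these are the coordinates of x relative to a pole at depth t below the
    boundary point y0. *)
Definition xi j x : R := if j == ord0 then theta (x 0 ord0) else x 0 j - y0 0 j.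
Definition dxi j x : R := if j == ord0 then dtheta (x 0 ord0) else 1.

Lemma pd_xi i j x : pd i (xi j) x ((i == j)%:R * dxi j x).
Proof.
rewrite /xi /dxi; case: ifP => [/eqP ->|_]; last first.
 by rewrite mulr1; apply: pd_eq (pdB (pd_coord i j x) (pd_cst i (y0 0 j) x)) _; rewrite subr0.
have h1 := pd_coord i ord0 x.
have h2 : pd i (fun y => pp (- y 0 ord0) ^+ 2) x (2 * pp (- x 0 ord0) * - (i == ord0)%:R).
 apply: (@pd_comp R n.+1 i (fun s => pp s ^+ 2)); [exact: is_derive_pp_sqr|exact: pdN].
apply: pd_eq (pdD (pdD h1 (pd_cst i t x)) (pdZ t^-1 h2)) _; rewrite /dtheta; ring.
Qed.

Lemma cont_xi j : continuous (xi j).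
Proof.
rewrite /xi; case: (j == ord0); last by apply: contB; [exact: continuous_coord|exact: cont_cst].
apply: contD; first by apply: contD; [exact: continuous_coord|exact: cont_cst].
apply: contM; first exact: cont_cst.
apply: contX; apply: cont_pp; apply: contN; exact: continuous_coord.
Qed.

Lemma cont_dxi j : continuous (dxi j).
Proof.
rewrite /dxi; case: (j == ord0); last exact: cont_cst.
apply: contB; first exact: cont_cst.
apply: contM; first exact: cont_cst.
by apply: cont_pp; apply: contN; exact: continuous_coord.
Qed.

Lemma xi0_gt0 x : 0 < xi ord0 x. Proof. by rewrite /xi eqxx theta_gt0. Qed.

Definition PP x : R := \sum_j xi j x ^+ 2.

Lemma xi_le_PP i j x : `|xi i x * xi j x| <= PP x.
Proof.
have h k : xi k x ^+ 2 <= PP x by rewrite /PP (bigD1 k)//= lerDl sumr_ge0// => l _; exact: sqr_ge0.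
have := h i; have := h j; have := normr_ge0 (xi i x); have := normr_ge0 (xi j x).
by rewrite normrM -[xi i x ^+ 2]real_normK ?num_real// -[xi j x ^+ 2]real_normK ?num_real//; nra.
Qed.

Lemma PP_gt0 x : 0 < PP x.
Proof.
apply: lt_le_trans (xi_le_PP ord0 ord0 x).
by rewrite normr_gt0 mulf_neq0// gt_eqF// xi0_gt0.
Qed.

Let PPn x : PP x != 0. Proof. by rewrite gt_eqF// PP_gt0. Qed.

Lemma cont_PP : continuous PP.
Proof. by apply: cont_sum => j _; apply: contX; exact: cont_xi. Qed.

Lemma pd_PP i x : pd i PP x (2 * xi i x * dxi i x).
Proof.
have := @pd_sum R n.+1 i _ (index_enum 'I_n.+1) (fun j y => xi j y ^+ 2)
 (fun j => 2 * xi j x * ((i == j)%:R * dxi j x)) x.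
move=> /(_ _) h; apply: pd_eq; first by apply: h => j; apply: pd_eq (pdX 1 (pd_xi i j x)) _; rewrite expr1.
rewrite (bigD1 i)//= eqxx big1; first by rewrite mulr1n; ring.
by move=> j ji; rewrite eq_sym (negbTE ji); rewrite mulr0n; ring.
Qed.

Definition qq x : R := 1 - c * (xi ord0 x ^+ 2 / PP x).

Lemma a_itv x : 0 <= xi ord0 x ^+ 2 / PP x <= 1.
Proof.
rewrite divr_ge0 ?sqr_ge0 ?(ltW (PP_gt0 x))//= ler_pdivrMr ?PP_gt0// mul1r.
by apply: le_trans (xi_le_PP ord0 ord0 x); rewrite expr2 ler_norm.
Qed.

Let c0 : 0 < c. Proof. by rewrite cE; have := k0; have := k1; nra. Qed.
Let c1 : c < 1. Proof. by rewrite cE; have := k0; nra. Qed.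

Lemma qq_itv x : 0 < qq x <= 1.
Proof.
have /andP[a0 a1] := a_itv x; rewrite /qq; move: a0 a1; set a := _ / _ => a0 a1.
have := c0; have := c1; nra.
Qed.

Let q0 x : 0 < qq x. Proof. by have /andP[] := qq_itv x. Qed.

Lemma cont_qq : continuous qq.
Proof.
apply: contB; first exact: cont_cst.
apply: contM; first exact: cont_cst.
apply: contM; first by apply: contX; exact: cont_xi.
by apply: contV; [exact: PPn|exact: cont_PP].
Qed.

Let D i : R := (i == ord0)%:R.
Let Dx i x : D i * xi i x = D i * xi ord0 x.
Proof. by rewrite /D; case: eqP => [->|_] //; rewrite !mul0r. Qed.

Definition da i x : R := 2 * xi ord0 x * D i / PP x - 2 * xi ord0 x ^+ 2 * xi i x / PP x ^+ 2.

Lemma pd_xi0 i x : pd i (xi ord0) x (D i * dxi i x).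
Proof. by apply: pd_eq (pd_xi i ord0 x) _; rewrite /D; case: eqP => [->|_] //; rewrite !mul0r. Qed.

Lemma pd_qq i x : pd i qq x (- c * da i x * dxi i x).
Proof.
apply: pd_eq; first by apply: pdB; [exact: pd_cst|apply: pdZ; apply: pdM; [exact: pdX (pd_xi0 i x)|apply: pdV (pd_PP i x); exact: PPn]].
by rewrite /da; field; exact: PPn.
Qed.

(** The gradient of the barrier in the upper half space, up to the scalar factor 5 PP^(-mm/2); its
    squared length is [qq]. *)
Definition BB i x : R := D i - mm * xi ord0 x * xi i x / PP x.
Definition dB i x : R := - (mm * (D i * xi ord0 x + xi ord0 x) / PP x) + 2 * mm * xi ord0 x * xi i x ^+ 2 / PP x ^+ 2.

Lemma pd_xii i x : pd i (xi i) x (dxi i x).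
Proof. by apply: pd_eq (pd_xi i i x) _; rewrite eqxx mul1r. Qed.

Lemma pd_BB i x : pd i (BB i) x (dB i x * dxi i x).
Proof.
apply: pd_eq; first by apply: pdB; [exact: pd_cst|apply: pdM; [apply: pdM; [apply: pdZ; exact: pd_xi0|exact: pd_xii]|apply: pdV (pd_PP i x); exact: PPn]].
have := Dx i x => E.
rewrite /dB -E; field; exact: PPn.
Qed.

Lemma cont_BB i : continuous (BB i).
Proof.
apply: contB; first exact: cont_cst.
apply: contM; last by apply: contV; [exact: PPn|exact: cont_PP].
by ctn; exact: cont_xi.
Qed.

Lemma BB_le i x : `|BB i x| <= 1 + mm.
Proof.
rewrite /BB (le_trans (ler_normB _ _))// lerD//.
 by rewrite /D; case: (i == ord0); rewrite ?normr1 ?normr0.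
rewrite -!mulrA normrM ger0_norm ?addr_ge0 ?(ltW k0)// ler_piMr ?addr_ge0 ?(ltW k0)//.
rewrite mulrA normrM normfV (gtr0_norm (PP_gt0 x)) ler_pdivrMr ?PP_gt0// mul1r; exact: xi_le_PP.
Qed.

Lemma sum_BB2 x : \sum_i BB i x ^+ 2 = qq x.
Proof.
have -> : \sum_i BB i x ^+ 2 = \sum_i (D i * (1 - 2 * mm * xi ord0 x ^+ 2 / PP x) + xi i x ^+ 2 * (mm * xi ord0 x / PP x) ^+ 2).
 apply: eq_bigr => i _; rewrite /BB.
 have DD : D i ^+ 2 = D i by rewrite /D; case: (i == ord0); rewrite ?expr1n ?expr0n.
 rewrite sqrrB DD; have := Dx i x => E.
 have -> : D i * (mm * xi ord0 x * xi i x / PP x) = (D i * xi i x) * (mm * xi ord0 x / PP x) by ring.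
 by rewrite E mulr2n; field; exact: PPn.
rewrite big_split -!mulr_suml -/(PP x) (bigD1 ord0)//= big1 ?addr0; last first.
 by move=> i /negbTE i0; rewrite /D i0.
by rewrite /qq /c /D eqxx; rewrite mulr1n; field; exact: PPn.
Qed.

(** The factor 5 makes it at least 1 at [ev] for all t in ]0, 1]; see [barrier_ev]. *)
Definition barrier x : R := 5 * xi ord0 x * PP x `^ (- (mm / 2)).
Definition dbarrier i x : R := 5 * PP x `^ (- (mm / 2)) * BB i x * dxi i x.

Let powR_pred x a : PP x `^ (a - 1) = PP x `^ a / PP x.
Proof. by rewrite powRB ?PPn ?implybT// powRr1// ltW// PP_gt0. Qed.

Lemma pd_barrier i x : pd i barrier x (dbarrier i x).
Proof.
apply: pd_eq; first by apply: pdM; [apply: pdZ; exact: pd_xi0|apply: pd_powR (pd_PP i x); exact: PP_gt0].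
by rewrite /dbarrier /BB powR_pred; field; exact: PPn.
Qed.

Lemma cont_barrier : continuous barrier.
Proof.
have cP a : continuous (fun x => PP x `^ a) by apply: cont_powR_pos; [exact: cont_PP|exact: PP_gt0].
by rewrite /barrier; ctn; exact: cont_xi.
Qed.

Lemma cont_dbarrier i : continuous (dbarrier i).
Proof.
have cP a : continuous (fun x => PP x `^ a) by apply: cont_powR_pos; [exact: cont_PP|exact: PP_gt0].
by rewrite /dbarrier; ctn; [exact: cont_BB|exact: cont_dxi].
Qed.

Lemma barrier_ge0 x : 0 <= barrier x.
Proof. by rewrite !mulr_ge0 ?powR_ge0// ltW// xi0_gt0. Qed.

(** In the upper half space this is 5^(1-p) times the flux of the gradient of the barrier; the
    formula has the required partial derivatives on the whole space. *)
Definition FF i x : R := PP x `^ (- (MM / 2)) * qq x `^ ((p - 2) / 2) * BB i x.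
Definition dFF i x : R := PP x `^ (- (MM / 2)) * qq x `^ ((p - 2) / 2) *
 (- (MM / PP x) * xi i x * BB i x - (p - 2) / 2 * c / qq x * da i x * BB i x + dB i x) * dxi i x.

Lemma pd_FF i x : pd i (FF i) x (dFF i x).
Proof.
have h1 := pd_powR (- (MM / 2)) (PP_gt0 x) (pd_PP i x).
have h2 := pd_powR ((p - 2) / 2) (q0 x) (pd_qq i x).
apply: pd_eq (pdM (pdM h1 h2) (pd_BB i x)) _.
have E : qq x `^ ((p - 2) / 2 - 1) = qq x `^ ((p - 2) / 2) / qq x.
 by rewrite powRB ?(gt_eqF (q0 x)) ?implybT// powRr1// ltW.
rewrite powR_pred E /dFF; field; by rewrite PPn gt_eqF.
Qed.

Lemma cont_FF i : continuous (FF i).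
Proof.
apply: contM; last exact: cont_BB.
by apply: contM; [apply: cont_powR_pos; [exact: cont_PP|exact: PP_gt0]|apply: cont_powR_pos; [exact: cont_qq|exact: q0]].
Qed.

Lemma cont_dFF i : continuous (dFF i).
Proof.
have cx := cont_xi; have cB := cont_BB; have cd := cont_dxi; have cP := cont_PP.
have cV k : continuous (fun x => (PP x ^+ k.+1)^-1).
 by apply: contV; [move=> x; rewrite expf_neq0|exact: contX].
have cV1 : continuous (fun x => (PP x)^-1) by exact: contV.
have cQ : continuous (fun x => (qq x)^-1) by apply: contV; [move=> x; rewrite gt_eqF|exact: cont_qq].
have cPa a : continuous (fun x => PP x `^ a) by apply: cont_powR_pos; [|exact: PP_gt0].
have cQa a : continuous (fun x => qq x `^ a) by apply: cont_powR_pos; [exact: cont_qq|exact: q0].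
by rewrite /dFF /da /dB; ctn.
Qed.

(** By the choice of [kap] everything cancels except a negative multiple of (p - 2) c xi_0 (1 -
    xi_0^2 / PP), where c = 1 - kap^2 is positive because p > n + 1. *)
Lemma div_FF x : 0 <= x 0 ord0 -> \sum_i dFF i x <= 0.
Proof.
move=> x0; have dx i : dxi i x = 1 by rewrite /dxi; case: ifP => // _; have [_ ->] := theta_pos x0.
set X := xi ord0 x; set P := PP x; set q := qq x; set nu := (p - 2) / 2.
have Pn : P != 0 by exact: PPn.
have qn : q != 0 := lt0r_neq0 (q0 x).
pose A0 := - (MM * X / P) - nu * c / q * (2 * X / P - 2 * (mm + 1) * X ^+ 3 / P ^+ 2) - mm * X / P.
pose A1 := MM * mm * X / P ^+ 2 - nu * c / q * (2 * mm * X ^+ 3 / P ^+ 3) + 2 * mm * X / P ^+ 2.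
pose A2 := - (mm * X / P).
have E i : dFF i x = P `^ (- (MM / 2)) * q `^ nu * (D i * A0 + xi i x ^+ 2 * A1 + A2).
 rewrite /dFF dx mulr1 -/P -/q -/nu; congr (_ * _). rewrite /BB /da /dB -/X -/P /A0 /A1 /A2.
 have := Dx i x; rewrite -/X; have DD : D i * D i = D i by rewrite /D; case: (i == ord0); rewrite ?mulr1 ?mulr0.
 move: DD; rewrite /D; case: eqP => [->|_] _ _.
  by have -> : (nat_of_bool true)%:R = 1 :> R by []; rewrite -/X; field; rewrite Pn qn.
 by have -> : (nat_of_bool false)%:R = 0 :> R by []; field; rewrite Pn qn.
rewrite (eq_bigr _ (fun i _ => E i)) -mulr_sumr.
have -> : \sum_i (D i * A0 + xi i x ^+ 2 * A1 + A2) = A0 + P * A1 + n.+1%:R * A2.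
 rewrite !big_split /= -!mulr_suml sumr_const card_ord mulr_natl.
 rewrite (bigD1 ord0)//= big1 ?addr0; last by move=> i /negbTE i0; rewrite /D i0.
 by rewrite /D eqxx mul1r.
have -> : A0 + P * A1 + n.+1%:R * A2 = - ((p - 2) * c * X * (1 - X ^+ 2 / P) / (P * q)).
 have nE : n.+1%:R = 1 + kap * (p - 1) by rewrite /kap -natr1 mulfVK ?gt_eqF// addrC.
 have ME : MM = (p - 1) * (1 + kap) by rewrite /MM /kap; field; rewrite gt_eqF.
 by rewrite /A0 /A1 /A2 nE ME /nu /mm; field; rewrite Pn qn.
rewrite mulrN oppr_le0; have /andP[a0 a1] := a_itv x.
have X0 : 0 <= X := ltW (xi0_gt0 x).
have P0 : 0 <= P := ltW (PP_gt0 x).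
have c0' := ltW c0; have q0' : 0 <= q := ltW (q0 x).
apply: mulr_ge0; first by rewrite mulr_ge0 ?powR_ge0.
apply: mulr_ge0; last by rewrite invr_ge0 mulr_ge0.
apply: mulr_ge0; last by rewrite subr_ge0.
by rewrite mulr_ge0// mulr_ge0// subr_ge0 ltW.
Qed.

Lemma dbarrierE x : 0 <= x 0 ord0 -> \row_i dbarrier i x = (5 * PP x `^ (- (mm / 2))) *: \row_i BB i x.
Proof.
move=> x0; have dx i : dxi i x = 1 by rewrite /dxi; case: ifP => // _; have [_ ->] := theta_pos x0.
by apply/rowP => i; rewrite !mxE /dbarrier dx mulr1.
Qed.

Lemma enorm_BB x : enorm (\row_i BB i x) = qq x `^ 2^-1.
Proof.
rewrite enorm_sqrt /dotp powR12_sqrt ?(ltW (q0 x))//; congr Num.sqrt.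
by rewrite -sum_BB2; apply: eq_bigr => i _; rewrite mxE expr2.
Qed.

Lemma flux_barrier x : 0 <= x 0 ord0 -> flux p (\row_i dbarrier i x) = 5 `^ (p - 1) *: \row_i FF i x.
Proof.
move=> x0; have E := dbarrierE x0; have eB := enorm_BB x.
have ME : MM = (p - 1) * mm by rewrite /MM /mm /kap; field; rewrite gt_eqF.
have s0 : 0 <= 5 * PP x `^ (- (mm / 2)) by rewrite mulr_ge0 ?powR_ge0.
rewrite /flux E enormZ (ger0_norm s0) eB; apply/rowP => i; rewrite !mxE /FF !mulrA; congr (_ * _).
rewrite !powRM// -!powRrM.
have -> : - (MM / 2) = - (mm / 2) * (p - 2) + - (mm / 2) by rewrite ME; field.
rewrite (powRD _ (r := - (mm / 2) * (p - 2))) ?PPn ?implybT//.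
have -> : 5 `^ (p - 1) = 5 `^ (p - 2) * 5.
 have -> : p - 1 = p - 2 + 1 by ring. by rewrite powRS// (_ : p - 2 + 1 = p - 1) ?gt_eqF//; ring.
by rewrite (mulrC (p - 2) 2^-1); ring.
Qed.

(** From |x|^2 <= 2 PP + 2 |y0|^2 = 2 PP + 1/2 and 1 <= PP / t^2, so that 1 + |x|^2 <= [KK] PP. *)
Definition KK : R := 2 + 3 / 2 / t ^+ 2.

Lemma KK_ge1 : 1 <= KK.
Proof.
rewrite /KK (@le_trans _ _ 2)//; first by lra.
by rewrite lerDl divr_ge0 ?exprn_ge0 ?(ltW t0)//; lra.
Qed.

Lemma rho_PP x : 0 <= x 0 ord0 -> rho x ^+ 2 <= KK * PP x.
Proof.
move=> x0; rewrite rho_sqr.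
have h0 : xi ord0 x = x 0 ord0 + t by rewrite /xi eqxx; have [->] := theta_pos x0.
have h1 : dotp x x <= 2 * PP x + 2 * dotp y0 y0.
 rewrite /dotp /PP !mulr_sumr -big_split /= ler_sum// => j _.
 have [->|j0] := eqVneq j ord0; first by rewrite h0 y00; have := t0; nra.
 by rewrite /xi (negbTE j0); rewrite -subr_ge0 (_ : _ - _ = (x 0 j - 2 * y0 0 j) ^+ 2) ?sqr_ge0; ring.
have h2 : t ^+ 2 <= PP x.
 apply: le_trans (le_trans (ler_norm _) (xi_le_PP ord0 ord0 x)); rewrite h0; have := t0; nra.
have h3 : 1 <= PP x / t ^+ 2 by rewrite ler_pdivlMr ?exprn_gt0// mul1r.
have -> : KK * PP x = 2 * PP x + 3 / 2 * (PP x / t ^+ 2) by rewrite /KK; field; rewrite gt_eqF.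
by move: h1; rewrite y0n; move: h3; set u := PP x / _; move: (PP x) (dotp x x) => a b; lra.
Qed.

Lemma PP_powR x a : 0 <= a -> 0 <= x 0 ord0 -> PP x `^ (- (a / 2)) <= KK `^ (a / 2) * rho x `^ (- a).
Proof.
move=> a0 x0; have a2 : 0 <= a / 2 by rewrite divr_ge0.
have K0 : 0 < KK := lt_le_trans ltr01 KK_ge1.
have -> : rho x `^ (- a) = (rho x ^+ 2) `^ (- (a / 2)).
 by rewrite powR_sqr ?(ltW (rho_gt0 x))//; congr (_ `^ _); field.
have -> : KK `^ (a / 2) = KK^-1 `^ (- (a / 2)).
 by rewrite -powR_inv1 ?(ltW K0)// -powRrM; congr (_ `^ _); ring.
rewrite -powRM ?invr_ge0 ?(ltW K0) ?sqr_ge0//; apply: powR_anti => //.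
 by rewrite mulr_gt0 ?invr_gt0 ?exprn_gt0 ?rho_gt0.
by rewrite ler_pdivrMl// rho_PP.
Qed.

Let K0 : 0 < KK. Proof. exact: lt_le_trans ltr01 KK_ge1. Qed.
Let m0 : 0 < mm. Proof. by rewrite addr_gt0. Qed.
Let M0 : 0 < MM. Proof. by rewrite addr_gt0// ltr0n. Qed.

Lemma powR_qq x a : 0 <= a -> qq x `^ a <= 1.
Proof.
move=> a0; have /andP[h0 h1] := qq_itv x.
rewrite -[X in _ <= X](_ : 1 `^ a = 1); last by rewrite powR1.
by apply: ge0_ler_powR; rewrite ?nnegrE ?(ltW h0).
Qed.

Definition KF : R := KK `^ (MM / 2) * (1 + mm).

Lemma KF_ge0 : 0 <= KF.
Proof. by rewrite mulr_ge0 ?powR_ge0// addr_ge0// ltW. Qed.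

Lemma FF_le i x : 0 <= x 0 ord0 -> `|FF i x| <= KF * rho x `^ (- MM).
Proof.
move=> x0; rewrite /FF !normrM !(ger0_norm (powR_ge0 _ _)).
have h1 := PP_powR (ltW M0) x0; have h2 := BB_le i x.
have h3 : qq x `^ ((p - 2) / 2) <= 1 by apply: powR_qq; rewrite divr_ge0// subr_ge0 ltW.
apply: (@le_trans _ _ (KK `^ (MM / 2) * rho x `^ (- MM) * 1 * (1 + mm))).
 by rewrite ler_pM ?mulr_ge0 ?powR_ge0// ler_pM ?powR_ge0.
by rewrite /KF; apply: eqW; ring.
Qed.

Lemma dbarrier_le x : 0 <= x 0 ord0 -> enorm (\row_i dbarrier i x) <= 5 * KK `^ (mm / 2) * rho x `^ (- mm).
Proof.
move=> x0; rewrite dbarrierE// enormZ enorm_BB ger0_norm ?mulr_ge0 ?powR_ge0//.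
apply: (@le_trans _ _ (5 * PP x `^ (- (mm / 2)))).
 by rewrite ler_piMr ?mulr_ge0 ?powR_ge0// powR_qq.
by rewrite -mulrA ler_wpM2l// PP_powR// ltW.
Qed.

Lemma barrier_ev : 1 <= barrier ev.
Proof.
have /andP[t0' t1] := t01.
have E0 : xi ord0 ev = 1 + t by rewrite /xi eqxx ev_0; have [->] := theta_pos ler01.
have EP : PP ev = (1 + t) ^+ 2 + 4^-1.
 rewrite /PP (bigD1 ord0)//= E0 -y0n /dotp [in RHS](bigD1 ord0)//= y00 mulr0 add0r; congr (_ + _).
 apply: eq_bigr => j j0; rewrite /xi (negbTE j0) /ev mxE eqxx (negbTE j0) /=.
 by rewrite mulr0n; ring.
have P1 : 1 <= PP ev by rewrite EP; nra.
have h : (PP ev)^-1 <= PP ev `^ (- (mm / 2)).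
 rewrite -powR_inv1 ?(le_trans ler01)//; apply: ler_powR => //.
 by rewrite lerN2 ler_pdivrMr// mul1r /mm; have := k1; lra.
rewrite /barrier E0; have u0 : 0 <= 5 * (1 + t) by nra.
apply: le_trans (ler_wpM2l u0 h); rewrite ler_pdivlMr// EP; nra.
Qed.

(** Where |x| < 3r/2 and r >= 1 one has rho <= 1 + 3r/2 <= 5r/2, so the bound 6/r of [dzet_le] is at
    most 15/rho. *)
Lemma dzet_rho r x : 1 <= r -> enorm (\row_i dzet r i x) <= 15 / rho x.
Proof.
move=> r1; have r0 : 0 < r by exact: lt_le_trans r1.
have [xr|xr] := leP (3 / 2 * r) (enorm x).
 have [_ h] := zet_out r0 xr; rewrite (_ : \row_i _ = 0) ?enorm0 ?divr_ge0 ?(ltW (rho_gt0 x))//.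
 by apply/rowP => i; rewrite !mxE h.
apply: (le_trans (dzet_le x r0)); rewrite ler_pdivlMr ?rho_gt0// mulrAC ler_pdivrMr//.
have := rho_le x; move: (rho x) (enorm x) xr => a b; lra.
Qed.

(** The field [FF] is tested with u times a cutoff of radius k + 1. The cutoff error is dominated by
    rho^(-MM): u grows at most like rho and the gradient of the cutoff decays like 1/rho. As p > 2,
    MM = p - 1 + n exceeds the dimension n + 1. *)
Lemma divergence_ineq u g C : W u g -> (forall x, 0 <= u x) -> (forall x, x 0 ord0 <= 0 -> u x = 0) ->
 (forall x, u x <= C * rho x) -> integ (fun x => \sum_i FF i x * g x 0 i) ->
 0 <= I (fun x => \sum_i FF i x * g x 0 i).
Proof.
move=> [cu wu] u0 uneg uC iS; have lu := cont_loc cu.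
pose z (k : nat) x := zet k.+1%:R x; pose dz (k : nat) i x := dzet k.+1%:R i x.
have k0' (k : nat) : 0 < k.+1%:R :> R by [].
pose A (k : nat) x := (\sum_i FF i x * g x 0 i) * z k x.
pose B (k : nat) x := u x * \sum_i FF i x * dz k i x.
have cz k : continuous (z k) by exact: cont_zet.
have cdz k i : continuous (dz k i) by exact: cont_dzet.
have bz k := @zet_bsupp R n.+1 _ (k0' k).
have main k : - I (B k) <= I (A k).
 pose F i x := FF i x * z k x; pose dF i x := FF i x * dz k i x + z k x * dFF i x.
 have cF i : continuous (F i) by apply: contM => //; exact: cont_FF.
 have cdF i : continuous (dF i) by apply: contD; apply: contM => //; [exact: cont_FF|exact: cont_dFF].
 have bF i : bsupp (2 * k.+1%:R) (F i) by move=> x h; rewrite /F /z (bz k).1// mulr0.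
 have bdF i : bsupp (2 * k.+1%:R) (dF i).
  by move=> x h; rewrite /dF /z /dz (bz k).1// (bz k).2// mulr0 mul0r addr0.
 have pF i x : pd i (F i) x (dF i x) by apply: pdM; [exact: pd_FF|exact: pd_zet].
 have i1 i : integ (fun x => u x * dF i x) := loc_cs_integ lu (cdF i) (bdF i).
 have i2 i : integ (fun x => g x 0 i * F i x) := loc_cs_integ (wd_loc (wu i)) (cF i) (bF i).
 have i3 : integ (B k).
  apply: (loc_cs_integ lu (r := 2 * k.+1%:R)).
   by ctn; exact: cont_FF.
  by move=> x h; rewrite big1// => i _; rewrite /dz (bz k).2// mulr0.
 have -> : I (A k) = \sum_i I (fun x => g x 0 i * F i x).
  rewrite -I_sum//; apply: eq_I => x; rewrite /A mulr_suml; apply: eq_bigr => i _; rewrite /F; ring.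
 rewrite (eq_bigr (fun i => - I (fun x => u x * dF i x))); last first.
  by move=> i _; rewrite ((wu i).2 _ _ _ (cF i) (bF i) (pF i) (cdF i)) opprK.
 rewrite sumrN lerN2 -I_sum//; apply: I_le => //; first exact: integ_sum.
 move=> x; rewrite -mulr_sumr /B. have [x0|/ltW x0] := leP (x 0 ord0) 0.
  by rewrite (uneg _ x0) !mul0r.
 rewrite ler_wpM2l// /dF big_split /= gerDl -mulr_sumr. have /andP[z0 _] := zet_itv k.+1%:R x.
 by rewrite mulr_ge0_le0//; exact: div_FF.
pose Cb := C * (n.+1%:R * KF) * 15.
have C0 : 0 <= C by have := uC 0; have := u0 0; have := rho_ge1 (0 : 'rV[R]_n.+1); nra.
have Cb0 : 0 <= Cb by apply: mulr_ge0 => //; apply: mulr_ge0 => //; apply: mulr_ge0 => //; exact: KF_ge0.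
have [|||||iA hA] := @I_dct R n.+1 A (fun x => \sum_i FF i x * g x 0 i) (fun x => `|\sum_i FF i x * g x 0 i|).
- by move=> k; apply: mfnM; [exact: integ_mfn|exact: mfn_cont].
- exact: integ_mfn.
- exact: integ_abs.
- apply: aeW => x; apply: cvg_near_cst.
 have [K hK] : exists K : nat, enorm x <= K%:R.
  by exists (Num.truncn (enorm x)).+1; apply: ltW; rewrite -truncn_le_nat.
 exists K => // k /= Kk; rewrite /A /z; have [|-> _] := @zet_in R n.+1 k.+1%:R x (k0' k); last by rewrite mulr1.
 by apply: (le_trans hK); rewrite ler_nat ltnW.
- by move=> k x; have /andP[h0 h1] := zet_itv k.+1%:R x; rewrite normrM (ger0_norm h0) ler_piMr.
have mB k : mfn (B k).
 apply: mfn_cont; apply: contM => //; apply: cont_sum => i _; apply: contM => //; exact: cont_FF.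
have [|||iB hB] := @I_dct R n.+1 B (fun=> 0) (fun x => Cb * rho x `^ (- MM)) mB (mfn_cst 0).
- apply: integZ; apply: integ_rho; rewrite /MM -natr1 addrC ltrD2r; have := p2; lra.
- apply: aeW => x; apply: cvg_near_cst.
 have [K hK] : exists K : nat, enorm x <= K%:R.
  by exists (Num.truncn (enorm x)).+1; apply: ltW; rewrite -truncn_le_nat.
 exists K => // k /= Kk; rewrite /B /dz; have [|_ h] := @zet_in R n.+1 k.+1%:R x (k0' k).
  by apply: (le_trans hK); rewrite ler_nat ltnW.
 by rewrite big1 ?mulr0// => i _; rewrite h mulr0.
- move=> k x; have [x0|/ltW x0] := leP (x 0 ord0) 0.
  by rewrite /B (uneg _ x0) mul0r normr0; apply: mulr_ge0; [exact: Cb0|exact: powR_ge0].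
 rewrite /B normrM (ger0_norm (u0 x)).
 have h1 : `|\sum_i FF i x * dz k i x| <= n.+1%:R * (KF * rho x `^ (- MM)) * (15 / rho x).
  have -> : \sum_i FF i x * dz k i x = dotp (\row_i FF i x) (\row_i dz k i x).
   by apply: eq_bigr => i _; rewrite !mxE.
  apply: (le_trans (dotp_le _ _)); rewrite ler_pM ?enorm_ge0//.
   apply: (le_trans (enorm_le_sum _)); apply: (@le_trans _ _ (\sum_(i < n.+1) KF * rho x `^ (- MM))).
    by apply: ler_sum => i _; rewrite mxE FF_le.
   by rewrite sumr_const card_ord mulr_natl.
  by apply: dzet_rho; rewrite ler1n.
 apply: (@le_trans _ _ (C * rho x * (n.+1%:R * (KF * rho x `^ (- MM)) * (15 / rho x)))).
  by rewrite ler_pM.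
 by rewrite le_eqVlt /Cb; apply/orP; left; apply/eqP; field; rewrite gt_eqF// rho_gt0.
have I00 : I (fun _ : 'rV[R]_n.+1 => 0) = 0 by exact: I0.
rewrite I00 in hB.
have hBN : - I (B k) @[k --> \oo] --> 0 by rewrite -oppr0; apply: cvgN.
by have := ler_lim_seq hBN hA main.
Qed.

(** Let u be the positive part of w - [barrier], with gradient g. The minimum of w and the barrier,
    w - u, is a competitor with gradient H. Where g is not 0, H is the gradient of the barrier, so
    the strong tangent inequality at H has a cross term that is nonnegative by [divergence_ineq],
    and minimality of w forces g to have energy 0. *)
Lemma comparison w G : comp p Hs ev w G -> energy p G = lstar n p -> (forall x, 0 <= w x) ->
 forall x, w x <= barrier x.
Proof.
move=> hc hm w0; have [WG LG wn w1] := hc.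
have p0 : 0 < p := p2_gt0 p2.
have p1 : 1 < p := p2_gt1 p2.
pose DV x : 'rV[R]_n.+1 := \row_i dbarrier i x.
have WV : W barrier DV by apply: W_smooth; [exact: pd_barrier|exact: cont_barrier|exact: cont_dbarrier].
pose b x : R := if 0 < w x - barrier x then 1 else 0.
pose u x := pp (w x - barrier x); pose g x : 'rV[R]_n.+1 := b x *: (G x - DV x).
have Wu : W u g := W_pp (WB WG WV).
have wneg x : x 0 ord0 <= 0 -> w x = 0 by move=> x0; apply: wn; rewrite /Hs /= ltNge x0.
have bpos x : 0 < w x - barrier x -> 0 <= x 0 ord0.
 rewrite subr_gt0 => h; rewrite leNgt; apply/negP => /ltW /wneg x0.
 by move: h; rewrite x0 ltNge barrier_ge0.
have u0 x : 0 <= u x by exact: pp_ge0.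
have uneg x : x 0 ord0 <= 0 -> u x = 0 by move=> /wneg x0; rewrite /u x0 pp_neg// sub0r oppr_le0 barrier_ge0.
have ule x : u x <= w x.
 rewrite /u; have [h|h] := leP 0 (w x - barrier x).
  by rewrite pp_pos// gerBl barrier_ge0.
 by rewrite pp_neg// ltW.
pose Cv := (5 * KK `^ (mm / 2)) `^ p.
have Lg : Lp p g.
 apply: (@Lp_le _ _ p (fun x => 2 `^ p * (enorm (G x) `^ p + Cv * rho x `^ (- (mm * p))))).
 - exact: W_mfn Wu.
 - move=> x; rewrite /g /b; case: ifP => [/bpos x0|_]; last first.
   by rewrite scale0r enorm0 powR0 ?gt_eqF// mulr_ge0// addr_ge0 ?mulr_ge0 ?powR_ge0.
  rewrite scale1r; apply: (le_trans (enormD_powR _ _ (ltW p0))).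
  rewrite ler_wpM2l// lerD2l enormN.
  apply: (@le_trans _ _ ((5 * KK `^ (mm / 2) * rho x `^ (- mm)) `^ p)).
   apply: ge0_ler_powR; rewrite ?nnegrE ?enorm_ge0 ?mulr_ge0 ?powR_ge0 ?(ltW p0)//; exact: dbarrier_le.
  by rewrite powRM ?mulr_ge0 ?powR_ge0// -powRrM mulNr.
 - apply: integZ; apply: integD; first exact: LG.2.
  apply: integZ; apply: integ_rho; apply: (lt_le_trans np).
  by rewrite ler_peMl ?(ltW p0)// lerDl ltW.
pose H x := G x - g x.
have LH : Lp p H := LpB (ltW p0) LG Lg.
have WH : W (fun x => w x - u x) H := WB WG Wu.
have cH : comp p Hs ev (fun x => w x - u x) H.
 split; [exact: WH|exact: LH| |].
  move=> x hx; have h : x 0 ord0 <= 0 by rewrite leNgt; apply/negP.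
  by rewrite uneg// wneg// subr0.
 by rewrite w1 /u w1 pp_neg ?subr0// subr_le0 barrier_ev.
have fluxE x : dotp (flux p (H x)) (g x) = 5 `^ (p - 1) * \sum_i FF i x * g x 0 i.
 rewrite /H /g /b; case: ifP => [/bpos x0|_]; last first.
  rewrite scale0r dotpC dotp0l big1 ?mulr0// => i _; by rewrite mxE mulr0.
 rewrite scale1r subKr flux_barrier// dotpZl; congr (_ * _).
 by apply: eq_bigr => i _; rewrite [in LHS]mxE.
have five : 0 < 5 `^ (p - 1) by [].
have iS : integ (fun x => \sum_i FF i x * g x 0 i).
 apply: (@le_integ _ _ _ (fun x => (5 `^ (p - 1))^-1 * (enorm (H x) `^ p + enorm (g x) `^ p))).
 - by apply: mfn_sum => i; apply: mfnM; [apply: mfn_cont; exact: cont_FF|exact: Lg.1].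
 - move=> x; have -> : \sum_i FF i x * g x 0 i = (5 `^ (p - 1))^-1 * dotp (flux p (H x)) (g x).
   by rewrite fluxE mulrA mulVf ?mul1r// gt_eqF.
  rewrite normrM ger0_norm// ler_wpM2l//. apply: (le_trans (dotp_le _ _)); rewrite enorm_flux//.
  have := young_w p1 ltr01 (enorm_ge0 (g x)) (enorm_ge0 (H x)). by rewrite powR1 !mul1r.
 - by apply: integZ; exact: integD LH.2 Lg.2.
have [C1 C10 hC] := morrey_energy p2 np.
(* Morrey's inequality from the origin, where w vanishes; its exponent is at most 1. *)
have uC x : u x <= (C1 * energy p G `^ p^-1) * rho x.
 apply: (le_trans (ule x)); have := hC w G WG LG x 0; rewrite (wneg 0) ?mxE// !subr0.
 move=> h; apply: (le_trans (le_trans (ler_norm _) h)).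
 rewrite ler_wpM2l ?mulr_ge0 ?powR_ge0 ?(ltW C10)//. have al0 := al_gt0 np.
 apply: (@le_trans _ _ (rho x `^ (1 - n.+1%:R / p))).
  apply: ge0_ler_powR; rewrite ?nnegrE ?(ltW al0) ?(ltW (rho_gt0 x))//.
  exact: le_trans (norm_le_enorm x) (enorm_le_rho x).
 by apply: ler1_powR; [exact: rho_ge1|rewrite gerBl divr_ge0// ltW].
have key := divergence_ineq Wu u0 uneg uC iS.
have pt x : enorm (H x) `^ p + p * (5 `^ (p - 1) * \sum_i FF i x * g x 0 i) + 2 `^ (1 - p) * enorm (g x) `^ p
  <= enorm (G x) `^ p.
 by have := enorm_tangent_strong (G x) (H x) p2; rewrite /H subKr -/(H x) fluxE.
have i1 : integ (fun x => p * (5 `^ (p - 1) * \sum_i FF i x * g x 0 i)) by apply: integZ; exact: integZ.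
have i2 : integ (fun x => 2 `^ (1 - p) * enorm (g x) `^ p) by apply: integZ; exact: Lg.2.
have E0 : energy p g = 0.
 have := I_le (integD (integD LH.2 i1) i2) LG.2 pt.
 rewrite (ID (integD LH.2 i1) i2) (ID LH.2 i1) (IZ _ (integZ _ iS)) (IZ _ iS) (IZ _ Lg.2).
 have h1 := cap_le cH; have h2 := energy_ge0 p g. have two : 0 < 2 `^ (1 - p) by [].
 rewrite -/(lstar n p) -hm in h1. exact: comparison_arith h1 h2 key two p0 five.
move=> x; have := W_energy0 p2 np Wu Lg E0 x ev.
have -> : u ev = 0 by rewrite /u w1 pp_neg// subr_le0 barrier_ev.
move=> h; rewrite leNgt; apply/negP => h'; move: h; rewrite /u pp_pos ?subr_ge0 ?(ltW h')//.
by move=> /eqP; rewrite subr_eq0 => /eqP h; move: h'; rewrite h ltxx.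
Qed.

End barrier.

(** * Shears along quadratic forms *)

Section shear.
Context {R : realType} (n : nat).
Implicit Types (x y : 'rV[R]_n.+1) (S : 'M[R]_n.+1) (i j : 'I_n.+1) (e : R).

Definition qf S x : R := \sum_i \sum_j S i j * (x 0 i * x 0 j).
Definition dqf S i x : R := \sum_j (S i j + S j i) * x 0 j.
(** The form lives on the boundary hyperplane, so [qf S] is constant in the direction [ev]; hence a
    shear is inverted by changing the sign of its parameter. *)
Definition tangential S := forall i j, i = ord0 \/ j = ord0 -> S i j = 0.

Lemma pd_qf S i x : pd i (qf S) x (dqf S i x).
Proof.
have h := @pd_sum R n.+1 i _ (index_enum 'I_n.+1) (fun k y => \sum_j S k j * (y 0 k * y 0 j))
 (fun k => \sum_j S k j * (x 0 k * (i == j)%:R + x 0 j * (i == k)%:R)) x.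
apply: pd_eq.
 by apply: h => k; apply: pd_sum => j; apply: pdZ; apply: pdM; exact: pd_coord.
rewrite /dqf; under eq_bigr do (under eq_bigr do rewrite mulrDr; rewrite big_split /=).
rewrite big_split /= addrC; under [in RHS]eq_bigr do rewrite mulrDl; rewrite [in RHS]big_split /=; congr (_ + _).
 rewrite (bigD1 i)//= [X in _ + X]big1 ?addr0.
  by apply: eq_bigr => j _; rewrite eqxx; rewrite mulr1n; ring.
 move=> k ki; apply: big1 => j _; rewrite eq_sym (negbTE ki). by rewrite mulr0n; ring.
apply: eq_bigr => k _; rewrite (bigD1 i)//= [X in _ + X]big1 ?addr0.
 by rewrite eqxx; rewrite mulr1n; ring.
by move=> j ji; rewrite eq_sym (negbTE ji); rewrite mulr0n; ring.
Qed.

Lemma cont_qf S : continuous (qf S).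
Proof.
apply: cont_sum => i _; apply: cont_sum => j _; apply: contM; first exact: cont_cst.
by ctn.
Qed.

Lemma cont_dqf S i : continuous (dqf S i).
Proof. by apply: cont_sum => j _; apply: contM; [exact: cont_cst|exact: continuous_coord]. Qed.

Let addev x (a : R) j : (x + a *: ev) 0 j = x 0 j + a * (j == ord0)%:R.
Proof. by rewrite /ev !mxE eqxx. Qed.

Lemma qf_ev S x (a : R) : tangential S -> qf S (x + a *: ev) = qf S x.
Proof.
move=> tS; apply: eq_bigr => i _; apply: eq_bigr => j _.
have [i0|i0] := eqVneq i ord0; first by rewrite tS ?mul0r//; left.
have [j0|j0] := eqVneq j ord0; first by rewrite tS ?mul0r//; right.
by rewrite !addev (negbTE i0) (negbTE j0) !mulr0 !addr0.
Qed.

Lemma dqf_ev S i x (a : R) : tangential S -> dqf S i (x + a *: ev) = dqf S i x.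
Proof.
move=> tS; apply: eq_bigr => j _.
have [j0|j0] := eqVneq j ord0.
 have h1 : S i j = 0 by apply: tS; right. have h2 : S j i = 0 by apply: tS; left.
 by rewrite h1 h2 addr0 !mul0r.
by rewrite !addev (negbTE j0) !mulr0 !addr0.
Qed.

Lemma dqf0 S x : tangential S -> dqf S ord0 x = 0.
Proof. by move=> tS; apply: big1 => j _; rewrite !tS ?addr0 ?mul0r//; [right|left]. Qed.

Lemma qf_ev0 S : tangential S -> qf S ev = 0.
Proof.
move=> tS; have := qf_ev 0 1 tS; rewrite scale1r add0r => ->.
by rewrite /qf big1// => i _; rewrite big1// => j _; rewrite !mxE !mulr0.
Qed.

Lemma tangential_sqr_ge0 x : 0 <= dotp x x - x 0 ord0 ^+ 2.
Proof.
by rewrite subr_ge0 -enormE -(real_normK (num_real (x 0 ord0))) ler_sqr ?nnegrE ?enorm_ge0// coord_le_enorm.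
Qed.

Definition shear S e x := x - (e * qf S x) *: ev.

Lemma shearK S e : tangential S -> cancel (shear S e) (shear S (- e)).
Proof. by move=> tS x; rewrite /shear -scaleNr qf_ev// mulNr -addrA -scalerBl subrr scale0r addr0. Qed.

Lemma cont_shear S e : continuous (shear S e).
Proof.
apply: continuous_rVP => j.
have -> : (fun x => shear S e x 0 j) = (fun x => x 0 j - (e * qf S x) * ev 0 j).
 by apply/funext => x; rewrite /shear rVB mxE.
by ctn; exact: cont_qf.
Qed.

Lemma leb_shear_qf S e A : tangential S -> measurable A -> leb n.+1 (shear S e @^-1` A) = leb n.+1 A.
Proof.
move=> tS mA; apply: (@leb_shear R n (fun x => e * qf S x)) => //.
 by ctn; exact: cont_qf.
by move=> x t; rewrite -/(@ev R n) qf_ev.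
Qed.

Lemma mfn_shear S e f : mfn f -> mfn (fun x => f (shear S e x)).
Proof.
move=> mf; apply: (measurableT_comp mf); exact: continuous_measurable_rV_rV (@cont_shear S e).
Qed.

Lemma integ_shear S e f : tangential S -> integ f -> integ (fun x => f (shear S e x)).
Proof.
move=> tS fi; have mp A (mA : measurable A) := @leb_shear_qf S e A tS mA.
exact: integrable_mp (@cont_shear S e) mp fi.
Qed.

Lemma I_shear S e f : tangential S -> mfn f -> I (fun x => f (shear S e x)) = I f.
Proof.
move=> tS mf; rewrite /I; congr fine.
apply: (@integral_mp R n.+1 (shear S e) (EFin \o f)); first exact: cont_shear.
 by move=> A mA; exact: leb_shear_qf.
by apply/measurable_EFinP.
Qed.

Lemma dqf_shear S i e x : tangential S -> dqf S i (shear S e x) = dqf S i x.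
Proof. by move=> tS; rewrite /shear -scaleNr; exact: dqf_ev. Qed.

(** The gradient of a sheared function, read at the image point. This is possible because [dqf] is
    invariant under the shear, and the energy can then be computed before composing. *)
Definition shear_grad S e (A : 'rV[R]_n.+1 -> 'rV[R]_n.+1) x : 'rV[R]_n.+1 :=
 A x - (e * A x 0 ord0) *: \row_i dqf S i x.

Lemma pd_shear S e i j x : pd i (fun x => shear S e x 0 j) x ((i == j)%:R - (j == ord0)%:R * (e * dqf S i x)).
Proof.
have -> : (fun x => shear S e x 0 j) = (fun x => x 0 j - ((j == ord0)%:R * e) * qf S x).
 by apply/funext => y; rewrite /shear rVB /ev !mxE eqxx; ring.
by apply: pd_eq (pdB (pd_coord i j x) (pdZ _ (pd_qf S i x))) _; rewrite mulrA.
Qed.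

Lemma W_shear S e u A : tangential S -> W u A ->
 W (fun x => u (shear S e x)) (fun x => shear_grad S e A (shear S e x)).
Proof.
move=> tS [cu wu]; split; first exact: cont_comp (@cont_shear S e) cu.
move=> i; have K1 := @shearK S e tS.
have K2 : cancel (shear S (- e)) (shear S e) by have := @shearK S (- e) tS; rewrite opprK.
pose a j y : R := (i == j)%:R - (j == ord0)%:R * (e * dqf S i y).
have := @wd_comp R n.+1 i u (fun j x => A x 0 j) (shear S e) (shear S (- e)) 1 a
 (fun j k y => (j == k)%:R - (k == ord0)%:R * (- e * dqf S j y)) (cont_loc cu) wu
 (@cont_shear S e) (@cont_shear S (- e)) K1 K2.
move=> H; apply: wd_eq; last apply: H.
- move=> x; rewrite /shear_grad rVB !mxE (bigD1 i)//= /a eqxx.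
 have [i0|i0] := eqVneq i ord0.
  rewrite big1 ?addr0.
   rewrite i0 !dqf0// !mulr0 !subr0. by rewrite mulr1n; rewrite mul1r.
  move=> j ji; have j0 : (j == ord0) = false by rewrite -i0 (negbTE ji).
  by rewrite eq_sym (negbTE ji) j0 mul0r subr0 mul0r.
 rewrite (bigD1 ord0)//= 1?eq_sym// big1 ?addr0; last first.
  by move=> j /andP[ji j0]; rewrite eq_sym (negbTE ji) (negbTE j0) mul0r subr0 mul0r.
 rewrite eq_sym (negbTE i0). rewrite mulr0n. rewrite mulr1n. by ring.
- by move=> f mf; exact: mfn_shear.
- by move=> f fi; exact: integ_shear.
- by move=> f fi; rewrite mul1r I_shear//; exact: integ_mfn.
- by move=> j x; apply: pd_eq (pd_shear S e i j x) _; rewrite /a dqf_shear.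
- by move=> j k y; exact: pd_shear.
- move=> j k; apply: contB; first exact: cont_cst.
 by ctn; exact: cont_dqf.
- move=> j; apply: contB; first exact: cont_cst.
 by ctn; exact: cont_dqf.
- move=> j y t; rewrite /a; have [->|j0] := eqVneq j ord0; first by rewrite -/(@ev R n) dqf_ev.
 by rewrite mulr0n; rewrite !mul0r.
Qed.

Lemma energy_shear S e p A : tangential S -> Lp p (shear_grad S e A) ->
 Lp p (fun x => shear_grad S e A (shear S e x)) /\
 energy p (fun x => shear_grad S e A (shear S e x)) = energy p (shear_grad S e A).
Proof.
move=> tS [mB iB]; split; last exact: (I_shear e tS (integ_mfn iB)).
split; last exact: (integ_shear e tS iB).
by move=> i; exact: (mfn_shear S e (mB i)).
Qed.

Lemma dqf_le S : exists2 L, 0 <= L & forall x, enorm (\row_i dqf S i x) <= L * enorm x.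
Proof.
exists (\sum_i \sum_j `|S i j + S j i|).
 by apply: sumr_ge0 => i _; apply: sumr_ge0.
move=> x; apply: (le_trans (enorm_le_sum _)); rewrite mulr_suml; apply: ler_sum => i _.
rewrite mxE /dqf (le_trans (ler_norm_sum _ _ _))// mulr_suml; apply: ler_sum => j _.
by rewrite normrM ler_wpM2l// coord_le_enorm.
Qed.

Lemma cont_flux p i : 2 < p -> continuous (fun b : 'rV[R]_n.+1 => flux p b 0 i).
Proof.
move=> p2; have -> : (fun b => flux p b 0 i) = (fun b => pp (enorm b) `^ (p - 2) * b 0 i).
 by apply/funext => b; rewrite /flux mxE pp_pos.
apply: contM; last exact: continuous_coord.
have q0 : 0 < p - 2 by rewrite subr_gt0.
exact: cont_comp (@enorm_continuous R n.+1) (cont_ppowR q0).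
Qed.

End shear.

Lemma powR_subl (R : realType) (a e : R) : 0 < a -> 0 < e < 1 -> (1 - e) `^ a * (1 + a * e) <= 1.
Proof.
move=> a0 /andP[e0 e1]; have q0 : 0 < 1 - e by rewrite subr_gt0.
have h1 : (1 - e) `^ a <= expR (- (a * e)).
 rewrite /powR gt_eqF// ler_expR -mulrN ler_wpM2l ?(ltW a0)//. by apply: le_ln1Dx; rewrite ltrN2.
have h2 : 1 + a * e <= expR (a * e) by exact: expR_ge1Dx.
apply: (@le_trans _ _ (expR (- (a * e)) * expR (a * e))); last by rewrite -expRD addNr expR0.
by apply: ler_pM => //; [exact: powR_ge0|rewrite addr_ge0// mulr_ge0// ltW].
Qed.

Lemma le_quarter (R : realType) (u s B : R) : 0 < s -> s * (4 * (u + 1)) <= B -> u * s <= B / 4.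
Proof. by move=> s0 h; lra. Qed.

Lemma expr_le_id (R : realType) (t : R) m : 0 < t -> t * 9 <= 1 -> (0 < m)%N -> t ^+ m <= t.
Proof.
move=> t0 t9 m0; rewrite -[X in _ <= X]expr1.
by apply: ler_wiXn2l => //; [exact: ltW|lra].
Qed.

Lemma lt0_first (R : realType) (p T t s A X : R) : 0 < A -> 0 <= p * T -> s <= t -> p * T * t <= A / 4 ->
 A <= X + A / 4 + p * (T * s) -> 0 < X.
Proof. by move=> A0 pT st h; have := ler_wpM2l pT st; rewrite mulrA; lra. Qed.

(** * Paraboloids and properties of the half space minimizer *)

Section minimizer.
Context {R : realType} (n : nat).
Local Notation rV := 'rV[R]_n.+1.
Implicit Types (x y : rV) (i j : 'I_n.+1) (S Q : 'M[R]_n.+1) (r e : R).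

Definition paraboloid (a : R) : 'M[R]_n.+1 := \matrix_(i, j) (if (i == j) && (i != ord0) then a else 0).

Lemma tangential_paraboloid a : tangential (paraboloid a).
Proof. move=> i j [->|->]; rewrite mxE ?andbF//.
by case: eqP => // ->; rewrite eqxx. Qed.

Lemma qf_paraboloid a x : qf (paraboloid a) x = a * (dotp x x - x 0 ord0 ^+ 2).
Proof.
rewrite /qf /dotp mulrBr mulr_sumr (bigD1 ord0)//= [X in _ = X - _](bigD1 ord0)//= expr2 addrAC subrr add0r.
rewrite big1 ?add0r; last by move=> j _; rewrite mxE eqxx andbF mul0r.
apply: eq_bigr => i i0; rewrite (bigD1 i)//= big1 ?addr0; first by rewrite mxE eqxx i0.
by move=> j ji; rewrite mxE eq_sym (negbTE ji) mul0r.
Qed.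

Lemma tr_paraboloid a : \tr (paraboloid a) = n%:R * a.
Proof.
rewrite /mxtrace (bigD1 ord0)//= mxE eqxx add0r.
rewrite (eq_bigr (fun=> a)); last by move=> i i0; rewrite mxE eqxx i0.
rewrite sumr_const -[X in X = _]mulr_natl; congr (_%:R * _).
by rewrite cardC1 card_ord.
Qed.

Lemma tr_paraboloid_gt0 (t : R) : (0 < n)%N -> 0 < t -> 0 < \tr (paraboloid (2 / t ^+ 2)).
Proof. by move=> n0 t0; rewrite tr_paraboloid mulr_gt0 ?ltr0n// divr_gt0// exprn_gt0. Qed.

Lemma I_cball (r : R) : 0 < r -> I (\1_(cball r) : rV -> R) = r ^+ n.+1 * I (\1_(cball 1) : rV -> R).
Proof.
move=> r0; have r2 : r^-1 != 0 by rewrite invr_neq0// gt_eqF.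
have -> : I (\1_(cball r) : rV -> R) = I (fun x => \1_(cball 1) (r^-1 *: x + 0)).
 apply: eq_I => x; rewrite !indicE; congr (_ : bool)%:R; apply/idP/idP; rewrite !inE /cball /= addr0 normrZ.
  by move=> h1; rewrite gtr0_norm ?invr_gt0// ler_pdivrMl// mulr1.
 by rewrite gtr0_norm ?invr_gt0// ler_pdivrMl// mulr1.
rewrite I_dilate//; last exact: integ_cball.
by rewrite gtr0_norm ?invr_gt0// -exprVn invrK.
Qed.

Lemma tilted_le (g d : rV) (e : R) : 0 <= e -> e * enorm d <= 1 ->
 enorm (g - (e * g 0 ord0) *: d) <= 2 * enorm g.
Proof.
move=> e0 h; apply: (le_trans (ler_enormD _ _)).
rewrite enormN enormZ normrM (ger0_norm e0) mulrDl mul1r lerD2l mulrAC.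
apply: (@le_trans _ _ (1 * enorm g)); last by rewrite mul1r.
by apply: ler_pM h (coord_le_enorm _ _) => //; rewrite mulr_ge0 ?enorm_ge0.
Qed.

Variables (p : R) (w : rV -> R) (G : rV -> rV).
Hypotheses (p2 : 2 < p) (np : n.+1%:R < p) (n0 : (0 < n)%N).
Hypotheses (hc : comp p Hs ev w G) (hm : energy p G = lstar n p) (w0 : forall x, 0 <= w x).
Let p0 : 0 < p := p2_gt0 p2.
Let p1 : 1 < p := p2_gt1 p2.
Let WG : W w G. Proof. by have [] := hc. Qed.
Let LG : Lp p G. Proof. by have [] := hc. Qed.
Let w1 : w ev = 1. Proof. by have [] := hc. Qed.
Let wneg x : x 0 ord0 <= 0 -> w x = 0.
Proof. by move=> x0; have [_ _ wn _] := hc; apply: wn; rewrite /Hs /= ltNge x0. Qed.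

(** * Pointwise bounds at infinity and near the origin *)

Section decay.

(** The pole: a boundary point at distance 1/2 from the origin, so that the resulting bound is
    regular at the origin. The last axis is tangential because n > 0. *)
Let z0 : rV := 2^-1 *: basis_rV ord_max.

Let z00 : z0 0 ord0 = 0.
Proof.
rewrite /z0 !mxE (_ : (ord0 == ord_max) = false) ?mulr0//.
by apply/negbTE; rewrite -val_eqE eq_sym -lt0n.
Qed.

Let z0n : dotp z0 z0 = 4^-1.
Proof. by rewrite /z0 dotpZl dotpZr dotp_basis mxE !eqxx; rewrite mulr1n; field. Qed.

Let m0 : 0 < mm n p.
Proof. by have /andP[k0 _] := kap_itv p2 np n0; rewrite addr_gt0. Qed.

(** The limit t -> 0 of [comparison], when the pole reaches the boundary. *)
Lemma minimizer_le x : 0 < x 0 ord0 -> w x <= 5 * x 0 ord0 * enorm (x - z0) `^ (- mm n p).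
Proof.
move=> x0; have xz : 0 < enorm (x - z0).
 rewrite enorm_gt0; apply/eqP => /rowP/(_ ord0); rewrite rVB z00 subr0 mxE => h.
 by move: x0; rewrite h ltxx.
rewrite -subr_le0; apply: (@le_eps R _ (5 * enorm (x - z0) `^ (- mm n p))); first by rewrite mulr_ge0 ?powR_ge0.
move=> e e0; pose t := Num.min e 1.
have t01 : 0 < t <= 1 by rewrite lt_min e0 ltr01 ge_min lexx orbT.
have te : t <= e by rewrite ge_min lexx.
have := comparison p2 np n0 t01 z00 z0n hc hm w0 x; rewrite /barrier.
have h0 : xi t z0 ord0 x = x 0 ord0 + t by rewrite /xi eqxx; have [->] := theta_pos t (ltW x0).
rewrite h0 => h; rewrite lerBlDr; apply: (le_trans h).
have hP : PP t z0 x `^ (- (mm n p / 2)) <= enorm (x - z0) `^ (- mm n p).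
 have -> : enorm (x - z0) `^ (- mm n p) = (enorm (x - z0) ^+ 2) `^ (- (mm n p / 2)).
  by rewrite powR_sqr//; congr (_ `^ _); field.
 apply: powR_anti; [by rewrite divr_ge0 ?(ltW m0)|by rewrite exprn_gt0|].
 rewrite enormE; apply: ler_sum => j _; rewrite rVB -expr2. have [->|j0] := eqVneq j ord0.
  by rewrite h0 z00 subr0 ler_sqr ?nnegrE ?lerDl ?addr_ge0 ?(ltW x0); have /andP[/ltW] := t01.
 by rewrite /xi (negbTE j0).
have /andP[t0 _] := t01.
apply: (@le_trans _ _ (5 * (x 0 ord0 + t) * enorm (x - z0) `^ (- mm n p))).
 by rewrite ler_wpM2l// mulr_ge0// addr_ge0// ltW.
have := ler_wpM2r (powR_ge0 (enorm (x - z0)) (- mm n p)) te.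
by move: (_ `^ _) (x 0 ord0) => D X; lra.
Qed.

Let z0_norm : enorm z0 = 2^-1.
Proof.
rewrite enorm_sqrt z0n (_ : 4^-1 = 2^-1 ^+ 2); last by field.
by rewrite sqrtr_sqr ger0_norm.
Qed.

Let m2 : mm n p <= 2.
Proof. by have /andP[_ k1] := kap_itv p2 np n0; rewrite /mm; lra. Qed.

Let powR4 : (4 : R) `^ mm n p <= 16.
Proof.
have -> : (16 : R) = 4 `^ 2 by rewrite powR_mulrn//; ring.
by apply: ler_powR m2; lra.
Qed.

(** The distance to the pole is at least 1/4 and mm <= 2, which gives the factor 5 * 4^2. *)
Lemma minimizer_near0 x : enorm x <= 4^-1 -> w x <= 80 * pp (x 0 ord0).
Proof.
move=> hx; have [x0|x0] := leP (x 0 ord0) 0; first by rewrite wneg// pp_neg// mulr0.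
rewrite pp_pos ?(ltW x0)//; apply: (le_trans (minimizer_le x0)).
have h : 4^-1 <= enorm (x - z0) by have := ler_enormB z0 x; rewrite enormB z0_norm; lra.
have h2 : enorm (x - z0) `^ (- mm n p) <= 16.
 apply: le_trans powR4; rewrite -[X in _ <= X `^ _]invrK -powR_inv1// -powRrM mulN1r.
 by apply: powR_anti => //; exact: ltW.
apply: (@le_trans _ _ (5 * x 0 ord0 * 16)); last by lra.
by rewrite ler_wpM2l// mulr_ge0// ltW.
Qed.

Lemma minimizer_decay : exists2 C, 0 < C & forall x, w x <= C * rho x `^ (- kap n p).
Proof.
have /andP[k0 k1] := kap_itv p2 np n0.
have [M M0 hM] := @cont_bounded_cball R n.+1 w 1 WG.1.
pose c := M * 2 `^ kap n p + 80.
exists c; first by rewrite ltr_wpDl// mulr_ge0.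
move=> x; have r1 := rho_ge1 x; have r0 := rho_gt0 x.
have [x1|x1] := leP (enorm x) 1.
 have rx : rho x <= 2 by apply: (le_trans (rho_le x)); lra.
 have h : 2 `^ (- kap n p) <= rho x `^ (- kap n p) by apply: powR_anti => //; exact: ltW.
 apply: (@le_trans _ _ (M * 2 `^ kap n p * 2 `^ (- kap n p))).
  rewrite -mulrA -powRD ?pnatr_eq0 ?implybT// subrr powRr0 mulr1.
  by apply: le_trans (hM x _); [exact: ler_norm|exact: le_trans (norm_le_enorm x) x1].
 by rewrite /c ler_pM ?mulr_ge0// lerDl.
have [x0|x0] := leP (x 0 ord0) 0.
 by rewrite wneg// mulr_ge0 ?powR_ge0// addr_ge0// mulr_ge0.
apply: (le_trans (minimizer_le x0)).
have h : rho x / 4 <= enorm (x - z0) by have := ler_enormB x z0; have := rho_le x; rewrite z0_norm; lra.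
have h2 : enorm (x - z0) `^ (- mm n p) <= 16 * rho x `^ (- mm n p).
 apply: (@le_trans _ _ ((rho x / 4) `^ (- mm n p))).
  by apply: powR_anti => //; [exact: ltW|rewrite divr_gt0].
 rewrite powRM ?(ltW r0)// mulrC ler_wpM2r ?powR_ge0//.
 by rewrite -powR_inv1// -powRrM mulN1r opprK.
have h3 : x 0 ord0 <= rho x := le_trans (le_trans (ler_norm _) (coord_le_enorm x ord0)) (enorm_le_rho x).
apply: (@le_trans _ _ (5 * rho x * (16 * rho x `^ (- mm n p)))).
 by rewrite ler_pM ?powR_ge0 ?mulr_ge0 ?(ltW x0)// ler_wpM2l.
have -> : 5 * rho x * (16 * rho x `^ (- mm n p)) = 80 * rho x `^ (- kap n p).
 rewrite (_ : - kap n p = - mm n p + 1); last by rewrite /mm; ring.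
 rewrite -powRS ?(ltW r0)//; first by ring.
 by rewrite (_ : - mm n p + 1 = - kap n p) ?oppr_eq0 ?gt_eqF//; rewrite /mm; ring.
by rewrite /c ler_wpM2r ?powR_ge0// lerDr mulr_ge0.
Qed.

End decay.

Lemma enorm_ev : enorm (@ev R n) = 1.
Proof. by rewrite enorm_sqrt {2}/ev dotp_basis ev_0 sqrtr1. Qed.

Lemma exists_exponent : exists k : nat, p <= k.+1%:R.
Proof. by exists (Num.truncn p); apply: ltW; rewrite -truncn_le_nat. Qed.

(** Hence h = z^(k+1), for a cutoff z, satisfies the condition on the gradient of h in
    [caccioppoli]: the derivative of h contains z^k. *)
Lemma pow_weight (k : nat) (z : R) : p <= k.+1%:R -> 0 <= z <= 1 -> z ^+ k <= (z ^+ k.+1) `^ ((p - 1) / p).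
Proof.
move=> pk /andP[z0 z1]; have q0 : 0 < (p - 1) / p by rewrite divr_gt0// subr_gt0.
have [->|zn] := eqVneq z 0.
 have k0 : (0 < k)%N by rewrite -ltnS -(ltr_nat R); apply: lt_le_trans pk.
 by rewrite !expr0n eqn0Ngt k0 powR0// gt_eqF.
have zp : 0 < z by rewrite lt_def zn.
rewrite -!powR_mulrn// -powRrM; apply: ger_powR; first by rewrite zp.
rewrite mulrA ler_pdivrMr//; move: pk; rewrite -natr1; move: (k%:R : R) => a; nra.
Qed.

(** Caccioppoli's inequality with a cutoff at scale r around the origin: there w = O(r) while the
    gradient of the cutoff is O(1/r), so only the volume of the ball remains. The density f allows
    smooth cutoffs in place of the ball. *)
Lemma energy_small_ball : exists C d, [/\ 0 <= C, 0 < d & forall r, 0 < r -> r <= d ->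
 forall f, mfn f -> (forall x, 0 <= f x) -> (forall x, f x <= enorm (G x) `^ p) -> (forall x, r < enorm x -> f x = 0) ->
 I f <= C * r ^+ n.+1].
Proof.
have [k pk] := exists_exponent.
pose K : R := k.+1%:R; have K0 : 0 <= K by [].
pose c := (80 * 2 * (6 * K)) `^ p; pose N : R := n.+1%:R.
pose V := I (\1_(cball 1) : rV -> R).
(* For r <= 1 / (8 N) the cube of radius 2 r lies in the Euclidean ball of radius 1/4, where
   [minimizer_near0] applies, and [ev] is off the support of the cutoff. *)
exists (c * (2 ^+ n.+1 * V)), (8 * N)^-1.
have N1 : 1 <= N by rewrite ler1n.
have N0 : 0 < N by exact: lt_le_trans N1.
split; first by rewrite !mulr_ge0 ?powR_ge0// I_ge0// => x; rewrite indicE ler0n.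
 by rewrite invr_gt0 mulr_gt0.
move=> r r0 rd f mf f0 fG fr.
have r8 : 8 * N * r <= 1 by rewrite mulrC -ler_pdivlMr ?mulr_gt0// mul1r.
pose h x := zet r x ^+ k.+1; pose dh i x := K * zet r x ^+ k * dzet r i x.
pose g x := 6 * K / r * \1_(cball (2 * r)) x.
have ph i x : pd i h x (dh i x) by apply: pdX; exact: pd_zet.
have ch : continuous h by apply: contX; exact: cont_zet.
have cdh i : continuous (dh i).
 by apply: contM; [apply: contM; [exact: cont_cst|apply: contX; exact: cont_zet]|exact: cont_dzet].
have h0 x : 0 <= h x by rewrite exprn_ge0; have /andP[] := zet_itv r x.
have hev : h ev = 0.
 rewrite /h; have [|->] := @zet_out R n.+1 r ev r0; last by rewrite expr0n.
 rewrite enorm_ev; have : 8 * r <= 1 by apply: le_trans r8; rewrite ler_wpM2r ?(ltW r0)// ler_peMr.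
 by lra.
have g0 x : 0 <= g x by rewrite mulr_ge0// divr_ge0 ?mulr_ge0 ?(ltW r0).
have hg x : enorm (\row_i dh i x) <= g x * h x `^ ((p - 1) / p).
 have [x2|x2] := leP `|x| (2 * r); last first.
  have -> : \row_i dh i x = 0.
   by apply/rowP => i; rewrite !mxE /dh (@zet_bsupp R n.+1 r r0).2// mulr0.
  by rewrite enorm0 mulr_ge0 ?powR_ge0.
 have -> : \row_i dh i x = (K * zet r x ^+ k) *: \row_i dzet r i x by apply/rowP => i; rewrite !mxE.
 have z01 := zet_itv r x; have /andP[z0 z1] := z01.
 have zk : 0 <= K * zet r x ^+ k by rewrite mulr_ge0 ?exprn_ge0.
 rewrite enormZ (ger0_norm zk) /g indicE mem_set// mulr1.
 apply: (le_trans (ler_wpM2l zk (dzet_le x r0))).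
 rewrite [X in X <= _](_ : _ = 6 * K / r * zet r x ^+ k); last by ring.
 by rewrite ler_wpM2l ?divr_ge0 ?mulr_ge0 ?(ltW r0)// pow_weight.
have pt x : (`|w x| * g x) `^ p <= c * \1_(cball (2 * r)) x.
 rewrite /g indicE; have [|_] := boolP (x \in cball (2 * r)); last first.
  by rewrite !mulr0 powR0// gt_eqF.
 rewrite inE /cball /= => x2; rewrite !mulr1 /c. have x4 : enorm x <= 4^-1.
  apply: (le_trans (enorm_le_norm x)); apply: (@le_trans _ _ (N * (2 * r))); first by rewrite ler_wpM2l// ltW.
  lra.
 have hw := minimizer_near0 x4. have hx : pp (x 0 ord0) <= 2 * r.
  rewrite /pp ge_max mulr_ge0 ?(ltW r0)//=; apply: (le_trans (le_trans (ler_norm _) (coord_le_norm x ord0))) => //.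
 have k0 : 0 <= 80 * 2 * (6 * K) by apply: mulr_ge0; apply: mulr_ge0; rewrite ?ler0n.
 have q0 : 0 <= 6 * K / r by rewrite mulr_ge0 ?mulr_ge0// invr_ge0 ltW.
 apply: ge0_ler_powR; [exact: ltW|rewrite nnegrE; apply: mulr_ge0; [exact: normr_ge0|exact: q0]|rewrite nnegrE; exact: k0|].
 rewrite ger0_norm// (_ : 80 * 2 * (6 * K) = 80 * 2 * r * (6 * K / r)); last by field; rewrite gt_eqF.
 rewrite ler_wpM2r//. by move: hw hx; move: (pp _) => a; lra.
have i1 : integ (fun x => c * \1_(cball (2 * r)) x) by apply: integZ; exact: integ_cball.
have mg : mfn (fun x => (`|w x| * g x) `^ p).
 apply: mfn_powR; apply: mfnM; first by apply: mfn_abs; apply: mfn_cont; exact: WG.1.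
 by apply: mfnM; [exact: mfn_cst|apply: mfn_indic; exact: measurable_cball].
have ig : integ (fun x => (`|w x| * g x) `^ p) by apply: le_integ i1 => // x; rewrite ger0_norm ?powR_ge0.
have [iA hA] := caccioppoli p2 hc hm ph ch cdh h0 hev g0 hg ig.
have fh x : f x <= enorm (G x) `^ p * h x.
 have [xr|xr] := leP (enorm x) r; last by rewrite fr// mulr_ge0 ?powR_ge0.
 by rewrite /h (zet_in r0 xr).1 expr1n mulr1.
have iF : integ f by apply: le_integ iA => // x; rewrite ger0_norm.
apply: (le_trans (I_le iF iA fh)); apply: (le_trans hA); apply: (le_trans (I_le ig i1 pt)).
rewrite IZ; last exact: integ_cball.
rewrite -!mulrA ler_wpM2l ?powR_ge0//.
have r2 : (2 * r)^-1 != 0 by rewrite invr_neq0// mulf_neq0// gt_eqF.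
have -> : I (\1_(cball (2 * r)) : rV -> R) = I (fun x => \1_(cball 1) ((2 * r)^-1 *: x + 0)).
 apply: eq_I => x; rewrite !indicE; congr (_ : bool)%:R; apply/idP/idP; rewrite !inE /cball /= addr0 normrZ.
  by move=> h1; rewrite gtr0_norm ?invr_gt0 ?mulr_gt0// ler_pdivrMl ?mulr_gt0// mulr1.
 by rewrite gtr0_norm ?invr_gt0 ?mulr_gt0// ler_pdivrMl ?mulr_gt0// mulr1.
rewrite I_dilate//; last exact: integ_cball.
rewrite gtr0_norm ?invr_gt0 ?mulr_gt0// -exprVn invrK exprMn -/V.
by apply: eqW; ring.
Qed.

(** Since kap p = n + kap, the integrand decays with exponent n + kap + p - 1, which exceeds the
    dimension n + 1 because p > 2. *)
Lemma integ_tail : integ (fun x => w x `^ p * rho x `^ (1 - p)).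
Proof.
have [C C0 hC] := minimizer_decay.
have /andP[k0 k1] := kap_itv p2 np n0.
apply: (@le_integ _ _ _ (fun x => C `^ p * rho x `^ (- (kap n p * p + (p - 1))))).
- by apply: mfnM; apply: mfn_powR; apply: mfn_cont; [exact: WG.1|exact: cont_rho].
- move=> x; rewrite ger0_norm ?mulr_ge0 ?powR_ge0//.
 have r0 := rho_gt0 x.
 rewrite opprD (powRD _ (r := - (kap n p * p))) ?(gt_eqF r0) ?implybT// mulrA opprB ler_wpM2r ?powR_ge0//.
 rewrite -mulNr powRrM -powRM ?(ltW C0)//.
 by apply: ge0_ler_powR; rewrite ?nnegrE ?(ltW p0) ?mulr_ge0 ?powR_ge0 ?(ltW C0).
- apply: integZ; apply: integ_rho.
 have -> : kap n p * p = n%:R + kap n p by rewrite /kap; field; rewrite gt_eqF// subr_gt0.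
 by rewrite -natr1 -addrA ltrD2l; have := p2; lra.
Qed.

(** Caccioppoli's inequality with a weight h that equals rho far out and vanishes near [ev]. Its
    gradient is bounded by c z^k, so g is a multiple of rho^(-(p-1)/p), and the right-hand side is
    [integ_tail]. *)
Lemma integ_moment : integ (fun x => enorm (G x) `^ p * rho x).
Proof.
have [k pk] := exists_exponent.
pose K : R := k.+1%:R; have K0 : 0 <= K by [].
pose z x := 1 - zet 4 x.
have z01 x : 0 <= z x <= 1 by have /andP[a b] := zet_itv 4 x; rewrite /z; apply/andP; split; lra.
pose h x := z x ^+ k.+1 * rho x.
pose dh i x := z x ^+ k.+1 * (x 0 i / rho x) + rho x * (K * z x ^+ k * - dzet 4 i x).
pose c := 15 * K + 1; pose g x := c * rho x `^ (- ((p - 1) / p)).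
have c0 : 0 <= c by rewrite addr_ge0// mulr_ge0.
have pz i x : pd i z x (- dzet 4 i x).
 by apply: (@pd_eq _ _ _ _ _ (0 - dzet 4 i x)); [apply: pdB; [exact: pd_cst|exact: pd_zet]|rewrite sub0r].
have cz : continuous z by apply: contB; [exact: cont_cst|exact: cont_zet].
have ph i x : pd i h x (dh i x) by apply: pdM; [apply: pdX; exact: pz|exact: pd_rho].
have cr := @cont_rho R n.+1.
have ch : continuous h by apply: contM => //; exact: contX.
have cdh i : continuous (dh i).
 apply: contD; apply: contM => //; first exact: contX.
  apply: contM; first exact: continuous_coord. by apply: contV => // x; rewrite gt_eqF// rho_gt0.
 by ctn; exact: cont_dzet.
have h0 x : 0 <= h x by have /andP[a b] := z01 x; rewrite mulr_ge0 ?exprn_ge0// ltW// rho_gt0.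
have four : 0 < 4 :> R by [].
have hev : h ev = 0.
 rewrite /h /z; have [|->] := @zet_in R n.+1 4 ev four; first by rewrite enorm_ev; lra.
 by rewrite subrr expr0n mul0r.
have g0 x : 0 <= g x by rewrite mulr_ge0 ?powR_ge0.
have hg x : enorm (\row_i dh i x) <= g x * h x `^ ((p - 1) / p).
 have /andP[a b] := z01 x; have r0 := rho_gt0 x.
 have -> : \row_i dh i x = (z x ^+ k.+1 / rho x) *: x + (- (rho x * (K * z x ^+ k))) *: \row_i dzet 4 i x.
  by apply/rowP => i; rewrite !mxE /dh; ring.
 have zk : 0 <= z x ^+ k by rewrite exprn_ge0. apply: (@le_trans _ _ (c * z x ^+ k)).
  apply: (le_trans (ler_enormD _ _)); rewrite !enormZ normrN !ger0_norm ?mulr_ge0 ?invr_ge0 ?exprn_ge0 ?(ltW r0)//.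
  rewrite /c mulrDl mul1r addrC lerD//.
   have four1 : 1 <= 4 :> R by rewrite ler1n.
   apply: (le_trans (ler_wpM2l _ (dzet_rho x four1))); first by rewrite !mulr_ge0// ltW.
   by apply: eqW; field; rewrite gt_eqF.
  rewrite -mulrA mulrC -mulrA; apply: (@le_trans _ _ (z x ^+ k.+1)); last by rewrite exprS ler_piMl.
  by rewrite mulrA ler_piMl ?exprn_ge0// mulrC ler_pdivrMr// mul1r enorm_le_rho.
 rewrite /g -mulrA ler_wpM2l// /h powRM ?exprn_ge0 ?(ltW r0)// mulrCA -powRD ?(gt_eqF r0) ?implybT//.
 by rewrite addNr powRr0 mulr1 pow_weight.
have E x : (`|w x| * g x) `^ p = c `^ p * (w x `^ p * rho x `^ (1 - p)).
 rewrite ger0_norm// /g !powRM ?mulr_ge0 ?powR_ge0// -powRrM.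
 have -> : - ((p - 1) / p) * p = 1 - p by field; rewrite gt_eqF. by ring.
have ig : integ (fun x => (`|w x| * g x) `^ p) by apply: eq_integ (integZ (c `^ p) integ_tail) => x; rewrite E.
have [iA _] := caccioppoli p2 hc hm ph ch cdh h0 hev g0 hg ig.
(* Where the weight is not yet equal to rho one has |x| < 6, hence rho <= 7. *)
have i2 := integD iA (integZ 7 LG.2).
apply: le_integ i2; first by apply: mfnM; [exact: integ_mfn LG.2|exact: mfn_cont].
move=> x; rewrite ger0_norm ?mulr_ge0 ?powR_ge0 ?(ltW (rho_gt0 x))//.
rewrite [7 * _]mulrC -mulrDr ler_wpM2l ?powR_ge0//.
have [x6|x6] := leP (3 / 2 * 4) (enorm x).
 by rewrite /h /z (zet_out four x6).1 subr0 expr1n mul1r lerDl.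
have := rho_le x; have := h0 x; move: x6; move: (enorm x) (rho x) (h x) => a b d; lra.
Qed.

Definition cut_grad r x : rV := zet r x *: G x + w x *: \row_i dzet r i x.

Lemma W_cut r : W (fun x => w x * zet r x) (cut_grad r).
Proof. by apply: W_prod => //; [exact: pd_zet|exact: cont_zet|exact: cont_dzet]. Qed.

Lemma cut_grad_in r x : 0 < r -> enorm x <= r -> cut_grad r x = G x.
Proof.
move=> r0 xr; have [h1 h2] := zet_in r0 xr.
rewrite /cut_grad h1 scale1r (_ : \row_i _ = 0) ?scaler0 ?addr0//.
by apply/rowP => i; rewrite !mxE h2.
Qed.

Lemma cut_grad_out r x : 0 < r -> 3 / 2 * r <= enorm x -> cut_grad r x = 0.
Proof.
move=> r0 xr; have [h1 h2] := zet_out r0 xr.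
rewrite /cut_grad h1 scale0r (_ : \row_i _ = 0) ?scaler0 ?addr0//.
by apply/rowP => i; rewrite !mxE h2.
Qed.

(** * First order expansion of the energy of the sheared, truncated minimizer *)

Section expansion.

(** The dominating function: the first term controls the tilt, of order |x|, the second the
    truncation. *)
Let gdom x := enorm (G x) `^ p * rho x + w x `^ p * rho x `^ (1 - p).
Let c1 : R := 2 `^ p * 15 `^ p.

Let gdom_ge0 x : 0 <= gdom x.
Proof. by rewrite addr_ge0 ?mulr_ge0 ?powR_ge0// ltW// rho_gt0. Qed.

Let c1_ge0 : 0 <= c1. Proof. by rewrite mulr_ge0. Qed.

Let integ_gdom : integ gdom.
Proof. by apply: integD; [exact: integ_moment|exact: integ_tail]. Qed.

Lemma cut_grad_le r x : 1 <= r -> enorm (cut_grad r x) `^ p * rho x <= c1 * gdom x.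
Proof.
move=> r1; have r0 := rho_gt0 x; have /andP[z0 z1] := zet_itv r x.
have h1 : enorm (zet r x *: G x) `^ p <= enorm (G x) `^ p.
 apply: ge0_ler_powR; rewrite ?nnegrE ?enorm_ge0 ?(ltW p0)//.
 by rewrite enormZ ger0_norm// ler_piMl ?enorm_ge0.
have h2 : enorm (w x *: \row_i dzet r i x) `^ p <= 15 `^ p * (w x `^ p * rho x `^ (- p)).
 rewrite enormZ ger0_norm//. apply: (@le_trans _ _ ((w x * (15 / rho x)) `^ p)).
  apply: ge0_ler_powR; rewrite ?nnegrE ?(ltW p0) ?mulr_ge0 ?enorm_ge0 ?invr_ge0 ?(ltW r0)//.
  by rewrite ler_wpM2l// dzet_rho.
 rewrite !powRM ?mulr_ge0 ?invr_ge0 ?(ltW r0)// -powR_inv1 ?(ltW r0)// -powRrM mulN1r.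
 by apply: eqW; ring.
have h3 := enormD_powR (zet r x *: G x) (w x *: \row_i dzet r i x) (ltW p0).
apply: (@le_trans _ _ (2 `^ p * (enorm (G x) `^ p + 15 `^ p * (w x `^ p * rho x `^ (- p))) * rho x)).
 rewrite ler_wpM2r ?(ltW r0)//; apply: (le_trans h3); rewrite ler_wpM2l//. exact: lerD.
rewrite /gdom /c1; have -> : 1 - p = - p + 1 by ring.
rewrite -powRS ?(ltW r0)//; last by rewrite addrC subr_eq0 eq_sym gt_eqF.
have f1 : 1 <= 15 `^ p by have := @ler_powR R 15 _ 0 p (ltW p0); rewrite powRr0; apply; rewrite ler1n.
rewrite -!mulrA ler_wpM2l// mulrDl mulrDr !mulrA lerD//.
by rewrite -mulrA ler_peMl ?mulr_ge0 ?powR_ge0 ?(ltW r0).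
Qed.

Variable S : 'M[R]_n.+1.
Hypothesis tS : tangential S.
Variable r : R.
Hypothesis r0 : 0 < r.

Let Dq x : rV := \row_i dqf S i x.
Let B e x := shear_grad S e (cut_grad (r / e)) x.

(** The formal derivative at e = 0 of the energy of [shear_grad S e G]. *)
Definition first_variation : R := - p * I (fun x => G x 0 ord0 * dotp (flux p (G x)) (\row_i dqf S i x)).

Let BE e x : B e x = cut_grad (r / e) x - (e * cut_grad (r / e) x 0 ord0) *: Dq x.
Proof. by []. Qed.

Lemma mfn_dqf i : mfn (dqf S i).
Proof. by apply: mfn_cont; exact: cont_dqf. Qed.

Lemma mfn_shear_grad (e : R) (A : rV -> rV) : (forall i, mfn (fun x => A x 0 i)) -> forall i, mfn (fun x => shear_grad S e A x 0 i).
Proof.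
move=> mA i; have -> : (fun x => shear_grad S e A x 0 i) = (fun x => A x 0 i - (e * A x 0 ord0) * dqf S i x).
 by apply/funext => x; rewrite /shear_grad rVB !mxE.
apply: mfnB => //; apply: mfnM; last exact: mfn_dqf.
by apply: mfnM => //; exact: mfn_cst.
Qed.

Let mA e i : mfn (fun x => cut_grad (r / e) x 0 i).
Proof. exact: W_mfn (W_cut (r / e)) i. Qed.
Let mB e i : mfn (fun x => B e x 0 i).
Proof. exact: mfn_shear_grad (mA e) i. Qed.

Lemma mfn_flux_dotp (H K : rV -> rV) : (forall i, mfn (fun x => H x 0 i)) -> (forall i, mfn (fun x => K x 0 i)) ->
 mfn (fun x => dotp (flux p (H x)) (K x)).
Proof.
move=> mH mK; apply: mfn_sum => i; apply: mfnM => //.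
have -> : (fun x => flux p (H x) 0 i) = (fun x => enorm (H x) `^ (p - 2) * H x 0 i).
 by apply/funext => x; rewrite /flux mxE.
by apply: mfnM => //; apply: mfn_powR; exact: mfn_enorm.
Qed.

(** An upper bound for the difference quotient of |B e|^p, from the tangent inequality at [B e]. The
    first term is the truncation error, supported where |x| >= r/e, so that its factor 1/e is at
    most rho / r. *)
Let F e x := e^-1 * (enorm (cut_grad (r / e) x) `^ p - enorm (G x) `^ p) -
 p * (cut_grad (r / e) x 0 ord0 * dotp (flux p (B e x)) (Dq x)).

Let mDq i : mfn (fun x => Dq x 0 i).
Proof. by under eq_fun do rewrite mxE; exact: mfn_dqf. Qed.

Let mF e : mfn (F e).
Proof.
apply: mfnB.
 apply: mfnM; first exact: mfn_cst.
 by apply: mfnB; apply: mfn_powR; apply: mfn_enorm; [exact: mA|exact: LG.1].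
apply: mfnM; first exact: mfn_cst.
by apply: mfnM; [exact: mA|apply: mfn_flux_dotp; [exact: mB|exact: mDq]].
Qed.

Let B_F e x : 0 < e -> enorm (B e x) `^ p <= enorm (G x) `^ p + e * F e x.
Proof.
move=> e0; have := enorm_tangent (cut_grad (r / e) x) (B e x) p1.
have -> : cut_grad (r / e) x - B e x = (e * cut_grad (r / e) x 0 ord0) *: Dq x by rewrite BE subKr.
rewrite dotpZr /F; set a := enorm (cut_grad _ _) `^ p; set b := enorm (B e x) `^ p.
set c := enorm (G x) `^ p; set d := cut_grad _ _ _ _; set f := dotp _ _ => h.
have -> : c + e * (e^-1 * (a - c) - p * (d * f)) = a - p * (e * d * f) by field; rewrite gt_eqF.
by rewrite lerBrDr.
Qed.

Let bound : exists2 C, 0 <= C & forall e x, 0 < e -> 1 <= r / e -> `|F e x| <= C * gdom x.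
Proof.
have [L L0 hL] := dqf_le S.
(* On the support of the truncation |x| <= 3r/(2e), so the tilt multiplies lengths by at most M,
   uniformly in e. *)
pose M := 1 + 3 / 2 * L * r.
have M0 : 0 <= M by rewrite addr_ge0// mulr_ge0 ?mulr_ge0 ?(ltW r0).
exists ((c1 + 1) / r + p * (M `^ (p - 1) * L * c1)).
 by rewrite addr_ge0 ?mulr_ge0 ?addr_ge0 ?invr_ge0 ?powR_ge0 ?(ltW r0) ?(ltW p0).
move=> e x e0 re1; have R0 : 0 < r / e by rewrite divr_gt0.
have rx := rho_gt0 x; have hA := cut_grad_le x re1.
rewrite mulrDl (le_trans (ler_normB _ _))// lerD//.
 have [xr|xr] := leP (enorm x) (r / e).
  by rewrite cut_grad_in// subrr mulr0 normr0 !mulr_ge0 ?invr_ge0 ?(ltW r0)// addr_ge0.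
 have h1 : e^-1 <= rho x / r.
  rewrite ler_pdivlMr// mulrC; apply: (le_trans (ltW xr)); exact: enorm_le_rho.
 rewrite normrM ger0_norm ?invr_ge0 ?(ltW e0)//.
 apply: (@le_trans _ _ (rho x / r * (enorm (cut_grad (r / e) x) `^ p + enorm (G x) `^ p))).
  rewrite ler_pM ?invr_ge0 ?(ltW e0)//.
  by rewrite (le_trans (ler_normB _ _))// !ger0_norm ?powR_ge0.
 have h2 : enorm (G x) `^ p * rho x <= gdom x by rewrite lerDl mulr_ge0 ?powR_ge0.
 rewrite [X in X <= _](_ : _ = (enorm (cut_grad (r / e) x) `^ p * rho x + enorm (G x) `^ p * rho x) / r); last by field; rewrite gt_eqF.
 rewrite [X in _ <= X](_ : _ = (c1 * gdom x + gdom x) / r); last by field; rewrite gt_eqF.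
 by rewrite ler_wpM2r ?invr_ge0 ?(ltW r0)// lerD.
set A := cut_grad (r / e) x in hA *.
have hB : enorm (B e x) <= M * enorm A.
 have [xr|xr] := leP (3 / 2 * (r / e)) (enorm x).
  by rewrite BE -/A /A cut_grad_out// mxE mulr0 scale0r subr0 enorm0 mulr0.
 rewrite BE -/A (le_trans (ler_enormD _ _))// enormN enormZ normrM (gtr0_norm e0).
 rewrite /M mulrDl mul1r lerD2l.
 have h1 : enorm (Dq x) <= L * (3 / 2 * (r / e)) by apply: (le_trans (hL x)); rewrite ler_wpM2l// ltW.
 apply: (@le_trans _ _ (e * enorm A * (L * (3 / 2 * (r / e))))).
  by rewrite ler_pM ?mulr_ge0 ?enorm_ge0 ?(ltW e0)// ler_wpM2l ?(ltW e0)// coord_le_enorm.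
 by apply: eqW; field; rewrite gt_eqF.
have pp0 : 0 <= p - 1 by rewrite subr_ge0 ltW.
have h2 : `|dotp (flux p (B e x)) (Dq x)| <= M `^ (p - 1) * enorm A `^ (p - 1) * (L * rho x).
 apply: (le_trans (dotp_le _ _)); rewrite enorm_flux// ler_pM ?powR_ge0 ?enorm_ge0//.
  rewrite -powRM//; apply: ge0_ler_powR hB; rewrite ?nnegrE ?mulr_ge0 ?enorm_ge0//.
 by apply: (le_trans (hL x)); rewrite ler_wpM2l// enorm_le_rho.
rewrite [X in _ <= X](_ : _ = p * (M `^ (p - 1) * L * c1 * gdom x)); last by ring.
rewrite normrM (gtr0_norm p0) ler_wpM2l ?(ltW p0)// normrM.
apply: (@le_trans _ _ (enorm A * (M `^ (p - 1) * enorm A `^ (p - 1) * (L * rho x)))).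
 by rewrite ler_pM// coord_le_enorm.
rewrite [X in X <= _](_ : _ = M `^ (p - 1) * L * (enorm A `^ p * rho x)).
 by rewrite -[X in _ <= X]mulrA ler_wpM2l// mulr_ge0 ?powR_ge0.
by rewrite -(mulr_powRB1 (enorm_ge0 A) p0); ring.
Qed.

(** Dominated convergence of [F] along e = 1/(k+1). At a fixed x the truncation disappears once r/e
    >= |x|, and continuity of the flux gives the limit of the remaining term. *)
Lemma expansion d : 0 < d -> exists K, forall k, (K <= k)%N ->
 1 <= r * k.+1%:R /\
 (let e := k.+1%:R^-1 in Lp p (shear_grad S e (cut_grad (r / e))) /\
  energy p (shear_grad S e (cut_grad (r / e))) <= lstar n p + e * (first_variation + d)).
Proof.
move=> d0; have [C C0 hC] := bound.
have [K1 hK1] : exists K1 : nat, r^-1 <= K1.+1%:R.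
 by exists (Num.truncn r^-1); apply: ltW; rewrite -truncn_le_nat.
(* The shift by K1 ensures r/e >= 1 for every index, as the domination requires. *)
pose ee (k : nat) : R := (k + K1).+1%:R^-1.
have ee0 k : 0 < ee k by rewrite invr_gt0.
have ree k : 1 <= r / ee k.
 rewrite /ee invrK mulrC -ler_pdivrMr// div1r (le_trans hK1)// ler_nat ltnS leq_addl//.
pose Finf x := - p * (G x 0 ord0 * dotp (flux p (G x)) (Dq x)).
have mFi : mfn Finf.
 by apply: mfnM; [exact: mfn_cst|apply: mfnM; [exact: LG.1|apply: mfn_flux_dotp; [exact: LG.1|exact: mDq]]].
have iC : integ (fun x => C * gdom x) by exact: integZ.
have bF k x : `|F (ee k) x| <= C * gdom x by exact: hC.
have cvF x : (fun k => F (ee k) x) @ \oo --> Finf x.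
 pose psi t := - p * (G x 0 ord0 * \sum_i flux p (G x - (t * G x 0 ord0) *: Dq x) 0 i * Dq x 0 i).
 have cpsi : continuous psi.
  apply: contM; first exact: cont_cst. apply: contM; first exact: cont_cst.
  apply: cont_sum => i _; apply: contM; last exact: cont_cst.
  have c2 : continuous (fun t : R => G x - (t * G x 0 ord0) *: Dq x).
   apply: continuous_rVP => j.
   have -> : (fun t : R => (G x - (t * G x 0 ord0) *: Dq x) 0 j) = (fun t => G x 0 j - t * (G x 0 ord0 * Dq x 0 j)).
    by apply/funext => t; rewrite !mxE; ring.
   apply: contB; first exact: cont_cst.
   by apply: contM; [move=> t; exact: cvg_id|exact: cont_cst].
  move=> t; apply: (@continuous_comp _ _ _ (fun t : R => G x - (t * G x 0 ord0) *: Dq x) (fun b => flux p b 0 i)).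
   exact: c2.
  exact: cont_flux.
 have psi0 : psi 0 = Finf x by rewrite /psi mul0r scale0r subr0.
 have e2 : ee k @[k --> \oo] --> (0 : R).
  have := @cvg_harmonic R; rewrite -(cvg_shiftn K1) => h; exact: h.
 have h1 : (fun k => psi (ee k)) @ \oo --> Finf x by rewrite -psi0; apply: (cvg_comp _ _ e2 (cpsi 0)).
 apply: cvg_trans h1; apply: near_eq_cvg. have [K hK] : exists K : nat, enorm x / r <= K%:R.
  by exists (Num.truncn (enorm x / r)).+1; apply: ltW; rewrite -truncn_le_nat.
 exists K => // k /= Kk. have xR : enorm x <= r / ee k.
  rewrite /ee invrK mulrC -ler_pdivrMr//; apply: (le_trans hK).
  by rewrite ler_nat; apply: (leq_trans Kk); rewrite (leq_trans (leq_addr K1 k)).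
 have RR : 0 < r / ee k by rewrite divr_gt0.
 by rewrite /F /B /shear_grad cut_grad_in// subrr mulr0 sub0r /psi mulNr.
have [iFi hI] := @I_dct R n.+1 (fun k => F (ee k)) Finf _ (fun k => mF _) mFi iC (aeW _ cvF) bF.
have fvE : first_variation = I Finf.
 rewrite /first_variation /Finf -IZ//. have pn : - p != 0 by rewrite oppr_eq0 gt_eqF.
 by apply: eq_integ (integZ (- p)^-1 iFi) => x; rewrite /Finf mulrA mulVf// mul1r.
have ev_lt : \forall k \near \oo, I (F (ee k)) <= I Finf + d.
 have := @cvgr_le R _ _ _ _ _ hI (I Finf + d); apply; by rewrite ltrDl.
have [K _ hK] := ev_lt; exists (K + K1)%N => k Kk.
have kE : (k - K1 + K1)%N = k by rewrite subnK// (leq_trans (leq_addl K K1)).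
have Kk' : (K <= k - K1)%N by rewrite leq_subRL ?(leq_trans (leq_addl K K1))// addnC.
have := hK _ Kk'; have := ee0 (k - K1)%N; have := ree (k - K1)%N.
rewrite /ee kE => re1 e0 hI'; split; first by move: re1; rewrite invrK.
set e := k.+1%:R^-1 in re1 e0 hI' *; rewrite /=.
have iF : integ (F e) by apply: le_integ iC => // x; exact: hC.
have iS := integD LG.2 (integZ e iF).
have LB : Lp p (B e) := Lp_le (mB e) (fun x => B_F x e0) iS.
split; first exact: LB.
apply: (le_trans (I_le LB.2 iS (fun x => B_F x e0))).
by rewrite (ID LG.2 (integZ e iF)) (IZ e iF) -hm lerD2l ler_wpM2l ?(ltW e0)// fvE.
Qed.

End expansion.

(** By uniqueness the minimizer is invariant under rotations that fix the axis, and weak gradients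
    are unique up to a null set. *)
Lemma minimizer_sym Q : orthogonal_mx Q -> (forall x, (x *m Q) 0 ord0 = x 0 ord0) -> ev *m Q = ev ->
 {ae leb n.+1, forall x, G (x *m Q) = G x *m Q}.
Proof.
move=> oQ Q0 Qe.
have HQ z : Hs (z *m Q) -> Hs z by rewrite /Hs /= Q0.
have [h1 E1] := @comp_orthogonal R n.+1 p Hs Hs ev ev w G Q oQ hc HQ Qe.
have wE := cap_unique p2 np hc h1 hm (etrans E1 hm).
have [W1 _ _ _] := h1; rewrite -wE in W1.
have QQ : Q^T *m Q = 1%:M by exact: mulmx1C.
apply: filterS (W_ae WG W1) => x ->.
by rewrite -mulmxA QQ mulmx1.
Qed.

(** * The first variation is a multiple of the trace *)

Section symmetry.

Definition moment i j : R := I (fun x => G x 0 ord0 * flux p (G x) 0 i * x 0 j).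

Let mflux i : mfn (fun x => flux p (G x) 0 i).
Proof.
have -> : (fun x => flux p (G x) 0 i) = (fun x => enorm (G x) `^ (p - 2) * G x 0 i).
 by apply/funext => x; rewrite /flux mxE.
by apply: mfnM; [apply: mfn_powR; apply: mfn_enorm; exact: LG.1|exact: LG.1].
Qed.

Lemma integ_moment_ij i j : integ (fun x => G x 0 ord0 * flux p (G x) 0 i * x 0 j).
Proof.
apply: le_integ (integ_moment).
 by apply: mfnM; [apply: mfnM => //; exact: LG.1|apply: mfn_cont; exact: continuous_coord].
move=> x; rewrite !normrM ler_pM//.
 rewrite -(mulr_powRB1 (enorm_ge0 (G x)) p0) ler_pM//; first exact: coord_le_enorm.
 by apply: le_trans (coord_le_enorm _ i) _; rewrite enorm_flux.
exact: le_trans (coord_le_enorm _ j) (enorm_le_rho x).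
Qed.

Lemma flux_mulmx Q (b : rV) : orthogonal_mx Q -> flux p (b *m Q) = flux p b *m Q.
Proof. by move=> oQ; rewrite /flux enorm_orthogonal// scalemxAl. Qed.

Lemma moment_orthogonal Q i j : orthogonal_mx Q -> (forall x, (x *m Q) 0 ord0 = x 0 ord0) -> ev *m Q = ev ->
 moment i j = I (fun x => G x 0 ord0 * (flux p (G x) *m Q) 0 i * (x *m Q) 0 j).
Proof.
move=> oQ Q0 Qe; have iJ := integ_moment_ij i j.
rewrite /moment -(I_orthogonal oQ (integ_mfn iJ)).
pose g x := G x 0 ord0 * (flux p (G x) *m Q) 0 i * (x *m Q) 0 j.
have mg : mfn g.
 apply: mfnM; last by apply: mfn_cont; apply: (cont_comp (@continuous_mulmx R _ _ Q) (@continuous_coord R _ j)).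
 apply: mfnM; first exact: LG.1.
 have -> : (fun x => (flux p (G x) *m Q) 0 i) = (fun x => \sum_k flux p (G x) 0 k * Q k i).
  by apply/funext => x; rewrite mxE.
 by apply: mfn_sum => k; apply: mfnM => //; exact: mfn_cst.
have aeg : {ae leb n.+1, forall x, G (x *m Q) 0 ord0 * flux p (G (x *m Q)) 0 i * (x *m Q) 0 j = g x}.
 apply: filterS (minimizer_sym oQ Q0 Qe) => x E. by rewrite /g E Q0 flux_mulmx.
by have [_ ->] := ae_eq_I (integ_orthogonal oQ iJ) mg aeg.
Qed.

Let ev_k i : i != ord0 -> @ev R n 0 i = 0.
Proof. by move=> i0; rewrite /ev mxE eqxx (negbTE i0). Qed.

Lemma moment_offdiag i j : i != ord0 -> i != j -> moment i j = 0.
Proof.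
move=> i0 ij; pose Q : 'M[R]_n.+1 := hh (basis_rV i).
have oQ : orthogonal_mx Q by exact: hh_orthogonal.
have QE (x) k : (x *m Q) 0 k = if k == i then - x 0 i else x 0 k.
 rewrite /Q hh_flip rVB !mxE eqxx /=; case: eqP => [->|_].
  by rewrite mulr1n; ring.
 by rewrite mulr0n; ring.
have Q0 x : (x *m Q) 0 ord0 = x 0 ord0 by rewrite QE eq_sym (negbTE i0).
have Qe : ev *m Q = ev :> rV by apply/rowP => k; rewrite QE; case: eqP => // ->; rewrite ev_k// oppr0.
have := moment_orthogonal i j oQ Q0 Qe.
have -> : I (fun x => G x 0 ord0 * (flux p (G x) *m Q) 0 i * (x *m Q) 0 j) = - moment i j.
 rewrite /moment -IN; last exact: integ_moment_ij.
 apply: eq_I => x; rewrite !QE eqxx eq_sym (negbTE ij); ring.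
by move=> h; lra.
Qed.

Lemma moment_diag i j : i != ord0 -> j != ord0 -> moment i i = moment j j.
Proof.
move=> i0 j0; have [->//|ij] := eqVneq i j.
pose Q : 'M[R]_n.+1 := hh (basis_rV i - basis_rV j).
have oQ : orthogonal_mx Q by exact: hh_orthogonal.
have QE (x) k : (x *m Q) 0 k = x 0 k - (x 0 i - x 0 j) * ((k == i)%:R - (k == j)%:R).
 by rewrite /Q hh_swap// !mxE !eqxx.
have Q0 x : (x *m Q) 0 ord0 = x 0 ord0.
 rewrite QE !(eq_sym ord0) (negbTE i0) (negbTE j0). by rewrite mulr0n; ring.
have Qe : ev *m Q = ev :> rV by apply/rowP => k; rewrite QE (ev_k i0) (ev_k j0) subrr mul0r subr0.
have Qi (x) : (x *m Q) 0 i = x 0 j.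
 rewrite QE eqxx (negbTE ij). by rewrite mulr0n; rewrite mulr1n; ring.
rewrite (moment_orthogonal i i oQ Q0 Qe); apply: eq_I => x; by rewrite !Qi.
Qed.

(** The first variation is linear in S with coefficients [moment i j]. Reflecting one tangential
    axis kills the off-diagonal coefficients, exchanging two such axes makes the diagonal ones
    equal. *)
Lemma first_variation_tr : exists c, forall S, tangential S -> first_variation S = c * \tr S.
Proof.
have oz : (ord_max : 'I_n.+1) != ord0 by rewrite -val_eqE -lt0n.
exists (- p * 2 * moment ord_max ord_max) => S tS.
have i1 i j : integ (fun x => (S i j + S j i) * (G x 0 ord0 * flux p (G x) 0 i * x 0 j)).
 by apply: integZ; exact: integ_moment_ij.
have E : I (fun x => G x 0 ord0 * dotp (flux p (G x)) (\row_i dqf S i x)) = \sum_i \sum_j (S i j + S j i) * moment i j.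
 have -> : \sum_i \sum_j (S i j + S j i) * moment i j =
   \sum_i I (fun x => \sum_j (S i j + S j i) * (G x 0 ord0 * flux p (G x) 0 i * x 0 j)).
  apply: eq_bigr => i _; rewrite I_sum//; apply: eq_bigr => j _; rewrite IZ//; exact: integ_moment_ij.
 rewrite -I_sum; last by move=> i; exact: integ_sum.
 apply: eq_I => x; rewrite /dotp mulr_sumr; apply: eq_bigr => i _; rewrite mxE /dqf !mulr_sumr.
 by apply: eq_bigr => j _; ring.
rewrite /first_variation E /mxtrace [in RHS]mulr_sumr mulr_sumr; apply: eq_bigr => i _.
have [i0|i0] := eqVneq i ord0.
 have S0 j : S i j = 0 by apply: tS; left. have S1 j : S j i = 0 by apply: tS; right.
 by rewrite S0 mulr0 big1 ?mulr0// => j _; rewrite S0 S1 addr0 mul0r.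
rewrite (bigD1 i)//= big1 ?addr0; last by move=> j ji; rewrite moment_offdiag ?mulr0// eq_sym.
by rewrite (moment_diag i0 oz); ring.
Qed.

End symmetry.

Let N : R := n.+1%:R.

(** The cost of lowering the function, divided by e p t^n: the first summand comes from the energy
    in the ball of radius 9 t, the second from the volume of the cube of radius 6 t. *)
Definition tilt_const (kp C V : R) : R := 2 `^ p * (2 `^ p * (C * 9 ^+ n.+1)) + (2 `^ p + 1) * kp `^ p * (6 ^+ n.+1 * V).

(** * Lowering a function sheared along a steep paraboloid *)

Section tilt.
Variables (t C1 d1 b0 kp V : R).
Hypotheses (t0 : 0 < t) (t9 : t * 9 <= 1) (td : 9 * t <= d1).
Hypotheses (b00 : 0 <= b0) (kpE : kp = b0 * 3) (kp0 : 0 <= kp).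
Hypothesis hb : forall x, enorm x <= 4^-1 -> w x <= b0 * pp (x 0 ord0).
Hypothesis VE : forall r : R, 0 < r -> I (\1_(cball r) : rV -> R) = r ^+ n.+1 * V.
Hypothesis hball : forall r, 0 < r -> r <= d1 ->
 forall f, mfn f -> (forall x, 0 <= f x) -> (forall x, f x <= enorm (G x) `^ p) -> (forall x, r < enorm x -> f x = 0) ->
 I f <= C1 * r ^+ n.+1.
Variables (S : 'M[R]_n.+1) (e M : R) (v : rV -> R) (B H : rV -> rV).
Hypotheses (tS : tangential S) (qS : forall x, qf S x = 2 / t ^+ 2 * (dotp x x - x 0 ord0 ^+ 2)).
Hypotheses (e0 : 0 < e) (e1 : e < 1) (et : e <= t).
Hypotheses (hM : forall x, `|x| <= 5 * t -> `|qf S x| <= M) (eM : e * M <= t).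
Hypotheses (vE : forall x, v x = w (shear S e x) * zet (1 / e) (shear S e x)) (HE : forall x, H x = B (shear S e x)).
Hypotheses (LB : Lp p B) (LH : Lp p H) (WH : W v H).
Hypothesis BG : forall x, enorm x <= 9 * t -> enorm (B x) <= 2 * enorm (G x).
Let D x : rV := b0 *: \row_i dzet (2 * t) i x.
Let R1 : 1 <= 1 / e. Proof. by rewrite ler_pdivlMr// mul1r ltW. Qed.
Let R0 : 0 < 1 / e. Proof. exact: lt_le_trans R1. Qed.
Let t2 : 0 < 2 * t. Proof. by rewrite mulr_gt0. Qed.

Let ush x := v x - (e * b0) * zet (2 * t) x.
Let K x := H x - e *: D x.

Let WK : W ush K.
Proof.
have W1 : W (fun x => zet (2 * t) x) (fun x => \row_i dzet (2 * t) i x).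
 by apply: W_smooth; [exact: pd_zet|exact: cont_zet|exact: cont_dzet].
have := WB WH (WZ (e * b0) W1); rewrite /ush /K /D.
by congr W; apply/funext => x; rewrite scalerA.
Qed.

(** At height at most e, v can be positive only where e q(x) < x_0 <= e. Then q(x) < 1, so the
    tangential distance is less than t and the cutoff of radius 2 t equals 1. There w is at most b0
    times the sheared height, hence at most b0 e, which is what is subtracted. *)
Let ush_le x : x 0 ord0 <= e -> ush x <= 0.
Proof.
move=> xe; rewrite /ush subr_le0; have /andP[z0 z1] := zet_itv (2 * t) x.
have rhs0 : 0 <= e * b0 * zet (2 * t) x by rewrite mulr_ge0// mulr_ge0// ltW.
have q0 := tangential_sqr_ge0 x.
have sh0 : shear S e x 0 ord0 = x 0 ord0 - e * qf S x by rewrite /shear rVB mxE ev_0 mulr1.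
have [s0|s0] := leP (shear S e x 0 ord0) 0; first by rewrite vE wneg// mul0r.
have qS0 : 0 <= qf S x by rewrite qS mulr_ge0// divr_ge0 ?exprn_ge0// ltW.
have x0 : 0 < x 0 ord0 by apply: lt_le_trans s0 _; rewrite sh0 gerBl mulr_ge0// ltW.
have q1 : qf S x < 1.
 rewrite ltNge; apply/negP => h; move: s0; rewrite sh0 subr_gt0 ltNge => /negP; apply.
 by apply: (le_trans xe); rewrite ler_peMr// ltW.
have yt : dotp x x - x 0 ord0 ^+ 2 <= t ^+ 2.
 have t2' : 0 < t ^+ 2 by rewrite exprn_gt0.
 move: q1; rewrite qS mulrAC ltr_pdivrMr// mul1r; move: (dotp x x - _) q0 => a; lra.
have x2 : enorm x <= 2 * t.
 rewrite -ler_sqr ?nnegrE ?enorm_ge0 ?(ltW t2)// enormE.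
 by move: yt x0 xe et; move: (dotp x x) (x 0 ord0) => a b; have := t0; nra.
have Tx : enorm (shear S e x) <= 2 * t.
 rewrite -ler_sqr ?nnegrE ?enorm_ge0 ?(ltW t2)// enormE /shear.
 rewrite !(dotpBl, dotpBr, dotpZl, dotpZr). have -> : dotp x ev = x 0 ord0 by exact: dotp_basis.
 have -> : dotp ev x = x 0 ord0 by rewrite dotpC; exact: dotp_basis.
 have -> : dotp (@ev R n) ev = 1 by rewrite {2}/ev dotp_basis ev_0.
 have h : 0 <= x 0 ord0 - e * qf S x <= t by rewrite -sh0 (ltW s0) sh0 (le_trans _ (le_trans xe et))// gerBl mulr_ge0// ltW.
 have -> : dotp x x - e * qf S x * x 0 ord0 - e * qf S x * (x 0 ord0 - e * qf S x * 1) =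
  (dotp x x - x 0 ord0 ^+ 2) + (x 0 ord0 - e * qf S x) ^+ 2 by ring.
 move: h yt => /andP[]; move: (x 0 ord0 - e * _) (dotp x x - _) => a b; have := t0; nra.
rewrite (zet_in t2 x2).1 mulr1 vE.
have hw : w (shear S e x) <= b0 * pp (shear S e x 0 ord0).
 apply: hb; apply: (le_trans Tx); have := t9; lra.
have /andP[y0 y1] := zet_itv (1 / e) (shear S e x).
apply: (@le_trans _ _ (w (shear S e x))); first by rewrite ler_piMr.
apply: (le_trans hw); rewrite pp_pos ?(ltW s0)// mulrC ler_wpM2r// sh0.
by apply: le_trans xe; rewrite gerBl mulr_ge0// ltW.
Qed.

Let ush_ev : ush ev = 1.
Proof.
have se : shear S e ev = ev by rewrite /shear qf_ev0// mulr0 scale0r subr0.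
rewrite /ush vE se w1 mul1r (@zet_in R n.+1 (1 / e) ev R0 _).1 ?enorm_ev//.
rewrite (@zet_out R n.+1 (2 * t) ev t2 _).1 ?mulr0 ?subr0// enorm_ev.
by have := t9; lra.
Qed.

Let D_le x : enorm (D x) <= kp / t.
Proof.
rewrite /D enormZ (ger0_norm b00); apply: (le_trans (ler_wpM2l b00 (dzet_le x t2))).
by rewrite le_eqVlt kpE; apply/orP; left; apply/eqP; field; rewrite gt_eqF.
Qed.

Let z x := zet (3 * t) x.
Let t3 : 0 < 3 * t. Proof. by rewrite mulr_gt0. Qed.
Let t6 : 0 < 6 * t. Proof. by rewrite mulr_gt0. Qed.

Let D_supp x : z x < 1 -> D x = 0.
Proof.
move=> z1; have h : 3 / 2 * (2 * t) <= enorm x.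
 rewrite leNgt; apply/negP => h; move: z1; rewrite /z (@zet_in R n.+1 (3 * t) x t3 _).1 ?ltxx//.
 lra.
by rewrite /D (_ : \row_i _ = 0) ?scaler0//; apply/rowP => i; rewrite !mxE (zet_out t2 h).2.
Qed.

Let Z x := 2 `^ p / t * (enorm (H x) `^ p * z x) + (2 `^ p + 1) * kp `^ p / t * z x.

(** The tangent inequality at K, then Young's inequality with parameter 1/t. As |D| <= kp/t, both
    resulting terms are of order 1/t; integrated over a ball of radius O(t) in dimension n + 1 they
    become O(t^n). *)
Let K_le x : enorm (K x) `^ p <= enorm (H x) `^ p + e * (p * Z x).
Proof.
have /andP[z0 z1] := zet_itv (3 * t) x; rewrite -/(z x) in z0 z1.
have Z0 : 0 <= Z x.
 have c1 : 0 <= 2 `^ p / t := divr_ge0 (powR_ge0 _ _) (ltW t0).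
 have c2 : 0 <= (2 `^ p + 1) * kp `^ p / t := divr_ge0 (mulr_ge0 (addr_ge0 (powR_ge0 _ _) ler01) (powR_ge0 _ _)) (ltW t0).
 exact: addr_ge0 (mulr_ge0 c1 (mulr_ge0 (powR_ge0 _ _) z0)) (mulr_ge0 c2 z0).
have [zx|zx] := ltP (z x) 1.
 by rewrite /K (D_supp zx) scaler0 subr0 lerDl mulr_ge0 ?mulr_ge0// ltW.
have zE : z x = 1 by apply/eqP; rewrite eq_le z1 zx.
have := enorm_tangent (H x) (K x) p1.
have -> : H x - K x = e *: D x by rewrite /K subKr.
rewrite dotpZr => h.
have h1 : - dotp (flux p (K x)) (D x) <= Z x.
 apply: (@le_trans _ _ (enorm (K x) `^ (p - 1) * enorm (D x))).
  by rewrite -(enorm_flux _ p1) (le_trans (ler_norm _))// normrN dotp_le.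
 have ti : 0 < t^-1 by rewrite invr_gt0.
 apply: (le_trans (young_w p1 ti (enorm_ge0 (D x)) (enorm_ge0 (K x)))).
 have hD : enorm (D x) `^ p <= kp `^ p * t `^ (- p).
  have -> : t `^ (- p) = t^-1 `^ p by rewrite -powR_inv1 ?(ltW t0)// -powRrM mulN1r.
  rewrite -powRM ?(ltW ti)//; apply: ge0_ler_powR; rewrite ?nnegrE ?enorm_ge0 ?(ltW p0)//.
  by rewrite mulr_ge0// ltW.
 have hKK : enorm (K x) `^ p <= 2 `^ p * (enorm (H x) `^ p + kp `^ p).
  have := enormD_powR (H x) (- (e *: D x)) (ltW p0); rewrite enormN => /le_trans; apply.
  rewrite ler_wpM2l// lerD2l; apply: ge0_ler_powR; rewrite ?nnegrE ?enorm_ge0 ?(ltW p0)//.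
  rewrite enormZ gtr0_norm//; apply: (le_trans (ler_wpM2l (ltW e0) (D_le x))).
  by rewrite mulrCA ler_piMr// ler_pdivrMr// mul1r.
 have -> : t^-1 `^ (1 - p) = t `^ (p - 1) by rewrite -powR_inv1 ?(ltW t0)// -powRrM mulN1r opprB.
 apply: (@le_trans _ _ (t^-1 * (2 `^ p * (enorm (H x) `^ p + kp `^ p)) + t `^ (p - 1) * (kp `^ p * t `^ (- p)))).
  by rewrite lerD// ler_wpM2l ?powR_ge0// ltW.
 have -> : t `^ (p - 1) * (kp `^ p * t `^ (- p)) = kp `^ p / t.
  rewrite mulrCA -powRD ?(gt_eqF t0) ?implybT// (_ : p - 1 - p = -1) ?powR_inv1 ?(ltW t0); ring.
 by rewrite /Z zE !mulr1; apply: eqW; ring.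
have h2 : enorm (K x) `^ p <= enorm (H x) `^ p - p * (e * dotp (flux p (K x)) (D x)) by rewrite lerBrDr.
apply: (le_trans h2); rewrite lerD2l -mulrN -mulrN mulrCA ler_wpM2l ?(ltW e0)// ler_wpM2l ?(ltW p0)//.
Qed.

Let mz : mfn z. Proof. by apply: mfn_cont; exact: cont_zet. Qed.
Let iz : integ z. Proof. exact: cs_integ (@cont_zet R n.+1 _) (@zet_bsupp R n.+1 _ t3).1. Qed.
Let iHz : integ (fun x => enorm (H x) `^ p * z x).
Proof.
apply: (@integMb _ _ _ _ 1) LH.2 mz _ => x; have /andP[a b] := zet_itv (3 * t) x.
by rewrite ger0_norm.
Qed.

Let Iz_le : I z <= (6 * t) ^+ n.+1 * V.
Proof.
rewrite -(VE t6); apply: I_le; [exact: iz|exact: integ_cball|].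
move=> x; have /andP[a b] := zet_itv (3 * t) x; rewrite indicE; have [_|h] := boolP (x \in cball (6 * t)); first exact: b.
rewrite /z (@zet_bsupp R n.+1 _ t3).1// mulrA (_ : 2 * 3 = 6); last by ring.
by rewrite ltNge; apply: contra h => h; rewrite inE.
Qed.

(** The support of z has radius 9t/2 and the shear moves its points by at most t, so they stay
    within 6 t, where the cutoff of radius 6 t equals 1; that cutoff is supported within 9 t. *)
Let IHz_le : I (fun x => enorm (H x) `^ p * z x) <= 2 `^ p * (C1 * (9 * t) ^+ n.+1).
Proof.
pose f y := enorm (B y) `^ p * zet (6 * t) y.
have if_ : integ f.
 apply: (@integMb _ _ _ _ 1) LB.2 _ _; first by apply: mfn_cont; exact: cont_zet.
 by move=> x; have /andP[a b] := zet_itv (6 * t) x; rewrite ger0_norm.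
have h1 x : enorm (H x) `^ p * z x <= f (shear S e x).
 rewrite HE /f ler_wpM2l ?powR_ge0//; have /andP[a b] := zet_itv (3 * t) x.
 have /andP[a' b'] := zet_itv (6 * t) (shear S e x).
 have [x4|x4] := leP (3 / 2 * (3 * t)) (enorm x); first by rewrite /z (zet_out t3 x4).1.
 rewrite (@zet_in R n.+1 (6 * t) _ t6 _).1//.
 have x5 : `|x| <= 5 * t by apply: (le_trans (norm_le_enorm x)); move: x4; have := t0; lra.
 rewrite /shear (le_trans (ler_enormD _ _))// enormN enormZ enorm_ev mulr1 normrM (gtr0_norm e0).
 have := ler_wpM2l (ltW e0) (hM x5); move: x4 eM; have := t0; lra.
apply: (le_trans (I_le iHz (integ_shear e tS if_) h1)); rewrite (I_shear e tS (integ_mfn if_)).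
pose g x := enorm (G x) `^ p * zet (6 * t) x.
have mg : mfn g by apply: mfnM; [exact: integ_mfn LG.2|apply: mfn_cont; exact: cont_zet].
have ig : integ g.
 apply: le_integ LG.2 => // x; have /andP[a b] := zet_itv (6 * t) x.
 by rewrite ger0_norm ?mulr_ge0 ?powR_ge0// ler_piMr ?powR_ge0.
have h2 x : f x <= 2 `^ p * g x.
 rewrite /f /g mulrA; have /andP[a b] := zet_itv (6 * t) x.
 have [x9|x9] := leP (3 / 2 * (6 * t)) (enorm x); first by rewrite (zet_out t6 x9).1 !mulr0.
 have {}x9 : enorm x <= 9 * t by move: x9; have := t0; lra.
 rewrite ler_wpM2r// -powRM//; apply: ge0_ler_powR; rewrite ?nnegrE ?mulr_ge0 ?enorm_ge0 ?(ltW p0)//.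
 exact: BG.
apply: (le_trans (I_le if_ (integZ (2 `^ p) ig) h2)); rewrite IZ// ler_wpM2l//.
apply: hball => //; first by rewrite mulr_gt0.
- by move=> x; have /andP[a b] := zet_itv (6 * t) x; rewrite mulr_ge0 ?powR_ge0.
- by move=> x; have /andP[a b] := zet_itv (6 * t) x; rewrite ler_piMr ?powR_ge0.
- move=> x x9; have h : 3 / 2 * (6 * t) <= enorm x by move: x9; have := t0; lra.
 by rewrite /g (zet_out t6 h).1 mulr0.
Qed.

(** The half space of heights above e is the image of [Hs] under the dilation of ratio 1 - e centred
    at [ev]. Scaling back, the capacity l is at most (1-e)^(p-N) times the energy of the lowered
    function, and [powR_subl] makes this a gain of (p - N) l at first order. *)
Lemma tilt_competitor X : energy p H <= lstar n p + e * X ->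
 (p - N) * lstar n p <= X + p * (tilt_const kp C1 V * t ^+ n).
Proof.
move=> hE.
have iZ : integ Z by apply: integD; apply: integZ; [exact: iHz|exact: iz].
have iS := integD LH.2 (integZ e (integZ p iZ)).
have LK : Lp p K := Lp_le (W_mfn WK) K_le iS.
have W2 := W_pp WK.
have L2 : Lp p (fun x => (if 0 < ush x then 1 else 0) *: K x).
 apply: (Lp_le (W_mfn W2) _ LK.2) => x; case: ifP => _; first by rewrite scale1r.
 by rewrite scale0r enorm0 powR0// gt_eqF.
have E2 : energy p (fun x => (if 0 < ush x then 1 else 0) *: K x) <= energy p K.
 apply: (I_le L2.2 LK.2) => x; case: ifP => _; first by rewrite scale1r.
 by rewrite scale0r enorm0 powR0 ?powR_ge0// gt_eqF.
pose U : set rV := [set x | e < x 0 ord0].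
have cU : comp p U ev (fun x => pp (ush x)) (fun x => (if 0 < ush x then 1 else 0) *: K x).
 split; [exact: W2|exact: L2| |by rewrite ush_ev pp_pos].
 by move=> x /negP; rewrite /U -leNgt => /ush_le h; exact: pp_neg.
have q0 : 0 < 1 - e by rewrite subr_gt0.
have o1 : orthogonal_mx (1%:M : 'M[R]_n.+1) by rewrite /orthogonal_mx trmx1 mulmx1.
have hV y : U ((1 - e) *: (y *m 1%:M) + e *: ev) -> Hs y.
 by rewrite /U /Hs /= mulmx1 mxE [((1 - e) *: y) 0 ord0]mxE [(e *: ev) 0 ord0]mxE ev_0 mulr1 ltrDr pmulr_rgt0.
have hx : (1 - e) *: (ev *m 1%:M) + e *: ev = ev :> rV by rewrite mulmx1 -scalerDl subrK scale1r.
have main := lstar_scaling p2 o1 q0 cU hV hx.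
have EK : energy p K <= lstar n p + e * (X + p * (tilt_const kp C1 V * t ^+ n)).
 apply: (le_trans (I_le LK.2 iS K_le)).
 rewrite (ID LH.2 (integZ e (integZ p iZ))) (IZ e (integZ p iZ)) (IZ p iZ).
 rewrite mulrDr addrA lerD//. rewrite ler_wpM2l ?(ltW e0)// ler_wpM2l ?(ltW p0)//.
 rewrite (ID (integZ _ iHz) (integZ _ iz)) (IZ _ iHz) (IZ _ iz).
 apply: (@le_trans _ _ (2 `^ p / t * (2 `^ p * (C1 * (9 * t) ^+ n.+1)) + (2 `^ p + 1) * kp `^ p / t * ((6 * t) ^+ n.+1 * V))).
  by rewrite lerD// ler_wpM2l ?mulr_ge0 ?powR_ge0 ?invr_ge0 ?(ltW t0).
 rewrite !exprMn (exprS t) /tilt_const; apply: eqW; field; by rewrite gt_eqF.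
have a0 : 0 < p - N by rewrite subr_gt0.
have e01 : 0 < e < 1 by rewrite e0 e1.
have key := powR_subl a0 e01.
have P0 : 0 < (1 - e) `^ (p - N) by rewrite powR_gt0.
have := le_trans main (ler_wpM2l (ltW P0) (le_trans E2 EK)).
have l0 := lstar_gt0 p2 np.
rewrite -/N; move: key P0 l0; move: (lstar n p) (X + _) => l Y key P0 l0 h.
have h1 : (1 - e) `^ (p - N) * ((1 + (p - N) * e) * l) <= (1 - e) `^ (p - N) * (l + e * Y).
 by apply: le_trans h; rewrite mulrA ler_piMl// ltW.
move: h1; rewrite (ler_pM2l P0) mulrDl mul1r lerD2l.
by rewrite -mulrA mulrCA (ler_pM2l e0).
Qed.

End tilt.

Lemma first_variation_pos : exists2 c, 0 < c & forall S, tangential S -> first_variation S = c * \tr S.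
Proof.
have [c hcS] := first_variation_tr.
exists c => //.
have [C1 [d1 [C10 d10 hball]]] := energy_small_ball.
pose V : R := I (\1_(cball 1) : rV -> R).
have V0 : 0 <= V by apply: I_ge0 => x; rewrite indicE ler0n.
pose kp : R := 80 * 3.
have kp0 : 0 <= kp by apply: mulr_ge0; exact: ler0n.
have b00 : 0 <= 80 :> R by exact: ler0n.
pose T := tilt_const kp C1 V.
have T0 : 0 <= T.
 by rewrite /T /tilt_const; do ?[apply: addr_ge0|apply: mulr_ge0|apply: powR_ge0|apply: exprn_ge0|exact: C10|exact: V0|exact: ler0n|exact: ler01].
have a0 : 0 < p - N by rewrite subr_gt0.
have l0 := lstar_gt0 p2 np.
pose A := (p - N) * lstar n p; have A0 : 0 < A by rewrite mulr_gt0.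
have pT : 0 <= p * T by rewrite mulr_ge0// ltW.
have pT1 : 0 < 4 * (p * T + 1) by rewrite mulr_gt0// ltr_wpDl.
(* The first bound keeps the cutoffs within the range of [minimizer_near0] and away from [ev], the
   second allows [energy_small_ball] at radius 9 t, and the third makes the cost of lowering at most
   A/4. The error of the expansion is another A/4. *)
pose t := Num.min (Num.min (9^-1) (d1 / 9)) (A / (4 * (p * T + 1))).
have t0 : 0 < t by rewrite /t !lt_min; apply/andP; split; [apply/andP; split; [rewrite invr_gt0|exact: divr_gt0]|exact: divr_gt0].
have t9 : t * 9 <= 1.
 have : t <= 9^-1 by rewrite /t !ge_min lexx. by move: t0; clearbody t => ?; lra.
have td : 9 * t <= d1.
 have : t <= d1 / 9 by rewrite /t !ge_min lexx orbT. by rewrite ler_pdivlMr// mulrC.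
have tA : p * T * t <= A / 4.
 have : t <= A / (4 * (p * T + 1)) by rewrite /t ge_min lexx orbT.
 by rewrite ler_pdivlMr//; exact: le_quarter.
clearbody t; pose S := paraboloid (2 / t ^+ 2); have tS : tangential S := tangential_paraboloid _.
have [L L0 hL] := dqf_le S.
have [M M0 hM] := @cont_bounded_cball R n.+1 (qf S) (5 * t) (@cont_qf R n S).
have A4 : 0 < A / 4 by rewrite divr_gt0.
have [K hK] := expansion S (@ltr01 R) A4.
(* These bounds give e < 1, e <= t, displacements e |q| <= t on the relevant cube, and a tilt that
   at most doubles gradients there. *)
pose e0 := Num.min (Num.min 2^-1 t) (Num.min (t / (M + 1)) (1 / (L * (9 * t) + 1))).
have M1 : 0 < M + 1 by rewrite ltr_wpDl.
have L1 : 0 < L * (9 * t) + 1 by rewrite ltr_wpDl// mulr_ge0// mulr_ge0// ltW.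
have e00 : 0 < e0.
 have d2 : 0 < 2^-1 by []. have d3 : 0 < t / (M + 1) := divr_gt0 t0 M1.
 have d4 : 0 < 1 / (L * (9 * t) + 1) := divr_gt0 ltr01 L1. by rewrite /e0 !lt_min d2 t0 d3 d4.
have [K1 _ hK1] := near_natSinv e00.
pose k := maxn K K1; have kK : (K <= k)%N by rewrite leq_maxl.
pose e : R := k.+1%:R^-1.
have ee : e <= e0 by apply: hK1; rewrite /= leq_maxr.
have eg0 : 0 < e by rewrite invr_gt0.
have h1 : e <= 2^-1 by apply: (le_trans ee); rewrite /e0 !ge_min lexx.
have h2 : e <= t by apply: (le_trans ee); rewrite /e0 !ge_min lexx orbT.
have h3 : e * M <= t.
 have : e <= t / (M + 1) by apply: (le_trans ee); rewrite /e0 !ge_min lexx !orbT.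
 by rewrite ler_pdivlMr// mulrDr mulr1; apply: le_trans; rewrite lerDl ltW.
have h4 : e * (L * (9 * t)) <= 1.
 have : e <= 1 / (L * (9 * t) + 1) by apply: (le_trans ee); rewrite /e0 !ge_min lexx !orbT.
 by rewrite ler_pdivlMr// mulrDr mulr1; apply: le_trans; rewrite lerDl ltW.
have e1 : e < 1 by apply: le_lt_trans h1 _; lra.
have [_ [LB EB]] := hK k kK.
have R1 : 1 <= 1 / e by rewrite ler_pdivlMr// mul1r ltW.
have [LH EH] := energy_shear tS LB.
have WH := W_shear e tS (W_cut (1 / e)).
have BG x : enorm x <= 9 * t -> enorm (shear_grad S e (cut_grad (1 / e)) x) <= 2 * enorm (G x).
 move=> x9; rewrite /shear_grad cut_grad_in; last first.
 - by apply: (le_trans x9); apply: le_trans R1; rewrite mulrC.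
 - exact: lt_le_trans R1. apply: (@tilted_le (G x) (\row_i dqf S i x) e (ltW eg0)).
 apply: le_trans h4; apply: (ler_wpM2l (ltW eg0)). by apply: (le_trans (hL x)); exact: ler_wpM2l.
have hE := eq_ind_r (fun E => E <= _) EB EH.
have hX := tilt_competitor t0 t9 td b00 (erefl kp) kp0 minimizer_near0 I_cball hball
 tS (qf_paraboloid _) eg0 e1 h2 hM h3 (fun x => erefl _) (fun x => erefl _) LB LH WH BG hE.
have pX : 0 < first_variation S := lt0_first A0 pT (expr_le_id t0 t9 n0) tA hX.
have tr0 : 0 < \tr S := tr_paraboloid_gt0 n0 t0.
by move: pX; rewrite (hcS S tS) (pmulr_lgt0 c tr0).
Qed.

End minimizer.

Lemma model_ineq (R : realFieldType) (a d C K r q T b s e : R) : 0 < a -> 0 < d -> 0 <= C -> 0 <= K -> 0 <= r ->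
 `|T - b| <= C * (`|s| * e) -> `|2^-1 * T + 2 * d * q| <= K * q -> 0 <= q -> s ^+ 2 <= `|s| * e ->
 `|s| * e <= `|s| * r -> 0 < a * s - (2^-1 * T + 2 * d * q) ->
 (C + d) * r <= a / 2 -> (C + d) * r * K <= a * (d / 2) -> 0 < a * s - 2^-1 * b - d * (q + s ^+ 2).
Proof.
move=> a0 d0 C0 K0 r0; rewrite ler_norml => /andP[hP _] hY q0 s2 sr X0 h1 h2.
set X := a * s - _ in X0.
have as_le : a * `|s| <= X + K * q.
 rewrite -(ger0_norm (ltW a0)) -normrM (_ : a * s = X + (2^-1 * T + 2 * d * q)); last by rewrite /X; ring.
 by rewrite (le_trans (ler_normD _ _))// gtr0_norm// lerD2l.
have Cd : 0 <= C + d by rewrite addr_ge0// ltW.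
have k1 : (C + d) * (`|s| * e) <= (C + d) * r * `|s| by rewrite -mulrA ler_wpM2l// [r * _]mulrC.
have k2 : a * ((C + d) * r * `|s|) <= a * (X / 2 + d / 2 * q).
 have g1 : (C + d) * r * (a * `|s|) <= (C + d) * r * (X + K * q) by rewrite ler_wpM2l// mulr_ge0.
 have g2 : (C + d) * r * X <= a / 2 * X by rewrite ler_wpM2r// ltW.
 have g3 : (C + d) * r * K * q <= a * (d / 2) * q by rewrite ler_wpM2r. lra.
rewrite ler_pM2l// in k2.
have k3 : d * s ^+ 2 <= d * (`|s| * e) by rewrite ler_wpM2l// ltW.
have dq : 0 <= d * q by rewrite mulr_ge0// ltW.
have k4 : 0 <= C * (`|s| * e) by rewrite mulr_ge0// (le_trans (sqr_ge0 _) s2).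
have E : a * s = X + 2^-1 * T + 2 * d * q by rewrite /X; ring.
rewrite E; clearbody X; clear E as_le hY s2 sr h1 h2 Cd; lra.
Qed.

(** * Second order expansions and the quadratic model of the boundary *)

Section second_order.
Context {R : realType}.

(** On the segment from z to z + w the difference between f and its quadratic polynomial has a
    derivative controlled by the first order expansions of the partial derivatives. The parameter
    lives in 'rV_1 so that [pd_chain] and [pd_MVT] apply. *)
Lemma C2_taylor m (f : 'rV[R]_m -> R) z (e : R) : C_ 2 f -> 0 < e ->
 exists2 d, 0 < d & forall w, `|w| <= d ->
  `|f (z + w) - f z - \sum_j w 0 j * partial j f z
   - 2^-1 * \sum_j \sum_k w 0 j * (w 0 k * partial k (partial j f) z)| <= e * `|w| ^+ 2.
Proof.
move=> C2f e_gt0; have C1f : C_ 1 f by exact: C_S.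
have e1 : 0 < e / (m%:R + 1) by rewrite divr_gt0// ltr_wpDl.
pose P d := forall j v, `|v| <= d ->
 `|partial j f (z + v) - partial j f z - \sum_k v 0 k * partial k (partial j f) z| <= e / (m%:R + 1) * `|v|.
have [d [d0 hd]] : exists d : R, 0 < d /\ P d.
 have : \forall d \near (0 : R)^'+, P d.
  apply: filter_forall => j; have [_ Cj] := C_pd j C2f.
  have [d d0 hd] := @C1_taylor R m (partial j f) (fun k => partial k (partial j f)) `|z| _
   (fun k => (C_pd k Cj).1) (fun k => C_cont (C_pd k Cj).2) e1.
  near=> d' => v vd; apply: hd => //; apply: (le_trans vd); near: d'; exact: nbhs_right_le.
 by move=> H; near (0:R)^'+ => d; exists d; split => //; near: d.
exists d => // w wd.
pose L : R := \sum_j w 0 j * partial j f z.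
pose Q : R := \sum_j \sum_k w 0 j * (w 0 k * partial k (partial j f) z).
pose psi (t : 'rV[R]_1) : R := f (z + t 0 0 *: w) - (t 0 0 * L + 2^-1 * (Q * t 0 0 ^+ 2)).
pose dpsi (t : 'rV[R]_1) : R := \sum_j w 0 j * partial j f (z + t 0 0 *: w) - (L + Q * t 0 0).
have hpsi t : pd ord0 psi t (dpsi t).
 apply: pdB.
  apply: (@pd_chain R 1 m f (fun j => partial j f) (fun t : 'rV[R]_1 => z + t 0 0 *: w) (fun j => w 0 j) ord0 t).
  - by move=> j y; have [] := C_pd j C1f.
  - by move=> j; have [_ h] := C_pd j C1f; exact: C_cont h.
  - move=> j; under eq_fun do rewrite !mxE mulrC.
   apply: pd_eq (pdD (pd_cst _ _ _) (pdZ _ (pd_coord _ _ _))) _. by rewrite eqxx add0r mulr1.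
 apply: pd_eq.
  apply: pdD; last by apply: pdZ; apply: pdZ; apply: pdX; exact: pd_coord.
  by apply: pdM; [exact: pd_coord|exact: pd_cst].
 rewrite eqxx expr1; rewrite mulr1n. by field.
have [t t1] := pd_MVT 0 1 hpsi.
have E0 (s : R) : (0 + s *: basis_rV ord0 : 'rV[R]_1) 0 0 = s by rewrite !mxE !eqxx add0r mulr1.
have P1 : psi (0 + 1 *: basis_rV ord0) = f (z + w) - (L + 2^-1 * Q).
 by rewrite /psi E0 scale1r mul1r expr1n mulr1.
have P0 : psi 0 = f z by rewrite /psi mxE scale0r addr0 mul0r expr0n !mulr0 addr0 subr0.
rewrite P1 P0 mul1r /dpsi E0 => E.
have -> : f (z + w) - f z - L - 2^-1 * Q =
  \sum_j w 0 j * (partial j f (z + t *: w) - partial j f z - \sum_k (t *: w) 0 k * partial k (partial j f) z).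
 rewrite (_ : _ - _ - _ - _ = f (z + w) - (L + 2^-1 * Q) - f z); last by ring.
 rewrite E opprD addrA /L /Q mulr_suml -!sumrB; apply: eq_bigr => j _.
 rewrite !mulrBr mulr_sumr mulr_suml; congr (_ - _); apply: eq_bigr => k _; rewrite mxE; ring.
rewrite normr1 in t1.
have tw : `|t *: w| <= `|w| by rewrite normrZ ler_piMl.
apply: (le_trans (ler_norm_sum _ _ _)).
apply: (@le_trans _ _ (\sum_(j < m) (e / (m%:R + 1) * `|w| ^+ 2))).
 apply: ler_sum => j _; rewrite normrM expr2 mulrA [leRHS]mulrC.
 apply: ler_pM => //; first exact: coord_le_norm.
 by apply: (le_trans (hd _ _ (le_trans tw wd))); rewrite ler_wpM2l// ltW.
rewrite sumr_const card_ord -[leLHS]mulr_natl mulrA ler_wpM2r//.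
by rewrite mulrCA ler_piMr ?(ltW e_gt0)// ler_pdivrMr// mul1r lerDl.
Unshelve. all: by end_near. Qed.

Variable n : nat.
Implicit Types (Om : set 'rV[R]_n.+1) (v xi : 'rV[R]_n.+1) (f : 'rV[R]_n -> R) (z : 'rV[R]_n) (S B : 'M[R]_n.+1).

(** In this form the bracket is the trace of the pulled back Hessian minus its entry in the normal
    direction, the quantity [\tr B - B ord0 ord0] of [bad_boundary_point]. *)
Lemma graph_mean_curvatureE f z : C_ 2 f ->
 graph_mean_curvature f z = n%:R^-1 * (rho (grad f z))^-1 * (\sum_i partial i (partial i f) z
  - (rho (grad f z)) ^- 2 * \sum_i \sum_j partial i f z * (partial j f z * partial i (partial j f) z)).
Proof.
move=> C2f; rewrite /graph_mean_curvature /div -mulrA; congr (_ * _).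
have C1f : C_ 1 f by exact: C_S.
pose a y := rho (grad f y).
have aE y : Num.sqrt (1 + enorm (grad f y) ^+ 2) = a y by rewrite enormE.
have h1 i j : pd i (partial j f) z (partial i (partial j f) z).
 have [_ Cj] := C_pd j C2f; exact: (C_pd i Cj).1.
have h2 i : pd i (fun y => rho (grad f y)) z (\sum_j partial i (partial j f) z * (partial j f z / a z)).
 have h3 : forall j (y : 'rV[R]_n), pd j (@rho R n) y (y 0 j / rho y) by move=> j y; exact: pd_rho.
 have h4 : forall j, continuous (fun y : 'rV[R]_n => y 0 j / rho y).
  move=> j; apply: contM; first exact: continuous_coord.
  by apply: contV; [move=> x; rewrite gt_eqF// rho_gt0|exact: cont_rho].
 have h5 j : pd i (fun y => grad f y 0 j) z (partial i (partial j f) z).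
  by under eq_fun do rewrite mxE; exact: h1.
 apply: pd_eq (pd_chain h3 h4 h5) _. by apply: eq_bigr => j _; rewrite mxE.
have a0 : a z != 0 by rewrite gt_eqF// rho_gt0.
have h3 i : pd i (fun y => ((Num.sqrt (1 + enorm (grad f y) ^+ 2))^-1 *: grad f y) 0 i) z
 ((a z)^-1 * partial i (partial i f) z +
  partial i f z * (- (a z) ^- 2 * (\sum_j partial i (partial j f) z * (partial j f z / a z)))).
 under eq_fun do rewrite !mxE aE. by apply: pd_eq (pdM (pdV a0 (h2 i)) (h1 i i)) _; ring.
under eq_bigr => i _ do rewrite (pd_partial (h3 i)).
rewrite big_split /= -mulr_sumr mulrBr; congr (_ + _).
rewrite !mulr_sumr -sumrN; apply: eq_bigr => i _.
rewrite !mulr_sumr -sumrN; apply: eq_bigr => j _; rewrite -/(a z); by field.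
Qed.

Definition tangential_part (B : 'M[R]_n.+1) : 'M[R]_n.+1 :=
 \matrix_(i, j) (if (i == ord0) || (j == ord0) then 0 else B i j).

Lemma tangential_tangential_part B : tangential (tangential_part B).
Proof. by move=> i j [->|->]; rewrite mxE eqxx ?orbT. Qed.

Lemma tr_tangential_part B : \tr (tangential_part B) = \tr B - B ord0 ord0.
Proof.
rewrite /mxtrace [in RHS](bigD1 ord0)//= addrAC subrr add0r (bigD1 ord0)//= mxE eqxx add0r.
by apply: eq_bigr => i i0; rewrite mxE (negbTE i0).
Qed.

Lemma qfE S v : qf S v = (v *m S *m v^T) 0 0.
Proof.
rewrite mxE /qf exchange_big /=; apply: eq_bigr => j _.
rewrite !mxE mulr_suml; apply: eq_bigr => i _; ring.
Qed.

Lemma qfD S S' v : qf (S + S') v = qf S v + qf S' v.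
Proof. by rewrite !qfE mulmxDr mulmxDl mxE. Qed.

Lemma qfZ a S v : qf (a *: S) v = a * qf S v.
Proof. by rewrite !qfE -scalemxAr -scalemxAl mxE. Qed.

Lemma tangentialD S S' : tangential S -> tangential S' -> tangential (S + S').
Proof. by move=> h h' i j ij; rewrite mxE h// h'// addr0. Qed.

Lemma tangentialZ a S : tangential S -> tangential (a *: S).
Proof. by move=> h i j ij; rewrite mxE h// mulr0. Qed.

Lemma sqr_coord_le v i : i != ord0 -> v 0 i ^+ 2 <= dotp v v - v 0 ord0 ^+ 2.
Proof.
move=> i0; rewrite /dotp (bigD1 ord0)//= (bigD1 i)//= -!expr2 addrAC subrr add0r lerDl.
by apply: sumr_ge0 => j _; rewrite -expr2 sqr_ge0.
Qed.

Lemma qf_tangential_le S : tangential S -> exists2 C, 0 <= C &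
 forall v, `|qf S v| <= C * (dotp v v - v 0 ord0 ^+ 2).
Proof.
move=> tS; exists (\sum_i \sum_j `|S i j|); first by apply: sumr_ge0 => i _; apply: sumr_ge0 => j _.
move=> v; rewrite /qf mulr_suml; apply: (le_trans (ler_norm_sum _ _ _)); apply: ler_sum => i _.
rewrite mulr_suml; apply: (le_trans (ler_norm_sum _ _ _)); apply: ler_sum => j _.
have [i0|i0] := eqVneq i ord0; first by rewrite tS ?normr0 ?mul0r ?normr0//; left.
have [j0|j0] := eqVneq j ord0; first by rewrite tS ?normr0 ?mul0r ?normr0//; right.
rewrite normrM ler_wpM2l// normrM.
have := sqr_coord_le v i0; have := sqr_coord_le v j0.
rewrite -(real_normK (num_real (v 0 i))) -(real_normK (num_real (v 0 j))).
move: (dotp v v - _) `|v 0 i| `|v 0 j| => q s t h1 h2; have := sqr_ge0 (s - t); lra.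
Qed.

Lemma qf_tangential_part_le B : exists2 C, 0 <= C &
 forall v, `|qf (tangential_part B) v - qf B v| <= C * (`|v 0 ord0| * enorm v).
Proof.
exists (\sum_i \sum_j `|B i j|); first by apply: sumr_ge0 => i _; apply: sumr_ge0 => j _.
move=> v; have r0 : 0 <= `|v 0 ord0| * enorm v by rewrite mulr_ge0 ?enorm_ge0.
rewrite /qf -sumrB mulr_suml; apply: (le_trans (ler_norm_sum _ _ _)); apply: ler_sum => i _.
rewrite -sumrB mulr_suml; apply: (le_trans (ler_norm_sum _ _ _)); apply: ler_sum => j _.
rewrite mxE; case: ifP => [ij|_]; last by rewrite subrr normr0 mulr_ge0.
rewrite mul0r sub0r normrN normrM ler_wpM2l// normrM.
case/orP: ij => /eqP ->; first by rewrite ler_wpM2l// coord_le_enorm.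
by rewrite mulrC ler_wpM2l// coord_le_enorm.
Qed.

(** The second order part of the boundary over its tangent plane, a being the length of the normal,
    raised by a paraboloid that absorbs all error terms. *)
Definition model (a d : R) B : 'M[R]_n.+1 := a^-1 *: (2^-1 *: tangential_part B + paraboloid n (2 * d)).

Lemma tangential_model a d B : tangential (model a d B).
Proof.
apply: tangentialZ; apply: tangentialD; last exact: tangential_paraboloid.
by apply: tangentialZ; exact: tangential_tangential_part.
Qed.

Lemma tr_model a d B : \tr (model a d B) = a^-1 * (2^-1 * (\tr B - B ord0 ord0) + n%:R * (2 * d)).
Proof. by rewrite /model !mxtraceZ mxtraceD mxtraceZ tr_tangential_part tr_paraboloid. Qed.

(* In terms of X = a s - q(v) > 0 one has |s| <= (X + K |y|^2) / a, so the terms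
  containing s are absorbed by X + d |y|^2 when |v| is small. *)
Lemma model_region B (a d : R) : 0 < a -> 0 < d -> exists2 r, 0 < r &
 forall v, enorm v <= r -> qf (model a d B) v < v 0 ord0 ->
 0 < a * v 0 ord0 - 2^-1 * qf B v - d * dotp v v.
Proof.
move=> a0 d0; have [C C0 hC] := qf_tangential_part_le B.
have [K K0 hK] := qf_tangential_le (tangentialZ a (tangential_model a d B)).
have Cd : 0 < C + d by rewrite ltr_wpDl.
have K1 : 0 < K + 1 by rewrite ltr_wpDl.
pose r := Num.min (a / (2 * (C + d))) (a * d / (2 * ((C + d) * (K + 1)))).
have r0 : 0 < r by rewrite lt_min !divr_gt0 ?mulr_gt0.
exists r => // v vr.
have h1 : (C + d) * r <= a / 2.
 have : r <= a / (2 * (C + d)) by rewrite /r ge_min lexx. by rewrite ler_pdivlMr//; lra.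
have h2 : (C + d) * r * K <= a * (d / 2).
 have : r <= a * d / (2 * ((C + d) * (K + 1))) by rewrite /r ge_min lexx orbT.
 rewrite ler_pdivlMr ?mulr_gt0// => h.
 have : (C + d) * r * K <= (C + d) * r * (K + 1) by rewrite ler_wpM2l ?lerDl// mulr_ge0 ?(ltW Cd) ?(ltW r0).
 lra.
have := hK v; have := hC v; have q0 := tangential_sqr_ge0 v; rewrite qfZ.
have -> : qf (model a d B) v = a^-1 * (2^-1 * qf (tangential_part B) v + 2 * d * (dotp v v - v 0 ord0 ^+ 2)).
 by rewrite /model qfZ qfD qfZ qf_paraboloid.
have an : a != 0 by rewrite gt_eqF.
rewrite (mulVKf an) => hP hY; rewrite -(ltr_pM2l a0) (mulVKf an) -subr_gt0.
have s2 : v 0 ord0 ^+ 2 <= `|v 0 ord0| * enorm v.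
 by rewrite -real_normK ?num_real// expr2 ler_wpM2l// coord_le_enorm.
have sr : `|v 0 ord0| * enorm v <= `|v 0 ord0| * r by rewrite ler_wpM2l.
move=> X0; have E : dotp v v = (dotp v v - v 0 ord0 ^+ 2) + v 0 ord0 ^+ 2 by ring.
rewrite [X in _ - d * X]E.
exact: model_ineq a0 d0 C0 K0 (ltW r0) hP hY q0 s2 sr X0 h1 h2.
Qed.

End second_order.

(** * A boundary point of negative mean curvature *)

Section boundary_geometry.
Context {R : realType} (n : nat).
Implicit Types (Om : set 'rV[R]_n.+1) (x y v xi : 'rV[R]_n.+1) (f : 'rV[R]_n -> R) (z : 'rV[R]_n).

Definition horiz_mx : 'M[R]_(n.+1, n) := \matrix_(i, j) (i == widen_ord (leqnSn n) j)%:R.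

Lemma horizontalE x : horizontal x = x *m horiz_mx.
Proof.
apply/rowP => j; rewrite !mxE (bigD1 (widen_ord (leqnSn n) j))//= big1 ?addr0.
 by rewrite mxE eqxx mulr1.
by move=> i /negbTE ij; rewrite mxE ij mulr0.
Qed.

Lemma horizontalD x y : horizontal (x + y) = horizontal x + horizontal y.
Proof. by rewrite !horizontalE mulmxDl. Qed.

Lemma horiz_mxK : horiz_mx^T *m horiz_mx = 1%:M.
Proof.
apply/matrixP => i j; rewrite !mxE (bigD1 (widen_ord (leqnSn n) i))//= big1 ?addr0.
 by rewrite !mxE eqxx mul1r; congr (_%:R); congr nat_of_bool; apply/eqP/eqP => [[ij]|->]; exact: val_inj.
by move=> k /negbTE ik; rewrite !mxE ik mul0r.
Qed.

Lemma quadratic_scale (w u : 'I_n -> R) (H : 'I_n -> 'I_n -> R) c : (forall j, w j = - (c^-1 * u j)) ->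
 \sum_j \sum_k w j * (w k * H k j) = c ^- 2 * \sum_i \sum_j u i * (u j * H i j).
Proof.
move=> h; rewrite -exprVn exchange_big mulr_sumr; apply: eq_bigr => i _; rewrite mulr_sumr; apply: eq_bigr => j _.
by rewrite !h; ring.
Qed.

Definition hess f z : 'M[R]_n := \matrix_(j, k) partial k (partial j f) z.

Lemma hessE f z (w : 'rV[R]_n) :
 (w *m hess f z *m w^T) 0 0 = \sum_j \sum_k w 0 j * (w 0 k * partial k (partial j f) z).
Proof.
rewrite mxE exchange_big /=; apply: eq_bigr => k _; rewrite !mxE mulr_suml; apply: eq_bigr => j _.
by rewrite mxE; ring.
Qed.

Lemma horizontal_grad_defun f xi : horizontal (grad_defun f xi) = - grad f (horizontal xi).
Proof.
apply/rowP => j; rewrite !mxE /ddefun (_ : (widen_ord _ j == ord_max) = false); last first.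
 by apply/negbTE; rewrite neq_ltn /= ltn_ord.
rewrite sub0r (bigD1 j)//= eqxx mul1r big1 ?addr0// => k kj.
rewrite (_ : (_ == _) = false) ?mul0r//; apply/negbTE; apply: contra kj => /eqP[jk].
by apply/eqP; apply: val_inj.
Qed.

Lemma dotp_horizontal x y : dotp x y = dotp (horizontal x) (horizontal y) + x 0 ord_max * y 0 ord_max.
Proof. by rewrite /dotp big_ord_recr; congr (_ + _); apply: eq_bigr => i _; rewrite !mxE. Qed.

Lemma enorm_grad_defun f xi : enorm (grad_defun f xi) = rho (grad f (horizontal xi)).
Proof.
by rewrite enorm_sqrt /rho dotp_horizontal grad_defun_max horizontal_grad_defun dotpNl dotpNr opprK mulr1 addrC.
Qed.

Lemma norm_horizontal x : `|horizontal x| <= `|x|.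
Proof. by apply/mx_norm_leP => // i; rewrite mxE coord_le_norm. Qed.

Lemma qf_ev_entry S : qf S (@ev R n) = S ord0 ord0.
Proof.
rewrite qfE /ev -rowE (mxE) (bigD1 ord0)//= big1 ?addr0; first by rewrite !mxE !eqxx mulr1.
by move=> j j0; rewrite !mxE (negbTE j0) andbF mulr0.
Qed.

Lemma boundary_defun Om y T f : open Om -> boundary Om y -> C2_chart Om y T f ->
 ~ Om y /\ defun f (T y) = 0.
Proof.
move=> oOm [cy iy] [[Q [b [oQ TE]]] C2f nz].
have Oy : ~ Om y by move=> h; apply: iy; rewrite /interior; exact: open_nbhs_nbhs.
split=> //; apply/eqP; rewrite eq_le; apply/andP; split.
 rewrite leNgt; apply/negP => h; apply: Oy; apply/(nbhs_singleton nz). by rewrite -subr_gt0.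
rewrite leNgt; apply/negP => h.
have cT : continuous (fun x => defun f (T x)).
 have cT : continuous T.
  move=> t; apply: continuous_rVP t => j.
  have -> : (fun x => T x 0 j) = (fun x => (\sum_i x 0 i * Q i j) + b 0 j).
   by apply/funext => x; rewrite TE !mxE.
  by ctn.
 apply: contB; first exact: cont_comp cT (@continuous_coord R n.+1 ord_max).
 have cf := @cont_comp _ _ _ (@horizontal R n) f (@horizontal_cont R n) (C_cont C2f).
 exact: (@cont_comp _ _ _ T (fun x => f (horizontal x)) cT cf).
have h2 : \forall x \near y, defun f (T x) < 0.
 exact: cvgr_lt _ (cT y) _ h.
have h3 : \forall x \near y, ~ Om x.
 near=> x; move=> Ox. have k1 : defun f (T x) < 0 by near: x.
 have : Om x <-> f (horizontal (T x)) < T x 0 ord_max by near: x.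
 move=> /iffLR/(_ Ox); rewrite -subr_gt0 -/(defun f (T x)) => k2.
 by move: (lt_trans k1 k2); rewrite ltxx.
by have [x [Ox nOx]] := cy _ h3.
Unshelve. all: by end_near. Qed.

(** In the frame of the inner normal the sign of the mean curvature is that of the tangential trace
    t of the Hessian. The Taylor error is at most d |v|^2, the slack already granted in
    [model_region]. *)
Lemma bad_boundary_point Om : (0 < n)%N -> open Om -> C2_set Om -> ~ mean_convex Om ->
 exists y (M S : 'M[R]_n.+1) (r : R), [/\ ~ Om y, orthogonal_mx M, tangential S & \tr S < 0] /\
  0 < r /\ forall v, enorm v <= r -> qf S v < v 0 ord0 -> Om (y + v *m M).
Proof.
move=> n0 oOm C2 nmc.
have [y [T [f [by_ [ch Hneg]]]]] : exists y T f, boundary Om y /\ C2_chart Om y T f /\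
  graph_mean_curvature f (horizontal (T y)) < 0.
 apply: contrapT => H; apply: nmc; split=> // y bdy _ [T [f [ch ->]]].
 by rewrite leNgt; apply/negP => h; apply: H; exists y, T, f.
have [Oy dy] := boundary_defun oOm by_ ch.
have [[Q [b [oQ TE]]] C2f /nbhs_ballP[rz /= rz0 hrz]] := ch.
have TD x u : T (x + u) = T x + u *m Q by rewrite !TE mulmxDl addrAC.
pose xi := T y; pose z := horizontal xi; pose g := grad_defun f xi.
pose a := enorm g; have a0 : 0 < a by exact: grad_defun_gt0.
pose P := hh (ev - a^-1 *: g).
have oP : orthogonal_mx P by exact: hh_orthogonal.
pose A := P *m horiz_mx; pose B := A *m hess f z *m A^T.
have hA v : horizontal (v *m P) = v *m A by rewrite horizontalE /A mulmxA.
have qB v : qf B v = \sum_j \sum_k horizontal (v *m P) 0 j * (horizontal (v *m P) 0 k * partial k (partial j f) z).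
 by rewrite -hessE hA qfE /B (trmx_mul v A) !mulmxA.
have trB : \tr B = \sum_i partial i (partial i f) z.
 rewrite /B mxtrace_mulC mulmxA /A trmx_mul -(mulmxA _ P^T) (mulmxA P^T) (mulmx1C oP) mul1mx horiz_mxK mul1mx.
 by apply: eq_bigr => i _; rewrite mxE.
have B00 : B ord0 ord0 = a ^- 2 * \sum_i \sum_j partial i f z * (partial j f z * partial i (partial j f) z).
 rewrite -qf_ev_entry qB frame_normal -/g -/a.
 have hg j : horizontal (a^-1 *: g) 0 j = - (a^-1 * partial j f z).
  by rewrite horizontalE -scalemxAl -horizontalE horizontal_grad_defun scalerN !mxE.
 exact: (@quadratic_scale (fun j => horizontal (a^-1 *: g) 0 j) (fun j => partial j f z)
  (fun k j => partial k (partial j f) z) a hg).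
pose t := \tr B - B ord0 ord0.
have t0 : t < 0.
 move: Hneg; rewrite graph_mean_curvatureE// -/z -(enorm_grad_defun f xi) -/g -/a -trB -B00 -/t.
 by rewrite pmulr_rlt0// mulr_gt0 ?invr_gt0 ?ltr0n.
(* The slack 2 d on each of the n tangential axes adds -t/4 to t/2, so the trace of the model keeps
   the sign of t. *)
pose d := - t / (8 * n%:R).
have nn : 0 < n%:R :> R by rewrite ltr0n.
have d0 : 0 < d by rewrite divr_gt0 ?oppr_gt0// mulr_gt0.
have [r1 r10 hr1] := model_region B a0 d0.
have [d2 d20 hd2] := C2_taylor z C2f d0.
exists y, (frame f Q xi), (model a d B), (Num.min r1 (Num.min d2 (rz / 2))); split.
 split=> //; [exact: frame_orthogonal|exact: tangential_model|].
 rewrite tr_model -/t pmulr_rlt0 ?invr_gt0// /d.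
 have -> : n%:R * (2 * (- t / (8 * n%:R))) = - t / 4 by field; rewrite gt_eqF. lra.
split; first by rewrite !lt_min r10 d20 divr_gt0.
move=> v; rewrite !le_min => /and3P[v1 v2 v3] qv.
have MQ : v *m frame f Q xi *m Q = v *m P by rewrite /frame -mulmxA -(mulmxA _ Q^T) (mulmx1C oQ) mulmx1.
have vM : `|v *m frame f Q xi| <= enorm v.
 by rewrite (le_trans (norm_le_enorm _))// enorm_orthogonal//; exact: frame_orthogonal.
have vP : `|horizontal (v *m P)| <= enorm v.
 by rewrite (le_trans (norm_horizontal _))// (le_trans (norm_le_enorm _))// enorm_orthogonal.
have hb : ball y rz (y + v *m frame f Q xi) by rewrite -ball_normE /= opprD addrA subrr sub0r normrN; lra.
apply/(hrz _ hb).
have Tx : T (y + v *m frame f Q xi) = xi + v *m P by rewrite TD MQ.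
rewrite Tx; rewrite horizontalD -/z mxE; move: dy => /eqP; rewrite subr_eq0 -/xi -/z => /eqP ->.
have := hd2 _ (le_trans vP v2); rewrite -qB => /(le_trans (ler_norm _)) k1.
have k2 := hr1 v v1 qv.
have k3 : a * v 0 ord0 = (v *m P) 0 ord_max - \sum_j horizontal (v *m P) 0 j * partial j f z.
 rewrite -(frame_dotp f xi v oQ) MQ dotp_horizontal grad_defun_max mul1r horizontal_grad_defun addrC; congr (_ + _).
 by rewrite dotpNl; congr (- _); apply: eq_bigr => j _; rewrite mxE mulrC.
have k4 : d * `|horizontal (v *m P)| ^+ 2 <= d * dotp v v.
 by rewrite ler_wpM2l ?(ltW d0)// -enormE ler_sqr ?nnegrE ?enorm_ge0.
move: k1 k2 k4; rewrite k3.
move: (f (z + _)) (f z) (\sum_j _) (qf B v) (dotp v v) (_ ^+ 2) ((v *m P) 0 ord_max) => A1 A2 A3 A4 A5 A6 A7; lra.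
Qed.

End boundary_geometry.

(** * The competitor in Omega and the strict inequality *)

Section strict_inequality.
Context {R : realType} (n : nat).
Implicit Types (Om : set 'rV[R]_n.+1) (x y v : 'rV[R]_n.+1) (S : 'M[R]_n.+1).

Lemma qf_scale S a v : qf S (a *: v) = a ^+ 2 * qf S v.
Proof. by rewrite !qfE linearZ /= -!scalemxAl -scalemxAr !mxE; ring. Qed.

(* The support of the sheared and truncated minimizer, at the scale e. *)
Lemma shear_support S : tangential S -> exists2 C, 0 <= C & forall e r x, 0 < e -> 0 <= r ->
 enorm (shear S e x) <= r / e -> enorm (e *: x) <= r + C * r ^+ 2.
Proof.
move=> tS; have [C C0 hC] := qf_tangential_le tS; exists C => // e r x e0 r0 h.
have -> : e *: x = e *: shear S e x + (qf S (e *: x)) *: ev.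
 by rewrite /shear scalerBr scalerA qf_scale mulrA expr2 subrK.
have h1 : enorm (e *: shear S e x) <= r by rewrite enormZ gtr0_norm// mulrC -ler_pdivlMr.
apply: (le_trans (ler_enormD _ _)); rewrite enormZ enorm_ev mulr1; apply: lerD => //.
have -> : qf S (e *: x) = qf S (e *: shear S e x).
 have := qf_ev (e *: x) (- (e * (e * qf S x))) tS; rewrite /shear scalerBr scaleNr scalerA => ->//.
apply: (le_trans (hC _)); apply: ler_wpM2l => //; apply: (@le_trans _ _ (dotp (e *: shear S e x) (e *: shear S e x))).
 by rewrite gerBl sqr_ge0.
by rewrite -enormE ler_sqr ?nnegrE ?enorm_ge0.
Qed.

(** After scaling by e, the support fits into the region provided by [bad_boundary_point]. The
    constant does not depend on e, so the radius r is fixed before e tends to 0. *)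
Lemma cut_support S : tangential S -> exists2 C, 0 <= C & forall w e r x, (forall y, ~ Hs y -> w y = 0 :> R) ->
 0 < e -> 0 < r -> w (shear S e x) * zet (r / e) (shear S e x) <> 0 ->
 enorm (e *: x) <= 3 / 2 * r + C * (3 / 2 * r) ^+ 2 /\ qf S (e *: x) < (e *: x) 0 ord0.
Proof.
move=> tS; have [C C0 hC] := shear_support tS; exists C => // w e r x wn e0 r0 h.
have re0 : 0 < r / e by rewrite divr_gt0.
split.
 apply: hC => //; first by rewrite mulr_ge0// ltW. rewrite leNgt; apply/negP => xr; apply: h.
 by rewrite (zet_out re0 _).1 ?mulr0// mulrA ltW.
rewrite qf_scale mxE expr2 -mulrA ltr_pM2l// -subr_gt0.
have -> : x 0 ord0 - e * qf S x = shear S e x 0 ord0 by rewrite /shear rVB mxE ev_0 mulr1.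
by rewrite ltNge; apply/negP => s0; apply: h; rewrite wn ?mul0r// /Hs /= ltNge s0.
Qed.

Lemma small_radius (C r0 : R) : 0 <= C -> 0 < r0 ->
 exists2 r, 0 < r & 3 / 2 * r + C * (3 / 2 * r) ^+ 2 <= r0.
Proof.
move=> C0 r00; have C1 : 0 < 3 + 3 * C by lra.
exists (Num.min 2^-1 (r0 / (3 + 3 * C))); first by rewrite lt_min invr_gt0 ltr0n divr_gt0.
set r := Num.min _ _; have r0' : 0 < r by rewrite lt_min invr_gt0 ltr0n divr_gt0.
have h1 : r <= 2^-1 by rewrite /r ge_min lexx.
have : r <= r0 / (3 + 3 * C) by rewrite /r ge_min lexx orbT.
rewrite ler_pdivlMr// => h2; clearbody r.
have h3 : C * r <= C * 2^-1 by rewrite ler_wpM2l.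
have h4 : 0 <= C * r by rewrite mulr_ge0// ltW.
have h5 : C * r * r <= C * r * 2^-1 by rewrite ler_wpM2l.
nra.
Qed.

Lemma cut_ev S (w : 'rV[R]_n.+1 -> R) e r : tangential S -> 0 < e -> 1 <= r / e -> w ev = 1 ->
 w (shear S e ev) * zet (r / e) (shear S e ev) = 1.
Proof.
move=> tS e0 r1 w1; have r0 : 0 < r / e by apply: lt_le_trans r1.
have -> : shear S e ev = ev by rewrite /shear qf_ev0// mulr0 scale0r subr0.
by rewrite w1 (zet_in r0 _).1 ?mulr1 ?enorm_ev.
Qed.

Lemma dilateK (e : R) y v : e != 0 -> e^-1 *: (y + e *: v) + - e^-1 *: y = v.
Proof. by move=> e0; rewrite scalerDr scalerA mulVf// scale1r scaleNr addrAC subrr add0r. Qed.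

Lemma comp_mem p U x u F : comp p U x u F -> U x.
Proof.
move=> [_ _ u0 u1]; apply: contrapT => h; move: u1; rewrite (u0 _ h) => /eqP.
by rewrite eq_sym oner_eq0.
Qed.

Lemma powR_mulK (e a b : R) : 0 < e -> e `^ a * (`|e^-1| `^ a * b) = b.
Proof.
move=> e0; rewrite gtr0_norm ?invr_gt0// mulrA -powRM ?invr_ge0 ?(ltW e0)//.
by rewrite mulfV ?gt_eqF// powR1 mul1r.
Qed.

(** Scaled back, the competitor sits at a point within e of y, so the distance to the complement is
    at most e, and the factor e^(p-N) cancels the scaling of the energy. *)
Lemma lambda_le_energy (p : R) Om y (M : 'M[R]_n.+1) (e : R) u F : 2 < p -> n.+1%:R < p -> open Om -> ~ Om y ->
 orthogonal_mx M -> 0 < e -> comp p [set x | Om (y + (e *: x) *m M)] ev u F -> (lambda p Om <= (energy p F)%:E)%E.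
Proof.
move=> p2 np oOm Oy oM e0; set U := [set x | _] => cU.
have ex : exists z, ~ Om z by exists y.
have oMt := orthogonal_tr oM.
have [c1 E1] := @comp_orthogonal R n.+1 p U [set z | U (z *m M^T)] ev (ev *m M) u F M^T oMt cU (fun z h => h)
 (etrans (esym (mulmxA _ _ _)) (etrans (congr1 (mulmx ev) oM) (mulmx1 _))).
pose x0 := y + e *: (ev *m M).
have en : e != 0 by rewrite gt_eqF.
have ein : e^-1 != 0 by rewrite invr_neq0.
have hV z : [set z | U (z *m M^T)] (e^-1 *: z + (- e^-1 *: y)) -> Om z.
 have E : y + (e *: ((e^-1 *: z + - e^-1 *: y) *m M^T)) *m M = z.
  rewrite scaleNr -scalerBr -!scalemxAl scalerA (mulfV en) scale1r -mulmxA (mulmx1C oM) mulmx1.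
  by rewrite addrC subrK.
 by rewrite /U /= E.
have hx : e^-1 *: x0 + (- e^-1 *: y) = ev *m M.
 exact: dilateK.
have [c2 E2] := comp_dilate ein c1 hV hx.
have Ox0 : Om x0 := comp_mem c2.
apply: (le_trans (lambda_le_ccap p2 np oOm ex Ox0)); rewrite lee_fin.
have a0 : 0 < p - n.+1%:R by rewrite subr_gt0.
have dx : dist_compl Om x0 <= e.
 apply: (le_trans (dist_compl_le _ Oy)).
 by rewrite /x0 (addrC y) addrK enormZ (enorm_orthogonal _ oM) enorm_ev mulr1 gtr0_norm.
have dx0 : 0 <= dist_compl Om x0 := ltW (dist_compl_gt0 oOm ex Ox0).
apply: (le_trans (ler_wpM2l (powR_ge0 _ _) (cap_le c2))); rewrite E2 E1.
have i0 : 0 <= `|e^-1| `^ (p - n.+1%:R) * energy p F := mulr_ge0 (powR_ge0 _ _) (energy_ge0 _ _).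
have h2 : dist_compl Om x0 `^ (p - n.+1%:R) <= e `^ (p - n.+1%:R).
 by apply: ge0_ler_powR; rewrite ?nnegrE ?(ltW a0) ?(ltW e0).
apply: (le_trans (ler_wpM2r i0 h2)).
by rewrite powR_mulK.
Qed.

Lemma first_order_lt (E l e f t : R) : 0 < e -> E <= l + e * (f + - t / 2) -> f = t -> t < 0 -> E < l.
Proof.
move=> e0 h ft t0; move: h; rewrite {f}ft => h; apply: (le_lt_trans h); rewrite gtrDl pmulr_rlt0; lra.
Qed.

Lemma lambda_lt_lstar p Om : 2 < p -> n.+1%:R < p -> (0 < n)%N -> open Om -> C2_set Om -> ~ mean_convex Om ->
 (lambda p Om < (lstar n p)%:E)%E.
Proof.
move=> p2 np n0 oOm C2 nmc.
have [y [M [S [r0 [[Oy oM tS tr0] [r00 hin]]]]]] := bad_boundary_point n0 oOm C2 nmc.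
have [w [G [hc hm w0]]] := minimizer_exists p2 np.
have [c c0 hS] := first_variation_pos p2 np n0 hc hm w0.
have [C C0 hC] := cut_support tS.
have [r r0' hr] := small_radius C0 r00.
(* The error allowed in the expansion is half of the negative first variation. *)
pose d := - (c * \tr S) / 2.
have d0 : 0 < d by rewrite divr_gt0// oppr_gt0 pmulr_rlt0.
have [k hk] := expansion p2 np n0 hc hm w0 S r0' d0.
have [R1] := hk k (leqnn k).
set e : R := k.+1%:R^-1; have e0 : 0 < e by rewrite invr_gt0.
rewrite -[k.+1%:R]invrK -/e in R1 *.
move=> [LB EB].
have [LH EH] := energy_shear tS LB.
have WH := W_shear e tS (W_cut hc (r / e)).
pose v x := w (shear S e x) * zet (r / e) (shear S e x).
pose H x := shear_grad S e (cut_grad w G (r / e)) (shear S e x).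
pose U : set 'rV[R]_n.+1 := [set x | Om (y + (e *: x) *m M)].
have [_ _ wn w1] := hc.
have v0 x : ~ U x -> v x = 0.
 move=> Ux; apply: contrapT => vx; apply: Ux.
 by have [h1 h2] := hC w e r x wn e0 r0' vx; exact: hin (le_trans h1 hr) h2.
have v1 : v ev = 1 := cut_ev tS e0 R1 w1.
have cU : comp p U ev v H := And4 WH LH v0 v1.
apply: (le_lt_trans (lambda_le_energy p2 np oOm Oy oM e0 cU)); rewrite lte_fin.
have : energy p H <= lstar n p + e * (first_variation p G S + d) := eq_ind_r (fun E => E <= _) EB EH.
have ct0 : c * \tr S < 0 by rewrite pmulr_rlt0.
by move=> hE; exact: first_order_lt e0 hE (hS S tS) ct0.
Qed.

End strict_inequality.

(* The dimension of the space is n.+1. *)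
Theorem theoremD (R : realType) (n : nat) (p : R) (Omega : set 'rV[R]_n.+1) :
 (2 <= n.+1)%N -> n.+1%:R < p ->
 Omega !=set0 -> bounded_set Omega -> open Omega ->
 C2_set Omega -> ~ mean_convex Omega ->
 (lambda p Omega < lambda p (half_space n))%E /\
 exists u, extremal p Omega u.
Proof.
move=> n2 np O0 bO oO C2 nmc.
have p2 : 2 < p by apply: le_lt_trans np; rewrite ler_nat.
have h := lambda_lt_lstar p2 np n2 oO C2 nmc.
split; first exact: lt_le_trans h (lstar_le_lambda p2 np).
exact: extremal_exists p2 np oO (bounded_complement bO) O0 bO C2 h.
Qed.
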